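(* Fix $\kappa\in(0,1)$. Let $k$ run through even integers with $|k|\to\infty$ and let $m=m(k)\le\ell$ be integers (with $m\ge0$ if $k>0$) such that $D=\ell-m\to\infty$ and $D<\kappa\log|k|/\log\log|k|$. Put $\delta=m/\ell$ and let $\mathcal S_\delta=\{w-\frac{i}{2\pi}\log|1-\delta|: w\in\mathcal L_\pm\}$, where $\pm$ is the sign of $k$. Then the zeros of $g_{k,m}$ in $\mathcal F$ other than $i$ and $\rho$ asymptotically approach $\mathcal S_\delta$, i.e. $\sup\{\operatorname{dist}(\tau,\mathcal S_\delta):\tau\in\mathcal F\setminus\{i,\rho\},\ g_{k,m}(\tau)=0\}\to0$.
   Context: $\mathfrak H$ is the upper half-plane, $q=e^{2\pi iz}$, $\rho=e^{2\pi i/3}$, $\mathcal F=\{z\in\mathfrak H:|\Re z|\le1/2,|z|\ge1\}$. For an even integer $k$ write $k=12\ell+k'$ with $\ell\in\mathbb Z$, $k'\in\{0,4,6,8,10,14\}$. For $m\le\ell$, $g_{k,m}$ is the unique weakly holomorphic modular form of weight $k$ for $\mathrm{SL}_2(\mathbb Z)$ with $q$-expansion $q^m+O(q^{\ell+1})$ (the Miller basis when $k\ge4$, $0\le m\le\ell$). The Szegő curve is $\mathcal S=\{w\in\mathbb C:|we^{1-w}|=1,\ |w|\le1\}$, and $\mathcal L_\pm=\{\tau\in\mathfrak H:|\Re\tau|\le1/2,\ \pm24e^{2\pi i\tau}\in\mathcal S\}$.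
   Formalization: The point ρ+1, the translate of ρ that also lies in the closed domain F, is excluded along with i and ρ, because for example when k ≡ 4 mod 12 the form vanishes there while the distance from ρ+1 to S_δ tends to infinity. *)

(* Defs.v *)
From Stdlib Require Import Reals ZArith.
From Coquelicot Require Import Coquelicot.
Import Coquelicot.Complex.
Open Scope R_scope.

Definition Cexp (z : C) : C :=
  (exp (Re z) * cos (Im z), exp (Re z) * sin (Im z)).


Definition in_H (z : C) : Prop := 0 < Im z.

Definition qpow (n : Z) (z : C) : C :=
  Cexp (RtoC (2 * PI * IZR n) * Ci * z)%C.

Definition Cpowz (w : C) (k : Z) : C :=
  if (0 <=? k)%Z then pow_n w (Z.to_nat k) else Cinv (pow_n w (Z.to_nat (- k))).

(* k = 12 ell + k' with k' in {0,4,6,8,10,14} (k even) *)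
Definition ell (k : Z) : Z :=
  if (k mod 12 =? 2)%Z then ((k - 14) / 12)%Z else (k / 12)%Z.

(* weakly holomorphic modular form of weight k for SL_2(Z):
   modular under every integer matrix of determinant 1, and equal on H to a
   q-series sum_{n >= N} a_n q^n (this encodes holomorphy on H and
   meromorphy at the cusp). *)
Definition whmf (k : Z) (f : C -> C) : Prop :=
  (forall a b c d : Z, (a * d - b * c = 1)%Z -> forall z : C, in_H z ->
     f ((RtoC (IZR a) * z + RtoC (IZR b)) / (RtoC (IZR c) * z + RtoC (IZR d)))%C
     = (Cpowz (RtoC (IZR c) * z + RtoC (IZR d))%C k * f z)%C) /\
  (exists (a : Z -> C) (N : Z), forall z : C, in_H z ->
     is_series (fun j : nat => (a (N + Z.of_nat j)%Z * qpow (N + Z.of_nat j) z)%C)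
               (f z)).

Definition is_gkm (k m : Z) (f : C -> C) : Prop :=
  (m <= ell k)%Z /\ whmf k f /\
  exists a : Z -> C,
    (forall z : C, in_H z ->
       is_series (fun j : nat => (a (m + Z.of_nat j)%Z * qpow (m + Z.of_nat j) z)%C)
                 (f z)) /\
    a m = RtoC 1 /\
    (forall n : Z, (m < n <= ell k)%Z -> a n = RtoC 0).

Definition inF (z : C) : Prop :=
  in_H z /\ Rabs (Re z) <= 1 / 2 /\ 1 <= Cmod z.

Definition rho : C := Cexp (RtoC (2 * PI / 3) * Ci)%C.

Definition Szego (w : C) : Prop :=
  Cmod (w * Cexp (RtoC 1 - w))%C = 1 /\ Cmod w <= 1.

Definition Lcurve (s : R) (t : C) : Prop :=
  in_H t /\ Rabs (Re t) <= 1 / 2 /\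
  Szego (RtoC (s * 24) * Cexp (RtoC (2 * PI) * Ci * t))%C.

Definition Sdelta (s delta : R) (t : C) : Prop :=
  exists w : C, Lcurve s w /\
    t = (w - Ci / RtoC (2 * PI) * RtoC (ln (Rabs (1 - delta))))%C.

(* Main.v *)
(** Write [k = 12 l + 4 u + 6 v] with [u <= 2], [v <= 1], and put [q = e^{2 pi i tau}], [D = l - m],
    [L = |l|], [s = sign l].  By a Liouville principle, [g = Delta^l E4^u E6^v F(j)] for a polynomial
    [F(x) = sum_{i<=D} c_i x^{D-i}], so away from [i] and [rho] the zeros of [g] are those of [F(j)].
    With [A = Delta/q] and [U = q j], the gap [g = q^m + O(q^{l+1})] says
      [sum_i c_i q^i U^{D-i} = A^{-l} E4^{-u} E6^{-v} + O(q^{D+1})].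
    Since [A^{-l} = e^{24 l q + O(l q^2)}], in the weighted l^1 norm of radius [D/(24 L)] the [c_i]
    differ from [(24 l)^i/i!] by [O(e^D D^2/L)], which the growth condition on [D] makes smaller than
    [e^{-3D}].  Hence at a zero, [w = 24 l/(D j)] nearly annihilates the truncated exponential
    [sum_{i<=D} (D w)^i/i!], and such [w] accumulate only at the Szego curve.  As [q j = 1 + O(q)] and
    [q -> 0], also [24 s q L/D] is close to that curve; dividing [q] by [|1 - delta| = D/L] is the
    vertical translation in the definition of [S_delta].

    For the Liouville principle: if [h] is modular of weight 0 and [O(q)] at the cusp, then
    [|h|^2/(|Delta| y^6)] attains its maximum on the upper half-plane, which the second-order Taylor
    expansion at that point rules out unless [h = 0]. *)

Require Import Defs.
From Stdlib Require Import Reals ZArith Lra Lia FunctionalExtensionality Classical IndefiniteDescription.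
From Coquelicot Require Import Coquelicot.
Import Coquelicot.Complex.
Open Scope R_scope.

(** * Finite sums and series *)

(** All analysis is done with series and real calculus; no contour integral occurs. Modularity of E4
    and E6 comes from summing the lattice over square boxes, which the inversion -1/z merely
    rotates, and each row of a box is evaluated by the Lipschitz formula, itself the limit of an
    iterated duplication identity. The zeros of E4 and E6 in the fundamental domain are found
    without a valence formula: both are injective functions of q for |q| <= 1/200. Quotients such as
    j are described at the cusp by asymptotic expansions, which are then compared as formal series.
    The exponent 3 in e^{-3D} is dictated by the exponential: |e^{Dw}| is at least e^{-D} on the
    unit disc, so a much smaller perturbation can be ignored. As the perturbation has size e^D
    D^2/L, it is enough that L exceeds a large multiple of e^{6D}, and the growth condition makes
    e^{6D} at most the square root of |k| eventually. The constants depend only on eps, on the sign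
    of k and on (u, v), twelve classes in all, so one threshold serves every form. *)

Fixpoint Csum (f : nat -> C) (n : nat) : C :=
  match n with O => RtoC 0 | S p => (Csum f p + f p)%C end.

Fixpoint Rsum (f : nat -> R) (n : nat) : R :=
  match n with O => 0 | S p => Rsum f p + f p end.

Lemma Csum_S f n : Csum f (S n) = (Csum f n + f n)%C.
Proof. reflexivity. Qed.

Lemma Rsum_S f n : Rsum f (S n) = Rsum f n + f n.
Proof. reflexivity. Qed.

Lemma Csum_ext f g n : (forall i, (i < n)%nat -> f i = g i) -> Csum f n = Csum g n.
Proof.
  induction n as [|n IH]; intros H; simpl; [reflexivity|].
  rewrite IH, H; auto.
Qed.

Lemma Csum_plus f g n : Csum (fun i => f i + g i)%C n = (Csum f n + Csum g n)%C.
Proof. induction n as [|n IH]; simpl; [ring|rewrite IH; ring]. Qed.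

Lemma Csum_minus f g n : Csum (fun i => f i - g i)%C n = (Csum f n - Csum g n)%C.
Proof. induction n as [|n IH]; simpl; [ring|rewrite IH; ring]. Qed.

Lemma Csum_scal c f n : Csum (fun i => c * f i)%C n = (c * Csum f n)%C.
Proof. induction n as [|n IH]; simpl; [ring|rewrite IH; ring]. Qed.

Lemma Csum_scal_r c f n : Csum (fun i => f i * c)%C n = (Csum f n * c)%C.
Proof. induction n as [|n IH]; simpl; [ring|rewrite IH; ring]. Qed.

Lemma Csum_zero f n : (forall i, (i < n)%nat -> f i = RtoC 0) -> Csum f n = RtoC 0.
Proof.
  induction n as [|n IH]; intros H; simpl; [reflexivity|].
  rewrite IH, H by auto. ring.
Qed.

Lemma Csum_split f n m : Csum f (n + m) = (Csum f n + Csum (fun i => f (n + i)%nat) m)%C.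
Proof.
  induction m as [|m IH]; simpl.
  - rewrite Nat.add_0_r. ring.
  - rewrite Nat.add_succ_r. simpl. rewrite IH. ring.
Qed.

Lemma Csum_Sl f n : Csum f (S n) = (f O + Csum (fun i => f (S i)) n)%C.
Proof. change (S n) with (1 + n)%nat. rewrite Csum_split. simpl. ring. Qed.

Lemma Csum_rev f n : Csum f n = Csum (fun i => f (n - 1 - i)%nat) n.
Proof.
  induction n as [|n IH]; [reflexivity|].
  rewrite (Csum_Sl (fun i => f (S n - 1 - i)%nat)). simpl Csum at 1. rewrite IH.
  replace (S n - 1 - 0)%nat with n by lia. rewrite Cplus_comm. f_equal.
  apply Csum_ext. intros i Hi. f_equal. lia.
Qed.

Lemma Csum_swap (f : nat -> nat -> C) n m :
  Csum (fun i => Csum (f i) m) n = Csum (fun j => Csum (fun i => f i j) n) m.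
Proof.
  induction n as [|n IH]; simpl.
  - rewrite Csum_zero; auto.
  - rewrite IH, <- Csum_plus. reflexivity.
Qed.

Lemma Csum_single f n k : (k < n)%nat -> (forall i, (i < n)%nat -> i <> k -> f i = RtoC 0) ->
  Csum f n = f k.
Proof.
  intros Hk H. replace n with (k + S (n - k - 1))%nat by lia.
  rewrite Csum_split, Csum_Sl, Nat.add_0_r.
  rewrite !Csum_zero; [ring| |]; intros; apply H; lia.
Qed.

Lemma Rsum_ext f g n : (forall i, (i < n)%nat -> f i = g i) -> Rsum f n = Rsum g n.
Proof.
  induction n as [|n IH]; intros H; simpl; [reflexivity|].
  rewrite IH, H; auto.
Qed.

Lemma Rsum_plus f g n : Rsum (fun i => f i + g i) n = Rsum f n + Rsum g n.
Proof. induction n as [|n IH]; simpl; [ring|rewrite IH; ring]. Qed.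

Lemma Rsum_scal c f n : Rsum (fun i => c * f i) n = c * Rsum f n.
Proof. induction n as [|n IH]; simpl; [ring|rewrite IH; ring]. Qed.

Lemma Rsum_scal_r c f n : Rsum (fun i => f i * c) n = Rsum f n * c.
Proof. induction n as [|n IH]; simpl; [ring|rewrite IH; ring]. Qed.

Lemma Rsum_le f g n : (forall i, (i < n)%nat -> f i <= g i) -> Rsum f n <= Rsum g n.
Proof.
  induction n as [|n IH]; intros H; simpl; [lra|].
  apply Rplus_le_compat; auto.
Qed.

Lemma Rsum_pos f n : (forall i, (i < n)%nat -> 0 <= f i) -> 0 <= Rsum f n.
Proof.
  induction n as [|n IH]; intros H; simpl; [lra|].
  specialize (H n ltac:(lia)) as H1. specialize (IH ltac:(auto)). lra.
Qed.

Lemma Rsum_split f n m : Rsum f (n + m) = Rsum f n + Rsum (fun i => f (n + i)%nat) m.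
Proof.
  induction m as [|m IH]; simpl.
  - rewrite Nat.add_0_r. ring.
  - rewrite Nat.add_succ_r. simpl. rewrite IH. ring.
Qed.

Lemma Rsum_Sl f n : Rsum f (S n) = f O + Rsum (fun i => f (S i)) n.
Proof. change (S n) with (1 + n)%nat. rewrite Rsum_split. simpl. ring. Qed.

Lemma Rsum_mono f n m : (forall i, 0 <= f i) -> (n <= m)%nat -> Rsum f n <= Rsum f m.
Proof.
  intros H Hnm. replace m with (n + (m - n))%nat by lia. rewrite Rsum_split.
  pose proof (Rsum_pos (fun i => f (n + i)%nat) (m - n)). assert (0 <= Rsum (fun i => f (n + i)%nat) (m - n)) by auto. lra.
Qed.

Lemma Rsum_term f n k : (forall i, 0 <= f i) -> (k < n)%nat -> f k <= Rsum f n.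
Proof.
  intros H Hk. apply Rle_trans with (Rsum f (S k)).
  - simpl. pose proof (Rsum_pos f k ltac:(auto)). lra.
  - apply Rsum_mono; [auto|lia].
Qed.

Lemma Rsum_const c n : Rsum (fun _ => c) n = INR n * c.
Proof. induction n as [|n IH]; [simpl; ring|]. rewrite S_INR. simpl. rewrite IH. ring. Qed.

Lemma Rsum_geom s n : s <> 1 -> Rsum (fun i => s ^ i) n = (1 - s ^ n) / (1 - s).
Proof.
  intros H. assert (1 - s <> 0) by lra.
  induction n as [|n IH]; simpl; [field; auto|]. rewrite IH. field. auto.
Qed.

Lemma Rsum_geom_le s n : 0 <= s < 1 -> Rsum (fun i => s ^ i) n <= / (1 - s).
Proof.
  intros H. rewrite Rsum_geom by lra. unfold Rdiv. rewrite <- (Rmult_1_l (/ (1 - s))) at 2.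
  apply Rmult_le_compat_r; [left; apply Rinv_0_lt_compat; lra|].
  pose proof (pow_le s n ltac:(lra)). lra.
Qed.

Lemma Cmod_Csum f n : Cmod (Csum f n) <= Rsum (fun i => Cmod (f i)) n.
Proof.
  induction n as [|n IH]; simpl.
  - rewrite Cmod_0. lra.
  - eapply Rle_trans; [apply Cmod_triangle|]. lra.
Qed.

Lemma Cmod_Csum_le f b n : (forall i, (i < n)%nat -> Cmod (f i) <= b i) ->
  Cmod (Csum f n) <= Rsum b n.
Proof. intros H. eapply Rle_trans; [apply Cmod_Csum|]. apply Rsum_le. auto. Qed.

Lemma Cmod_minus_sym x y : Cmod (x - y) = Cmod (y - x).
Proof. rewrite <- Cmod_opp. f_equal. ring. Qed.

Lemma Cmod_tri2 x y : Cmod (x - y) <= Cmod x + Cmod y.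
Proof. unfold Cminus. eapply Rle_trans; [apply Cmod_triangle|]. rewrite Cmod_opp. lra. Qed.

Lemma Cmod_tri_inv x y : Cmod x - Cmod y <= Cmod (x + y).
Proof.
  pose proof (Cmod_tri2 (x + y) y). replace (x + y - y)%C with x in H by ring. lra.
Qed.

Lemma Cmod_tri_inv2 x y : Cmod x - Cmod y <= Cmod (x - y).
Proof. unfold Cminus. rewrite <- (Cmod_opp y). apply Cmod_tri_inv. Qed.

Lemma Cmod_tri_mid y x z : Cmod (x - z) <= Cmod (x - y) + Cmod (y - z).
Proof. eapply Rle_trans; [|apply Cmod_triangle]. right. f_equal. ring. Qed.

Definition CLim (u : nat -> C) (l : C) : Prop :=
  forall eps, 0 < eps -> exists N, forall n, (N <= n)%nat -> Cmod (u n - l) < eps.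

Definition Rlim0 (e : nat -> R) : Prop :=
  forall eps, 0 < eps -> exists N, forall n, (N <= n)%nat -> Rabs (e n) < eps.

Lemma CLim_squeeze u l e : Rlim0 e -> (exists N0, forall n, (N0 <= n)%nat -> Cmod (u n - l) <= e n) -> CLim u l.
Proof.
  intros He [N0 H] eps Heps. destruct (He eps Heps) as [N HN].
  exists (max N0 N). intros n Hn. specialize (HN n ltac:(lia)). specialize (H n ltac:(lia)).
  pose proof (Rle_abs (e n)). lra.
Qed.

Lemma CLim_unique u l l' : CLim u l -> CLim u l' -> l = l'.
Proof.
  intros H H'. destruct (Ceq_dec l l') as [|Hn]; [auto|exfalso].
  assert (Hp : 0 < Cmod (l - l')) by (apply Cmod_gt_0, Cminus_eq_contra; auto).
  destruct (H (Cmod (l - l') / 2)) as [N HN]; [lra|].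
  destruct (H' (Cmod (l - l') / 2)) as [N' HN']; [lra|].
  specialize (HN (N + N')%nat ltac:(lia)). specialize (HN' (N + N')%nat ltac:(lia)).
  pose proof (Cmod_tri_mid (u (N + N')%nat) l l'). rewrite (Cmod_minus_sym l (u _)) in H0. lra.
Qed.

Lemma CLim_const c : CLim (fun _ => c) c.
Proof. intros eps He. exists O. intros. replace (c - c)%C with (RtoC 0) by ring. rewrite Cmod_0. auto. Qed.

Lemma CLim_ext u v l : (exists N, forall n, (N <= n)%nat -> u n = v n) -> CLim u l -> CLim v l.
Proof.
  intros [N0 E] H eps He. destruct (H eps He) as [N HN]. exists (max N0 N).
  intros n Hn. rewrite <- E by lia. apply HN. lia.
Qed.

Lemma CLim_plus u v l m : CLim u l -> CLim v m -> CLim (fun n => u n + v n)%C (l + m)%C.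
Proof.
  intros H H' eps He. destruct (H (eps / 2)) as [N HN]; [lra|].
  destruct (H' (eps / 2)) as [N' HN']; [lra|]. exists (max N N'). intros n Hn.
  specialize (HN n ltac:(lia)). specialize (HN' n ltac:(lia)).
  replace (u n + v n - (l + m))%C with ((u n - l) + (v n - m))%C by ring.
  eapply Rle_lt_trans; [apply Cmod_triangle|]. lra.
Qed.

Lemma CLim_scal c u l : CLim u l -> CLim (fun n => c * u n)%C (c * l)%C.
Proof.
  intros H eps He. pose proof (Cmod_ge_0 c).
  destruct (H (eps / (Cmod c + 1))) as [N HN]; [apply Rdiv_lt_0_compat; lra|].
  exists N. intros n Hn. specialize (HN n Hn).
  replace (c * u n - c * l)%C with (c * (u n - l))%C by ring. rewrite Cmod_mult.
  apply Rle_lt_trans with ((Cmod c + 1) * Cmod (u n - l)).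
  - apply Rmult_le_compat_r; [apply Cmod_ge_0|lra].
  - apply Rmult_lt_compat_l with (r := Cmod c + 1) in HN; [|lra].
    replace ((Cmod c + 1) * (eps / (Cmod c + 1))) with eps in HN by (field; lra). auto.
Qed.

Lemma CLim_minus u v l m : CLim u l -> CLim v m -> CLim (fun n => u n - v n)%C (l - m)%C.
Proof.
  intros H H'. replace (l - m)%C with (l + (- (1)) * m)%C by ring.
  eapply CLim_ext; [|apply CLim_plus; [exact H|apply (CLim_scal (- (1))%C); exact H']].
  exists O. intros. simpl. ring.
Qed.

Lemma CLim_sub u l (phi : nat -> nat) : (forall n, (n <= phi n)%nat) -> CLim u l ->
  CLim (fun n => u (phi n)) l.
Proof.
  intros Hp H eps He. destruct (H eps He) as [N HN]. exists N. intros n Hn.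
  apply HN. specialize (Hp n). lia.
Qed.

Lemma CLim_mod_le u l B : CLim u l -> (exists N, forall n, (N <= n)%nat -> Cmod (u n) <= B) -> Cmod l <= B.
Proof.
  intros H [N0 HB]. apply Rnot_lt_le. intros Hlt.
  destruct (H (Cmod l - B)) as [N HN]; [lra|]. specialize (HN (max N0 N) ltac:(lia)).
  specialize (HB (max N0 N) ltac:(lia)). rewrite Cmod_minus_sym in HN.
  pose proof (Cmod_tri_inv2 l (u (max N0 N))). lra.
Qed.

(** The n-th partial sum has n terms, one fewer than [sum_n a n]; [is_series_Csums] accounts for the
    shift. *)
Definition Csums (a : nat -> C) (l : C) : Prop := CLim (Csum a) l.

Lemma Un_cv_Rsum_cauchy b B : (forall n, 0 <= b n) -> (forall n, Rsum b n <= B) ->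
  forall eps, 0 < eps -> exists N, forall n m, (N <= n)%nat -> (n <= m)%nat -> Rsum b m - Rsum b n < eps.
Proof.
  intros Hb HB eps He.
  assert (Hg : Un_growing (Rsum b)) by (intros n; simpl; specialize (Hb n); lra).
  assert (Hub : has_ub (Rsum b)). { exists B. intros x [i Hi]. rewrite Hi. apply HB. }
  destruct (growing_cv _ Hg Hub) as [l Hl]. destruct (Hl (eps / 2)) as [N HN]; [lra|].
  exists N. intros n m Hn Hm. pose proof (HN n ltac:(lia)) as H1. pose proof (HN m ltac:(lia)) as H2.
  unfold Rdist in *. apply Rabs_def2 in H1. apply Rabs_def2 in H2. lra.
Qed.

Lemma Csum_diff_le a b n m : (forall i, Cmod (a i) <= b i) -> (n <= m)%nat ->
  Cmod (Csum a m - Csum a n) <= Rsum b m - Rsum b n.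
Proof.
  intros H Hnm. replace m with (n + (m - n))%nat by lia. rewrite Csum_split, Rsum_split.
  replace (Csum a n + Csum (fun i => a (n + i)%nat) (m - n) - Csum a n)%C with (Csum (fun i => a (n + i)%nat) (m - n)) by ring.
  replace (Rsum b n + Rsum (fun i => b (n + i)%nat) (m - n) - Rsum b n) with (Rsum (fun i => b (n + i)%nat) (m - n)) by ring.
  apply Cmod_Csum_le. auto.
Qed.

Lemma im_le_Cmod z : Rabs (Im z) <= Cmod z.
Proof. eapply Rle_trans; [|apply Rmax_Cmod]. apply Rmax_r. Qed.

Lemma Cmod_le_sum z : Cmod z <= Rabs (Re z) + Rabs (Im z).
Proof.
  destruct z as [x y]. simpl. replace (x, y) with (RtoC x + RtoC y * Ci)%C.
  - eapply Rle_trans; [apply Cmod_triangle|]. rewrite Cmod_mult, !Cmod_R, Cmod_Ci. lra.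
  - unfold RtoC, Ci, Cplus, Cmult. simpl. f_equal; ring.
Qed.

Lemma CLim_complete u : (forall eps, 0 < eps -> exists N, forall n m, (N <= n)%nat -> (n <= m)%nat -> Cmod (u m - u n) < eps) ->
  exists l, CLim u l.
Proof.
  intros H.
  assert (Hc : forall p : C -> R, (forall z, Rabs (p z) <= Cmod z) -> (forall x y, p (x - y)%C = p x - p y) ->
     Cauchy_crit (fun n => p (u n))).
  { intros p Hp Hm eps He. destruct (H eps He) as [N HN]. exists N. intros n m Hn Hm'.
    unfold Rdist. rewrite <- Hm. eapply Rle_lt_trans; [apply Hp|].
    destruct (Nat.le_ge_cases n m) as [h|h].
    - rewrite Cmod_minus_sym. apply HN; lia.
    - apply HN; lia. }
  destruct (Rcomplete.R_complete _ (Hc Re re_le_Cmod ltac:(intros; destruct x, y; reflexivity))) as [x Hx].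
  destruct (Rcomplete.R_complete _ (Hc Im im_le_Cmod ltac:(intros; destruct x0, y; reflexivity))) as [y Hy].
  exists (x, y). intros eps He. destruct (Hx (eps / 2)) as [N1 H1]; [lra|].
  destruct (Hy (eps / 2)) as [N2 H2]; [lra|]. exists (max N1 N2). intros n Hn.
  eapply Rle_lt_trans; [apply Cmod_le_sum|].
  specialize (H1 n ltac:(lia)). specialize (H2 n ltac:(lia)). unfold Rdist in *.
  destruct (u n) as [p r]. simpl in *. unfold Rminus in *. lra.
Qed.

Lemma Csums_exists a b B : (forall n, Cmod (a n) <= b n) -> (forall n, Rsum b n <= B) ->
  exists l, Csums a l.
Proof.
  intros Hab HB. apply CLim_complete. intros eps He.
  assert (Hb : forall n, 0 <= b n) by (intros n; eapply Rle_trans; [apply Cmod_ge_0|apply Hab]).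
  destruct (Un_cv_Rsum_cauchy b B Hb HB eps He) as [N HN]. exists N. intros n m Hn Hm.
  eapply Rle_lt_trans; [apply Csum_diff_le with (b := b)|]; auto.
Qed.

Lemma Csums_tail a l b N T : Csums a l -> (forall i, Cmod (a (N + i)%nat) <= b i) ->
  (forall n, Rsum b n <= T) -> Cmod (l - Csum a N) <= T.
Proof.
  intros H Hab HT.
  apply CLim_mod_le with (u := fun n => (Csum a (N + n) - Csum a N)%C).
  - apply CLim_minus; [|apply CLim_const].
    apply (CLim_sub (Csum a) l (fun n => (N + n)%nat)); [intros; lia|exact H].
  - exists O. intros n _. rewrite Csum_split.
    replace (Csum a N + Csum (fun i => a (N + i)%nat) n - Csum a N)%C with (Csum (fun i => a (N + i)%nat) n) by ring.
    eapply Rle_trans; [apply Cmod_Csum_le with (b := b)|]; auto.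
Qed.

Lemma Csums_bound a l b T : Csums a l -> (forall i, Cmod (a i) <= b i) ->
  (forall n, Rsum b n <= T) -> Cmod l <= T.
Proof.
  intros H Hb HT. pose proof (Csums_tail a l b O T H Hb HT). simpl in H0.
  replace (l - 0)%C with l in H0 by ring. auto.
Qed.

Lemma Csums_unique a l l' : Csums a l -> Csums a l' -> l = l'.
Proof. apply CLim_unique. Qed.

Lemma Csums_plus a b l m : Csums a l -> Csums b m -> Csums (fun n => a n + b n)%C (l + m)%C.
Proof.
  intros H H'. unfold Csums. eapply CLim_ext; [|apply CLim_plus; [exact H|exact H']].
  exists O. intros. symmetry. apply Csum_plus.
Qed.

Lemma Csums_scal c a l : Csums a l -> Csums (fun n => c * a n)%C (c * l)%C.
Proof.
  intros H. unfold Csums. eapply CLim_ext; [|apply CLim_scal; exact H].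
  exists O. intros. symmetry. apply Csum_scal.
Qed.

Lemma Csums_ext a b l : (forall n, a n = b n) -> Csums a l -> Csums b l.
Proof. intros E. apply CLim_ext. exists O. intros. apply Csum_ext. auto. Qed.

Lemma Csums_shift a l N : Csums a l -> Csums (fun i => a (N + i)%nat) (l - Csum a N)%C.
Proof.
  intros H. unfold Csums.
  eapply CLim_ext with (u := fun n => (Csum a (N + n) - Csum a N)%C).
  - exists O. intros n _. rewrite Csum_split. ring.
  - apply CLim_minus; [|apply CLim_const].
    apply (CLim_sub (Csum a) l (fun n => (N + n)%nat)); [intros; lia|exact H].
Qed.

Lemma Csums_term0 a l : Csums a l -> CLim a 0.
Proof.
  intros H. replace (RtoC 0) with (l - l)%C by ring.
  eapply CLim_ext with (u := fun n => (Csum a (S n) - Csum a n)%C).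
  - exists O. intros n _. simpl. ring.
  - apply CLim_minus; [|exact H]. apply (CLim_sub _ _ S); [intros; lia|exact H].
Qed.

Lemma CLim_bounded u l : CLim u l -> exists B, 0 <= B /\ forall n, Cmod (u n) <= B.
Proof.
  intros H. destruct (H 1 ltac:(lra)) as [N HN].
  exists (Rsum (fun i => Cmod (u i)) N + (Cmod l + 1)).
  pose proof (Rsum_pos (fun i => Cmod (u i)) N ltac:(intros; apply Cmod_ge_0)).
  pose proof (Cmod_ge_0 l). split; [lra|]. intros n.
  destruct (Nat.lt_ge_cases n N) as [h|h].
  - pose proof (Rsum_term (fun i => Cmod (u i)) N n ltac:(intros; apply Cmod_ge_0) h). simpl in H2. lra.
  - specialize (HN n h). pose proof (Cmod_tri_inv2 (u n) l). lra.
Qed.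

Lemma Rlim0_geom c s : 0 <= s < 1 -> Rlim0 (fun n => c * s ^ n).
Proof.
  intros Hs eps He.
  destruct (pow_lt_1_zero s ltac:(rewrite Rabs_right; lra) (eps / (Rabs c + 1))) as [N HN].
  { apply Rdiv_lt_0_compat; [lra|]. pose proof (Rabs_pos c). lra. }
  exists N. intros n Hn. specialize (HN n Hn). rewrite Rabs_mult. pose proof (Rabs_pos c).
  apply Rle_lt_trans with ((Rabs c + 1) * Rabs (s ^ n)).
  - apply Rmult_le_compat_r; [apply Rabs_pos|lra].
  - apply Rmult_lt_compat_l with (r := Rabs c + 1) in HN; [|lra].
    replace ((Rabs c + 1) * (eps / (Rabs c + 1))) with eps in HN by (field; lra). auto.
Qed.

Lemma Rlim0_inv c : Rlim0 (fun n => c / INR (S n)).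
Proof.
  intros eps He. pose proof (Rabs_pos c).
  destruct (archimed_cor1 (eps / (Rabs c + 1))) as [N [HN HN0]].
  { apply Rdiv_lt_0_compat; lra. }
  exists N. intros n Hn. unfold Rdiv. rewrite Rabs_mult.
  assert (0 < INR N) by (apply lt_0_INR; auto).
  assert (INR N <= INR (S n)) by (apply le_INR; lia).
  rewrite (Rabs_right (/ INR (S n))) by (apply Rle_ge; left; apply Rinv_0_lt_compat; lra).
  apply Rle_lt_trans with ((Rabs c + 1) * / INR N).
  - apply Rmult_le_compat; try lra. left; apply Rinv_0_lt_compat; lra.
    apply Rinv_le_contravar; lra.
  - apply Rmult_lt_compat_l with (r := Rabs c + 1) in HN; [|lra].
    replace ((Rabs c + 1) * (eps / (Rabs c + 1))) with eps in HN by (field; lra). auto.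
Qed.

(* Dominated convergence for sums whose length also grows. *)
Lemma tannery (t : nat -> nat -> C) (t0 : nat -> C) (b : nat -> R) B (len : nat -> nat) l :
  (forall M i, (i < len M)%nat -> Cmod (t M i) <= b i) -> (forall i, Cmod (t0 i) <= b i) ->
  (forall n, Rsum b n <= B) -> (forall M, (M <= len M)%nat) ->
  (forall i, CLim (fun M => t M i) (t0 i)) -> Csums t0 l ->
  CLim (fun M => Csum (t M) (len M)) l.
Proof.
  intros Hb Hb0 HB Hlen Hlim Hs eps He.
  assert (Hbp : forall n, 0 <= b n) by (intros n; eapply Rle_trans; [apply Cmod_ge_0|apply Hb0]).
  destruct (Un_cv_Rsum_cauchy b B Hbp HB (eps / 5) ltac:(lra)) as [K HK].
  destruct (Hs (eps / 5) ltac:(lra)) as [K' HK'].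
  set (P := max K K').
  assert (Hfin : CLim (fun M => Csum (t M) P) (Csum t0 P)).
  { clearbody P. induction P as [|P IH]; simpl; [apply CLim_const|]. apply CLim_plus; auto. }
  destruct (Hfin (eps / 5) ltac:(lra)) as [M0 HM0].
  exists (max M0 P). intros M HM. specialize (HM0 M ltac:(lia)). specialize (Hlen M).
  specialize (HK' P ltac:(lia)).
  assert (H1 : Cmod (Csum (t M) (len M) - Csum (t M) P) <= Rsum b (len M) - Rsum b P).
  { replace (len M) with (P + (len M - P))%nat by lia. rewrite Csum_split, Rsum_split.
    replace (Csum (t M) P + Csum (fun i => t M (P + i)%nat) (len M - P) - Csum (t M) P)%C
      with (Csum (fun i => t M (P + i)%nat) (len M - P)) by ring.
    replace (Rsum b P + Rsum (fun i => b (P + i)%nat) (len M - P) - Rsum b P)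
      with (Rsum (fun i => b (P + i)%nat) (len M - P)) by ring.
    apply Cmod_Csum_le. intros i Hi. apply Hb. lia. }
  specialize (HK P (len M) ltac:(lia) ltac:(lia)).
  pose proof (Cmod_tri_mid (Csum (t M) P) (Csum (t M) (len M)) l).
  pose proof (Cmod_tri_mid (Csum t0 P) (Csum (t M) P) l). lra.
Qed.

(** * The complex exponential *)

Lemma C_eq x y : Re x = Re y -> Im x = Im y -> x = y.
Proof. destruct x, y; simpl; intros; subst; auto. Qed.

Lemma Cexp_plus a b : Cexp (a + b)%C = (Cexp a * Cexp b)%C.
Proof.
  unfold Cexp. rewrite re_plus, im_plus, exp_plus, cos_plus, sin_plus.
  apply C_eq; simpl; ring.
Qed.

Lemma Cexp_0 : Cexp 0 = RtoC 1.
Proof. unfold Cexp. simpl. rewrite exp_0, cos_0, sin_0. apply C_eq; simpl; ring. Qed.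

Lemma Cmod_Cexp z : Cmod (Cexp z) = exp (Re z).
Proof.
  unfold Cmod, Cexp. simpl fst; simpl snd.
  replace ((exp (Re z) * cos (Im z)) ^ 2 + (exp (Re z) * sin (Im z)) ^ 2) with (exp (Re z) ^ 2 * ((sin (Im z))² + (cos (Im z))²)) by (unfold Rsqr; ring).
  rewrite sin2_cos2, Rmult_1_r, sqrt_pow2; auto. left; apply exp_pos.
Qed.

Lemma Cexp_neq0 z : Cexp z <> RtoC 0.
Proof. apply Cmod_gt_0. rewrite Cmod_Cexp. apply exp_pos. Qed.

Lemma Cexp_INR n z : Cexp (RtoC (INR n) * z)%C = (Cexp z ^ n)%C.
Proof.
  induction n as [|n IH].
  - simpl INR. rewrite Cmult_0_l, Cexp_0. reflexivity.
  - rewrite S_INR, RtoC_plus, Cmult_plus_distr_r, Cmult_1_l, Cexp_plus, IH. simpl. ring.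
Qed.

Lemma Cexp_opp z : Cexp (- z)%C = (/ Cexp z)%C.
Proof.
  assert (Cexp z * Cexp (- z) = 1)%C by (rewrite <- Cexp_plus, Cplus_opp_r; apply Cexp_0).
  pose proof (Cexp_neq0 z). apply (f_equal (fun w => / Cexp z * w)%C) in H.
  rewrite Cmult_assoc, Cinv_l, Cmult_1_l, Cmult_1_r in H; auto.
Qed.

Definition Cder (f : R -> C) (t : R) (d : C) : Prop :=
  is_derive (fun s => Re (f s)) t (Re d) /\ is_derive (fun s => Im (f s)) t (Im d).

Lemma Cder_plus f g t d e : Cder f t d -> Cder g t e -> Cder (fun s => f s + g s)%C t (d + e)%C.
Proof.
  intros [H1 H2] [H3 H4]. split.
  - apply (is_derive_plus (fun s => Re (f s)) (fun s => Re (g s))); auto.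
  - apply (is_derive_plus (fun s => Im (f s)) (fun s => Im (g s))); auto.
Qed.

Lemma Cder_minus f g t d e : Cder f t d -> Cder g t e -> Cder (fun s => f s - g s)%C t (d - e)%C.
Proof.
  intros [H1 H2] [H3 H4]. split.
  - apply (is_derive_minus (fun s => Re (f s)) (fun s => Re (g s))); auto.
  - apply (is_derive_minus (fun s => Im (f s)) (fun s => Im (g s))); auto.
Qed.

Lemma Cder_real (g : R -> R) c t d : is_derive g t d -> Cder (fun s => RtoC (g s) * c)%C t (RtoC d * c)%C.
Proof.
  intros H. destruct c as [c1 c2]. split.
  - apply is_derive_ext with (f := fun s => g s * c1); [intros s; simpl; ring|].
    replace (Re (d * (c1, c2))%C) with (d * c1) by (simpl; ring).
    apply (is_derive_scal_l g t d c1). exact H.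
  - apply is_derive_ext with (f := fun s => g s * c2); [intros s; simpl; ring|].
    replace (Im (d * (c1, c2))%C) with (d * c2) by (simpl; ring).
    apply (is_derive_scal_l g t d c2). exact H.
Qed.

Lemma Cder_Cexp z t : Cder (fun s => Cexp (RtoC s * z)%C) t (z * Cexp (RtoC t * z))%C.
Proof.
  destruct z as [x y]. split.
  - apply is_derive_ext with (f := fun s => exp (s * x) * cos (s * y)).
    { intros s. unfold Cexp. simpl. f_equal; f_equal; ring. }
    auto_derive; auto. simpl. replace (t * x - 0 * y) with (t * x) by ring.
    replace (t * y + 0 * x) with (t * y) by ring. ring.
  - apply is_derive_ext with (f := fun s => exp (s * x) * sin (s * y)).
    { intros s. unfold Cexp. simpl. f_equal; f_equal; ring. }
    auto_derive; auto. simpl. replace (t * x - 0 * y) with (t * x) by ring.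
    replace (t * y + 0 * x) with (t * y) by ring. ring.
Qed.

(** A mean value inequality for curves in C. Projecting onto the direction of [f t] reduces it to
    the real mean value theorem for [g] minus a real part. *)
Lemma Cder_bound (f df : R -> C) (g dg : R -> R) :
  f 0 = RtoC 0 -> g 0 = 0 -> (forall t, Cder f t (df t)) -> (forall t, is_derive g t (dg t)) ->
  (forall t, 0 <= t <= 1 -> Cmod (df t) <= dg t) -> forall t, 0 <= t <= 1 -> Cmod (f t) <= g t.
Proof.
  intros f0 g0 Hf Hg Hb t Ht.
  destruct (Req_dec (Cmod (f t)) 0) as [h0|h0].
  - rewrite h0. destruct (MVT_gen g 0 t dg) as [c [Hc Hm]].
    + intros; auto.
    + intros x _. apply derivable_continuous_pt, ex_derive_Reals_0. eexists; apply Hg.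
    + rewrite Rmin_left, Rmax_right in Hc by lra. rewrite g0 in Hm.
      specialize (Hb c ltac:(lra)). pose proof (Cmod_ge_0 (df c)). nra.
  (* [u] has modulus 1 and rotates [f t] onto the positive real axis. *)
  - set (u := (Cconj (f t) / RtoC (Cmod (f t)))%C).
    assert (Hpos : 0 < Cmod (f t)) by (pose proof (Cmod_ge_0 (f t)); lra).
    assert (Hn : RtoC (Cmod (f t)) <> RtoC 0) by (intros E; apply RtoC_inj in E; lra).
    assert (Hu : Cmod u = 1).
    { unfold u. rewrite Cmod_div by auto. rewrite Cmod_conj, Cmod_R, Rabs_right by lra. field. lra. }
    assert (Hft : Re (u * f t)%C = Cmod (f t)).
    { replace (u * f t)%C with (RtoC (Cmod (f t))); [apply re_RtoC|].
      unfold u. replace (Cconj (f t) / Cmod (f t) * f t)%C with ((f t * Cconj (f t)) / Cmod (f t))%C by (field; auto).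
      rewrite <- Cmod2_conj, RtoC_pow. field. auto. }
    set (phi := fun s => g s - Re (u * f s)%C).
    assert (Hphi : forall s, is_derive phi s (dg s - Re (u * df s)%C)).
    { intros s. unfold phi.
      apply (is_derive_ext (fun s => g s - (Re u * Re (f s) - Im u * Im (f s)))); [intros r; rewrite re_mult; reflexivity|].
      rewrite re_mult. destruct (Hf s) as [H1 H2].
      apply (is_derive_minus (V := R_NormedModule) g); [apply Hg|].
      apply (is_derive_minus (V := R_NormedModule) (fun r => Re u * Re (f r)) (fun r => Im u * Im (f r))).
      - apply (is_derive_scal (fun r => Re (f r))). auto.
      - apply (is_derive_scal (fun r => Im (f r))). auto. }
    destruct (MVT_gen phi 0 t (fun s => dg s - Re (u * df s)%C)) as [c [Hc Hm]].
    + intros; auto.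
    + intros x _. apply derivable_continuous_pt, ex_derive_Reals_0. eexists; apply Hphi.
    + rewrite Rmin_left, Rmax_right in Hc by lra. unfold phi in Hm.
      rewrite f0, g0, Cmult_0_r, Hft, re_RtoC in Hm.
      specialize (Hb c ltac:(lra)).
      assert (Re (u * df c)%C <= Cmod (df c)).
      { eapply Rle_trans; [apply Rle_abs|]. eapply Rle_trans; [apply re_le_Cmod|].
        rewrite Cmod_mult, Hu. lra. }
      assert (0 <= (dg c - Re (u * df c)%C) * (t - 0)) by (apply Rmult_le_pos; lra).
      lra.
Qed.

Lemma Cder_ext f g t d : (forall s, f s = g s) -> Cder f t d -> Cder g t d.
Proof.
  intros E [H1 H2]. split; eapply is_derive_ext; try (exact H1); try exact H2; intros s; simpl; rewrite E; auto.
Qed.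

(** Proved along the segment t z with t in [0, 1], by induction on N: the derivative in t of the
    remainder of order N + 1 is z times the remainder of order N, so integrating the bound for N
    gives the one for N + 1. *)
Lemma Cexp_taylor z N :
  Cmod (Cexp z - Csum (fun n => z ^ n / RtoC (INR (fact n)))%C N) <=
  Cmod z ^ N / INR (fact N) * exp (Cmod z).
Proof.
  assert (H : forall t, 0 <= t <= 1 ->
    Cmod (Cexp (RtoC t * z) - Csum (fun n => (RtoC t * z) ^ n / RtoC (INR (fact n)))%C N) <=
    t ^ N * (Cmod z ^ N / INR (fact N) * exp (Cmod z))).
  { induction N as [|N IH]; intros t Ht.
    - simpl. replace (Cexp (t * z) - 0)%C with (Cexp (t * z)%C) by ring. rewrite Cmod_Cexp.
      unfold Rdiv. rewrite Rinv_1, !Rmult_1_l.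
      assert (Re (t * z)%C <= Cmod z).
      { rewrite re_scal_l. pose proof (re_le_Cmod z). pose proof (Rle_abs (Re z)).
        pose proof (Cmod_ge_0 z). nra. }
      destruct H; [left; apply exp_increasing; auto|rewrite H; right; auto].
    - assert (HN : INR (fact (S N)) = INR (S N) * INR (fact N)) by (rewrite <- mult_INR; reflexivity).
      pose proof (lt_0_INR (S N) ltac:(lia)) as HS. pose proof (INR_fact_lt_0 N) as HF.
      apply (Cder_bound (fun s => Cexp (RtoC s * z) - Csum (fun n => (RtoC s * z) ^ n / RtoC (INR (fact n))) (S N))%C
        (fun s => z * (Cexp (RtoC s * z) - Csum (fun n => (RtoC s * z) ^ n / RtoC (INR (fact n))) N))%C
        (fun s => s ^ (S N) * (Cmod z ^ S N / INR (fact (S N)) * exp (Cmod z)))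
        (fun s => Cmod z * (s ^ N * (Cmod z ^ N / INR (fact N) * exp (Cmod z))))).
      + rewrite Csum_Sl, Csum_zero.
        * rewrite Cmult_0_l, Cexp_0. simpl. field.
        * intros i _. rewrite Cmult_0_l. simpl. unfold Cdiv. ring.
      + simpl. ring.
      + intros s. replace (z * (Cexp (s * z) - Csum (fun n => (s * z) ^ n / INR (fact n)) N))%C with
         (z * Cexp (s * z) - z * Csum (fun n => (s * z) ^ n / INR (fact n)) N)%C by ring.
        apply Cder_minus; [apply Cder_Cexp|]. clear - HF.
        induction N as [|N IH].
        * simpl. apply Cder_ext with (f := fun _ => (RtoC 1 * (0 + 1 / 1))%C); [intros; ring|].
          replace (z * 0)%C with (RtoC 0 * (0 + 1/1))%C by ring.
          apply (Cder_real (fun _ => 1) (0 + 1 / 1)%C s 0). apply (is_derive_const 1).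
        * assert (HF' := INR_fact_lt_0 N). specialize (IH HF').
          change (Csum (fun n => ((s * z) ^ n / INR (fact n))%C) (S N)) with
            (Csum (fun n => ((s * z) ^ n / INR (fact n))%C) N + (s * z) ^ N / INR (fact N))%C.
          rewrite Cmult_plus_distr_l.
          apply (Cder_plus (fun s => Csum (fun n => ((s * z) ^ n / INR (fact n))%C) (S N))); [exact IH|].
          assert (E1 : INR (fact (S N)) = INR (S N) * INR (fact N)) by (rewrite <- mult_INR; reflexivity).
          pose proof (lt_0_INR (S N) ltac:(lia)) as HS.
          replace (z * ((s * z) ^ N / INR (fact N)))%C with
            (RtoC (INR (S N) * s ^ N) * (z ^ S N / INR (fact (S N))))%C.
          2:{ rewrite E1, Cpow_mult_l, Cpow_S, !RtoC_mult, RtoC_pow. field.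
              split; intros E; apply RtoC_inj in E; lra. }
          apply Cder_ext with (f := fun s => (RtoC (s ^ S N) * (z ^ S N / INR (fact (S N))))%C).
          { intros r. rewrite Cpow_mult_l, RtoC_pow. unfold Cdiv. ring. }
          apply (Cder_real (fun r => r ^ S N) _ s (INR (S N) * s ^ N)). apply is_derive_Reals, (derivable_pt_lim_pow s (S N)).
      + intros s. rewrite HN.
        replace (Cmod z * (s ^ N * (Cmod z ^ N / INR (fact N) * exp (Cmod z)))) with
          (INR (S N) * s ^ N * (Cmod z ^ S N / (INR (S N) * INR (fact N)) * exp (Cmod z))) by (rewrite <- !tech_pow_Rmult; field; lra).
        apply (is_derive_scal_l (fun r => r ^ S N) s (INR (S N) * s ^ N) (Cmod z ^ S N / (INR (S N) * INR (fact N)) * exp (Cmod z))).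
        apply is_derive_Reals, (derivable_pt_lim_pow s (S N)).
      + intros s Hs. rewrite Cmod_mult. apply Rmult_le_compat_l; [apply Cmod_ge_0|]. apply IH. auto.
      + auto. }
  specialize (H 1 ltac:(lra)). rewrite Cmult_1_l, pow1, Rmult_1_l in H. auto.
Qed.

Lemma Cexp_taylor2 z : Cmod (Cexp z - 1 - z)%C <= Cmod z ^ 2 * exp (Cmod z).
Proof.
  pose proof (Cexp_taylor z 2). change (INR (fact 2)) with 2 in H.
  change (Csum (fun n => (z ^ n / INR (fact n))%C) 2) with (0 + 1 / 1 + z * 1 / 1)%C in H.
  replace (Cexp z - (0 + 1 / 1 + z * 1 / 1))%C with (Cexp z - 1 - z)%C in H by field.
  pose proof (exp_pos (Cmod z)). pose proof (Cmod_ge_0 z).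
  eapply Rle_trans; [exact H|]. apply Rmult_le_compat_r; [lra|]. pose proof (pow_le _ 2 H1). lra.
Qed.

Lemma Cexp_taylor3 z : Cmod (Cexp z - 1 - z - z * z / 2)%C <= Cmod z ^ 3 * exp (Cmod z).
Proof.
  pose proof (Cexp_taylor z 3). replace (INR (fact 3)) with 6 in H by (simpl; ring).
  change (Csum (fun n => (z ^ n / INR (fact n))%C) 3) with (0 + 1 / 1 + z * 1 / 1 + z * (z * 1) / (1 + 1)%R)%C in H.
  replace (Cexp z - (0 + 1 / 1 + z * 1 / 1 + z * (z * 1) / (1 + 1)%R))%C with (Cexp z - 1 - z - z * z / 2)%C in H.
  2:{ rewrite RtoC_plus. field. }
  pose proof (exp_pos (Cmod z)). pose proof (Cmod_ge_0 z).
  assert (0 <= Cmod z ^ 3) by (apply pow_le; auto).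
  eapply Rle_trans; [exact H|]. apply Rmult_le_compat_r; [lra|].
  lra.
Qed.

Lemma Cexp_series z : Csums (fun n => z ^ n / RtoC (INR (fact n)))%C (Cexp z).
Proof.
  apply CLim_squeeze with (e := fun N => Cmod z ^ N / INR (fact N) * exp (Cmod z)).
  - intros eps He. pose proof (exp_pos (Cmod z)).
    destruct (cv_speed_pow_fact (Cmod z) (eps / exp (Cmod z))) as [N HN].
    { apply Rdiv_lt_0_compat; lra. }
    exists N. intros n Hn. specialize (HN n Hn). unfold Rdist in HN. rewrite Rminus_0_r in HN.
    rewrite Rabs_mult, (Rabs_right (exp _)) by lra.
    apply Rmult_lt_compat_r with (r := exp (Cmod z)) in HN; [|lra].
    replace (eps / exp (Cmod z) * exp (Cmod z)) with eps in HN by (field; lra). auto.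
  - exists O. intros n _. rewrite Cmod_minus_sym. apply Cexp_taylor.
Qed.

Lemma CLim_mult u v l m : CLim u l -> CLim v m -> CLim (fun n => u n * v n)%C (l * m)%C.
Proof.
  intros H H'. destruct (CLim_bounded _ _ H) as [B [HB0 HB]].
  replace (l * m)%C with (0 + l * m)%C by ring.
  apply CLim_ext with (u := fun n => (u n * (v n - m) + m * u n)%C).
  { exists O. intros. ring. }
  replace (0 + l * m)%C with (0 + m * l)%C by ring.
  apply CLim_plus; [|apply CLim_scal; auto].
  intros eps He. destruct (H' (eps / (B + 1))) as [N HN]; [apply Rdiv_lt_0_compat; lra|].
  exists N. intros n Hn. specialize (HN n Hn). specialize (HB n).
  replace (u n * (v n - m) - 0)%C with (u n * (v n - m))%C by ring. rewrite Cmod_mult.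
  apply Rle_lt_trans with ((B + 1) * Cmod (v n - m)).
  - apply Rmult_le_compat_r; [apply Cmod_ge_0|lra].
  - apply Rmult_lt_compat_l with (r := B + 1) in HN; [|lra].
    replace ((B + 1) * (eps / (B + 1))) with eps in HN by (field; lra). auto.
Qed.

Lemma CLim_pow u l p : CLim u l -> CLim (fun n => u n ^ p)%C (l ^ p)%C.
Proof. intros H. induction p as [|p IH]; simpl; [apply CLim_const|]. apply CLim_mult; auto. Qed.

Lemma CLim_inv u l : l <> RtoC 0 -> CLim u l -> CLim (fun n => / u n)%C (/ l)%C.
Proof.
  intros Hl H eps He. assert (Hp : 0 < Cmod l) by (apply Cmod_gt_0; auto).
  destruct (H (Cmod l / 2)) as [N1 H1]; [lra|].
  destruct (H (eps * (Cmod l * Cmod l) / 2)) as [N2 H2].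
  { apply Rdiv_lt_0_compat; [|lra]. apply Rmult_lt_0_compat; auto. apply Rmult_lt_0_compat; auto. }
  exists (max N1 N2). intros n Hn. specialize (H1 n ltac:(lia)). specialize (H2 n ltac:(lia)).
  assert (Hu : Cmod l / 2 < Cmod (u n)).
  { rewrite Cmod_minus_sym in H1. pose proof (Cmod_tri_inv2 l (u n)). pose proof (Cmod_tri_inv2 l (l - u n)).
    replace (l - (l - u n))%C with (u n) in H3 by ring. lra. }
  assert (Hun : u n <> RtoC 0) by (apply Cmod_gt_0; lra).
  replace (/ u n - / l)%C with (- (u n - l) * / (u n * l))%C by (field; auto).
  rewrite Cmod_mult, Cmod_opp, Cmod_inv, Cmod_mult by (apply Cmult_neq_0; auto).
  apply Rle_lt_trans with (Cmod (u n - l) * / (Cmod l / 2 * Cmod l)).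
  - apply Rmult_le_compat_l; [apply Cmod_ge_0|]. apply Rinv_le_contravar; nra.
  - apply Rmult_lt_reg_r with (Cmod l / 2 * Cmod l); [nra|].
    rewrite Rmult_assoc, Rinv_l by nra. lra.
Qed.

Definition eu (z : C) : C := Cexp (RtoC (2 * PI) * Ci * z)%C.

Lemma eu_plus a b : eu (a + b)%C = (eu a * eu b)%C.
Proof. unfold eu. rewrite <- Cexp_plus. f_equal. ring. Qed.

Lemma eu_1 : eu 1 = RtoC 1.
Proof.
  unfold eu, Cexp. replace (Re (RtoC (2 * PI) * Ci * 1)%C) with 0 by (simpl; ring).
  replace (Im (RtoC (2 * PI) * Ci * 1)%C) with (2 * PI) by (simpl; ring).
  rewrite exp_0, cos_2PI, sin_2PI. apply C_eq; simpl; ring.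
Qed.

Lemma eu_half : eu (1 / 2)%C = RtoC (-1).
Proof.
  unfold eu, Cexp. replace (RtoC (2 * PI) * Ci * (1 / 2))%C with (RtoC PI * Ci)%C by (rewrite RtoC_mult; field).
  replace (Re (RtoC PI * Ci)%C) with 0 by (simpl; ring).
  replace (Im (RtoC PI * Ci)%C) with PI by (simpl; ring).
  rewrite exp_0, cos_PI, sin_PI. apply C_eq; simpl; ring.
Qed.

Lemma eu_neq0 z : eu z <> RtoC 0.
Proof. apply Cexp_neq0. Qed.

Lemma Cmod_eu z : Cmod (eu z) = exp (- (2 * PI) * Im z).
Proof. unfold eu. rewrite Cmod_Cexp. f_equal. destruct z. simpl. ring. Qed.

Lemma eu_INR n z : eu (RtoC (INR n) * z)%C = (eu z ^ n)%C.
Proof. unfold eu. rewrite <- Cexp_INR. f_equal. ring. Qed.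

Lemma eu_m1 z : eu (z - 1)%C = eu z.
Proof.
  replace (eu z) with (eu ((z - 1) + 1)%C) by (f_equal; ring).
  rewrite eu_plus, eu_1. ring.
Qed.

(** 2.37 is half of 4.74 = 2 * 3.16 * 3/4, the bound for |Im X| that arises in [lip_bound]. The
    Taylor polynomial of degree 7 is large enough on this range. *)
Lemma sin_lower t : 0 <= t <= 2.37 -> t / 20 <= sin t.
Proof.
  intros Ht. assert (2.37 <= PI) by (pose proof PI2_3_2; lra).
  destruct (SIN t ltac:(lra) ltac:(lra)) as [H1 _]. eapply Rle_trans; [|exact H1].
  unfold sin_lb, sin_approx, sin_term. simpl sum_f_R0.
  replace (INR (fact (2 * 0 + 1))) with 1 by (simpl; ring).
  replace (INR (fact (2 * 1 + 1))) with 6 by (simpl; ring).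
  replace (INR (fact (2 * 2 + 1))) with 120 by (simpl; ring).
  replace (INR (fact (2 * 3 + 1))) with 5040 by (simpl; ring).
  simpl pow.
  set (x := t * t). assert (0 <= x <= 5.6169) by (unfold x; nra).
  assert (0 <= t * (1 - 1 / 20 - x / 6 + x * x / 120 - x * x * x / 5040)).
  { apply Rmult_le_pos; [lra|]. nra. }
  unfold x in *. lra.
Qed.

(** If PI were larger, sin 3.16 would be positive, while its Taylor upper bound of degree 9 is
    negative. *)
Lemma PI_upper : PI <= 3.16.
Proof.
  destruct (Rle_lt_dec PI 3.16) as [h|h]; auto. exfalso.
  pose proof PI_4.
  assert (Hs : 0 <= sin 3.16) by (left; apply sin_gt_0; lra).
  destruct (SIN 3.16 ltac:(lra) ltac:(lra)) as [_ H2].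
  unfold sin_ub, sin_approx, sin_term in H2. cbv [sum_f_R0] in H2.
  replace (INR (fact (2 * 0 + 1))) with 1 in H2 by (simpl; ring).
  replace (INR (fact (2 * 1 + 1))) with 6 in H2 by (simpl; ring).
  replace (INR (fact (2 * 2 + 1))) with 120 in H2 by (simpl; ring).
  replace (INR (fact (2 * 3 + 1))) with 5040 in H2 by (simpl; ring).
  assert (F : forall n, INR (fact (S n)) = INR (S n) * INR (fact n)) by (intros; rewrite <- mult_INR; reflexivity).
  change (2 * 4 + 1)%nat with 9%nat in H2. rewrite (F 8%nat), (F 7%nat) in H2.
  replace (INR (fact 7)) with 5040 in H2 by (simpl; ring).
  replace (INR 9) with 9 in H2 by (simpl; ring). replace (INR 8) with 8 in H2 by (simpl; ring).
  simpl pow in H2. lra.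
Qed.

Lemma one_minus_cos b : 1 - cos b = 2 * (sin (b / 2)) ^ 2.
Proof. replace b with (2 * (b / 2)) at 1 by field. rewrite cos_2a_sin. ring. Qed.

Lemma exp_neg_bounds a : 0 <= a <= 1 -> 1 / 3 <= exp (- a) <= 1 - a / 2.
Proof.
  intros Ha. split.
  - rewrite exp_Ropp. replace (1 / 3) with (/ 3) by field. apply Rinv_le_contravar; [apply exp_pos|].
    eapply Rle_trans; [|apply exp_le_3]. destruct (proj2 Ha); [left; apply exp_increasing; auto|subst; lra].
  - pose proof (exp_ineq1_le a). rewrite exp_Ropp.
    apply Rle_trans with (/ (1 + a)); [apply Rinv_le_contravar; lra|].
    apply Rmult_le_reg_r with (1 + a); [lra|]. rewrite Rinv_l by lra. nra.
Qed.

(** For X = -a + i b, |1 - e^X|^2 equals (1 - e^{-a})^2 + 4 e^{-a} sin^2(b/2), so the two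
    coordinates are bounded separately. As 4.74 < 2 pi, the only zero in the range is X = 0. *)
Lemma one_minus_Cexp_lower X : -1 <= Re X <= 0 -> Rabs (Im X) <= 4.74 -> Cmod X / 100 <= Cmod (1 - Cexp X).
Proof.
  intros Ha Hb. destruct X as [x b]. simpl in Ha, Hb.
  set (a := - x). assert (Ha' : 0 <= a <= 1) by (unfold a; lra).
  destruct (exp_neg_bounds a Ha') as [E1 E2].
  assert (Es : Rabs b / 40 <= Rabs (sin (b / 2))).
  { destruct (Rle_lt_dec 0 b) as [h|h].
    - rewrite Rabs_right in * by lra. pose proof (sin_lower (b / 2) ltac:(lra)).
      rewrite Rabs_right; lra.
    - rewrite Rabs_left in * by lra. pose proof (sin_lower (- b / 2) ltac:(lra)).
      replace (- b / 2) with (- (b / 2)) in H by field. rewrite sin_neg in H.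
      rewrite Rabs_left; lra. }
  assert (Hsq : Cmod (1 - Cexp (x, b)) ^ 2 = (1 - exp (- a)) ^ 2 + 4 * exp (- a) * (sin (b / 2)) ^ 2).
  { rewrite Cmod2_alt. unfold Cexp. simpl Re; simpl Im. replace (- a) with x by (unfold a; ring).
    replace (sin (b/2) ^ 2) with ((1 - cos b) / 2) by (rewrite one_minus_cos; field).
    pose proof (sin2_cos2 b). unfold Rsqr in H.
    replace ((1 + - (exp x * cos b)) ^ 2 + (0 + - (exp x * sin b)) ^ 2) with
      (1 - 2 * exp x * cos b + exp x ^ 2 * (sin b * sin b + cos b * cos b)) by ring.
    rewrite H. field. }
  assert (Hx : Cmod (x, b) ^ 2 = a ^ 2 + b ^ 2).
  { rewrite Cmod2_alt. simpl. unfold a. ring. }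
  apply Rsqr_incr_0_var; [|apply Cmod_ge_0].
  rewrite !Rsqr_pow2. rewrite Hsq. replace ((Cmod (x, b) / 100) ^ 2) with (Cmod (x, b) ^ 2 / 10000) by field.
  rewrite Hx.
  assert (S1 : b ^ 2 / 1600 <= sin (b / 2) ^ 2).
  { rewrite <- (pow2_abs b), <- (pow2_abs (sin (b/2))). pose proof (Rabs_pos b).
    replace (Rabs b ^ 2 / 1600) with ((Rabs b / 40) ^ 2) by field. apply pow_incr. lra. }
  assert (S2 : (a / 2) ^ 2 <= (1 - exp (- a)) ^ 2) by (apply pow_incr; lra).
  pose proof (pow2_ge_0 (sin (b / 2))). pose proof (pow2_ge_0 a). pose proof (pow2_ge_0 b). nra.
Qed.

Lemma sum_inv_sq n : Rsum (fun i => / INR (S i) ^ 2) n <= 2.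
Proof.
  apply Rle_trans with (2 - / INR (S n)).
  2:{ pose proof (Rinv_0_lt_compat (INR (S n)) ltac:(apply lt_0_INR; lia)). lra. }
  apply Rle_trans with (Rsum (fun i => / INR (S i) ^ 2) (S n)).
  { apply Rsum_mono; [|lia]. intros i. left. apply Rinv_0_lt_compat, pow_lt, lt_0_INR. lia. }
  induction n as [|n IH]; [simpl; lra|].
  change (Rsum (fun i => / INR (S i) ^ 2) (S (S n))) with (Rsum (fun i => / INR (S i) ^ 2) (S n) + / INR (S (S n)) ^ 2).
  rewrite (S_INR (S n)). set (t := INR (S n)) in *.
  assert (1 <= t) by (unfold t; rewrite S_INR; pose proof (pos_INR n); lra).
  assert (/ (t + 1) ^ 2 <= / t - / (t + 1)); [|lra].
  replace (/ t - / (t + 1)) with (/ (t * (t + 1))) by (field; lra).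
  apply Rinv_le_contravar; nra.
Qed.

(** * The Lipschitz formula *)

(* The duplication formula, iterated, is a Riemann-type sum over the 2^n-th division points; its
   limit is the Lipschitz formula  sum_d (z+d)^{-p} = const * phi (e^{2 pi i z}). *)
Section Lipschitz.
Variables (P : C -> C) (p : nat) (K : R).
Let phi (u : C) : C := (P u / (1 - u) ^ p)%C.
Hypothesis P_bound : forall u, Cmod u <= 1 -> Cmod (P u) <= K.
Hypothesis P_dup : forall v, v <> RtoC 1 -> v <> RtoC (-1) ->
  (phi v + phi (- v) = 2 ^ p * phi (v * v))%C.
Hypothesis P_lim : forall u, CLim u 1 -> CLim (fun n => P (u n)) (RtoC K).
Hypothesis p_ge : (2 <= p)%nat.

Variable z : C.
Hypothesis z_im : 0 <= Im z.
Variable c : R.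
Hypothesis c_pos : 0 < c.
Hypothesis z_c : forall i, c * INR (S i) <= Cmod (z + RtoC (INR i)) /\ c * INR (S i) <= Cmod (z - 1 - RtoC (INR i)).
Hypothesis z_ne : forall n j, eu ((z + RtoC (INR j)) / 2 ^ n)%C <> RtoC 1.

Lemma two_pow_neq0 n : (2 ^ n)%C <> RtoC 0.
Proof. apply Cpow_nz. intros E. apply RtoC_inj in E. lra. Qed.

(** Adding 1/2 to a division point changes the sign of [eu], so the terms j and j + 2^n of level n +
    1 combine by [P_dup] into the term j of level n. *)
Lemma dup_iter n :
  phi (eu z) = (/ (2 ^ p) ^ n * Csum (fun j => phi (eu ((z + RtoC (INR j)) / 2 ^ n))) (2 ^ n))%C.
Proof.
  induction n as [|n IH].
  - simpl. replace ((z + 0) / 1)%C with z by field. field.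
  - rewrite IH. clear IH.
    assert (E : (2 ^ S n = 2 ^ n + 2 ^ n)%nat) by (simpl; lia). rewrite E, Csum_split.
    rewrite <- Csum_plus.
    rewrite (Csum_ext (fun i => phi (eu ((z + RtoC (INR i)) / 2 ^ S n)) + phi (eu ((z + RtoC (INR (2 ^ n + i))) / 2 ^ S n)))%C
      (fun j => 2 ^ p * phi (eu ((z + RtoC (INR j)) / 2 ^ n)))%C).
    { rewrite Csum_scal, (Cpow_S (2 ^ p)). field. split; [apply Cpow_nz, two_pow_neq0|apply two_pow_neq0]. }
    intros j _. pose proof (two_pow_neq0 n) as H2.
    assert (H20 : RtoC 2 <> RtoC 0) by (intros F; apply RtoC_inj in F; lra).
    set (w := ((z + INR j) / 2 ^ S n)%C).
    assert (Ew : ((z + INR j) / 2 ^ n = w + w)%C).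
    { unfold w. rewrite Cpow_S. field. auto. }
    assert (Ew2 : ((z + INR (2 ^ n + j)) / 2 ^ S n = w + 1 / 2)%C).
    { unfold w. rewrite plus_INR, pow_INR, RtoC_plus, RtoC_pow. simpl INR.
      replace (1 + 1) with 2 by ring. rewrite Cpow_S. field. auto. }
    rewrite Ew2, Ew, !eu_plus, eu_half.
    replace (eu w * -1)%C with (- eu w)%C by ring. apply P_dup.
    + unfold w. apply z_ne.
    + intros F. apply (z_ne (S n) (2 ^ n + j)). rewrite Ew2, eu_plus, eu_half, F. ring.
Qed.

(** The upper half of the division points is shifted down by one period and reversed. For fixed i
    the numerators z + i and z - 1 - i no longer depend on the level, which a termwise limit
    requires. *)
Lemma dup_iter_sym n :
  phi (eu z) = Csum (fun i => / (2 ^ p) ^ S n * (phi (eu ((z + RtoC (INR i)) / 2 ^ S n)) +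
     phi (eu ((z - 1 - RtoC (INR i)) / 2 ^ S n))))%C (2 ^ n).
Proof.
  rewrite (dup_iter (S n)), Csum_scal. f_equal.
  assert (E : (2 ^ S n = 2 ^ n + 2 ^ n)%nat) by (simpl; lia). rewrite E, Csum_split, Csum_plus.
  f_equal. rewrite Csum_rev. apply Csum_ext. intros i Hi. f_equal.
  rewrite <- eu_m1. f_equal. rewrite plus_INR, minus_INR, minus_INR by lia. simpl (INR 1).
  rewrite pow_INR. simpl (INR 2). replace (1 + 1) with 2 by ring.
  rewrite Cpow_S, !RtoC_plus, !RtoC_minus, RtoC_pow. field.
  apply two_pow_neq0.
Qed.

Let term (w : C) : C := (RtoC K / (RtoC (2 * PI) * Ci * w) ^ p)%C.

(** A bound independent of the level M = 2^n, as dominated convergence demands: |1 - e^X| >= |X|/100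
    for X = 2 pi i w/M, and the powers of M cancel. *)
Lemma lip_bound w M : 0 < M -> w <> RtoC 0 -> 0 <= Im w -> 2 * PI * Im w <= M -> Rabs (Re w) <= 3 / 4 * M ->
  Cmod (/ (RtoC M) ^ p * phi (eu (w / RtoC M)))%C <= K * (/ (Cmod w / 20)) ^ p.
Proof.
  intros HM Hw Hi HiM Hr. pose proof PI_upper as HP. pose proof PI2_3_2 as HP2.
  assert (HMC : RtoC M <> RtoC 0) by (intros F; apply RtoC_inj in F; lra).
  assert (Hwp : 0 < Cmod w) by (apply Cmod_gt_0; auto).
  set (X := (RtoC (2 * PI) * Ci * (w / RtoC M))%C).
  assert (EX : X = (RtoC (2 * PI / M) * (Ci * w))%C).
  { unfold X. rewrite RtoC_div by lra. field. auto. }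
  assert (Re1 : Re X = - (2 * PI * Im w / M)) by (rewrite EX; destruct w; simpl; field; lra).
  assert (Im1 : Im X = 2 * PI * Re w / M) by (rewrite EX; destruct w; simpl; field; lra).
  assert (HX : Cmod X = 2 * PI / M * Cmod w).
  { rewrite EX, !Cmod_mult, Cmod_Ci, Cmod_R, Rabs_right; [ring|].
    apply Rle_ge, Rlt_le, Rdiv_lt_0_compat; lra. }
  assert (HL : Cmod X / 100 <= Cmod (1 - Cexp X)).
  { apply one_minus_Cexp_lower.
    - rewrite Re1. split.
      + assert (2 * PI * Im w / M <= 1); [|lra]. apply Rmult_le_reg_r with M; auto.
        unfold Rdiv. rewrite Rmult_assoc, Rinv_l by lra. lra.
      + assert (0 <= 2 * PI * Im w / M); [|lra]. apply Rmult_le_pos; [nra|]. left; apply Rinv_0_lt_compat; auto.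
    - rewrite Im1. unfold Rdiv. rewrite Rabs_mult, Rabs_mult, (Rabs_right (2 * PI)) by lra.
      rewrite Rabs_inv, (Rabs_right M) by lra. apply Rmult_le_reg_r with M; auto.
      rewrite Rmult_assoc, Rinv_l by lra. pose proof (Rabs_pos (Re w)). nra. }
  assert (HL2 : Cmod w / 20 <= M * Cmod (1 - Cexp X)).
  { rewrite HX in HL. apply Rle_trans with (M * (2 * PI / M * Cmod w / 100)).
    - replace (M * (2 * PI / M * Cmod w / 100)) with (2 * PI * Cmod w / 100) by (field; lra). nra.
    - apply Rmult_le_compat_l; lra. }
  assert (Hne : (1 - Cexp X)%C <> RtoC 0).
  { apply Cmod_gt_0. apply Rmult_lt_reg_l with M; auto. lra. }
  unfold phi. change (eu (w / RtoC M)) with (Cexp X).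
  replace (/ RtoC M ^ p * (P (Cexp X) / (1 - Cexp X) ^ p))%C with (P (Cexp X) * / (RtoC M * (1 - Cexp X)) ^ p)%C.
  2:{ rewrite Cpow_mult_l. field. split; apply Cpow_nz; auto. }
  rewrite Cmod_mult, Cmod_inv by (apply Cpow_nz, Cmult_neq_0; auto).
  rewrite Cmod_pow, Cmod_mult, Cmod_R, (Rabs_right M) by lra.
  apply Rmult_le_compat; try apply Cmod_ge_0.
  - left. apply Rinv_0_lt_compat, pow_lt. lra.
  - apply P_bound. rewrite Cmod_Cexp. rewrite <- exp_0. rewrite Re1.
    assert (0 <= 2 * PI * Im w / M) by (apply Rmult_le_pos; [nra|]; left; apply Rinv_0_lt_compat; auto).
    destruct H; [left; apply exp_increasing; lra|right; f_equal; lra].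
  - rewrite pow_inv. apply Rinv_le_contravar; [apply pow_lt; lra|]. apply pow_incr. lra.
Qed.

Lemma Rlim0_half c0 : Rlim0 (fun n => c0 / 2 ^ n).
Proof.
  intros eps He. destruct (Rlim0_geom c0 (/ 2) ltac:(lra) eps He) as [N HN]. exists N. intros n Hn.
  specialize (HN n Hn). rewrite pow_inv in HN. exact HN.
Qed.

(** By the second-order Taylor bound, M (1 - e^{2 pi i w/M}) tends to -2 pi i w along M = 2^(N0 +
    n), while the numerator tends to [K]. *)
Lemma lip_lim w N0 : w <> RtoC 0 ->
  CLim (fun n => / (2 ^ p) ^ (N0 + n) * phi (eu (w / 2 ^ (N0 + n))))%C ((-1) ^ p * term w)%C.
Proof.
  intros Hw. set (Y := (RtoC (2 * PI) * Ci * w)%C).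
  assert (HY : Y <> RtoC 0).
  { pose proof PI_RGT_0. apply Cmult_neq_0; auto. apply Cmult_neq_0; [|apply Ci_nz].
    intros F; apply RtoC_inj in F; lra. }
  set (x := fun n => (Y / 2 ^ (N0 + n))%C).
  assert (Hx : forall n, Cmod (x n) = Cmod Y / 2 ^ (N0 + n)).
  { intros n. unfold x. rewrite Cmod_div by apply two_pow_neq0. f_equal.
    rewrite Cmod_pow, Cmod_R, Rabs_right; [auto|lra]. }
  assert (Hx1 : forall n, Cmod (x n) <= Cmod Y).
  { intros n. rewrite Hx. pose proof (Cmod_ge_0 Y). assert (1 <= 2 ^ (N0 + n)) by (apply pow_R1_Rle; lra).
    apply Rmult_le_reg_r with (2 ^ (N0 + n)); [lra|]. unfold Rdiv. rewrite Rmult_assoc, Rinv_l by lra. nra. }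
  assert (Hx2 : forall n, Cmod (x n) <= Cmod Y / 2 ^ n).
  { intros n. rewrite Hx. pose proof (Cmod_ge_0 Y). apply Rmult_le_compat_l; auto.
    apply Rinv_le_contravar; [apply pow_lt; lra|]. apply Rle_pow; [lra|lia]. }
  assert (L1 : CLim (fun n => Cexp (x n)) 1).
  { apply CLim_squeeze with (e := fun n => (Cmod Y * (Cmod Y * exp (Cmod Y) + 1)) / 2 ^ n).
    - apply Rlim0_half.
    - exists O. intros n _. replace (Cexp (x n) - 1)%C with (Cexp (x n) - 1 - x n + x n)%C by ring.
      eapply Rle_trans; [apply Cmod_triangle|]. pose proof (Cexp_taylor2 (x n)).
      specialize (Hx1 n). specialize (Hx2 n). pose proof (Cmod_ge_0 (x n)).
      assert (exp (Cmod (x n)) <= exp (Cmod Y)) by (destruct Hx1 as [h|h]; [left; apply exp_increasing; auto|rewrite h; right; auto]).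
      pose proof (exp_pos (Cmod (x n))).
      apply Rle_trans with (Cmod (x n) * (Cmod Y * exp (Cmod Y) + 1)).
      + assert (Cmod (x n) ^ 2 * exp (Cmod (x n)) <= Cmod (x n) * (Cmod Y * exp (Cmod Y))); [|lra].
        replace (Cmod (x n) ^ 2 * exp (Cmod (x n))) with (Cmod (x n) * (Cmod (x n) * exp (Cmod (x n)))) by ring.
        apply Rmult_le_compat_l; auto. apply Rmult_le_compat; lra.
      + replace (Cmod Y * (Cmod Y * exp (Cmod Y) + 1) / 2 ^ n) with (Cmod Y / 2 ^ n * (Cmod Y * exp (Cmod Y) + 1))
          by (unfold Rdiv; ring).
        apply Rmult_le_compat_r; [|exact Hx2]. pose proof (Cmod_ge_0 Y). pose proof (exp_pos (Cmod Y)). nra. }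
  assert (L2 : CLim (fun n => 2 ^ (N0 + n) * (1 - Cexp (x n)))%C (- Y)%C).
  { apply CLim_squeeze with (e := fun n => (Cmod Y ^ 2 * exp (Cmod Y)) / 2 ^ n).
    - apply Rlim0_half.
    - exists O. intros n _. pose proof (two_pow_neq0 (N0 + n)) as H2.
      replace (2 ^ (N0 + n) * (1 - Cexp (x n)) - - Y)%C with (- (2 ^ (N0 + n) * (Cexp (x n) - 1 - x n)))%C.
      2:{ unfold x. field. auto. }
      rewrite Cmod_opp, Cmod_mult, Cmod_pow, Cmod_R, (Rabs_right 2) by lra.
      assert (Hp : 0 < 2 ^ (N0 + n)) by (apply pow_lt; lra).
      apply Rle_trans with (2 ^ (N0 + n) * (Cmod (x n) ^ 2 * exp (Cmod Y))).
      + apply Rmult_le_compat_l; [lra|]. eapply Rle_trans; [apply Cexp_taylor2|].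
        apply Rmult_le_compat_l; [apply pow_le, Cmod_ge_0|]. specialize (Hx1 n).
        destruct Hx1 as [h|h]; [left; apply exp_increasing; auto|rewrite h; right; auto].
      + rewrite Hx. replace (2 ^ (N0 + n) * ((Cmod Y / 2 ^ (N0 + n)) ^ 2 * exp (Cmod Y))) with
          (Cmod Y ^ 2 * exp (Cmod Y) / 2 ^ (N0 + n)) by (field; lra).
        apply Rmult_le_compat_l; [apply Rmult_le_pos; [apply pow_le, Cmod_ge_0|left; apply exp_pos]|].
        apply Rinv_le_contravar; [apply pow_lt; lra|]. apply Rle_pow; [lra|lia]. }
  assert (HmY : (- Y)%C <> RtoC 0).
  { intros F. apply HY. replace Y with (- (- Y))%C by ring. rewrite F. ring. }
  replace ((-1) ^ p * term w)%C with (RtoC K * / (- Y) ^ p)%C.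
  2:{ unfold term. fold Y. replace (- Y)%C with ((-1) * Y)%C by ring. rewrite Cpow_mult_l.
      assert (Hm1 : (RtoC (-1) ^ p * RtoC (-1) ^ p = 1)%C).
      { rewrite <- Cpow_mult_l. replace (RtoC (-1) * RtoC (-1))%C with (RtoC 1) by ring. apply Cpow_1_l. }
      assert ((RtoC (-1) ^ p)%C <> RtoC 0) by (intros F; rewrite F, Cmult_0_l in Hm1; apply C1_nz; auto).
      assert (HYp : (Y ^ p)%C <> RtoC 0) by (apply Cpow_nz; auto).
      replace (/ (RtoC (-1) ^ p * Y ^ p))%C with ((RtoC (-1) ^ p * RtoC (-1) ^ p) * / (RtoC (-1) ^ p * Y ^ p))%C by (rewrite Hm1; ring).
      field. auto. }
  apply CLim_ext with (u := fun n => (P (Cexp (x n)) * / (2 ^ (N0 + n) * (1 - Cexp (x n))) ^ p)%C).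
  - destruct (L2 (Cmod (- Y)) ltac:(apply Cmod_gt_0; auto)) as [N HN]. exists N. intros n Hn.
    specialize (HN n Hn).
    assert (Hz : (1 - Cexp (x n))%C <> RtoC 0).
    { intros F. rewrite F in HN. replace (2 ^ (N0 + n) * 0 - - Y)%C with (- - Y)%C in HN by ring.
      rewrite Cmod_opp in HN. lra. }
    unfold phi. replace (eu (w / 2 ^ (N0 + n))) with (Cexp (x n)).
    2:{ unfold eu, x, Y. f_equal. field. apply two_pow_neq0. }
    rewrite Cpow_mult_l, <- !Cpow_mult_r, (Nat.mul_comm p). field.
    split; apply Cpow_nz; auto. intros F; apply RtoC_inj in F; lra.
  - apply CLim_mult; [apply P_lim; auto|]. apply CLim_inv; [apply Cpow_nz; auto|]. apply CLim_pow. auto.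
Qed.

(** Here p >= 2 enters: the decay of order p is weakened to the summable inverse square. *)
Lemma lip_decay i (N0 : nat) : exists b, b = (K * (/ (c / 20)) ^ p * 2 * / INR (S i) ^ 2) /\
  forall w, c * INR (S i) <= Cmod w -> K * (/ (Cmod w / 20)) ^ p * 2 <= b.
Proof.
  eexists; split; [reflexivity|]. intros w Hw.
  assert (HK : 0 <= K).
  { apply Rle_trans with (Cmod (P 0)); [apply Cmod_ge_0|apply P_bound]. rewrite Cmod_0. lra. }
  set (t := INR (S i)) in *. assert (Ht : 1 <= t) by (unfold t; rewrite S_INR; pose proof (pos_INR i); lra).
  assert (H1 : (/ (Cmod w / 20)) ^ p <= (/ (c / 20)) ^ p * / t ^ p).
  { rewrite <- pow_inv, <- Rpow_mult_distr. apply pow_incr. assert (0 < c * t) by nra. split.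
    - left. apply Rinv_0_lt_compat. lra.
    - rewrite <- Rinv_mult. apply Rinv_le_contravar; lra. }
  assert (H2 : / t ^ p <= / t ^ 2).
  { apply Rinv_le_contravar; [apply pow_lt; lra|]. apply Rle_pow; auto. }
  assert (H3 : 0 <= (/ (c / 20)) ^ p) by (apply pow_le; left; apply Rinv_0_lt_compat; lra).
  replace (K * (/ (c / 20)) ^ p * 2 * / t ^ 2) with (K * ((/ (c / 20)) ^ p * / t ^ 2) * 2) by ring.
  apply Rmult_le_compat_r; [lra|]. apply Rmult_le_compat_l; auto.
  eapply Rle_trans; [exact H1|]. apply Rmult_le_compat_l; auto.
Qed.

(** At every level the sum over division points equals [phi (eu z)], so its limit, computed termwise
    by [tannery], is that same number. *)
Lemma lipschitz_gen :
  Csums (fun i => (-1) ^ p * term (z + RtoC (INR i)) + (-1) ^ p * term (z - 1 - RtoC (INR i)))%C (phi (eu z)).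
Proof.
  pose proof PI_upper as HP. pose proof PI2_3_2 as HP2.
  (* Levels start at N0 so that [lip_bound] applies to every i < 2^(N0 + n): the real parts stay
     below 2^(N0 + n) + 2^N0 / 4, hence below three quarters of the modulus 2^(N0 + n + 1). *)
  assert (Hm : exists N0 : nat, 2 * PI * Im z <= 2 ^ N0 /\ 4 * (Rabs (Re z) + 1) <= 2 ^ N0).
  { destruct (INR_unbounded (2 * PI * Im z + 4 * (Rabs (Re z) + 1))) as [N0 HN].
    exists N0. assert (INR N0 <= 2 ^ N0).
    { clear HN. induction N0 as [|n IH]; [simpl; lra|]. rewrite S_INR. simpl.
      assert (1 <= 2 ^ n) by (apply pow_R1_Rle; lra). lra. }
    pose proof (Rabs_pos (Re z)). assert (0 <= 2 * PI * Im z) by (apply Rmult_le_pos; lra). lra. }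
  destruct Hm as [N0 [HN1 HN2]].
  assert (Hz1 : forall i, (z + RtoC (INR i))%C <> RtoC 0).
  { intros i. apply Cmod_gt_0. destruct (z_c i) as [H _]. pose proof (lt_0_INR (S i) ltac:(lia)). nra. }
  assert (Hz2 : forall i, (z - 1 - RtoC (INR i))%C <> RtoC 0).
  { intros i. apply Cmod_gt_0. destruct (z_c i) as [_ H]. pose proof (lt_0_INR (S i) ltac:(lia)). nra. }
  set (t := fun n i => (/ (2 ^ p) ^ S (N0 + n) * (phi (eu ((z + RtoC (INR i)) / 2 ^ S (N0 + n))) +
     phi (eu ((z - 1 - RtoC (INR i)) / 2 ^ S (N0 + n)))))%C).
  set (t0 := fun i => ((-1) ^ p * term (z + RtoC (INR i)) + (-1) ^ p * term (z - 1 - RtoC (INR i)))%C).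
  set (b := fun i => K * (/ (c / 20)) ^ p * 2 * / INR (S i) ^ 2).
  assert (Hlim : forall i, CLim (fun n => t n i) (t0 i)).
  { intros i. unfold t, t0.
    apply CLim_ext with (u := fun n => (/ (2 ^ p) ^ (S N0 + n) * phi (eu ((z + RtoC (INR i)) / 2 ^ (S N0 + n))) +
      / (2 ^ p) ^ (S N0 + n) * phi (eu ((z - 1 - RtoC (INR i)) / 2 ^ (S N0 + n))))%C).
    { exists O. intros n _. simpl Nat.add. ring. }
    apply CLim_plus; apply lip_lim; auto. }
  assert (Hbt : forall n i, (i < 2 ^ (N0 + n))%nat -> Cmod (t n i) <= b i).
  { intros n i Hi. unfold t, b.
    assert (HM : RtoC (2 ^ S (N0 + n)) = (2 ^ S (N0 + n))%C) by apply RtoC_pow.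
    assert (Hi' : INR i <= 2 ^ (N0 + n) - 1).
    { apply le_INR in Hi. rewrite S_INR, pow_INR in Hi. simpl (INR 2) in Hi. replace (1 + 1) with 2 in Hi by ring. lra. }
    assert (HMN : 2 ^ N0 <= 2 ^ (N0 + n)) by (apply Rle_pow; [lra|lia]).
    assert (HMS : 2 ^ S (N0 + n) = 2 * 2 ^ (N0 + n)) by reflexivity.
    pose proof (pos_INR i). assert (0 < 2 ^ (N0 + n)) by (apply pow_lt; lra).
    pose proof (Rle_abs (Re z)). pose proof (Rle_abs (- Re z)). rewrite Rabs_Ropp in H2.
    assert (Hgen : forall w, w <> RtoC 0 -> Im w = Im z -> Rabs (Re w) <= 3 / 4 * 2 ^ S (N0 + n) -> c * INR (S i) <= Cmod w ->
       Cmod (/ (2 ^ p) ^ S (N0 + n) * phi (eu (w / 2 ^ S (N0 + n))))%C * 2 <= K * (/ (c / 20)) ^ p * 2 * / INR (S i) ^ 2).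
    { intros w Hw0 Hwi Hwr Hwc. destruct (lip_decay i N0) as [b' [Eb Hb']]. specialize (Hb' w Hwc). rewrite Eb in Hb'.
      eapply Rle_trans; [|exact Hb']. apply Rmult_le_compat_r; [lra|].
      rewrite <- Cpow_mult_r, (Nat.mul_comm p), Cpow_mult_r, <- HM. apply lip_bound; auto.
      - rewrite HMS. lra.
      - rewrite Hwi. auto.
      - rewrite Hwi, HMS. lra. }
    rewrite Cmult_plus_distr_l. eapply Rle_trans; [apply Cmod_triangle|].
    assert (G1 := Hgen (z + RtoC (INR i))%C (Hz1 i)). assert (G2 := Hgen (z - 1 - RtoC (INR i))%C (Hz2 i)).
    destruct (z_c i) as [c1 c2].
    assert (R1 : Re (z + RtoC (INR i))%C = Re z + INR i) by (destruct z; simpl; ring).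
    assert (R2 : Re (z - 1 - RtoC (INR i))%C = Re z - 1 - INR i) by (destruct z; simpl; ring).
    assert (I1 : Im (z + RtoC (INR i))%C = Im z) by (destruct z; simpl; ring).
    assert (I2 : Im (z - 1 - RtoC (INR i))%C = Im z) by (destruct z; simpl; ring).
    specialize (G1 I1). specialize (G2 I2). rewrite R1 in G1. rewrite R2 in G2. rewrite HMS in G1 at 1. rewrite HMS in G2 at 1.
    assert (A1 : Rabs (Re z + INR i) <= 3 / 4 * (2 * 2 ^ (N0 + n))) by (apply Rabs_le; lra).
    assert (A2 : Rabs (Re z - 1 - INR i) <= 3 / 4 * (2 * 2 ^ (N0 + n))) by (apply Rabs_le; lra).
    specialize (G1 A1 c1). specialize (G2 A2 c2). lra. }
  assert (Hb0 : forall i, Cmod (t0 i) <= b i).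
  { intros i. apply CLim_mod_le with (u := fun n => t n i); auto.
    exists i. intros n Hn. apply Hbt. apply Nat.lt_le_trans with (2 ^ i)%nat; [apply Nat.pow_gt_lin_r; lia|].
    apply Nat.pow_le_mono_r; lia. }
  assert (HB : forall n, Rsum b n <= K * (/ (c / 20)) ^ p * 2 * 2).
  { intros n. unfold b. rewrite Rsum_scal. apply Rmult_le_compat_l.
    - assert (HK : 0 <= K).
      { apply Rle_trans with (Cmod (P 0)); [apply Cmod_ge_0|apply P_bound]. rewrite Cmod_0. lra. }
      assert (H3 : 0 <= (/ (c / 20)) ^ p) by (apply pow_le; left; apply Rinv_0_lt_compat; lra). nra.
    - apply sum_inv_sq. }
  destruct (Csums_exists t0 b _ Hb0 HB) as [l Hl].
  replace (phi (eu z)) with l; [exact Hl|].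
  apply CLim_unique with (u := fun n => Csum (t n) (2 ^ (N0 + n))).
  - apply tannery with (t0 := t0) (b := b) (B := K * (/ (c / 20)) ^ p * 2 * 2); auto.
    intros M. apply Nat.le_trans with (2 ^ M)%nat; [apply Nat.lt_le_incl, Nat.pow_gt_lin_r; lia|].
    apply Nat.pow_le_mono_r; lia.
  - apply CLim_ext with (u := fun _ => phi (eu z)); [|apply CLim_const].
    exists O. intros n _. apply dup_iter_sym.
Qed.
End Lipschitz.

(** * Lipschitz formulas of weights 4 and 6, and two zeta values *)

Lemma lin_geom s s' : 0 <= s < s' -> exists C, 0 <= C /\ forall n, INR n * s ^ n <= C * s' ^ n.
Proof.
  intros Hs. set (t := s / s'). assert (Ht : 0 <= t < 1).
  { unfold t. split; [apply Rmult_le_pos; [lra|left; apply Rinv_0_lt_compat; lra]|].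
    apply Rmult_lt_reg_r with s'; [lra|]. unfold Rdiv. rewrite Rmult_assoc, Rinv_l; lra. }
  exists (/ (1 - t)). split; [left; apply Rinv_0_lt_compat; lra|]. intros n.
  replace (s ^ n) with (t ^ n * s' ^ n).
  2:{ rewrite <- Rpow_mult_distr. f_equal. unfold t. field. lra. }
  rewrite <- Rmult_assoc. apply Rmult_le_compat_r; [apply pow_le; lra|].
  (* Since t < 1, n t^n is at most 1 + t + ... + t^(n-1). *)
  eapply Rle_trans; [|apply (Rsum_geom_le t n Ht)]. rewrite <- Rsum_const.
  apply Rsum_le. intros i Hi. replace n with (i + (n - i))%nat by lia. rewrite pow_add.
  rewrite <- (Rmult_1_r (t ^ i)) at 2. apply Rmult_le_compat_l; [apply pow_le; lra|].
  rewrite <- (pow1 (n - i)). apply pow_incr. lra.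
Qed.

Lemma pow_geom e s s' : 0 <= s < s' -> exists C, 0 <= C /\ forall n, INR n ^ e * s ^ n <= C * s' ^ n.
Proof.
  revert s. induction e as [|e IH]; intros s Hs.
  - exists 1. split; [lra|]. intros n. simpl. rewrite !Rmult_1_l. apply pow_incr. lra.
  - destruct (lin_geom s ((s + s') / 2)) as [C1 [HC1 H1]]; [lra|].
    destruct (IH ((s + s') / 2)) as [C2 [HC2 H2]]; [lra|].
    exists (C1 * C2). split; [apply Rmult_le_pos; auto|]. intros n. simpl.
    specialize (H1 n). specialize (H2 n). assert (0 <= INR n ^ e) by (apply pow_le, pos_INR).
    replace (INR n * INR n ^ e * s ^ n) with (INR n ^ e * (INR n * s ^ n)) by ring.
    apply Rle_trans with (INR n ^ e * (C1 * ((s + s') / 2) ^ n)); [apply Rmult_le_compat_l; auto|].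
    replace (INR n ^ e * (C1 * ((s + s') / 2) ^ n)) with (C1 * (INR n ^ e * ((s + s') / 2) ^ n)) by ring.
    rewrite Rmult_assoc. apply Rmult_le_compat_l; auto.
Qed.

Lemma Rsum_geom_bound C s n : 0 <= C -> 0 <= s < 1 -> Rsum (fun i => C * s ^ i) n <= C / (1 - s).
Proof. intros HC Hs. rewrite Rsum_scal. apply Rmult_le_compat_l; auto. apply Rsum_geom_le. auto. Qed.

Lemma powser_exists e u : Cmod u < 1 -> exists l, Csums (fun n => RtoC (INR n ^ e) * u ^ n)%C l.
Proof.
  intros Hu. pose proof (Cmod_ge_0 u).
  destruct (pow_geom e (Cmod u) ((Cmod u + 1) / 2)) as [C [HC H1]]; [lra|].
  apply Csums_exists with (b := fun n => C * ((Cmod u + 1) / 2) ^ n) (B := C / (1 - (Cmod u + 1) / 2)).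
  - intros n. rewrite Cmod_mult, Cmod_R, Cmod_pow, Rabs_right; auto. apply Rle_ge, pow_le, pos_INR.
  - intros n. apply Rsum_geom_bound; auto. lra.
Qed.

Lemma one_minus_neq u : Cmod u < 1 -> (1 - u)%C <> RtoC 0.
Proof.
  intros Hu. apply Cmod_gt_0. pose proof (Cmod_tri_inv2 1 u). rewrite Cmod_1 in H. lra.
Qed.

(** Closed forms of the sums of n^3 u^n and n^5 u^n. The inner factors are Eulerian polynomials;
    their values 6 = 3! and 120 = 5! at u = 1 are the constants [K] fed to [lipschitz_gen]. *)
Definition phi3 (u : C) : C := (u * (1 + 4 * u + u * u) / (1 - u) ^ 4)%C.
Definition phi5 (u : C) : C := (u * (1 + 26 * u + 66 * u ^ 2 + 26 * u ^ 3 + u ^ 4) / (1 - u) ^ 6)%C.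

(** Shifting the index and expanding (n + 1)^e binomially expresses each sum through those of lower
    exponent; the resulting triangular system is solved explicitly. *)
Lemma powser_sums u : Cmod u < 1 ->
  Csums (fun n => RtoC (INR n ^ 3) * u ^ n)%C (phi3 u) /\ Csums (fun n => RtoC (INR n ^ 5) * u ^ n)%C (phi5 u).
Proof.
  intros Hu. pose proof (one_minus_neq u Hu) as Hn.
  assert (Hshift : forall e l, Csums (fun n => RtoC (INR n ^ e) * u ^ n)%C l ->
    Csums (fun n => RtoC ((INR n + 1) ^ e) * u ^ S n)%C (l - RtoC (0 ^ e))%C).
  { intros e l H. apply (Csums_shift _ _ 1) in H. simpl Csum in H.
    replace (l - (0 + RtoC (0 ^ e) * 1))%C with (l - RtoC (0 ^ e))%C in H by ring.
    eapply Csums_ext; [|exact H]. intros n. cbv beta. change (1 + n)%nat with (S n). rewrite S_INR. reflexivity. }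
  destruct (powser_exists 0 u Hu) as [S0 H0]. destruct (powser_exists 1 u Hu) as [S1 H1].
  destruct (powser_exists 2 u Hu) as [S2 H2]. destruct (powser_exists 3 u Hu) as [S3 H3].
  destruct (powser_exists 4 u Hu) as [S4 H4]. destruct (powser_exists 5 u Hu) as [S5 H5].
  assert (E0 : (S0 = 1 + u * S0)%C).
  { assert (S0 - 1 = u * S0)%C; [|rewrite <- H; ring]. apply (Csums_unique (fun n => RtoC ((INR n + 1) ^ 0) * u ^ S n)%C).
    - replace (S0 - 1)%C with (S0 - RtoC (0 ^ 0))%C by (simpl; ring). apply (Hshift 0%nat S0 H0).
    - eapply Csums_ext; [|exact (Csums_scal u _ _ H0)]. intros n. simpl. ring. }
  assert (E1 : (S1 = u * (S1 + S0))%C).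
  { apply (Csums_unique (fun n => RtoC ((INR n + 1) ^ 1) * u ^ S n)%C).
    - replace S1 with (S1 - RtoC (0 ^ 1))%C by (simpl; rewrite Rmult_0_l; ring). apply (Hshift 1%nat S1 H1).
    - eapply Csums_ext; [|exact (Csums_scal u _ _ (Csums_plus _ _ _ _ H1 H0))]. intros n.
      rewrite !RtoC_pow, RtoC_plus. simpl. ring. }
  assert (E2 : (S2 = u * (S2 + 2 * S1 + S0))%C).
  { apply (Csums_unique (fun n => RtoC ((INR n + 1) ^ 2) * u ^ S n)%C).
    - replace S2 with (S2 - RtoC (0 ^ 2))%C by (simpl; rewrite Rmult_0_l; ring). apply (Hshift 2%nat S2 H2).
    - eapply Csums_ext; [|exact (Csums_scal u _ _ (Csums_plus _ _ _ _ (Csums_plus _ _ _ _ H2 (Csums_scal 2 _ _ H1)) H0))]. intros n.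
      rewrite !RtoC_pow, RtoC_plus. simpl. ring. }
  assert (E3 : (S3 = u * (S3 + 3 * S2 + 3 * S1 + S0))%C).
  { apply (Csums_unique (fun n => RtoC ((INR n + 1) ^ 3) * u ^ S n)%C).
    - replace S3 with (S3 - RtoC (0 ^ 3))%C by (simpl; rewrite Rmult_0_l; ring). apply (Hshift 3%nat S3 H3).
    - eapply Csums_ext; [|exact (Csums_scal u _ _ (Csums_plus _ _ _ _ (Csums_plus _ _ _ _ (Csums_plus _ _ _ _ H3 (Csums_scal 3 _ _ H2)) (Csums_scal 3 _ _ H1)) H0))]. intros n.
      rewrite !RtoC_pow, RtoC_plus. simpl. ring. }
  assert (E4 : (S4 = u * (S4 + 4 * S3 + 6 * S2 + 4 * S1 + S0))%C).
  { apply (Csums_unique (fun n => RtoC ((INR n + 1) ^ 4) * u ^ S n)%C).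
    - replace S4 with (S4 - RtoC (0 ^ 4))%C by (simpl; rewrite Rmult_0_l; ring). apply (Hshift 4%nat S4 H4).
    - eapply Csums_ext; [|exact (Csums_scal u _ _ (Csums_plus _ _ _ _ (Csums_plus _ _ _ _ (Csums_plus _ _ _ _ (Csums_plus _ _ _ _ H4 (Csums_scal 4 _ _ H3)) (Csums_scal 6 _ _ H2)) (Csums_scal 4 _ _ H1)) H0))]. intros n.
      rewrite !RtoC_pow, RtoC_plus. simpl. ring. }
  assert (E5 : (S5 = u * (S5 + 5 * S4 + 10 * S3 + 10 * S2 + 5 * S1 + S0))%C).
  { apply (Csums_unique (fun n => RtoC ((INR n + 1) ^ 5) * u ^ S n)%C).
    - replace S5 with (S5 - RtoC (0 ^ 5))%C by (simpl; rewrite Rmult_0_l; ring). apply (Hshift 5%nat S5 H5).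
    - eapply Csums_ext; [|exact (Csums_scal u _ _ (Csums_plus _ _ _ _ (Csums_plus _ _ _ _ (Csums_plus _ _ _ _ (Csums_plus _ _ _ _ (Csums_plus _ _ _ _ H5 (Csums_scal 5 _ _ H4)) (Csums_scal 10 _ _ H3)) (Csums_scal 10 _ _ H2)) (Csums_scal 5 _ _ H1)) H0))]. intros n.
      rewrite !RtoC_pow, RtoC_plus. simpl. ring. }
  assert (F : forall s r, (s = r + u * s)%C -> s = (r / (1 - u))%C).
  { intros s r E. replace r with (s * (1 - u))%C; [field; auto|].
    replace (s * (1 - u))%C with (s - u * s)%C by ring. rewrite E at 1. ring. }
  apply F in E0.
  assert (E1' : S1 = (u * S0 / (1 - u))%C) by (apply F; rewrite E1 at 1; ring).
  assert (E2' : S2 = (u * (2 * S1 + S0) / (1 - u))%C) by (apply F; rewrite E2 at 1; ring).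
  assert (E3' : S3 = (u * (3 * S2 + 3 * S1 + S0) / (1 - u))%C) by (apply F; rewrite E3 at 1; ring).
  assert (E4' : S4 = (u * (4 * S3 + 6 * S2 + 4 * S1 + S0) / (1 - u))%C) by (apply F; rewrite E4 at 1; ring).
  assert (E5' : S5 = (u * (5 * S4 + 10 * S3 + 10 * S2 + 5 * S1 + S0) / (1 - u))%C) by (apply F; rewrite E5 at 1; ring).
  clear E1 E2 E3 E4 E5. split.
  - replace (phi3 u) with S3; auto. unfold phi3. rewrite E3', E2', E1', E0. field. auto.
  - replace (phi5 u) with S5; auto. unfold phi5. rewrite E5', E4', E3', E2', E1', E0. field. auto.
Qed.

(** Real points are allowed so that z = 1/2 qualifies, where the formula yields the zeta values. The
    last clause keeps the denominators 1 - [eu] at the division points different from zero. *)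
Definition lip_ok (z : C) (c : R) : Prop :=
  0 <= Im z /\ 0 < c /\
  (forall i, c * INR (S i) <= Cmod (z + RtoC (INR i)) /\ c * INR (S i) <= Cmod (z - 1 - RtoC (INR i))) /\
  (forall n j, eu ((z + RtoC (INR j)) / 2 ^ n)%C <> RtoC 1).

(* (-2 pi i)^p / (p-1)! for p = 4 and p = 6. *)
Definition kap4 : C := RtoC (8 * PI ^ 4 / 3).
Definition kap6 : C := RtoC (- (8 * PI ^ 6 / 15)).

Lemma lip_ok_neq z c : lip_ok z c -> forall i, (z + RtoC (INR i))%C <> RtoC 0 /\ (z - 1 - RtoC (INR i))%C <> RtoC 0.
Proof.
  intros [_ [Hc [H _]]] i. destruct (H i) as [H1 H2]. pose proof (lt_0_INR (S i) ltac:(lia)).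
  split; apply Cmod_gt_0; nra.
Qed.

Lemma Ci_sq : (Ci * Ci = -1)%C.
Proof. apply C_eq; simpl; ring. Qed.

Lemma lipschitz4 z c : lip_ok z c ->
  Csums (fun i => / (z + RtoC (INR i)) ^ 4 + / (z - 1 - RtoC (INR i)) ^ 4)%C (kap4 * phi3 (eu z))%C.
Proof.
  intros Hz. pose proof (lip_ok_neq z c Hz) as Hne. destruct Hz as [Hi [Hc [H1 H2]]].
  pose proof PI_RGT_0 as HP. assert (HPC : RtoC PI <> RtoC 0) by (intros F; apply RtoC_inj in F; lra).
  pose proof (lipschitz_gen (fun u => u * (1 + 4 * u + u * u))%C 4 6) as L.
  assert (L' := fun a b d => L a b d ltac:(lia) z Hi c Hc H1 H2). clear L.
  eapply Csums_ext; [|apply (Csums_scal kap4); apply L'].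
  - intros i. destruct (Hne i) as [N1 N2]. cbv beta.
    replace (RtoC (2 * PI)) with (2 * RtoC PI)%C by (rewrite RtoC_mult; auto).
    assert (Hx : forall x, x <> RtoC 0 -> (kap4 * ((-1) ^ 4 * (6 / (2 * RtoC PI * Ci * x) ^ 4)) = / x ^ 4)%C).
    { intros x Hx. unfold kap4. rewrite !Cpow_mult_l. replace (Ci ^ 4)%C with (RtoC 1).
      2:{ transitivity ((Ci * Ci) * (Ci * Ci))%C; [rewrite Ci_sq; ring|simpl; ring]. }
      replace (RtoC (8 * PI ^ 4 / 3)) with (8 * RtoC PI ^ 4 / 3)%C.
      2:{ unfold Rdiv. rewrite !RtoC_mult, RtoC_inv, RtoC_pow by lra. reflexivity. }
      field. repeat split; auto. }
    rewrite Cmult_plus_distr_l, !Hx by auto. reflexivity.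
  - intros u Hu. pose proof (Cmod_ge_0 u) as H0. rewrite Cmod_mult.
    assert (Cmod (1 + 4 * u + u * u) <= 6).
    { eapply Rle_trans; [apply Cmod_triangle|]. pose proof (Cmod_triangle 1 (4 * u)).
      rewrite !Cmod_mult, !Cmod_R, (Rabs_right 4), (Rabs_right 1) in * by lra. nra. }
    pose proof (Cmod_ge_0 (1 + 4 * u + u * u)). nra.
  - intros v Hv1 Hv2. unfold Cdiv.
    assert (A1 : (1 - v)%C <> RtoC 0) by (apply Cminus_eq_contra; auto).
    assert (A2 : (1 + v)%C <> RtoC 0).
    { intros F. apply Hv2. replace v with (1 + v - 1)%C by ring. rewrite F. rewrite <- RtoC_minus. f_equal; ring. }
    replace (1 - - v)%C with (1 + v)%C by ring.
    assert (A3 : (1 - v * v)%C <> RtoC 0) by (replace (1 - v * v)%C with ((1 - v) * (1 + v))%C by ring; apply Cmult_neq_0; auto).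
    field. auto.
  - intros u Hu. replace (RtoC 6) with (1 * (1 + 4 * 1 + 1 * 1))%C by ring.
    apply CLim_mult; auto. apply CLim_plus; [apply CLim_plus; [apply CLim_const|apply CLim_scal; auto]|apply CLim_mult; auto].
Qed.

Lemma lipschitz6 z c : lip_ok z c ->
  Csums (fun i => / (z + RtoC (INR i)) ^ 6 + / (z - 1 - RtoC (INR i)) ^ 6)%C (kap6 * phi5 (eu z))%C.
Proof.
  intros Hz. pose proof (lip_ok_neq z c Hz) as Hne. destruct Hz as [Hi [Hc [H1 H2]]].
  pose proof PI_RGT_0 as HP. assert (HPC : RtoC PI <> RtoC 0) by (intros F; apply RtoC_inj in F; lra).
  pose proof (lipschitz_gen (fun u => u * (1 + 26 * u + 66 * u ^ 2 + 26 * u ^ 3 + u ^ 4))%C 6 120) as L.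
  assert (L' := fun a b d => L a b d ltac:(lia) z Hi c Hc H1 H2). clear L.
  eapply Csums_ext; [|apply (Csums_scal kap6); apply L'].
  - intros i. destruct (Hne i) as [N1 N2]. cbv beta.
    replace (RtoC (2 * PI)) with (2 * RtoC PI)%C by (rewrite RtoC_mult; auto).
    assert (Hx : forall x, x <> RtoC 0 -> (kap6 * ((-1) ^ 6 * (120 / (2 * RtoC PI * Ci * x) ^ 6)) = / x ^ 6)%C).
    { intros x Hx. unfold kap6. rewrite !Cpow_mult_l. replace (Ci ^ 6)%C with (RtoC (-1)).
      2:{ transitivity ((Ci * Ci) * (Ci * Ci) * (Ci * Ci))%C; [rewrite Ci_sq; ring|simpl; ring]. }
      replace (RtoC (- (8 * PI ^ 6 / 15))) with (- (8 * RtoC PI ^ 6 / 15))%C.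
      2:{ unfold Rdiv. rewrite RtoC_opp, !RtoC_mult, RtoC_inv, RtoC_pow by lra. reflexivity. }
      field. repeat split; auto. }
    rewrite Cmult_plus_distr_l, !Hx by auto. reflexivity.
  - intros u Hu. pose proof (Cmod_ge_0 u) as H0. rewrite Cmod_mult.
    assert (Hp : forall n, Cmod (u ^ n) <= 1).
    { intros n. rewrite Cmod_pow. rewrite <- (pow1 n). apply pow_incr. lra. }
    assert (Cmod (1 + 26 * u + 66 * u ^ 2 + 26 * u ^ 3 + u ^ 4) <= 120).
    { pose proof (Cmod_triangle (1 + 26 * u + 66 * u ^ 2 + 26 * u ^ 3) (u ^ 4)).
      pose proof (Cmod_triangle (1 + 26 * u + 66 * u ^ 2) (26 * u ^ 3)).
      pose proof (Cmod_triangle (1 + 26 * u) (66 * u ^ 2)).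
      pose proof (Cmod_triangle 1 (26 * u)).
      pose proof (Hp 2%nat). pose proof (Hp 3%nat). pose proof (Hp 4%nat).
      rewrite !(Cmod_mult (RtoC _)), !Cmod_R, (Rabs_right 26), (Rabs_right 66), (Rabs_right 1) in * by lra. lra. }
    pose proof (Cmod_ge_0 (1 + 26 * u + 66 * u ^ 2 + 26 * u ^ 3 + u ^ 4)). nra.
  - intros v Hv1 Hv2. unfold Cdiv.
    assert (A1 : (1 - v)%C <> RtoC 0) by (apply Cminus_eq_contra; auto).
    assert (A2 : (1 + v)%C <> RtoC 0).
    { intros F. apply Hv2. replace v with (1 + v - 1)%C by ring. rewrite F. rewrite <- RtoC_minus. f_equal; ring. }
    replace (1 - - v)%C with (1 + v)%C by ring.
    assert (A3 : (1 - v * v)%C <> RtoC 0) by (replace (1 - v * v)%C with ((1 - v) * (1 + v))%C by ring; apply Cmult_neq_0; auto).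
    field. auto.
  - intros u Hu. replace (RtoC 120) with (1 * (1 + 26 * 1 + 66 * 1 ^ 2 + 26 * 1 ^ 3 + 1 ^ 4))%C by ring.
    apply CLim_mult; auto. repeat apply CLim_plus; try apply CLim_const; try apply CLim_pow; auto; apply CLim_scal; auto; apply CLim_pow; auto.
Qed.

Lemma half_ok : lip_ok (1 / 2)%C (1 / 2).
Proof.
  assert (E : (1 / 2)%C = RtoC (1 / 2)) by (rewrite RtoC_div by lra; reflexivity).
  repeat split.
  - rewrite E. simpl. lra.
  - lra.
  - rewrite E, <- RtoC_plus, Cmod_R, S_INR. pose proof (pos_INR i). rewrite Rabs_right; lra.
  - rewrite E, <- !RtoC_minus, Cmod_R, S_INR. pose proof (pos_INR i). rewrite Rabs_left; lra.
  - intros n j F. assert (H : (eu ((1 / 2 + RtoC (INR j)) / 2 ^ n) ^ (2 ^ n) = 1)%C).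
    { rewrite F. apply Cpow_1_l. }
    rewrite <- eu_INR, pow_INR, RtoC_pow in H. simpl INR in H. replace (1 + 1) with 2 in H by ring.
    replace (2 ^ n * ((1 / 2 + INR j) / 2 ^ n))%C with (1 / 2 + INR j * 1)%C in H.
    2:{ field. apply two_pow_neq0. }
    rewrite eu_plus, eu_half, eu_INR, eu_1, Cpow_1_l, Cmult_1_r in H. apply RtoC_inj in H. lra.
Qed.

(** At z = 1/2 the terms are 2^p over p-th powers of odd integers, each occurring twice. So K / (2 *
    2^p) is the odd part of the zeta value, which is 1 - 2^{-p} times the whole. *)
Lemma zeta_from_odd p K : (2 <= p)%nat -> Nat.Even p ->
  Csums (fun i => / (1 / 2 + RtoC (INR i)) ^ p + / (1 / 2 - 1 - RtoC (INR i)) ^ p)%C K ->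
  Csums (fun i => / RtoC (INR (S i)) ^ p)%C (K / (2 * (2 ^ p - 1)))%C.
Proof.
  intros Hp [h Eh] HK.
  assert (H2 : RtoC 2 <> RtoC 0) by (intros F; apply RtoC_inj in F; lra).
  assert (HS : forall i, RtoC (INR (S i)) <> RtoC 0) by (intros i F; apply RtoC_inj in F; pose proof (lt_0_INR (S i) ltac:(lia)); lra).
  assert (Hodd : Csums (fun i => / RtoC (INR (S (2 * i))) ^ p)%C (K / (2 * 2 ^ p))%C).
  { replace (K / (2 * 2 ^ p))%C with (/ (2 * 2 ^ p) * K)%C by (unfold Cdiv; ring).
    eapply Csums_ext; [|apply Csums_scal; exact HK]. intros i. cbv beta.
    replace (1 / 2 + INR i)%C with (INR (S (2 * i)) / 2)%C.
    2:{ rewrite S_INR, mult_INR. simpl (INR 2). rewrite RtoC_plus, RtoC_mult. replace (1 + 1) with 2 by ring. field. }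
    replace (1 / 2 - 1 - INR i)%C with (-1 * (INR (S (2 * i)) / 2))%C.
    2:{ rewrite S_INR, mult_INR. simpl (INR 2). rewrite RtoC_plus, RtoC_mult. replace (1 + 1) with 2 by ring. field. }
    rewrite (Cpow_mult_l (-1)). replace (RtoC (-1) ^ p)%C with (RtoC 1).
    2:{ rewrite Eh, Cpow_mult_r. replace (RtoC (-1) ^ 2)%C with (RtoC 1) by ring. rewrite Cpow_1_l. auto. }
    unfold Cdiv. rewrite Cpow_mult_l, Cpow_inv by auto. field. split; apply Cpow_nz; auto. }
  destruct (Csums_exists (fun i => / RtoC (INR (S i)) ^ p)%C (fun i => / INR (S i) ^ 2) 2) as [Z HZ].
  { intros i. rewrite Cmod_inv, Cmod_pow, Cmod_R by (apply Cpow_nz; auto).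
    assert (1 <= INR (S i)) by (rewrite S_INR; pose proof (pos_INR i); lra).
    rewrite Rabs_right by lra. apply Rinv_le_contravar; [apply pow_lt; lra|apply Rle_pow; auto]. }
  { apply sum_inv_sq. }
  assert (E : (Z = K / (2 * 2 ^ p) + / 2 ^ p * Z)%C).
  { apply CLim_unique with (u := fun N => Csum (fun i => / RtoC (INR (S i)) ^ p)%C (2 * N)).
    - apply (CLim_sub (Csum (fun i => / RtoC (INR (S i)) ^ p)%C) Z (fun n => 2 * n)%nat); [intros; lia|exact HZ].
    - apply CLim_ext with (u := fun N => (Csum (fun i => / RtoC (INR (S (2 * i))) ^ p) N + / 2 ^ p * Csum (fun i => / RtoC (INR (S i)) ^ p) N)%C).
      2:{ apply CLim_plus; [exact Hodd|]. apply CLim_scal. exact HZ. }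
      exists O. intros N _. induction N as [|N IH]; [simpl; ring|].
      replace (2 * S N)%nat with (S (S (2 * N))) by lia. rewrite !Csum_S, <- IH.
      replace (INR (S (S (2 * N)))) with (2 * INR (S N)).
      2:{ rewrite (S_INR (S (2 * N))), (S_INR (2 * N)), mult_INR, S_INR. simpl (INR 2). ring. }
      rewrite RtoC_mult, (Cpow_mult_l 2). field. repeat split; apply Cpow_nz; auto. }
  assert (Hq : (2 ^ p - 1)%C <> RtoC 0).
  { rewrite <- RtoC_pow, <- RtoC_minus. intros F. apply RtoC_inj in F.
    pose proof (Rle_pow 2 2 p ltac:(lra) Hp). simpl in H. lra. }
  replace (K / (2 * (2 ^ p - 1)))%C with Z; auto.
  assert (H2p : (2 ^ p)%C <> RtoC 0) by (apply Cpow_nz; auto).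
  apply (f_equal (fun w => (w - / 2 ^ p * Z) * (2 ^ p / (2 ^ p - 1)))%C) in E.
  replace ((Z - / 2 ^ p * Z) * (2 ^ p / (2 ^ p - 1)))%C with Z in E by (field; auto).
  rewrite E. field. auto.
Qed.

(** phi3(-1) = 1/8 and 2 (2^4 - 1) = 30 produce 240, the number that normalizes E4. In [zeta6],
    phi5(-1) = -1/4 and 2 (2^6 - 1) = 126 produce -504 in the same way. *)
Lemma zeta4 : Csums (fun i => / RtoC (INR (S i)) ^ 4)%C (kap4 / 240)%C.
Proof.
  pose proof (zeta_from_odd 4 _ ltac:(lia) ltac:(exists 2%nat; lia) (lipschitz4 _ _ half_ok)) as H.
  rewrite eu_half in H. replace (kap4 / 240)%C with (kap4 * phi3 (-1) / (2 * (2 ^ 4 - 1)))%C; auto.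
  unfold phi3. field.
Qed.

Lemma zeta6 : Csums (fun i => / RtoC (INR (S i)) ^ 6)%C (kap6 / (-504))%C.
Proof.
  pose proof (zeta_from_odd 6 _ ltac:(lia) ltac:(exists 3%nat; lia) (lipschitz6 _ _ half_ok)) as H.
  rewrite eu_half in H. replace (kap6 / (-504))%C with (kap6 * phi5 (-1) / (2 * (2 ^ 6 - 1)))%C; auto.
  unfold phi5. field.
Qed.

(** * Modularity of E4 and E6 *)

(* [/ 0 = 0], so the term (c, d) = (0, 0) contributes nothing. *)
Lemma Cinv_0 : (/ 0)%C = RtoC 0.
Proof. unfold Cinv. simpl. apply C_eq; simpl; unfold Rdiv; ring. Qed.

Section Box.
Variables (p : nat).
Hypothesis p_ge : (4 <= p)%nat.
Hypothesis p_even : Nat.Even p.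

Definition lat (tau : C) (c d : R) : C := (/ (RtoC c * tau + RtoC d) ^ p)%C.
Definition idx (N i : nat) : R := INR i - INR N.
(** The square |c|, |d| <= N is invariant under (c, d) -> (d, -c), so the finite sum already
    transforms exactly under -1/tau and no infinite double series has to be rearranged. *)
Definition box (N : nat) (tau : C) : C :=
  Csum (fun i => Csum (fun j => lat tau (idx N i) (idx N j)) (2 * N + 1)) (2 * N + 1).

Lemma in_H_neq0 tau : in_H tau -> tau <> RtoC 0.
Proof. intros H F. unfold in_H in H. rewrite F in H. simpl in H. lra. Qed.

Lemma idx_rev N i : (i < 2 * N + 1)%nat -> idx N (2 * N + 1 - 1 - i) = - idx N i.
Proof.
  intros Hi. unfold idx. rewrite minus_INR by lia. replace (2 * N + 1 - 1)%nat with (N + N)%nat by lia.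
  rewrite plus_INR. ring.
Qed.

Lemma lat_opp tau c d : lat tau (- c) (- d) = lat tau c d.
Proof.
  unfold lat. rewrite !RtoC_opp. destruct p_even as [h Eh].
  replace (- c * tau + - d)%C with (-1 * (c * tau + d))%C by ring.
  rewrite (Cpow_mult_l (-1)), Eh, (Cpow_mult_r (-1)). replace (RtoC (-1) ^ 2)%C with (RtoC 1) by ring.
  rewrite Cpow_1_l. f_equal. ring.
Qed.

Lemma lat_S tau c d : tau <> RtoC 0 -> lat (- / tau)%C c d = (tau ^ p * lat tau d (- c))%C.
Proof.
  intros Ht. unfold lat. rewrite RtoC_opp.
  assert (Hp : (tau ^ p)%C <> RtoC 0) by (apply Cpow_nz; auto).
  replace (c * - / tau + d)%C with ((d * tau + - c) * / tau)%C by (field; auto).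
  destruct (Ceq_dec (d * tau + - c)%C 0) as [E|E].
  - rewrite E, Cmult_0_l. destruct p as [|p']; [lia|]. simpl. rewrite !Cmult_0_l, Cinv_0. ring.
  - rewrite Cpow_mult_l, Cpow_inv by auto. field. split; auto. apply Cpow_nz; auto.
Qed.

Lemma box_S N tau : tau <> RtoC 0 -> box N (- / tau)%C = (tau ^ p * box N tau)%C.
Proof.
  intros Ht. unfold box. rewrite <- Csum_scal, Csum_swap. apply Csum_ext. intros j _.
  rewrite <- Csum_scal, Csum_rev. apply Csum_ext. intros i Hi.
  rewrite lat_S, idx_rev, Ropp_involutive by auto. reflexivity.
Qed.

Lemma lat_lower tau c d : in_H tau -> Rabs d * (Im tau / (Im tau + Cmod tau)) <= Cmod (RtoC c * tau + RtoC d) /\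
  Rabs c * Im tau <= Cmod (RtoC c * tau + RtoC d).
Proof.
  intros H. unfold in_H in H. pose proof (Cmod_ge_0 tau).
  assert (H2 : Rabs c * Im tau <= Cmod (c * tau + d)).
  { eapply Rle_trans; [|apply im_le_Cmod]. replace (Im (c * tau + d)%C) with (c * Im tau).
    - rewrite Rabs_mult, (Rabs_right (Im tau)) by lra. lra.
    - destruct tau; simpl; ring. }
  split; auto.
  assert (H1 : Rabs d <= Cmod (c * tau + d) + Rabs c * Cmod tau).
  { rewrite <- (Cmod_R d), <- (Cmod_R c), <- Cmod_mult.
    replace (RtoC d) with ((c * tau + d) - c * tau)%C at 1 by ring. apply Cmod_tri2. }
  set (m := Cmod (c * tau + d)) in *. set (y := Im tau) in *. set (t := Cmod tau) in *.
  apply Rmult_le_reg_r with (y + t); [lra|].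
  replace (Rabs d * (y / (y + t)) * (y + t)) with (Rabs d * y) by (field; lra).
  apply Rle_trans with ((m + Rabs c * t) * y); [apply Rmult_le_compat_r; lra|].
  assert (Rabs c * y * t <= m * t) by (apply Rmult_le_compat_r; auto). nra.
Qed.

Definition lowc (tau : C) : R := Rmin (Im tau / (Im tau + Cmod tau)) (Im tau) / 2.

Lemma lowc_pos tau : in_H tau -> 0 < lowc tau.
Proof.
  intros H. unfold lowc, in_H in *. pose proof (Cmod_ge_0 tau).
  assert (0 < Im tau / (Im tau + Cmod tau)) by (apply Rdiv_lt_0_compat; lra).
  unfold Rmin. destruct (Rle_dec _ _); lra.
Qed.

Lemma lat_lower2 tau c d : in_H tau -> 1 <= Rabs c -> lowc tau * (Rabs d + 1) <= Cmod (RtoC c * tau + RtoC d).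
Proof.
  intros H Hc. destruct (lat_lower tau c d H) as [H1 H2]. unfold lowc. unfold in_H in H.
  pose proof (Rmin_l (Im tau / (Im tau + Cmod tau)) (Im tau)).
  pose proof (Rmin_r (Im tau / (Im tau + Cmod tau)) (Im tau)). pose proof (Rabs_pos d). 
  set (M := Rmin _ _) in *. nra.
Qed.

(** The constant [lowc tau] is the same for all rows, which makes the error in [row_approx] uniform
    in [a]. *)
Lemma lip_ok_mult tau a : in_H tau -> lip_ok (RtoC (INR (S a)) * tau)%C (lowc tau).
Proof.
  intros H. pose proof (lowc_pos tau H) as Hp. unfold in_H in H.
  pose proof (lt_0_INR (S a) ltac:(lia)) as Ha.
  assert (Hc : 1 <= Rabs (INR (S a))) by (rewrite Rabs_right by lra; rewrite S_INR; pose proof (pos_INR a); lra).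
  repeat split; auto.
  - rewrite im_scal_l. nra.
  - pose proof (lat_lower2 tau (INR (S a)) (INR i) H Hc) as L. rewrite S_INR.
    rewrite (Rabs_right (INR i)) in L by (apply Rle_ge, pos_INR). auto.
  - pose proof (lat_lower2 tau (INR (S a)) (- INR (S i)) H Hc) as L.
    rewrite Rabs_Ropp, (Rabs_right (INR (S i))) in L by (apply Rle_ge, pos_INR).
    replace (INR (S a) * tau - 1 - INR i)%C with (INR (S a) * tau + (- INR (S i))%R)%C.
    + pose proof (pos_INR (S i)). eapply Rle_trans; [|exact L]. nra.
    + rewrite (S_INR i), RtoC_opp, RtoC_plus. ring.
  - intros n j F. apply (f_equal Cmod) in F. rewrite Cmod_1, Cmod_eu in F.
    rewrite <- exp_0 in F. apply exp_inv in F. pose proof PI_RGT_0.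
    assert (Hpw : 0 < 2 ^ n) by (apply pow_lt; lra).
    replace (Im ((INR (S a) * tau + INR j) / 2 ^ n)%C) with (INR (S a) * Im tau / 2 ^ n) in F.
    + assert (0 < INR (S a) * Im tau / 2 ^ n) by (apply Rdiv_lt_0_compat; nra). nra.
    + rewrite <- RtoC_pow. unfold Cdiv. rewrite <- RtoC_inv by lra. rewrite im_scal_r, im_plus, im_scal_l, im_RtoC. field. lra.
Qed.

Definition row (N : nat) (tau : C) (c : R) : C := Csum (fun j => lat tau c (idx N j)) (2 * N + 1).

Lemma box_rows N tau : box N tau = (row N tau 0 + 2 * Csum (fun a => row N tau (INR (S a))) N)%C.
Proof.
  unfold box. fold (row N tau).
  replace (2 * N + 1)%nat with (N + S N)%nat at 1 by lia.
  change (fun i : nat => Csum (fun j : nat => lat tau (idx N i) (idx N j)) (2 * N + 1)) with (fun i => row N tau (idx N i)).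
  rewrite Csum_split, Csum_Sl.
  assert (E0 : idx N (N + 0) = 0) by (unfold idx; rewrite Nat.add_0_r; ring). rewrite E0.
  assert (E1 : Csum (fun i => row N tau (idx N (N + S i))) N = Csum (fun a => row N tau (INR (S a))) N).
  { apply Csum_ext. intros i _. f_equal. unfold idx. rewrite plus_INR. ring. }
  assert (E2 : Csum (fun i => row N tau (idx N i)) N = Csum (fun a => row N tau (INR (S a))) N).
  { rewrite Csum_rev. apply Csum_ext. intros i Hi.
    replace (idx N (N - 1 - i)) with (- INR (S i)).
    2:{ unfold idx. rewrite !minus_INR by lia. rewrite S_INR. simpl. ring. }
    unfold row. rewrite Csum_rev. apply Csum_ext. intros j Hj. rewrite idx_rev by auto. apply lat_opp. }
  rewrite E1, E2. ring.
Qed.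

(** A row has 2N + 1 entries and the symmetric Lipschitz sum only 2N; the entry d = N is left
    over. *)
Lemma row_split N tau c : row N tau c =
  (Csum (fun i => / (RtoC c * tau + RtoC (INR i)) ^ p + / (RtoC c * tau - 1 - RtoC (INR i)) ^ p) N + / (RtoC c * tau + RtoC (INR N)) ^ p)%C.
Proof.
  unfold row. replace (2 * N + 1)%nat with (N + S N)%nat by lia.
  rewrite Csum_split, Csum_plus, Csum_S.
  rewrite (Csum_ext (fun i => lat tau c (idx N (N + i))) (fun i => / (RtoC c * tau + RtoC (INR i)) ^ p)%C).
  2:{ intros i _. unfold lat, idx. rewrite plus_INR. do 2 f_equal. f_equal. f_equal. ring. }
  rewrite (Csum_rev (fun j => lat tau c (idx N j))).
  rewrite (Csum_ext (fun i => lat tau c (idx N (N - 1 - i))) (fun i => / (RtoC c * tau - 1 - RtoC (INR i)) ^ p)%C).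
  2:{ intros i Hi. unfold lat, idx. rewrite !minus_INR by lia. do 2 f_equal.
      replace (INR N - INR 1 - INR i - INR N) with (- (1 + INR i)) by (simpl; ring). rewrite RtoC_opp, RtoC_plus. ring. }
  replace (lat tau c (idx N (N + N))) with (/ (RtoC c * tau + RtoC (INR N)) ^ p)%C.
  2:{ unfold lat, idx. rewrite plus_INR. do 2 f_equal. f_equal. f_equal. ring. }
  ring.
Qed.

(** Of the p >= 4 factors two give the inverse square of N + 1 and two a convergent sum. A bound of
    order 1/N would not be enough, because the errors of N rows are added. *)
Lemma tail_sum N n : Rsum (fun i => / (INR (S N) + INR i) ^ p) n <= 2 / INR (S N) ^ 2.
Proof.
  assert (H : forall i, / (INR (S N) + INR i) ^ p <= / INR (S N) ^ 2 * / INR (S i) ^ 2).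
  { intros i. rewrite <- Rinv_mult. rewrite !S_INR. pose proof (pos_INR i). pose proof (pos_INR N).
    apply Rinv_le_contravar.
    - apply Rmult_lt_0_compat; apply pow_lt; lra.
    - replace p with (2 + (2 + (p - 4)))%nat by lia. rewrite !pow_add.
      apply Rmult_le_compat; try (apply pow_le; lra).
      + apply pow_incr. lra.
      + rewrite <- (Rmult_1_r ((INR i + 1) ^ 2)). apply Rmult_le_compat; try (apply pow_le; lra); try lra.
        * apply pow_incr. lra.
        * apply pow_R1_Rle. lra. }
  eapply Rle_trans; [apply Rsum_le; intros i _; apply H|]. rewrite Rsum_scal.
  unfold Rdiv. rewrite Rmult_comm. apply Rmult_le_compat_r; [|apply sum_inv_sq].
  left. apply Rinv_0_lt_compat, pow_lt, lt_0_INR. lia.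
Qed.

Variables (phi : C -> C) (kap : C).
Hypothesis lip : forall z c, lip_ok z c ->
  Csums (fun i => / (z + RtoC (INR i)) ^ p + / (z - 1 - RtoC (INR i)) ^ p)%C (kap * phi (eu z))%C.

Lemma row_approx N tau a : in_H tau ->
  Cmod (row N tau (INR (S a)) - kap * phi (eu (RtoC (INR (S a)) * tau))) <= 5 * (/ lowc tau) ^ p / INR (S N) ^ 2.
Proof.
  intros H. pose proof (lip_ok_mult tau a H) as Hok. pose proof (lip _ _ Hok) as L.
  pose proof (lowc_pos tau H) as Hc. destruct Hok as [_ [_ [Hlow _]]].
  assert (Hterm : forall x w, 0 < x -> lowc tau * x <= Cmod w -> Cmod (/ w ^ p)%C <= (/ lowc tau) ^ p * / x ^ p).
  { intros x w Hx Hw. assert (0 < lowc tau * x) by nra.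
    assert (w <> RtoC 0) by (apply Cmod_gt_0; lra).
    rewrite Cmod_inv, Cmod_pow by (apply Cpow_nz; auto). rewrite pow_inv, <- Rinv_mult, <- Rpow_mult_distr.
    apply Rinv_le_contravar; [apply pow_lt; auto|apply pow_incr; lra]. }
  rewrite row_split. set (z := (RtoC (INR (S a)) * tau)%C) in *.
  assert (T : Cmod (kap * phi (eu z) - Csum (fun i => / (z + RtoC (INR i)) ^ p + / (z - 1 - RtoC (INR i)) ^ p)%C N) <= 2 * (/ lowc tau) ^ p * (2 / INR (S N) ^ 2)).
  { apply Csums_tail with (b := fun i => 2 * (/ lowc tau) ^ p * / (INR (S N) + INR i) ^ p).
    - exact L.
    - intros i. destruct (Hlow (N + i)%nat) as [l1 l2].
      replace (INR (S (N + i))) with (INR (S N) + INR i) in * by (rewrite !S_INR, plus_INR; ring).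
      eapply Rle_trans; [apply Cmod_triangle|].
      assert (0 < INR (S N) + INR i) by (pose proof (pos_INR i); pose proof (lt_0_INR (S N) ltac:(lia)); lra).
      pose proof (Hterm _ _ H0 l1). pose proof (Hterm _ _ H0 l2). lra.
    - intros n. rewrite Rsum_scal. apply Rmult_le_compat_l; [|apply tail_sum].
      apply Rmult_le_pos; [lra|]. apply pow_le. left. apply Rinv_0_lt_compat. auto. }
  assert (T2 : Cmod (/ (z + RtoC (INR N)) ^ p)%C <= (/ lowc tau) ^ p * / INR (S N) ^ 2).
  { destruct (Hlow N) as [l1 _]. pose proof (lt_0_INR (S N) ltac:(lia)) as HN. eapply Rle_trans; [apply (Hterm _ _ HN l1)|].
    apply Rmult_le_compat_l; [apply pow_le; left; apply Rinv_0_lt_compat; auto|].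
    apply Rinv_le_contravar; [apply pow_lt; auto|]. apply Rle_pow; [|lia]. rewrite S_INR. pose proof (pos_INR N). lra. }
  rewrite Cmod_minus_sym in T.
  replace (Csum (fun i => / (z + INR i) ^ p + / (z - 1 - INR i) ^ p) N + / (z + INR N) ^ p - kap * phi (eu z))%C with
    ((Csum (fun i => / (z + INR i) ^ p + / (z - 1 - INR i) ^ p) N - kap * phi (eu z)) + / (z + INR N) ^ p)%C by ring.
  eapply Rle_trans; [apply Cmod_triangle|]. unfold Rdiv in *. lra.
Qed.

Variable Z : C.
Hypothesis HZ : Csums (fun i => / RtoC (INR (S i)) ^ p)%C Z.

(** The entry d = 0 has value 0 by the convention for inverses; the others come in equal pairs
    because p is even. *)
Lemma row0_lim tau : CLim (fun N => row N tau 0) (2 * Z)%C.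
Proof.
  apply CLim_ext with (u := fun N => (2 * Csum (fun i => / RtoC (INR (S i)) ^ p) N)%C); [|apply CLim_scal; exact HZ].
  exists O. intros N _. rewrite row_split, Csum_plus.
  assert (Hm1 : (RtoC (-1) ^ p = 1)%C).
  { destruct p_even as [h Eh]. rewrite Eh, Cpow_mult_r. replace (RtoC (-1) ^ 2)%C with (RtoC 1) by ring. apply Cpow_1_l. }
  rewrite (Csum_ext (fun i => / (0 * tau - 1 - INR i) ^ p)%C (fun i => / RtoC (INR (S i)) ^ p)%C).
  2:{ intros i _. f_equal. rewrite S_INR, RtoC_plus. replace (0 * tau - 1 - INR i)%C with (-1 * (INR i + 1))%C by ring.
      rewrite (Cpow_mult_l (-1)), Hm1. ring. }
  assert (E : (Csum (fun i => / (0 * tau + INR i) ^ p) N + / (0 * tau + INR N) ^ p)%C = Csum (fun i => / RtoC (INR (S i)) ^ p)%C N).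
  { rewrite <- (Csum_S (fun i => / (0 * tau + INR i) ^ p)%C), Csum_Sl.
    replace (0 * tau + INR 0)%C with (RtoC 0) by (simpl; ring).
    destruct p as [|p']; [lia|]. simpl Cpow at 1. rewrite Cmult_0_l, Cinv_0, Cplus_0_l.
    apply Csum_ext. intros i _. f_equal. f_equal. ring. }
  rewrite <- E. ring.
Qed.

(** Each of the N rows is within O(1/N^2) of its Lipschitz value, so replacing all of them costs
    O(1/N). *)
Lemma box_lim tau G : in_H tau -> CLim (fun N => Csum (fun a => phi (eu (RtoC (INR (S a)) * tau))) N) G ->
  CLim (fun N => box N tau) (2 * Z + 2 * kap * G)%C.
Proof.
  intros H HG.
  apply CLim_ext with (u := fun N => (row N tau 0 + 2 * Csum (fun a => row N tau (INR (S a))) N)%C).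
  { exists O. intros. symmetry. apply box_rows. }
  apply CLim_plus; [apply row0_lim|]. replace (2 * kap * G)%C with (2 * (0 + kap * G))%C by ring. apply CLim_scal.
  apply CLim_ext with (u := fun N => ((Csum (fun a => row N tau (INR (S a)) - kap * phi (eu (RtoC (INR (S a)) * tau))) N) +
    kap * Csum (fun a => phi (eu (RtoC (INR (S a)) * tau))) N)%C).
  { exists O. intros N _. rewrite Csum_minus, Csum_scal. ring. }
  apply CLim_plus; [|apply CLim_scal; exact HG].
  apply CLim_squeeze with (e := fun N => (5 * (/ lowc tau) ^ p) / INR (S N)); [apply Rlim0_inv|].
  exists O. intros N _. replace (Csum (fun a => row N tau (INR (S a)) - kap * phi (eu (INR (S a) * tau))) N - 0)%C with
    (Csum (fun a => row N tau (INR (S a)) - kap * phi (eu (INR (S a) * tau))) N)%C by ring.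
  eapply Rle_trans; [apply Cmod_Csum_le; intros a _; apply row_approx; auto|].
  rewrite Rsum_const. pose proof (lowc_pos tau H) as Hl.
  assert (0 <= (/ lowc tau) ^ p) by (apply pow_le; left; apply Rinv_0_lt_compat; auto).
  pose proof (lt_0_INR (S N) ltac:(lia)). assert (INR N <= INR (S N)) by (apply le_INR; lia).
  apply Rle_trans with (INR (S N) * (5 * (/ lowc tau) ^ p / INR (S N) ^ 2)).
  - apply Rmult_le_compat_r; auto. apply Rmult_le_pos; [lra|]. left. apply Rinv_0_lt_compat, pow_lt. auto.
  - right. field. lra.
Qed.
End Box.

(* The divisor sum sigma_e n, with the complementary divisor n/d as summand. *)
Definition sig (e n : nat) : R :=
  Rsum (fun c => if (n mod (S c) =? 0)%nat then INR (n / S c) ^ e else 0) n.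

Lemma sig_pos e n : 0 <= sig e n.
Proof. apply Rsum_pos. intros i _. destruct (_ =? _)%nat; [apply pow_le, pos_INR|lra]. Qed.

Lemma sig_le e n : sig e n <= INR n ^ S e.
Proof.
  unfold sig. rewrite <- tech_pow_Rmult, <- Rsum_const. apply Rsum_le. intros i _.
  destruct (_ =? _)%nat; [|apply pow_le, pos_INR]. apply pow_incr. split; [apply pos_INR|].
  apply le_INR. apply Nat.Div0.div_le_upper_bound. nia.
Qed.

Section Lambert.
Variables (e : nat) (phi : C -> C).
Hypothesis e_pos : (1 <= e)%nat.
Hypothesis phi_ser : forall u, Cmod u < 1 -> Csums (fun n => RtoC (INR n ^ e) * u ^ n)%C (phi u).

(** The series of phi(q^m) rewritten in powers of q, so that all m share one summation index. *)
Definition lam (m : nat) (q : C) (n : nat) : C :=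
  if (n mod m =? 0)%nat then (RtoC (INR (n / m) ^ e) * q ^ n)%C else RtoC 0.

Lemma lam_partial m q R : (1 <= m)%nat ->
  Csum (lam m q) (m * R) = Csum (fun r => RtoC (INR r ^ e) * (q ^ m) ^ r)%C R.
Proof.
  intros Hm. induction R as [|R IH]; [rewrite Nat.mul_0_r; reflexivity|].
  replace (m * S R)%nat with (m * R + m)%nat by lia. rewrite Csum_split, IH, Csum_S. f_equal.
  rewrite (Csum_single _ m 0); [|lia|].
  2:{ intros i Hi Hi0. unfold lam. rewrite Nat.add_comm, Nat.mul_comm, Nat.Div0.mod_add, Nat.mod_small by lia.
      destruct i; [lia|reflexivity]. }
  unfold lam. rewrite Nat.add_0_r, Nat.mul_comm, Nat.Div0.mod_mul, Nat.eqb_refl, Nat.div_mul by lia.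
  rewrite Nat.mul_comm, Cpow_mult_r. reflexivity.
Qed.

Lemma lam_bound q C s' m n : (1 <= m)%nat -> (forall n, INR n ^ e * Cmod q ^ n <= C * s' ^ n) -> 0 <= C -> 0 <= s' ->
  Cmod (lam m q n) <= C * s' ^ n.
Proof.
  intros Hm HC C0 Hs. unfold lam. destruct (_ =? _)%nat.
  - rewrite Cmod_mult, Cmod_R, Cmod_pow, Rabs_right by (apply Rle_ge, pow_le, pos_INR).
    eapply Rle_trans; [|apply HC]. apply Rmult_le_compat_r; [apply pow_le, Cmod_ge_0|].
    apply pow_incr. split; [apply pos_INR|]. apply le_INR. apply Nat.Div0.div_le_upper_bound. nia.
  - rewrite Cmod_0. apply Rmult_le_pos; auto. apply pow_le; auto.
Qed.

Lemma lam_tail q m N C s' : (1 <= m)%nat -> Cmod q < s' -> s' < 1 -> 0 <= C -> (forall n, INR n ^ e * Cmod q ^ n <= C * s' ^ n) ->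
  Cmod (phi (q ^ m)%C - Csum (lam m q) N) <= C / (1 - s') * s' ^ N.
Proof.
  intros Hm Hq Hs C0 HC. pose proof (Cmod_ge_0 q) as Hq0.
  destruct (Csums_exists (lam m q) (fun n => C * s' ^ n) (C / (1 - s'))) as [L HL].
  { intros n. apply lam_bound; auto. lra. }
  { intros n. apply Rsum_geom_bound; auto. lra. }
  assert (E : L = phi (q ^ m)%C).
  { apply CLim_unique with (u := fun R => Csum (lam m q) (m * R)).
    - apply (CLim_sub (Csum (lam m q)) L (fun R => m * R)%nat); [intros; nia|exact HL].
    - eapply CLim_ext; [|apply phi_ser].
      + exists O. intros R _. rewrite lam_partial by auto. reflexivity.
      + rewrite Cmod_pow. destruct m; [lia|]. simpl. assert (Cmod q ^ m <= 1).
        { rewrite <- (pow1 m). apply pow_incr. lra. } nra. }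
  rewrite <- E. apply Csums_tail with (b := fun i => C * s' ^ N * s' ^ i); auto.
  - intros i. rewrite Rmult_assoc, <- pow_add. apply lam_bound; auto. lra.
  - intros n. replace (C / (1 - s') * s' ^ N) with (C * s' ^ N / (1 - s')) by (field; lra).
    apply Rsum_geom_bound; [|lra]. apply Rmult_le_pos; auto. apply pow_le. lra.
Qed.

Lemma sig_partial q N : Csum (fun n => RtoC (sig e n) * q ^ n)%C N = Csum (fun c => Csum (lam (S c) q) N) N.
Proof.
  rewrite Csum_swap. apply Csum_ext. intros n Hn. unfold sig.
  transitivity (Csum (fun c => lam (S c) q n) n).
  - assert (G : forall k, (RtoC (Rsum (fun c => if (n mod (S c) =? 0)%nat then INR (n / S c) ^ e else 0)%R k) * q ^ n)%C =
       Csum (fun c => lam (S c) q n) k).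
    { induction k as [|k IH]; [simpl; ring|].
      rewrite Csum_S, <- IH, Rsum_S, RtoC_plus. unfold lam at 1. destruct (_ =? _)%nat; ring. }
    apply G.
  - replace N with (n + (N - n))%nat by lia. rewrite Csum_split.
    rewrite (Csum_zero (fun i => lam (S (n + i)) q n)); [ring|]. intros i _. unfold lam.
    (* A modulus larger than n leaves the remainder n, so only n = 0 survives the test, and there
       0^e = 0. *)
    rewrite Nat.mod_small, Nat.div_small by lia. destruct n; simpl; [|reflexivity].
    destruct e; [lia|]. simpl. rewrite Rmult_0_l. ring.
Qed.

(** Cutting the first N Lambert terms phi(q^a) at degree N gives exactly the partial divisor series;
    the N discarded tails are each O(s'^N), so their sum vanishes in the limit. *)
Lemma sig_lambert q : Cmod q < 1 -> exists G, Csums (fun n => RtoC (sig e n) * q ^ n)%C G /\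
  CLim (fun N => Csum (fun a => phi (q ^ S a)%C) N) G.
Proof.
  intros Hq. pose proof (Cmod_ge_0 q) as Hq0. set (s' := (Cmod q + 1) / 2).
  destruct (pow_geom (S e) (Cmod q) s' ltac:(unfold s'; lra)) as [C1 [C10 HC1]].
  destruct (pow_geom e (Cmod q) s' ltac:(unfold s'; lra)) as [C2 [C20 HC2]].
  destruct (Csums_exists (fun n => RtoC (sig e n) * q ^ n)%C (fun n => C1 * s' ^ n) (C1 / (1 - s'))) as [G HG].
  { intros n. rewrite Cmod_mult, Cmod_R, Cmod_pow, Rabs_right by (apply Rle_ge, sig_pos).
    eapply Rle_trans; [|apply HC1]. apply Rmult_le_compat_r; [apply pow_le; auto|apply sig_le]. }
  { intros n. apply Rsum_geom_bound; auto. unfold s'; lra. }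
  exists G. split; auto.
  assert (Hd : CLim (fun N => Csum (fun a => phi (q ^ S a) - Csum (lam (S a) q) N)%C N) 0).
  { destruct (lin_geom s' ((s' + 1) / 2) ltac:(unfold s'; lra)) as [C3 [C30 HC3]].
    apply CLim_squeeze with (e := fun N => (C2 / (1 - s') * C3) * ((s' + 1) / 2) ^ N).
    - apply Rlim0_geom. unfold s'; lra.
    - exists O. intros N _. assert (HK : 0 <= C2 / (1 - s')) by (apply Rmult_le_pos; auto; left; apply Rinv_0_lt_compat; unfold s'; lra).
      replace (Csum (fun a => phi (q ^ S a) - Csum (lam (S a) q) N) N - 0)%C with (Csum (fun a => phi (q ^ S a) - Csum (lam (S a) q) N) N)%C by ring.
      eapply Rle_trans; [apply Cmod_Csum_le; intros a _; apply (lam_tail q (S a) N C2 s'); auto; try lia; unfold s'; lra|].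
      rewrite Rsum_const. specialize (HC3 N).
      replace (INR N * (C2 / (1 - s') * s' ^ N)) with (C2 / (1 - s') * (INR N * s' ^ N)) by ring.
      rewrite Rmult_assoc. apply Rmult_le_compat_l; auto. }
  replace G with (0 + G)%C by ring.
  eapply CLim_ext; [|apply CLim_plus; [exact Hd|exact HG]].
  exists O. intros N _. cbv beta. rewrite Csum_minus, sig_partial. ring.
Qed.
End Lambert.

(** A total limit operator, so that [E4] and [E6] are plain functions on C; its value is meaningful
    only where the limit exists. *)
Definition Clim (u : nat -> C) : C := (real (Lim_seq (fun n => Re (u n))), real (Lim_seq (fun n => Im (u n)))).

Lemma CLim_Re u l : CLim u l -> is_lim_seq (fun n => Re (u n)) (Re l) /\ is_lim_seq (fun n => Im (u n)) (Im l).
Proof.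
  intros H. split; apply is_lim_seq_spec; intros [eps He]; destruct (H eps He) as [N HN]; exists N; intros n Hn; simpl;
    specialize (HN n Hn).
  - pose proof (re_le_Cmod (u n - l)). destruct (u n), l. simpl in *. unfold Rminus. lra.
  - pose proof (im_le_Cmod (u n - l)). destruct (u n), l. simpl in *. unfold Rminus. lra.
Qed.

Lemma Clim_correct u l : CLim u l -> Clim u = l.
Proof.
  intros H. destruct (CLim_Re _ _ H) as [H1 H2]. unfold Clim.
  rewrite (is_lim_seq_unique _ _ H1), (is_lim_seq_unique _ _ H2). destruct l; reflexivity.
Qed.

Definition e4 (n : nat) : R := match n with O => 1 | _ => 240 * sig 3 n end.
Definition e6 (n : nat) : R := match n with O => 1 | _ => -504 * sig 5 n end.
Definition E4 (z : C) : C := Clim (Csum (fun n => RtoC (e4 n) * eu z ^ n)%C).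
Definition E6 (z : C) : C := Clim (Csum (fun n => RtoC (e6 n) * eu z ^ n)%C).

Lemma eu_lt1 z : in_H z -> Cmod (eu z) < 1.
Proof.
  intros H. rewrite Cmod_eu. rewrite <- exp_0. apply exp_increasing. unfold in_H in H.
  pose proof PI_RGT_0. nra.
Qed.

Lemma eis_series (ee : nat -> R) (e : nat) (c : R) q G :
  (forall n, ee n = match n with O => 1 | _ => c * sig e n end) -> (1 <= e)%nat ->
  Csums (fun n => RtoC (sig e n) * q ^ n)%C G -> Csums (fun n => RtoC (ee n) * q ^ n)%C (1 + RtoC c * G)%C.
Proof.
  intros Hee He HG.
  assert (H1 : Csums (fun n => match n with O => RtoC 1 | _ => RtoC 0 end) 1).
  { unfold Csums. apply CLim_ext with (u := fun _ => RtoC 1); [|apply CLim_const].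
    exists 1%nat. intros n Hn. destruct n; [lia|]. rewrite Csum_Sl, Csum_zero by auto. ring. }
  eapply Csums_ext; [|apply Csums_plus; [exact H1|apply Csums_scal; exact HG]].
  intros n. cbv beta. rewrite Hee. destruct n.
  - unfold sig. simpl. ring.
  - rewrite RtoC_mult. ring.
Qed.

(** At z and at -1/z alike the box sums converge to 2 kap/cst times the Eisenstein series, so the
    exact relation [box_S] passes to the limit. *)
Lemma eis_gen p e (ee : nat -> R) phi kap cst :
  (4 <= p)%nat -> Nat.Even p -> (1 <= e)%nat -> kap <> RtoC 0 -> cst <> 0 ->
  (forall z c, lip_ok z c -> Csums (fun i => / (z + RtoC (INR i)) ^ p + / (z - 1 - RtoC (INR i)) ^ p)%C (kap * phi (eu z))%C) ->
  (forall u, Cmod u < 1 -> Csums (fun n => RtoC (INR n ^ e) * u ^ n)%C (phi u)) ->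
  Csums (fun i => / RtoC (INR (S i)) ^ p)%C (kap / RtoC cst)%C ->
  (forall n, ee n = match n with O => 1 | _ => cst * sig e n end) ->
  (forall z, in_H z -> Csums (fun n => RtoC (ee n) * eu z ^ n)%C (Clim (Csum (fun n => RtoC (ee n) * eu z ^ n)%C))) /\
  (forall z, in_H z -> Clim (Csum (fun n => RtoC (ee n) * eu (- / z) ^ n)%C) = (z ^ p * Clim (Csum (fun n => RtoC (ee n) * eu z ^ n)%C))%C).
Proof.
  intros Hp Hpe He Hk Hcst Hlip Hphi Hzeta Hee.
  assert (HcC : RtoC cst <> RtoC 0) by (intros F; apply RtoC_inj in F; lra).
  assert (Hser : forall z, in_H z -> Csums (fun n => RtoC (ee n) * eu z ^ n)%C (Clim (Csum (fun n => RtoC (ee n) * eu z ^ n)%C))).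
  { intros z Hz. destruct (sig_lambert e phi He Hphi (eu z) (eu_lt1 z Hz)) as [G [HG _]].
    pose proof (eis_series ee e cst (eu z) G Hee He HG) as H. rewrite (Clim_correct _ _ H). exact H. }
  split; auto.
  assert (Hbox : forall z, in_H z -> CLim (fun N => box p N z) (2 * kap / RtoC cst * Clim (Csum (fun n => RtoC (ee n) * eu z ^ n)%C))%C).
  { intros z Hz. destruct (sig_lambert e phi He Hphi (eu z) (eu_lt1 z Hz)) as [G [HG HG2]].
    pose proof (eis_series ee e cst (eu z) G Hee He HG) as H. rewrite (Clim_correct _ _ H).
    replace (2 * kap / cst * (1 + cst * G))%C with (2 * (kap / cst) + 2 * kap * G)%C by (field; auto).
    apply (box_lim p Hp Hpe phi kap Hlip _ Hzeta z G Hz).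
    eapply CLim_ext; [|exact HG2]. exists O. intros N _. apply Csum_ext. intros a _. rewrite eu_INR. reflexivity. }
  intros z Hz. assert (Hz0 := in_H_neq0 z Hz).
  assert (HSz : in_H (- / z)%C).
  { unfold in_H in *. destruct z as [x y]. simpl in *. 
    replace (- (- y / (x * (x * 1) + y * (y * 1)))) with (y / (x * (x * 1) + y * (y * 1))) by (unfold Rdiv; ring).
    apply Rdiv_lt_0_compat; nra. }
  pose proof (Hbox z Hz) as L1. pose proof (Hbox _ HSz) as L2.
  apply (CLim_scal (z ^ p)%C) in L1.
  assert (E : (2 * kap / cst * Clim (Csum (fun n => ee n * eu (- / z) ^ n)) = z ^ p * (2 * kap / cst * Clim (Csum (fun n => ee n * eu z ^ n))))%C).
  { apply CLim_unique with (u := fun N => box p N (- / z)%C); auto.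
    eapply CLim_ext; [|exact L1]. exists O. intros N _. symmetry. apply box_S; auto. }
  assert (H2 : RtoC 2 <> RtoC 0) by (intros F; apply RtoC_inj in F; lra).
  apply (f_equal (fun w => w * (cst / (2 * kap)))%C) in E.
  match type of E with (?l = ?r)%C => match goal with |- ?l' = ?r' => replace l' with l by (field; auto); rewrite E; field; auto end end.
Qed.

Lemma E4_facts : (forall z, in_H z -> Csums (fun n => RtoC (e4 n) * eu z ^ n)%C (E4 z)) /\
  (forall z, in_H z -> E4 (- / z)%C = (z ^ 4 * E4 z)%C).
Proof.
  apply (eis_gen 4 3 e4 phi3 kap4 240); try lia; try lra.
  - exists 2%nat. lia.
  - unfold kap4. intros F. apply RtoC_inj in F. pose proof (pow_lt PI 4 PI_RGT_0). lra.
  - exact lipschitz4.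
  - intros u Hu. apply (powser_sums u Hu).
  - exact zeta4.
  - intros [|n]; reflexivity.
Qed.

Lemma E6_facts : (forall z, in_H z -> Csums (fun n => RtoC (e6 n) * eu z ^ n)%C (E6 z)) /\
  (forall z, in_H z -> E6 (- / z)%C = (z ^ 6 * E6 z)%C).
Proof.
  apply (eis_gen 6 5 e6 phi5 kap6 (-504)); try lia; try lra.
  - exists 3%nat. lia.
  - unfold kap6. intros F. apply RtoC_inj in F. pose proof (pow_lt PI 6 PI_RGT_0). lra.
  - exact lipschitz6.
  - intros u Hu. apply (powser_sums u Hu).
  - exact zeta6.
  - intros [|n]; reflexivity.
Qed.

Lemma PI_lower : 3.12 <= PI.
Proof.
  apply Rnot_lt_le. intros h. pose proof PI2_3_2 as H3.
  destruct (COS (PI / 2) ltac:(lra) ltac:(lra)) as [H _].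
  rewrite cos_PI2 in H. unfold cos_lb, cos_approx, cos_term in H. cbv [sum_f_R0] in H.
  replace (INR (fact (2 * 0))) with 1 in H by (simpl; ring).
  replace (INR (fact (2 * 1))) with 2 in H by (simpl; ring).
  replace (INR (fact (2 * 2))) with 24 in H by (simpl; ring).
  replace (INR (fact (2 * 3))) with 720 in H by (simpl; ring).
  simpl pow in H. set (x := PI / 2) in *. assert (1.5 <= x < 1.56) by (unfold x in *; lra).
  set (y := x * x). assert (2.25 <= y <= 2.4336) by (unfold y; nra).
  assert (E : 1 - y / 2 + y * y / 24 - y * y * y / 720 <= 0) by (unfold y; lra).
  nra.
Qed.

(** 5.366 is just below 2 * 3.12 * 0.86, and 0.86 is just below the height sqrt 3 / 2 of [rho];
    hence |q| <= 1/200 on the whole fundamental domain. *)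
Lemma exp_5 : 200 <= exp 5.366.
Proof.
  pose proof (exp_ge_taylor 1.34 6 ltac:(lra)) as H. cbv [sum_f_R0] in H.
  replace (INR (fact 0)) with 1 in H by (simpl; ring). replace (INR (fact 1)) with 1 in H by (simpl; ring).
  replace (INR (fact 2)) with 2 in H by (simpl; ring). replace (INR (fact 3)) with 6 in H by (simpl; ring).
  replace (INR (fact 4)) with 24 in H by (simpl; ring). replace (INR (fact 5)) with 120 in H by (simpl; ring).
  replace (INR (fact 6)) with 720 in H by (simpl; ring). simpl pow in H.
  assert (H1 : 3.8 <= exp 1.34) by lra.
  replace 5.366 with (1.34 + (1.34 + (1.34 + (1.34 + 0.006)))) by lra. rewrite !exp_plus.
  pose proof (exp_ineq1_le 0.006). 
  assert (3.8 * (3.8 * (3.8 * (3.8 * 1))) <= exp 1.34 * (exp 1.34 * (exp 1.34 * (exp 1.34 * exp 0.006)))); [|lra].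
  repeat (apply Rmult_le_compat; try lra).
Qed.

Lemma eu_small z : 0.86 <= Im z -> Cmod (eu z) <= / 200.
Proof.
  intros H. rewrite Cmod_eu. pose proof PI_lower. replace (- (2 * PI) * Im z) with (- (2 * PI * Im z)) by ring.
  rewrite exp_Ropp. apply Rinv_le_contravar; [lra|]. eapply Rle_trans; [apply exp_5|].
  assert (5.366 <= 2 * PI * Im z) by nra. destruct H1 as [h|h]; [left; apply exp_increasing; auto|rewrite <- h; right; auto].
Qed.

Lemma inF_Im z : inF z -> 0.86 <= Im z.
Proof.
  intros [H [Hr Hm]]. unfold in_H in H. assert (H1 : 1 <= Cmod z ^ 2) by (rewrite <- (pow1 2); apply pow_incr; lra).
  rewrite Cmod2_alt in H1. apply Rabs_le_between in Hr. nra.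
Qed.

Lemma Im_Sz z : in_H z -> Im (- / z)%C = Im z / Cmod z ^ 2.
Proof. intros H. rewrite Cmod2_alt. unfold in_H in H. destruct z as [x y]. simpl in *. field. nra. Qed.

Lemma in_H_S z : in_H z -> in_H (- / z)%C.
Proof.
  intros H. unfold in_H. rewrite Im_Sz by auto. apply Rdiv_lt_0_compat; [exact H|].
  apply pow_lt, Cmod_gt_0. apply in_H_neq0; auto.
Qed.

(** If |Re z| <= 1/2 and Im z < 0.86, then |z|^2 <= 1/4 + 0.86^2 = 0.9896, so -1/z is higher by a
    factor of at least 1.01. Stopping at height 0.86 instead of at the exact fundamental domain thus
    bounds the number of inversions. *)
Lemma modular_reduction (P : C -> Prop) :
  (forall z, in_H z -> P (z + 1)%C -> P z) -> (forall z, in_H z -> P (z - 1)%C -> P z) ->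
  (forall z, in_H z -> P (- / z)%C -> P z) ->
  (forall z, 0.86 <= Im z -> Rabs (Re z) <= 1 / 2 -> P z) ->
  forall z, in_H z -> P z.
Proof.
  intros Hp Hm HS Hb.
  assert (Hsh : forall (n : nat) z, in_H z -> (P (z + INR n)%C -> P z) /\ (P (z - INR n)%C -> P z)).
  { induction n as [|n IH]; intros z Hz.
    - simpl. replace (z + 0)%C with z by ring. replace (z - 0)%C with z by ring. auto.
    - rewrite S_INR, RtoC_plus. split; intros H.
      + apply Hp; auto. refine (proj1 (IH (z + 1)%C _) _); [unfold in_H in *; destruct z; simpl in *; lra|].
        replace (z + 1 + INR n)%C with (z + (INR n + 1))%C by ring. auto.
      + apply Hm; auto. refine (proj2 (IH (z - 1)%C _) _); [unfold in_H in *; destruct z; simpl in *; lra|].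
        replace (z - 1 - INR n)%C with (z - (INR n + 1))%C by ring. auto. }
  assert (Htr : forall z, in_H z -> exists t : R, Rabs (Re z + t) <= 1 / 2 /\ (P (z + t)%C -> P z)).
  { intros z Hz. set (N := up (Re z - 1 / 2)). destruct (archimed (Re z - 1 / 2)) as [A1 A2]. fold N in A1, A2.
    exists (- IZR N). split; [apply Rabs_le; lra|]. intros H.
    destruct (Z_le_dec 0 N) as [h|h].
    - apply (Hsh (Z.to_nat N) z Hz). rewrite INR_IZR_INZ, Z2Nat.id by auto.
      rewrite RtoC_opp in H. exact H.
    - apply (proj1 (Hsh (Z.to_nat (- N)) z Hz)). rewrite INR_IZR_INZ, Z2Nat.id by lia.
      rewrite opp_IZR. exact H. }
  assert (Hind : forall n z, in_H z -> 0.86 <= Im z * 1.01 ^ n -> P z).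
  { induction n as [|n IH]; intros z Hz Hn.
    - destruct (Htr z Hz) as [t [Ht HP]]. apply HP, Hb.
      + destruct z; simpl in *; lra.
      + destruct z; simpl in *; auto.
    - destruct (Htr z Hz) as [t [Ht HP]]. apply HP.
      assert (Hz' : in_H (z + t)%C) by (unfold in_H in *; destruct z; simpl in *; lra).
      assert (HI : Im (z + t)%C = Im z) by (destruct z; simpl; ring).
      assert (HR : Re (z + t)%C = Re z + t) by (destruct z; simpl; ring).
      destruct (Rle_lt_dec 0.86 (Im z)) as [h|h].
      + apply Hb; rewrite ?HI, ?HR; auto.
      + apply HS; auto. apply IH; [apply in_H_S; auto|]. rewrite Im_Sz, HI by auto.
        assert (Hc : 0 < Cmod (z + t)%C ^ 2) by (apply pow_lt, Cmod_gt_0, in_H_neq0; auto).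
        assert (Hc2 : Cmod (z + t)%C ^ 2 <= 0.9896).
        { rewrite Cmod2_alt, HI, HR. apply Rabs_le_between in Ht. unfold in_H in Hz. nra. }
        assert (Im z * 1.01 <= Im z / Cmod (z + t)%C ^ 2).
        { apply Rmult_le_compat_l; [unfold in_H in Hz; lra|]. apply Rmult_le_reg_r with (Cmod (z + t)%C ^ 2); auto.
          rewrite Rinv_l by lra. lra. }
        eapply Rle_trans; [exact Hn|]. simpl pow. rewrite <- Rmult_assoc. apply Rmult_le_compat_r; auto.
        apply pow_le. lra. }
  intros z Hz. assert (Hpos := Hz). unfold in_H in Hpos.
  destruct (Pow_x_infinity 1.01 ltac:(rewrite Rabs_right; lra) (0.86 / Im z)) as [n Hn].
  apply (Hind n z Hz). specialize (Hn n (Nat.le_refl n)). rewrite Rabs_right in Hn by (apply Rle_ge, pow_le; lra).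
  apply Rge_le in Hn. apply Rmult_le_compat_l with (r := Im z) in Hn; [|lra].
  replace (Im z * (0.86 / Im z)) with 0.86 in Hn by (field; lra). auto.
Qed.

Lemma eu_p1 z : eu (z + 1)%C = eu z.
Proof. rewrite eu_plus, eu_1. ring. Qed.

Lemma E4_T z : E4 (z + 1)%C = E4 z. Proof. unfold E4. rewrite eu_p1. reflexivity. Qed.
Lemma E6_T z : E6 (z + 1)%C = E6 z. Proof. unfold E6. rewrite eu_p1. reflexivity. Qed.

(** * The fundamental domain *)

Definition Delta (z : C) : C := ((E4 z ^ 3 - E6 z ^ 2) / 1728)%C.

Lemma Delta_T z : Delta (z + 1)%C = Delta z.
Proof. unfold Delta. rewrite E4_T, E6_T. reflexivity. Qed.

Lemma Delta_S z : in_H z -> Delta (- / z)%C = (z ^ 12 * Delta z)%C.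
Proof. intros H. unfold Delta. rewrite (proj2 E4_facts), (proj2 E6_facts) by auto. field. Qed.

Definition sser (e : nat) (q : C) : C := Clim (Csum (fun n => RtoC (sig e n) * q ^ n)%C).

Lemma sser_sums e q : Cmod q < 1 -> Csums (fun n => RtoC (sig e n) * q ^ n)%C (sser e q).
Proof.
  intros Hq. pose proof (Cmod_ge_0 q) as Hq0.
  destruct (pow_geom (S e) (Cmod q) ((Cmod q + 1) / 2) ltac:(lra)) as [C1 [C10 HC1]].
  destruct (Csums_exists (fun n => RtoC (sig e n) * q ^ n)%C (fun n => C1 * ((Cmod q + 1) / 2) ^ n) (C1 / (1 - (Cmod q + 1) / 2))) as [G HG].
  { intros n. rewrite Cmod_mult, Cmod_R, Cmod_pow, Rabs_right by (apply Rle_ge, sig_pos).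
    eapply Rle_trans; [|apply HC1]. apply Rmult_le_compat_r; [apply pow_le; auto|apply sig_le]. }
  { intros n. apply Rsum_geom_bound; auto. lra. }
  unfold sser. rewrite (Clim_correct _ _ HG). exact HG.
Qed.

Lemma E4_sser z : in_H z -> E4 z = (1 + 240 * sser 3 (eu z))%C.
Proof.
  intros H. apply Clim_correct. apply (eis_series e4 3 240); [intros [|n]; reflexivity|lia|].
  apply sser_sums, eu_lt1, H.
Qed.

Lemma E6_sser z : in_H z -> E6 z = (1 - 504 * sser 5 (eu z))%C.
Proof.
  intros H. replace (1 - 504 * sser 5 (eu z))%C with (1 + RtoC (-504) * sser 5 (eu z))%C by ring.
  apply Clim_correct. apply (eis_series e6 5 (-504)); [intros [|n]; reflexivity|lia|].
  apply sser_sums, eu_lt1, H.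
Qed.

Lemma sig_1 e : sig e 1 = 1.
Proof. unfold sig. simpl. rewrite pow1. ring. Qed.

Lemma sig_2 e : sig e 2 = 2 ^ e + 1.
Proof. unfold sig. simpl. rewrite pow1. replace (1 + 1) with 2 by ring. ring. Qed.

(** The last hypothesis dominates the divisor sum through [sig_le]. With K = 3^(e+1), any L >=
    (4/3)^(e+1) will do: 81 and 4 for e = 3, 729 and 6 for e = 5. *)
Lemma sser_expand e q K L : Cmod q <= / 200 -> 0 <= K -> 0 <= L <= 20 ->
  (forall n, INR (3 + n) ^ S e <= K * L ^ n) ->
  Cmod (sser e q - q - RtoC (2 ^ e + 1) * q ^ 2) <= K / (1 - L / 200) * Cmod q ^ 3.
Proof.
  intros Hq HK HL H. pose proof (Cmod_ge_0 q) as Hq0.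
  pose proof (sser_sums e q ltac:(lra)) as HS.
  assert (T : Cmod (sser e q - Csum (fun n => RtoC (sig e n) * q ^ n)%C 3) <= K / (1 - L / 200) * Cmod q ^ 3).
  { apply Csums_tail with (b := fun n => (K * Cmod q ^ 3) * (L / 200) ^ n); auto.
    - intros n. rewrite Cmod_mult, Cmod_R, Cmod_pow, Rabs_right, pow_add by (apply Rle_ge, sig_pos).
      replace (K * Cmod q ^ 3 * (L / 200) ^ n) with (K * L ^ n * (Cmod q ^ 3 * (/ 200) ^ n)) by (unfold Rdiv; rewrite Rpow_mult_distr; ring).
      apply Rmult_le_compat.
      + apply sig_pos.
      + apply Rmult_le_pos; apply pow_le; auto.
      + eapply Rle_trans; [apply sig_le|]. apply H.
      + apply Rmult_le_compat_l; [apply pow_le; auto|]. apply pow_incr. lra.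
    - intros n. replace (K / (1 - L / 200) * Cmod q ^ 3) with (K * Cmod q ^ 3 / (1 - L / 200)) by (unfold Rdiv; ring).
      apply Rsum_geom_bound; [|lra]. apply Rmult_le_pos; auto. apply pow_le; auto. }
  replace (sser e q - q - (2 ^ e + 1)%R * q ^ 2)%C with (sser e q - Csum (fun n => RtoC (sig e n) * q ^ n)%C 3)%C; auto.
  change (Csum (fun n => RtoC (sig e n) * q ^ n)%C 3) with (0 + RtoC (sig e 0) * q ^ 0 + RtoC (sig e 1) * q ^ 1 + RtoC (sig e 2) * q ^ 2)%C.
  rewrite sig_1, sig_2. change (sig e 0) with 0. simpl. ring.
Qed.

Lemma Cmod_add_le x y a b : Cmod x <= a -> Cmod y <= b -> Cmod (x + y) <= a + b.
Proof. intros. eapply Rle_trans; [apply Cmod_triangle|]. lra. Qed.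

Lemma sser3_expand q : Cmod q <= / 200 -> Cmod (sser 3 q - q - 9 * q ^ 2) <= 83 * Cmod q ^ 3.
Proof.
  intros Hq. pose proof (Cmod_ge_0 q). pose proof (sser_expand 3 q 81 4 Hq ltac:(lra) ltac:(lra)) as H3.
  replace (2 ^ 3 + 1)%R with 9 in H3 by ring.
  eapply Rle_trans; [apply H3|].
  - induction n as [|n IH]; [simpl; lra|]. rewrite Nat.add_succ_r, S_INR. simpl (4 ^ S n).
    set (x := INR (3 + n)) in *. assert (3 <= x) by (unfold x; rewrite plus_INR; pose proof (pos_INR n); simpl INR; lra).
    assert ((x + 1) ^ 4 <= 4 * x ^ 4); [|lra].
    assert (x + 1 <= 4 / 3 * x) by lra. apply Rle_trans with ((4 / 3 * x) ^ 4); [apply pow_incr; lra|].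
    rewrite Rpow_mult_distr. apply Rmult_le_compat_r; [apply pow_le; lra|lra].
  - apply Rmult_le_compat_r; [apply pow_le; lra|lra].
Qed.

(** The constant terms cancel and the linear ones add up to 3 * 240 + 2 * 504 = 1728. The remainder
    must stay below 1728 |q|, so all q^2 terms, which amount to -24 * 1728 q^2, are collected before
    estimating. *)
Lemma Delta_sser_ne q : q <> RtoC 0 -> Cmod q <= / 200 ->
  Cmod (((1 + 240 * sser 3 q) ^ 3 - (1 - 504 * sser 5 q) ^ 2) - 1728 * q) <= 1400 * Cmod q.
Proof.
  intros Hq0 Hq. assert (H0 : 0 < Cmod q) by (apply Cmod_gt_0; auto).
  pose proof (sser_expand 5 q 729 6 Hq ltac:(lra) ltac:(lra)) as H5.
  pose proof (sser3_expand q Hq) as A3.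
  assert (A5 : Cmod (sser 5 q - q - (2 ^ 5 + 1)%R * q ^ 2) <= 752 * Cmod q ^ 3).
  { eapply Rle_trans; [apply H5|].
    - induction n as [|n IH]; [simpl; lra|]. rewrite Nat.add_succ_r, S_INR. simpl (6 ^ S n).
      set (x := INR (3 + n)) in *. assert (3 <= x) by (unfold x; rewrite plus_INR; pose proof (pos_INR n); simpl INR; lra).
      assert ((x + 1) ^ 6 <= 6 * x ^ 6); [|lra].
      assert (x + 1 <= 4 / 3 * x) by lra. apply Rle_trans with ((4 / 3 * x) ^ 6); [apply pow_incr; lra|].
      rewrite Rpow_mult_distr. apply Rmult_le_compat_r; [apply pow_le; lra|lra].
    - apply Rmult_le_compat_r; [apply pow_le; lra|lra]. }
  clear H5. replace (2 ^ 5 + 1)%R with 33 in A5 by ring.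
  set (t := (sser 3 q - q - 9 * q ^ 2)%C) in *. set (u := (sser 5 q - q - 33 * q ^ 2)%C) in *.
  set (v := (9 * q ^ 2 + t)%C). set (w := (33 * q ^ 2 + u)%C). set (m := Cmod q) in *.
  assert (M3 : m ^ 3 <= m ^ 2 * / 200) by (simpl; nra).
  assert (M2 : m ^ 2 <= m * / 200) by (simpl; nra).
  assert (Bv : Cmod v <= 0.0471 * m).
  { unfold v. eapply Rle_trans; [apply Cmod_triangle|]. rewrite Cmod_mult, Cmod_R, Cmod_pow, Rabs_right by lra. fold m. lra. }
  assert (Bw : Cmod w <= 0.184 * m).
  { unfold w. eapply Rle_trans; [apply Cmod_triangle|]. rewrite Cmod_mult, Cmod_R, Cmod_pow, Rabs_right by lra. fold m. lra. }
  replace ((1 + 240 * sser 3 q) ^ 3 - (1 - 504 * sser 5 q) ^ 2 - 1728 * q)%C with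
    (RtoC (-41472) * q ^ 2 + 720 * t + 1008 * u + 172800 * (v * (2 * q + v)) + RtoC (-254016) * (w * (2 * q + w)) + 13824000 * (q + v) ^ 3)%C.
  2:{ unfold v, w, t, u. ring. }
  assert (B1 : Cmod (RtoC (-41472) * q ^ 2) <= 41472 * m ^ 2).
  { rewrite Cmod_mult, Cmod_R, Cmod_pow, Rabs_left by lra. fold m. lra. }
  assert (B2 : Cmod (720 * t) <= 720 * 83 * m ^ 3) by (rewrite Cmod_mult, Cmod_R, Rabs_right by lra; lra).
  assert (B3 : Cmod (1008 * u) <= 1008 * 752 * m ^ 3) by (rewrite Cmod_mult, Cmod_R, Rabs_right by lra; lra).
  assert (Bqv : Cmod (2 * q + v) <= 2.0471 * m).
  { eapply Rle_trans; [apply Cmod_triangle|]. rewrite Cmod_mult, Cmod_R, Rabs_right by lra. fold m. lra. }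
  assert (Bqw : Cmod (2 * q + w) <= 2.184 * m).
  { eapply Rle_trans; [apply Cmod_triangle|]. rewrite Cmod_mult, Cmod_R, Rabs_right by lra. fold m. lra. }
  assert (B4 : Cmod (172800 * (v * (2 * q + v))) <= 172800 * (0.0471 * m * (2.0471 * m))).
  { rewrite !Cmod_mult, Cmod_R, Rabs_right by lra. apply Rmult_le_compat_l; [lra|]. apply Rmult_le_compat; auto; apply Cmod_ge_0. }
  assert (B5 : Cmod (RtoC (-254016) * (w * (2 * q + w))) <= 254016 * (0.184 * m * (2.184 * m))).
  { rewrite !Cmod_mult, Cmod_R, Rabs_left by lra. replace (- -254016) with 254016 by ring.
    apply Rmult_le_compat_l; [lra|]. apply Rmult_le_compat; auto; apply Cmod_ge_0. }
  assert (B6 : Cmod (13824000 * (q + v) ^ 3) <= 13824000 * (1.0471 * m) ^ 3).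
  { rewrite Cmod_mult, Cmod_R, Cmod_pow, Rabs_right by lra. apply Rmult_le_compat_l; [lra|]. apply pow_incr. split; [apply Cmod_ge_0|].
    eapply Rle_trans; [apply Cmod_triangle|]. fold m. lra. }
  eapply Rle_trans; [repeat apply Cmod_add_le; eassumption|]. lra.
Qed.

Lemma Delta_high z : 0.86 <= Im z -> in_H z -> 0.1 * Cmod (eu z) <= Cmod (Delta z) <= 2 * Cmod (eu z).
Proof.
  intros H Hz. pose proof (Delta_sser_ne (eu z) (eu_neq0 z) (eu_small z H)) as B.
  rewrite <- E4_sser, <- E6_sser in B by auto.
  replace (E4 z ^ 3 - E6 z ^ 2 - 1728 * eu z)%C with (1728 * (Delta z - eu z))%C in B by (unfold Delta; field).
  rewrite Cmod_mult, Cmod_R, Rabs_right in B by lra.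
  pose proof (Cmod_tri_inv2 (eu z) (eu z - Delta z)). pose proof (Cmod_triangle (eu z) (Delta z - eu z)).
  replace (eu z - (eu z - Delta z))%C with (Delta z) in H0 by ring. rewrite (Cmod_minus_sym (eu z)) in H0.
  replace (eu z + (Delta z - eu z))%C with (Delta z) in H1 by ring. pose proof (Cmod_ge_0 (eu z)). lra.
Qed.

Lemma Delta_neq0 z : in_H z -> Delta z <> RtoC 0.
Proof.
  revert z. assert (G : forall z, in_H z -> in_H z -> Delta z <> RtoC 0); [|auto].
  apply (modular_reduction (fun z => in_H z -> Delta z <> RtoC 0)).
  - intros z Hz H _ F. apply H; [unfold in_H in *; destruct z; simpl in *; lra|]. rewrite Delta_T. auto.
  - intros z Hz H _ F. apply H; [unfold in_H in *; destruct z; simpl in *; lra|]. rewrite <- Delta_T.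
    replace (z - 1 + 1)%C with z by ring. auto.
  - intros z Hz H _ F. apply H; [apply in_H_S; auto|]. rewrite Delta_S, F by auto. ring.
  - intros z Hz _ HH F. destruct (Delta_high z Hz HH) as [B _]. rewrite F, Cmod_0 in B.
    pose proof (proj1 (Cmod_gt_0 _) (eu_neq0 z)). lra.
Qed.

Lemma pow_diff_le r x y n : Cmod x <= r -> Cmod y <= r ->
  Cmod (x ^ S n - y ^ S n)%C <= Cmod (x - y) * (INR (S n) * r ^ n).
Proof.
  intros Hx Hy. pose proof (Cmod_ge_0 x). pose proof (Cmod_ge_0 y).
  induction n as [|n IH]; [simpl; rewrite !Cmult_1_r; lra|].
  replace (x ^ S (S n) - y ^ S (S n))%C with (x * (x ^ S n - y ^ S n) + (x - y) * y ^ S n)%C by (simpl; ring).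
  eapply Rle_trans; [apply Cmod_triangle|]. rewrite !Cmod_mult, Cmod_pow, (S_INR (S n)).
  assert (Cmod x * Cmod (x ^ S n - y ^ S n) <= r * (Cmod (x - y) * (INR (S n) * r ^ n))).
  { apply Rmult_le_compat; auto. apply Cmod_ge_0. }
  assert (Cmod (x - y) * Cmod y ^ S n <= Cmod (x - y) * r ^ S n).
  { apply Rmult_le_compat_l; [apply Cmod_ge_0|]. apply pow_incr. lra. }
  simpl pow in *. lra.
Qed.

(** The terms beyond the linear one change by at most 0.64 / (1 - 0.09) < 1 times |x - y|. The
    constants come from sig_e(n) n <= n^7 <= 128 * 18^(n-2), as 18 >= (3/2)^7, and from the factor
    200^(1-n) of a difference of n-th powers. *)
Lemma sser_injective e x y : (S (S e) <= 7)%nat -> Cmod x <= / 200 -> Cmod y <= / 200 -> sser e x = sser e y -> x = y.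
Proof.
  intros He Hx Hy E. destruct (Ceq_dec x y) as [|Hn]; [auto|exfalso].
  assert (Hp : 0 < Cmod (x - y)) by (apply Cmod_gt_0, Cminus_eq_contra; auto).
  pose proof (Csums_plus _ _ _ _ (sser_sums e x ltac:(lra)) (Csums_scal (-1) _ _ (sser_sums e y ltac:(lra)))) as HS.
  rewrite E in HS. replace (sser e y + -1 * sser e y)%C with (RtoC 0) in HS by ring.
  assert (T : Cmod (0 - Csum (fun n => RtoC (sig e n) * x ^ n + -1 * (RtoC (sig e n) * y ^ n))%C 2) <= Cmod (x - y) * (0.64 / (1 - 0.09))).
  { apply Csums_tail with (b := fun n => (Cmod (x - y) * 0.64) * 0.09 ^ n); auto.
    - intros n. replace (sig e (2 + n) * x ^ (2 + n) + -1 * (sig e (2 + n) * y ^ (2 + n)))%C with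
        (RtoC (sig e (2 + n)) * (x ^ S (S n) - y ^ S (S n)))%C by (simpl Nat.add; ring).
      rewrite Cmod_mult, Cmod_R, Rabs_right by (apply Rle_ge, sig_pos).
      assert (K : sig e (2 + n) * (INR (S (S n)) * (/ 200) ^ S n) <= 0.64 * 0.09 ^ n).
      { assert (K1 : sig e (2 + n) * INR (S (S n)) <= 128 * 18 ^ n).
        { apply Rle_trans with (INR (2 + n) ^ 7).
          - apply Rle_trans with (INR (2 + n) ^ S (S e)).
            + rewrite <- (tech_pow_Rmult _ (S e)), Rmult_comm. apply Rmult_le_compat_l; [apply pos_INR|]. apply sig_le.
            + apply Rle_pow; auto. rewrite plus_INR. pose proof (pos_INR n). simpl (INR 2). lra.
          - clear. induction n as [|n IH]; [simpl; lra|]. rewrite Nat.add_succ_r, S_INR. simpl (18 ^ S n).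
            set (x := INR (2 + n)) in *. assert (2 <= x) by (unfold x; rewrite plus_INR; pose proof (pos_INR n); simpl INR; lra).
            assert ((x + 1) ^ 7 <= 18 * x ^ 7); [|lra].
            assert (x + 1 <= 3 / 2 * x) by lra. apply Rle_trans with ((3 / 2 * x) ^ 7); [apply pow_incr; lra|].
            rewrite Rpow_mult_distr. apply Rmult_le_compat_r; [apply pow_le; lra|lra]. }
        replace (0.64 * 0.09 ^ n) with (128 * 18 ^ n * (/ 200) ^ S n).
        - rewrite <- Rmult_assoc. apply Rmult_le_compat_r; [apply pow_le; lra|auto].
        - replace 0.09 with (18 * / 200) by lra. rewrite Rpow_mult_distr. simpl. lra. }
      pose proof (pow_diff_le (/ 200) x y (S n) Hx Hy) as PD. pose proof (sig_pos e (2 + n)).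
      apply Rle_trans with (sig e (2 + n) * (Cmod (x - y) * (INR (S (S n)) * (/ 200) ^ S n))).
      + apply Rmult_le_compat_l; auto.
      + replace (sig e (2 + n) * (Cmod (x - y) * (INR (S (S n)) * (/ 200) ^ S n))) with
          (Cmod (x - y) * (sig e (2 + n) * (INR (S (S n)) * (/ 200) ^ S n))) by ring.
        rewrite Rmult_assoc. apply Rmult_le_compat_l; lra.
    - intros n. replace (Cmod (x - y) * (0.64 / (1 - 0.09))) with (Cmod (x - y) * 0.64 / (1 - 0.09)) by (unfold Rdiv; ring).
      apply Rsum_geom_bound; lra. }
  replace (0 - Csum (fun n => RtoC (sig e n) * x ^ n + -1 * (RtoC (sig e n) * y ^ n))%C 2)%C with (- (x - y))%C in T.
  - rewrite Cmod_opp in T. lra.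
  - change (Csum (fun n => RtoC (sig e n) * x ^ n + -1 * (RtoC (sig e n) * y ^ n))%C 2) with
      (0 + (RtoC (sig e 0) * x ^ 0 + -1 * (RtoC (sig e 0) * y ^ 0)) + (RtoC (sig e 1) * x ^ 1 + -1 * (RtoC (sig e 1) * y ^ 1)))%C.
    rewrite sig_1. change (sig e 0) with 0. simpl. ring.
Qed.

Lemma eu_eq_Im z w : eu z = eu w -> Im z = Im w.
Proof.
  intros E. apply (f_equal Cmod) in E. rewrite !Cmod_eu in E. apply exp_inv in E. pose proof PI_RGT_0. nra.
Qed.

Lemma eu_eq_Re z w : eu z = eu w -> cos (2 * PI * (Re z - Re w)) = 1.
Proof.
  intros E. pose proof (eu_eq_Im _ _ E) as HI.
  assert (E2 : eu (z - w)%C = RtoC 1).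
  { apply (f_equal (fun t => t * eu (- w))%C) in E. rewrite <- !eu_plus in E.
    replace (w + - w)%C with (RtoC 0) in E by ring. unfold Cminus. rewrite E. unfold eu. rewrite Cmult_0_r. apply Cexp_0. }
  unfold eu, Cexp in E2. apply (f_equal Re) in E2. simpl Re at 1 in E2. rewrite re_RtoC in E2.
  destruct z as [a b], w as [c d]. simpl in *. subst d.
  match goal with H : exp ?A * cos ?B = 1 |- _ => replace A with 0 in H by ring; replace B with (2 * PI * (a - c)) in H by ring end.
  rewrite exp_0 in E2. lra.
Qed.

Lemma cos_2pi_small d : 0 <= d <= 1 -> cos (2 * PI * d) = 1 -> d = 0 \/ d = 1.
Proof.
  intros Hd H. pose proof PI_RGT_0. replace (2 * PI * d) with (2 * (PI * d)) in H by ring. rewrite cos_2a_sin in H.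
  destruct (Req_dec d 0); auto. destruct (Req_dec d 1); auto. exfalso.
  assert (0 < sin (PI * d)) by (apply sin_gt_0; nra). nra.
Qed.

Lemma rho_val : rho = (-1 / 2, sqrt 3 / 2).
Proof.
  unfold rho, Cexp. replace (Re ((2 * PI / 3)%R * Ci)%C) with 0 by (simpl; ring).
  replace (Im ((2 * PI / 3)%R * Ci)%C) with (2 * (PI / 3)) by (simpl; field).
  rewrite exp_0, cos_2PI3, sin_2PI3. f_equal; field.
Qed.

Lemma inF_rho : inF rho.
Proof.
  rewrite rho_val. pose proof (sqrt_lt_R0 3 ltac:(lra)). pose proof (sqrt_sqrt 3 ltac:(lra)). repeat split.
  - unfold in_H. simpl. lra.
  - simpl. rewrite Rabs_left; lra.
  - apply Rsqr_incr_0_var; [|apply Cmod_ge_0]. rewrite !Rsqr_pow2, Cmod2_alt. simpl. nra.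
Qed.

Lemma inF_Ci : inF Ci.
Proof.
  repeat split; [unfold in_H; simpl; lra| |rewrite Cmod_Ci; lra]. simpl. rewrite Rabs_R0. lra.
Qed.

(** -1/rho = rho + 1, so E4(rho) = rho^4 E4(rho) = rho E4(rho), while rho is not 1. *)
Lemma E4_rho : E4 rho = RtoC 0.
Proof.
  assert (H : in_H rho) by apply inF_rho. pose proof (proj2 E4_facts rho H) as E.
  assert (S3 : sqrt 3 * sqrt 3 = 3) by (apply sqrt_sqrt; lra).
  assert (R1 : (rho * (rho + 1) = -1)%C).
  { rewrite rho_val. apply C_eq; simpl; nra. }
  assert (R0 := in_H_neq0 _ H).
  assert (E1 : (- / rho = rho + 1)%C).
  { replace (rho + 1)%C with (/ rho * (rho * (rho + 1)))%C by (field; auto). rewrite R1. ring. }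
  rewrite E1, E4_T in E.
  assert (R4 : (rho ^ 4 = rho)%C).
  { replace (rho ^ 4)%C with (rho * (1 + (rho - 1) * (rho * (rho + 1) + 1)))%C by (simpl; ring). rewrite R1. ring. }
  rewrite R4 in E. assert ((1 - rho) * E4 rho = 0)%C by (replace ((1 - rho) * E4 rho)%C with (E4 rho - rho * E4 rho)%C by ring; rewrite <- E; ring).
  destruct (Ceq_dec (E4 rho) 0); auto. exfalso. apply (Cmult_neq_0 (1 - rho)%C (E4 rho)); auto.
  intros F. apply (f_equal Im) in F. rewrite rho_val in F. simpl in F. pose proof (sqrt_lt_R0 3 ltac:(lra)). lra.
Qed.

Lemma E6_Ci : E6 Ci = RtoC 0.
Proof.
  assert (H : in_H Ci) by apply inF_Ci. pose proof (proj2 E6_facts Ci H) as E.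
  replace (- / Ci)%C with Ci in E by (rewrite Ci_inv; ring).
  replace (Ci ^ 6)%C with (RtoC (-1)) in E.
  2:{ transitivity ((Ci * Ci) * (Ci * Ci) * (Ci * Ci))%C; [rewrite Ci_sq; ring|simpl; ring]. }
  apply (f_equal (fun w => (w + E6 Ci) / 2)%C) in E.
  replace ((E6 Ci + E6 Ci) / 2)%C with (E6 Ci) in E by field. rewrite E. field.
Qed.

(** Injectivity in q compares the zero with [rho]: equal q means equal heights and real parts that
    differ by an integer, which leaves the two corners of the domain. *)
Lemma E4_zero z : inF z -> E4 z = RtoC 0 -> z = rho \/ z = (rho + 1)%C.
Proof.
  intros HF E. assert (Hz := proj1 HF). pose proof inF_rho as HR. assert (HRH := proj1 HR).
  rewrite <- E4_rho, !E4_sser in E by auto.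
  assert (E' : sser 3 (eu z) = sser 3 (eu rho)).
  { apply (f_equal (fun w => (w - 1) / 240)%C) in E. 
    replace ((1 + 240 * sser 3 (eu z) - 1) / 240)%C with (sser 3 (eu z)) in E by field. rewrite E. field. }
  apply sser_injective in E'; [|lia|apply eu_small, inF_Im; auto|apply eu_small, inF_Im; auto].
  pose proof (eu_eq_Im _ _ E') as HI. pose proof (eu_eq_Re _ _ E') as HRe.
  destruct HF as [_ [Hre _]]. apply Rabs_le_between in Hre. rewrite rho_val in *. simpl Re in HRe. simpl Im in HI.
  destruct (cos_2pi_small (Re z - -1 / 2)) as [h|h]; [lra|auto| |].
  - left. apply C_eq; simpl; lra.
  - right. apply C_eq; simpl; lra.
Qed.

Lemma E6_zero z : inF z -> E6 z = RtoC 0 -> z = Ci.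
Proof.
  intros HF E. assert (Hz := proj1 HF). pose proof inF_Ci as HR. assert (HRH := proj1 HR).
  rewrite <- E6_Ci, !E6_sser in E by auto.
  assert (E' : sser 5 (eu z) = sser 5 (eu Ci)).
  { apply (f_equal (fun w => (1 - w) / 504)%C) in E. 
    replace ((1 - (1 - 504 * sser 5 (eu z))) / 504)%C with (sser 5 (eu z)) in E by field. rewrite E. field. }
  apply sser_injective in E'; [|lia|apply eu_small, inF_Im; auto|apply eu_small, inF_Im; auto].
  pose proof (eu_eq_Im _ _ E') as HI. pose proof (eu_eq_Re _ _ E') as HRe.
  destruct HF as [_ [Hre _]]. apply Rabs_le_between in Hre. simpl Re in HRe. simpl Im in HI.
  assert (Re z = 0).
  { destruct (Rle_lt_dec 0 (Re z)) as [h|h].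
    - destruct (cos_2pi_small (Re z)) as [h'|h']; [lra| |lra|lra]. rewrite <- HRe. f_equal. ring.
    - destruct (cos_2pi_small (- Re z)) as [h'|h']; [lra| |lra|lra]. rewrite <- HRe, <- cos_neg. f_equal. ring. }
  apply C_eq; simpl; lra.
Qed.

(** * The Liouville principle *)

(* Second-order Taylor expansions are the only consequence of holomorphy on H that is needed. *)
Definition O3 (r : C -> C) : Prop :=
  exists K d, 0 <= K /\ 0 < d /\ forall h, Cmod h < d -> Cmod (r h) <= K * Cmod h ^ 3.

Definition T2 (f : C -> C) (z a b c : C) : Prop :=
  O3 (fun h => f (z + h) - (a + b * h + c * (h * h)))%C.

Definition T2at (f : C -> C) (z : C) : Prop := exists a b c, T2 f z a b c.

Lemma O3_plus r s : O3 r -> O3 s -> O3 (fun h => r h + s h)%C.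
Proof.
  intros [K [d [HK [Hd H]]]] [K' [d' [HK' [Hd' H']]]]. exists (K + K'), (Rmin d d').
  repeat split; [lra|apply Rmin_pos; auto|]. intros h Hh.
  pose proof (Rmin_l d d'). pose proof (Rmin_r d d').
  rewrite Rmult_plus_distr_r. apply Cmod_add_le; [apply H|apply H']; lra.
Qed.

Definition Bdd (g : C -> C) : Prop := exists B d, 0 <= B /\ 0 < d /\ forall h, Cmod h < d -> Cmod (g h) <= B.

Lemma O3_mult r g : O3 r -> Bdd g -> O3 (fun h => r h * g h)%C.
Proof.
  intros [K [d [HK [Hd H]]]] [K' [d' [HK' [Hd' H']]]]. exists (K * K'), (Rmin d d').
  repeat split; [nra|apply Rmin_pos; auto|]. intros h Hh.
  pose proof (Rmin_l d d'). pose proof (Rmin_r d d').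
  specialize (H h ltac:(lra)). specialize (H' h ltac:(lra)). rewrite Cmod_mult.
  replace (K * K' * Cmod h ^ 3) with (K * Cmod h ^ 3 * K') by ring.
  apply Rmult_le_compat; auto; apply Cmod_ge_0.
Qed.

Lemma O3_ext r s : (forall h, r h = s h) -> O3 r -> O3 s.
Proof. intros E [K [d H]]. exists K, d. intuition. rewrite <- E. auto. Qed.

Lemma Bdd_const c : Bdd (fun _ => c).
Proof. exists (Cmod c), 1. repeat split; intros; try lra. apply Cmod_ge_0. Qed.

Lemma Bdd_id : Bdd (fun h => h).
Proof. exists 1, 1. repeat split; intros; lra. Qed.

Lemma Bdd_plus f g : Bdd f -> Bdd g -> Bdd (fun h => f h + g h)%C.
Proof.
  intros [K [d [HK [Hd H]]]] [K' [d' [HK' [Hd' H']]]]. exists (K + K'), (Rmin d d').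
  repeat split; [lra|apply Rmin_pos; auto|]. intros h Hh.
  pose proof (Rmin_l d d'). pose proof (Rmin_r d d'). apply Cmod_add_le; [apply H|apply H']; lra.
Qed.

Lemma Bdd_mult f g : Bdd f -> Bdd g -> Bdd (fun h => f h * g h)%C.
Proof.
  intros [K [d [HK [Hd H]]]] [K' [d' [HK' [Hd' H']]]]. exists (K * K'), (Rmin d d').
  repeat split; [nra|apply Rmin_pos; auto|]. intros h Hh.
  pose proof (Rmin_l d d'). pose proof (Rmin_r d d'). rewrite Cmod_mult.
  apply Rmult_le_compat; try apply Cmod_ge_0; [apply H|apply H']; lra.
Qed.

Lemma Bdd_O3 r : O3 r -> Bdd r.
Proof.
  intros [K [d [HK [Hd H]]]]. exists K, (Rmin d 1). repeat split; auto; [apply Rmin_pos; lra|].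
  intros h Hh. pose proof (Rmin_l d 1). pose proof (Rmin_r d 1). specialize (H h ltac:(lra)).
  eapply Rle_trans; [exact H|]. rewrite <- (Rmult_1_r K) at 2. apply Rmult_le_compat_l; auto.
  rewrite <- (pow1 3). apply pow_incr. split; [apply Cmod_ge_0|lra].
Qed.

Lemma Bdd_ext f g : (forall h, f h = g h) -> Bdd f -> Bdd g.
Proof. intros E [K [d H]]. exists K, d. intuition. rewrite <- E. auto. Qed.

Lemma O3_cube : O3 (fun h => h * h * h)%C.
Proof. exists 1, 1. repeat split; try lra. intros h _. rewrite !Cmod_mult. simpl. lra. Qed.

Lemma T2_Bdd f z a b c : T2 f z a b c -> Bdd (fun h => f (z + h)%C).
Proof.
  intros H. apply Bdd_ext with (f := fun h => ((f (z + h) - (a + b * h + c * (h * h))) + (a + b * h + c * (h * h)))%C).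
  - intros; ring.
  - apply Bdd_plus; [apply Bdd_O3; exact H|]. apply Bdd_plus; [apply Bdd_plus; [apply Bdd_const|]|].
    + apply (Bdd_mult (fun _ => b) (fun h => h)); [apply Bdd_const|apply Bdd_id].
    + apply (Bdd_mult (fun _ => c) (fun h => h * h)%C); [apply Bdd_const|]. apply (Bdd_mult (fun h => h) (fun h => h)); apply Bdd_id.
Qed.

Lemma T2_const k z : T2 (fun _ => k) z k 0 0.
Proof. exists 0, 1. repeat split; try lra. intros h _. replace (k - (k + 0 * h + 0 * (h * h)))%C with (RtoC 0) by ring. rewrite Cmod_0. lra. Qed.

Lemma T2_plus f g z a b c a' b' c' : T2 f z a b c -> T2 g z a' b' c' -> T2 (fun w => f w + g w)%C z (a + a') (b + b') (c + c').
Proof.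
  intros H H'. eapply O3_ext; [|apply O3_plus; [exact H|exact H']]. intros h. cbv beta. ring.
Qed.

Ltac bdd := repeat first [apply Bdd_const | apply Bdd_id | assumption |
  match goal with |- Bdd (fun h => (@?f h + @?g h)%C) => apply (Bdd_plus f g) | |- Bdd (fun h => (@?f h * @?g h)%C) => apply (Bdd_mult f g) end].

Lemma T2_mult f g z a b c a' b' c' : T2 f z a b c -> T2 g z a' b' c' ->
  T2 (fun w => f w * g w)%C z (a * a') (a * b' + b * a') (a * c' + b * b' + c * a').
Proof.
  intros H H'. pose proof (T2_Bdd _ _ _ _ _ H') as Hb.
  apply O3_ext with (r := fun h => ((f (z + h) - (a + b * h + c * (h * h))) * g (z + h) +
    ((g (z + h) - (a' + b' * h + c' * (h * h))) * (a + b * h + c * (h * h)) + (h * h * h) * (b * c' + c * b' + c * c' * h)))%C).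
  - intros h. ring.
  - apply O3_plus; [apply (O3_mult _ (fun h => g (z + h)%C)); auto|]. apply O3_plus.
    + apply (O3_mult _ (fun h => (a + b * h + c * (h * h))%C)); auto. bdd.
    + apply (O3_mult (fun h => (h * h * h)%C) (fun h => (b * c' + c * b' + c * c' * h)%C)); [apply O3_cube|]. bdd.
Qed.

Lemma T2_val f z a b c : T2 f z a b c -> f z = a.
Proof.
  intros [K [d [HK [Hd H]]]]. specialize (H (RtoC 0)). rewrite Cmod_0 in H. specialize (H Hd).
  replace (z + 0)%C with z in H by ring. replace (a + b * 0 + c * (0 * 0))%C with a in H by ring.
  replace (K * 0 ^ 3) with 0 in H by ring. pose proof (Cmod_ge_0 (f z - a)).
  apply Ceq_minus, Cmod_eq_0. lra.
Qed.

Lemma T2_cont f z : T2at f z -> forall eps, 0 < eps -> exists d, 0 < d /\ forall h, Cmod h < d -> Cmod (f (z + h)%C - f z)%C < eps.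
Proof.
  intros [a [b [c HT]]] eps He. pose proof (T2_val _ _ _ _ _ HT) as Ev. 
  destruct (T2_Bdd _ _ _ _ _ HT) as [_ _]. destruct HT as [K [d [HK [Hd H]]]].
  set (L := K + Cmod b + Cmod c + 1). pose proof (Cmod_ge_0 b). pose proof (Cmod_ge_0 c).
  assert (HL : 0 < eps / L) by (apply Rdiv_lt_0_compat; unfold L; lra).
  exists (Rmin (Rmin d 1) (eps / L)). split; [apply Rmin_pos; auto; apply Rmin_pos; lra|].
  intros h Hh. pose proof (Rmin_l (Rmin d 1) (eps / L)). pose proof (Rmin_r (Rmin d 1) (eps / L)).
  pose proof (Rmin_l d 1). pose proof (Rmin_r d 1). specialize (H h ltac:(lra)).
  rewrite Ev. replace (f (z + h) - a)%C with ((f (z + h) - (a + b * h + c * (h * h))) + (b * h + c * (h * h)))%C by ring.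
  assert (Hm : Cmod h < 1) by lra. assert (Hm2 : Cmod h < eps / L) by lra. pose proof (Cmod_ge_0 h).
  apply Rle_lt_trans with (L * Cmod h).
  - apply Rle_trans with (K * Cmod h ^ 3 + (Cmod b * Cmod h + Cmod c * (Cmod h * Cmod h))).
    + apply Cmod_add_le; auto. apply Cmod_add_le; rewrite !Cmod_mult; lra.
    + assert (Cmod h * Cmod h <= Cmod h) by nra. assert (Cmod h ^ 3 <= Cmod h) by (simpl; nra).
      assert (K * Cmod h ^ 3 <= K * Cmod h) by (apply Rmult_le_compat_l; auto).
      assert (Cmod c * (Cmod h * Cmod h) <= Cmod c * Cmod h) by (apply Rmult_le_compat_l; auto). unfold L. nra.
  - apply Rmult_lt_compat_l with (r := L) in Hm2; [|unfold L; lra].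
    replace (L * (eps / L)) with eps in Hm2 by (field; unfold L; lra). auto.
Qed.

(** If Q is the quadratic polynomial with the claimed coefficients, [T2_mult] gives f Q = 1 +
    O(h^3). Then 1/f - Q = (1 - f Q)/f is O(h^3) as well, because 1/f is bounded near z. *)
Lemma T2_inv f z a b c : T2 f z a b c -> a <> RtoC 0 ->
  T2 (fun w => / f w)%C z (/ a) (- b / (a * a)) ((b * b - a * c) / (a * a * a)).
Proof.
  intros H Ha.
  set (A := (/ a)%C). set (B := (- b / (a * a))%C). set (D := ((b * b - a * c) / (a * a * a))%C).
  assert (Ev := T2_val _ _ _ _ _ H).
  assert (Hne : exists d, 0 < d /\ forall h, Cmod h < d -> Cmod a / 2 <= Cmod (f (z + h)%C)).
  { destruct (T2_cont f z ltac:(exists a, b, c; exact H) (Cmod a / 2)) as [d [Hd Hc]].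
    { assert (0 < Cmod a) by (apply Cmod_gt_0; auto). lra. }
    exists d. split; auto. intros h Hh. specialize (Hc h Hh). rewrite Ev, Cmod_minus_sym in Hc.
    pose proof (Cmod_tri_inv2 a (a - f (z + h))%C). replace (a - (a - f (z + h)))%C with (f (z + h)%C) in H0 by ring. lra. }
  destruct Hne as [d0 [Hd0 Hne]]. assert (Hap : 0 < Cmod a) by (apply Cmod_gt_0; auto).
  assert (Hbi : Bdd (fun h => - / f (z + h))%C).
  { exists (/ (Cmod a / 2)), d0. repeat split; auto.
    - left. apply Rinv_0_lt_compat. lra.
    - intros h Hh. specialize (Hne h Hh). rewrite Cmod_opp, Cmod_inv by (apply Cmod_gt_0; lra).
      apply Rinv_le_contravar; lra. }
  assert (HQ : T2 (fun w => A + B * (w - z) + D * ((w - z) * (w - z)))%C z A B D).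
  { exists 0, 1. repeat split; try lra. intros h _. replace (A + B * (z + h - z) + D * ((z + h - z) * (z + h - z)) - (A + B * h + D * (h * h)))%C with (RtoC 0) by ring.
    rewrite Cmod_0. lra. }
  pose proof (T2_mult _ _ _ _ _ _ _ _ _ H HQ) as HP.
  replace (a * A)%C with (RtoC 1) in HP by (unfold A; field; auto).
  replace (a * B + b * A)%C with (RtoC 0) in HP by (unfold A, B; field; auto).
  replace (a * D + b * B + c * A)%C with (RtoC 0) in HP by (unfold A, B, D; field; auto).
  assert (HF : O3 (fun h => (f (z + h) * (A + B * (z + h - z) + D * ((z + h - z) * (z + h - z))) - (1 + 0 * h + 0 * (h * h))) * (- / f (z + h)))%C).
  { apply (O3_mult _ (fun h => (- / f (z + h))%C)); auto. }
  destruct HF as [K [d [HK [Hd HF]]]]. exists K, (Rmin d d0). repeat split; auto; [apply Rmin_pos; auto|].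
  intros h Hh. pose proof (Rmin_l d d0). pose proof (Rmin_r d d0). specialize (HF h ltac:(lra)). specialize (Hne h ltac:(lra)).
  assert (Hf : f (z + h)%C <> RtoC 0) by (apply Cmod_gt_0; lra).
  eapply Rle_trans; [|exact HF]. right. f_equal. field. auto.
Qed.

Lemma T2at_plus f g z : T2at f z -> T2at g z -> T2at (fun w => f w + g w)%C z.
Proof. intros [a [b [c H]]] [a' [b' [c' H']]]. do 3 eexists. apply T2_plus; eassumption. Qed.

Lemma T2at_mult f g z : T2at f z -> T2at g z -> T2at (fun w => f w * g w)%C z.
Proof. intros [a [b [c H]]] [a' [b' [c' H']]]. do 3 eexists. apply T2_mult; eassumption. Qed.

Lemma T2at_const k z : T2at (fun _ => k) z.
Proof. do 3 eexists. apply T2_const. Qed.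

Lemma T2at_inv f z : T2at f z -> f z <> RtoC 0 -> T2at (fun w => / f w)%C z.
Proof. intros [a [b [c H]]] Hn. rewrite (T2_val _ _ _ _ _ H) in Hn. do 3 eexists. apply T2_inv; eassumption. Qed.

Lemma T2at_pow f z n : T2at f z -> T2at (fun w => f w ^ n)%C z.
Proof. intros H. induction n as [|n IH]; simpl; [apply T2at_const|]. apply T2at_mult; auto. Qed.

Lemma T2at_ext f g z : (exists d, 0 < d /\ forall h, Cmod h < d -> f (z + h)%C = g (z + h)%C) -> T2at f z -> T2at g z.
Proof.
  intros [d [Hd E]] [a [b [c [K [d' [HK [Hd' H]]]]]]]. exists a, b, c, K, (Rmin d d'). repeat split; auto; [apply Rmin_pos; auto|].
  intros h Hh. pose proof (Rmin_l d d'). pose proof (Rmin_r d d'). rewrite <- E by lra. apply H. lra.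
Qed.

Lemma T2at_Cexp k z : T2at (fun w => Cexp (k * w)%C) z.
Proof.
  exists (Cexp (k * z)%C), (Cexp (k * z) * k)%C, (Cexp (k * z) * (k * k / 2))%C.
  exists (Cmod (Cexp (k * z)) * (Cmod k ^ 3 * exp (Cmod k))), 1. repeat split; try lra.
  - apply Rmult_le_pos; [apply Cmod_ge_0|]. apply Rmult_le_pos; [apply pow_le, Cmod_ge_0|left; apply exp_pos].
  - intros h Hh. replace (k * (z + h))%C with (k * z + k * h)%C by ring. rewrite Cexp_plus.
    replace (Cexp (k * z) * Cexp (k * h) - (Cexp (k * z) + Cexp (k * z) * k * h + Cexp (k * z) * (k * k / 2) * (h * h)))%C with
      (Cexp (k * z) * (Cexp (k * h) - 1 - k * h - (k * h) * (k * h) / 2))%C by field.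
    rewrite Cmod_mult, Rmult_assoc. apply Rmult_le_compat_l; [apply Cmod_ge_0|].
    eapply Rle_trans; [apply Cexp_taylor3|]. rewrite Cmod_mult, Rpow_mult_distr.
    pose proof (Cmod_ge_0 k). pose proof (Cmod_ge_0 h). pose proof (exp_pos (Cmod k)).
    assert (exp (Cmod k * Cmod h) <= exp (Cmod k)).
    { destruct (Rle_lt_or_eq_dec (Cmod k * Cmod h) (Cmod k) ltac:(nra)) as [e|e]; [left; apply exp_increasing; auto|rewrite e; lra]. }
    replace (Cmod k ^ 3 * exp (Cmod k) * Cmod h ^ 3) with (Cmod k ^ 3 * Cmod h ^ 3 * exp (Cmod k)) by ring.
    apply Rmult_le_compat_l; auto. apply Rmult_le_pos; apply pow_le; auto.
Qed.

Lemma exp_INR_mult n x : exp (INR n * x) = exp x ^ n.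
Proof.
  induction n as [|n IH]; [simpl; rewrite Rmult_0_l; apply exp_0|].
  rewrite S_INR, Rmult_plus_distr_r, exp_plus, IH, Rmult_1_l. simpl. ring.
Qed.

(** Each factor e^{n x} with x = 2 pi i h is expanded to second order, with error at most (n|x|)^3
    e^{n|x|}. Geometric decay of the terms at z pays for n^3 and, for small h, for the
    exponential. *)
Lemma qseries_T2 (a : nat -> C) (f : C -> C) :
  (forall z, in_H z -> Csums (fun n => a n * eu z ^ n)%C (f z)) -> forall z, in_H z -> T2at f z.
Proof.
  intros Hf z Hz. assert (Hzi := Hz). unfold in_H in Hzi. pose proof PI_RGT_0 as HPI.
  (* The terms of the series at half the height are bounded, which at z itself gives the decay t^n
     with t = e^{-pi y}. *)
  set (y := Im z) in *. set (u := eu z). set (z' := (z - RtoC (y / 2) * Ci)%C).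
  assert (Hz' : Im z' = y / 2) by (unfold z', y; destruct z; simpl; field).
  assert (HzH' : in_H z') by (unfold in_H; rewrite Hz'; lra).
  destruct (CLim_bounded _ _ (Csums_term0 _ _ (Hf z' HzH'))) as [B [HB0 HB]].
  set (t := exp (- (PI * y))).
  assert (Ht : 0 < t < 1) by (unfold t; split; [apply exp_pos|]; rewrite <- exp_0; apply exp_increasing; nra).
  assert (Hut : forall n, Cmod (a n * u ^ n)%C <= B * t ^ n).
  { intros n. specialize (HB n). rewrite !Cmod_mult, !Cmod_pow in *.
    replace (Cmod u) with (Cmod (eu z') * t).
    - rewrite Rpow_mult_distr, <- Rmult_assoc. apply Rmult_le_compat_r; [apply pow_le; lra|auto].
    - unfold u, t. rewrite !Cmod_eu, <- exp_plus. f_equal. rewrite Hz'. fold y. field. }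
  set (b := fun n => (a n * u ^ n)%C) in *.
  set (t1 := (t + 1) / 2). set (t2 := (t1 + 1) / 2).
  destruct (pow_geom 3 t1 t2 ltac:(unfold t2, t1; lra)) as [C3 [C30 HC3]].
  assert (Hmom : forall e, exists l, Csums (fun n => RtoC (INR n ^ e) * b n)%C l).
  { intros e. destruct (pow_geom e t t1 ltac:(unfold t1; lra)) as [Ce [Ce0 HCe]].
    apply Csums_exists with (b := fun n => B * Ce * t1 ^ n) (B := B * Ce / (1 - t1)).
    - intros n. rewrite Cmod_mult, Cmod_R, Rabs_right by (apply Rle_ge, pow_le, pos_INR).
      apply Rle_trans with (INR n ^ e * (B * t ^ n)); [apply Rmult_le_compat_l; [apply pow_le, pos_INR|apply Hut]|].
      specialize (HCe n). replace (INR n ^ e * (B * t ^ n)) with (B * (INR n ^ e * t ^ n)) by ring.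
      rewrite Rmult_assoc. apply Rmult_le_compat_l; auto.
    - intros n. apply Rsum_geom_bound; [apply Rmult_le_pos; auto|unfold t1; lra]. }
  destruct (Hmom 0%nat) as [M0 H0]. destruct (Hmom 1%nat) as [M1 H1]. destruct (Hmom 2%nat) as [M2 H2].
  set (k := (RtoC (2 * PI) * Ci)%C).
  assert (Hk : Cmod k = 2 * PI) by (unfold k; rewrite Cmod_mult, Cmod_R, Cmod_Ci, Rabs_right; lra).
  (* For |x| <= xi the product t e^{|x|} is at most t1 < 1. *)
  set (xi := ln (t1 / t)).
  assert (Hxi : 0 < xi).
  { unfold xi. rewrite <- ln_1. apply ln_increasing; [lra|]. apply Rmult_lt_reg_r with t; [lra|].
    unfold Rdiv. rewrite Rmult_assoc, Rinv_l by lra. unfold t1. lra. }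
  assert (Hexi : exp xi = t1 / t) by (apply exp_ln; apply Rdiv_lt_0_compat; unfold t1; lra).
  exists M0, (M1 * k)%C, (M2 * (k * k / 2))%C.
  exists (B * C3 / (1 - t2) * (2 * PI) ^ 3), (Rmin (y / 2) (xi / (2 * PI))).
  repeat split.
  - apply Rmult_le_pos; [|apply pow_le; lra]. apply Rmult_le_pos; [apply Rmult_le_pos; auto|].
    left. apply Rinv_0_lt_compat. unfold t2, t1. lra.
  - apply Rmin_pos; [lra|apply Rdiv_lt_0_compat; lra].
  - intros h Hh. pose proof (Rmin_l (y / 2) (xi / (2 * PI))) as m1. pose proof (Rmin_r (y / 2) (xi / (2 * PI))) as m2.
    assert (HzH : in_H (z + h)%C).
    { unfold in_H. rewrite im_plus. fold y. pose proof (im_le_Cmod h). apply Rabs_le_between in H. lra. }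
    set (x := (k * h)%C).
    assert (Hx : Cmod x = 2 * PI * Cmod h) by (unfold x; rewrite Cmod_mult, Hk; auto).
    assert (Hxx : Cmod x <= xi).
    { rewrite Hx. apply Rle_trans with (2 * PI * (xi / (2 * PI))); [apply Rmult_le_compat_l; lra|right; field; lra]. }
    pose proof (Hf _ HzH) as HS.
    assert (HS' : Csums (fun n => b n * (Cexp (RtoC (INR n) * x) - 1 - RtoC (INR n) * x - (RtoC (INR n) * x) * (RtoC (INR n) * x) / 2))%C
      (f (z + h) - (M0 + M1 * k * h + M2 * (k * k / 2) * (h * h)))%C).
    { replace (f (z + h) - (M0 + M1 * k * h + M2 * (k * k / 2) * (h * h)))%C with
        (f (z + h) + (-1 * M0 + (- x * M1 + (- (x * x) / 2) * M2)))%C by (unfold x; field).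
      eapply Csums_ext; [|exact (Csums_plus _ _ _ _ HS (Csums_plus _ _ _ _ (Csums_scal (-1) _ _ H0) (Csums_plus _ _ _ _ (Csums_scal (- x)%C _ _ H1) (Csums_scal (- (x * x) / 2)%C _ _ H2))))].
      intros n. cbv beta. rewrite eu_plus, Cpow_mult_l. fold u. unfold b.
      replace (eu h ^ n)%C with (Cexp (RtoC (INR n) * x)%C).
      2:{ rewrite Cexp_INR. unfold eu, x, k. reflexivity. }
      rewrite !RtoC_pow. simpl (_ ^ 0)%C. simpl (_ ^ 1)%C. simpl (_ ^ 2)%C. field. }
    apply (Csums_bound _ _ (fun n => (B * C3 * Cmod x ^ 3) * t2 ^ n) _ HS').
    + intros n. rewrite Cmod_mult. pose proof (pos_INR n) as Hn. pose proof (Cmod_ge_0 x) as Hx0.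
      apply Rle_trans with ((B * t ^ n) * ((INR n * Cmod x) ^ 3 * (exp xi) ^ n)).
      * apply Rmult_le_compat; try apply Cmod_ge_0; [apply Hut|].
        eapply Rle_trans; [apply Cexp_taylor3|]. rewrite Cmod_mult, Cmod_R, (Rabs_right (INR n)) by lra.
        apply Rmult_le_compat_l; [apply pow_le, Rmult_le_pos; auto|].
        rewrite <- exp_INR_mult.
        assert (INR n * Cmod x <= INR n * xi) by (apply Rmult_le_compat_l; auto).
        destruct H as [e|e]; [left; apply exp_increasing; auto|rewrite e; lra].
      * rewrite Hexi. replace (B * t ^ n * ((INR n * Cmod x) ^ 3 * (t1 / t) ^ n)) with
          ((B * Cmod x ^ 3) * (INR n ^ 3 * (t * (t1 / t)) ^ n)) by (rewrite !Rpow_mult_distr; ring).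
        replace (t * (t1 / t)) with t1 by (field; lra). specialize (HC3 n).
        replace (B * C3 * Cmod x ^ 3 * t2 ^ n) with ((B * Cmod x ^ 3) * (C3 * t2 ^ n)) by ring.
        apply Rmult_le_compat_l; auto. apply Rmult_le_pos; auto. apply pow_le; auto.
    + intros n. replace (B * C3 / (1 - t2) * (2 * PI) ^ 3 * Cmod h ^ 3) with (B * C3 * Cmod x ^ 3 / (1 - t2)).
      * apply Rsum_geom_bound; [|unfold t2, t1; lra]. apply Rmult_le_pos; [apply Rmult_le_pos; auto|apply pow_le, Cmod_ge_0].
      * rewrite Hx, Rpow_mult_distr. unfold Rdiv. ring.
Qed.

Lemma E4_T2 z : in_H z -> T2at E4 z.
Proof. apply qseries_T2 with (a := fun n => RtoC (e4 n)). apply E4_facts. Qed.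

Lemma E6_T2 z : in_H z -> T2at E6 z.
Proof. apply qseries_T2 with (a := fun n => RtoC (e6 n)). apply E6_facts. Qed.

Lemma Delta_T2 z : in_H z -> T2at Delta z.
Proof.
  intros H. apply T2at_ext with (f := fun w => ((E4 w ^ 3 + RtoC (-1) * E6 w ^ 2) * (/ 1728))%C).
  - exists 1. split; [lra|]. intros h _. unfold Delta, Cdiv. ring.
  - apply (T2at_mult (fun w => (E4 w ^ 3 + RtoC (-1) * E6 w ^ 2)%C) (fun _ => (/ 1728)%C)); [|apply T2at_const].
    apply T2at_plus; [apply T2at_pow, E4_T2; auto|].
    apply (T2at_mult (fun _ => RtoC (-1)) (fun w => (E6 w ^ 2)%C)); [apply T2at_const|apply T2at_pow, E6_T2; auto].
Qed.

(** * Compactness and the maximum principle *)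

Lemma BW_subseq (u : nat -> R) a b : (forall n, a <= u n <= b) ->
  exists l phi, a <= l <= b /\ forall n, (n <= phi n)%nat /\ Rabs (u (phi n) - l) < / INR (S n).
Proof.
  intros Hu. destruct (Bolzano_Weierstrass u (fun c => a <= c <= b) (compact_P3 a b) Hu) as [l Hl].
  assert (H : forall n, exists p, (n <= p)%nat /\ Rabs (u p - l) < / INR (S n)).
  { intros n. assert (Hp : 0 < / INR (S n)) by (apply Rinv_0_lt_compat, lt_0_INR; lia).
    destruct (Hl (fun x => Rabs (x - l) < / INR (S n)) n) as [p Hp'].
    - exists (mkposreal _ Hp). intros x Hx. exact Hx.
    - exists p. auto. }
  destruct (functional_choice _ H) as [phi Hphi]. exists l, phi. split; [|exact Hphi].
  split; apply Rnot_lt_le; intros Hlt.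
  - destruct (archimed_cor1 (a - l) ltac:(lra)) as [N [HN HN0]]. destruct (Hphi N) as [_ H1].
    assert (/ INR (S N) <= / INR N) by (apply Rinv_le_contravar; [apply lt_0_INR; auto|apply le_INR; lia]).
    specialize (Hu (phi N)). apply Rabs_def2 in H1. lra.
  - destruct (archimed_cor1 (l - b) ltac:(lra)) as [N [HN HN0]]. destruct (Hphi N) as [_ H1].
    assert (/ INR (S N) <= / INR N) by (apply Rinv_le_contravar; [apply lt_0_INR; auto|apply le_INR; lia]).
    specialize (Hu (phi N)). apply Rabs_def2 in H1. lra.
Qed.

(** The conclusion names no supremum and so covers unbounded [f] too; boundedness on a rectangle
    then comes out of [EVT2] instead of being needed for it. *)
Lemma maximizing_seq (T : Type) (f : T -> R) (x0 : T) :
  exists s : nat -> T, forall x eps, 0 < eps -> exists N, forall n, (N <= n)%nat -> f x - eps < f (s n).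
Proof.
  destruct (classic (exists M, forall x, f x <= M)) as [[M HM]|Hunb].
  - destruct (completeness (fun r => exists x, r = f x)) as [L [HL1 HL2]].
    + exists M. intros r [x Hx]. subst. auto.
    + exists (f x0), x0. auto.
    + assert (H : forall n, exists x, L - / INR (S n) < f x).
      { intros n. apply NNPP. intros Hn. assert (Hp : 0 < / INR (S n)) by (apply Rinv_0_lt_compat, lt_0_INR; lia).
        assert (L <= L - / INR (S n)); [|lra]. apply HL2. intros r [x Hx]. subst. apply Rnot_lt_le. intros Hlt. apply Hn. exists x. auto. }
      destruct (functional_choice _ H) as [s Hs]. exists s. intros x eps He.
      destruct (archimed_cor1 eps He) as [N [HN HN0]]. exists N. intros n Hn. specialize (Hs n).
      assert (/ INR (S n) <= / INR N) by (apply Rinv_le_contravar; [apply lt_0_INR; auto|apply le_INR; lia]).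
      specialize (HL1 (f x) ltac:(exists x; auto)). lra.
  - assert (H : forall n : nat, exists x, INR n < f x).
    { intros n. apply NNPP. intros Hn. apply Hunb. exists (INR n). intros x. apply Rnot_lt_le. intros Hlt. apply Hn. exists x; auto. }
    destruct (functional_choice _ H) as [s Hs]. exists s. intros x eps He.
    destruct (INR_unbounded (f x)) as [N HN]. exists N. intros n Hn. specialize (Hs n). apply le_INR in Hn. lra.
Qed.

Lemma EVT2 (f : R -> R -> R) a b a' b' : a <= b -> a' <= b' ->
  (forall x y, a <= x <= b -> a' <= y <= b' -> forall eps, 0 < eps -> exists d, 0 < d /\
     forall x' y', a <= x' <= b -> a' <= y' <= b' -> Rabs (x' - x) < d -> Rabs (y' - y) < d -> Rabs (f x' y' - f x y) < eps) ->
  exists x0 y0, a <= x0 <= b /\ a' <= y0 <= b' /\ forall x y, a <= x <= b -> a' <= y <= b' -> f x y <= f x0 y0.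
Proof.
  intros Hab Hab' Hc.
  set (T := {p : R * R | a <= fst p <= b /\ a' <= snd p <= b'}).
  assert (t0 : T) by (exists (a, a'); simpl; lra).
  destruct (maximizing_seq T (fun t => f (fst (proj1_sig t)) (snd (proj1_sig t))) t0) as [s Hs].
  destruct (BW_subseq (fun n => fst (proj1_sig (s n))) a b) as [x0 [phi [Hx0 Hphi]]].
  { intros n. apply (proj2_sig (s n)). }
  destruct (BW_subseq (fun n => snd (proj1_sig (s (phi n)))) a' b') as [y0 [psi [Hy0 Hpsi]]].
  { intros n. apply (proj2_sig (s (phi n))). }
  exists x0, y0. split; [auto|split; auto]. intros x y Hx Hy. apply Rnot_lt_le. intros Hlt.
  set (eps := (f x y - f x0 y0) / 2). assert (He : 0 < eps) by (unfold eps; lra).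
  destruct (Hc x0 y0 Hx0 Hy0 eps He) as [d [Hd Hdd]].
  destruct (Hs (exist _ (x, y) (conj Hx Hy)) eps He) as [N HN]. simpl in HN.
  destruct (archimed_cor1 d Hd) as [N' [HN' HN0']].
  set (n := (N + N')%nat). destruct (Hpsi n) as [P1 P2]. destruct (Hphi (psi n)) as [Q1 Q2].
  specialize (HN (phi (psi n)) ltac:(unfold n in *; lia)).
  set (t := s (phi (psi n))) in *. destruct (proj2_sig t) as [T1 T2].
  assert (I1 : / INR (S n) <= / INR N') by (apply Rinv_le_contravar; [apply lt_0_INR; auto|apply le_INR; unfold n; lia]).
  assert (I2 : / INR (S (psi n)) <= / INR N') by (apply Rinv_le_contravar; [apply lt_0_INR; auto|apply le_INR; unfold n in *; lia]).
  specialize (Hdd _ _ T1 T2 ltac:(lra) ltac:(lra)). apply Rabs_def2 in Hdd. unfold eps in *. lra.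
Qed.

Lemma one_plus_exp_le u : (1 + u) * exp (- u) <= 1.
Proof.
  rewrite exp_Ropp. pose proof (exp_ineq1_le u). pose proof (exp_pos u).
  apply Rmult_le_reg_r with (exp u); auto. rewrite Rmult_assoc, Rinv_l by lra. lra.
Qed.

(** From e^u >= 1 + u + u^2/2. The quadratic deficit is what outweighs the cubic remainder in
    [no_damped_max]. *)
Lemma one_plus_exp_lt u : 0 <= u <= 1 / 2 -> (1 + u) * exp (- u) <= 1 - u ^ 2 / 4.
Proof.
  intros Hu. rewrite exp_Ropp. pose proof (exp_ge_taylor u 2 ltac:(lra)) as H. cbv [sum_f_R0] in H.
  replace (INR (fact 0)) with 1 in H by (simpl; ring). replace (INR (fact 1)) with 1 in H by (simpl; ring).
  replace (INR (fact 2)) with 2 in H by (simpl; ring). simpl pow in *.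
  assert (H1 : 1 + u + u * u / 2 <= exp u) by lra.
  apply Rmult_le_reg_r with (exp u); [apply exp_pos|]. rewrite Rmult_assoc, Rinv_l by (pose proof (exp_pos u); lra).
  rewrite Rmult_1_r. assert (H2 : 0 <= 1 - u * (u * 1) / 4) by nra.
  apply Rle_trans with ((1 - u * (u * 1) / 4) * (1 + u + u * u / 2)); [|apply Rmult_le_compat_l; auto].
  assert (0 <= u * u * (1 / 4 - u / 4 - u * u / 8)) by (apply Rmult_le_pos; nra). lra.
Qed.

Lemma pow6_le x : 0 <= x <= 1 -> x ^ 6 <= x.
Proof. intros H. simpl. assert (x * (x * (x * (x * (x * 1)))) <= 1); [|nra]. 
  assert (x ^ 5 <= 1 ^ 5) by (apply pow_incr; auto). simpl in H0. lra. Qed.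

(* A function holomorphic to second order has discrete Laplacian of size O(r^3), so the damping
   ((1+u) e^{-u})^6 = 1 - O(u^2) in the vertical direction is incompatible with |K(0)| being maximal. *)
Lemma no_damped_max K y0 : 0 < y0 -> T2at K 0 -> K 0 <> RtoC 0 ->
  (exists d, 0 < d /\ forall t, Cmod t < d -> Cmod (K t) <= Cmod (K 0) * ((1 + Im t / y0) * exp (- (Im t / y0))) ^ 6) -> False.
Proof.
  intros Hy [k0 [k1 [k2 HT]]] HK0 [d [Hd Hb]].
  pose proof (T2_val _ _ _ _ _ HT) as Ev. destruct HT as [C0 [d' [HC0 [Hd' HT]]]].
  set (kp := Cmod (K 0)) in *. assert (Hkp : 0 < kp) by (apply Cmod_gt_0; auto).
  (* The last entry makes 16 C0 r y0^2 smaller than kp, so the loss kp r^2/(4 y0^2) at the upper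
     point exceeds the four remainders C0 r^3. *)
  set (r := Rmin (Rmin d d' / 2) (Rmin (y0 / 2) (kp / (y0 ^ 2 * (16 * (C0 + 1)) + 1)))).
  assert (Hy2 : 0 < y0 ^ 2) by (apply pow_lt; auto).
  assert (HB : 0 < y0 ^ 2 * (16 * (C0 + 1)) + 1) by nra.
  assert (Hr : 0 < r).
  { unfold r. repeat apply Rmin_pos; try lra. apply Rmult_lt_0_compat; [apply Rmin_pos; auto|lra]. apply Rdiv_lt_0_compat; auto. }
  assert (Hr1 : r <= Rmin d d' / 2) by apply Rmin_l.
  assert (Hr2 : r <= y0 / 2) by (eapply Rle_trans; [apply Rmin_r|apply Rmin_l]).
  assert (Hr3 : r <= kp / (y0 ^ 2 * (16 * (C0 + 1)) + 1)) by (eapply Rle_trans; [apply Rmin_r|apply Rmin_r]).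
  pose proof (Rmin_l d d'). pose proof (Rmin_r d d'). 
  assert (Hrd : r < d /\ r < d') by lra.
  assert (Ht : forall t, Cmod t = r -> Cmod (K t - (k0 + k1 * t + k2 * (t * t)))%C <= C0 * r ^ 3).
  { intros t Et. specialize (HT t ltac:(rewrite Et; lra)). rewrite Et, Cplus_0_l in HT. auto. }
  assert (HKu : forall t, Cmod t = r -> Cmod (K t) <= kp * ((1 + Im t / y0) * exp (- (Im t / y0)))).
  { intros t Et. eapply Rle_trans; [apply Hb; rewrite Et; lra|]. apply Rmult_le_compat_l; [lra|]. apply pow6_le.
    split; [|apply one_plus_exp_le]. apply Rmult_le_pos; [|left; apply exp_pos].
    pose proof (im_le_Cmod t) as Hi. rewrite Et in Hi. apply Rabs_le_between in Hi.
    assert (-1 <= Im t / y0); [|lra]. apply Rmult_le_reg_r with y0; auto. unfold Rdiv. rewrite Rmult_assoc, Rinv_l by lra. lra. }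
  assert (HK1 : forall t, Cmod t = r -> Cmod (K t) <= kp).
  { intros t Et. eapply Rle_trans; [apply HKu; auto|]. rewrite <- (Rmult_1_r kp) at 2.
    apply Rmult_le_compat_l; [lra|]. apply one_plus_exp_le. }
  assert (m1 : Cmod r = r) by (rewrite Cmod_R, Rabs_right; lra).
  assert (m2 : Cmod (- r)%C = r) by (rewrite Cmod_opp; auto).
  assert (m3 : Cmod (r * Ci)%C = r) by (rewrite Cmod_mult, Cmod_Ci, m1; ring).
  assert (m4 : Cmod (- (r * Ci))%C = r) by (rewrite Cmod_opp; auto).
  pose proof (Ht _ m1) as t1. pose proof (Ht _ m2) as t2. pose proof (Ht _ m3) as t3. pose proof (Ht _ m4) as t4.
  pose proof (HK1 _ m1) as u1. pose proof (HK1 _ m2) as u2. pose proof (HK1 _ m4) as u4.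
  assert (u3 : Cmod (K (r * Ci)%C) <= kp * (1 - (r / y0) ^ 2 / 4)).
  { eapply Rle_trans; [apply HKu; auto|]. apply Rmult_le_compat_l; [lra|].
    replace (Im (r * Ci)%C) with r by (simpl; ring). apply one_plus_exp_lt. split.
    - apply Rmult_le_pos; [lra|]. left. apply Rinv_0_lt_compat; auto.
    - apply Rmult_le_reg_r with y0; auto. unfold Rdiv at 1. rewrite Rmult_assoc, Rinv_l by lra. lra. }
  (* Over the points r, -r, ir, -ir the linear terms cancel, and so do the quadratic ones because
     (ir)^2 = -r^2. *)
  assert (E : (4 * k0 = (K r + K (- r) + K (r * Ci) + K (- (r * Ci))) -
    ((K r - (k0 + k1 * r + k2 * (r * r))) + (K (- r) - (k0 + k1 * - r + k2 * (- r * - r))) +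
     (K (r * Ci) - (k0 + k1 * (r * Ci) + k2 * ((r * Ci) * (r * Ci)))) + (K (- (r * Ci)) - (k0 + k1 * (- (r * Ci)) + k2 * ((- (r * Ci)) * (- (r * Ci)))))))%C).
  { replace ((r * Ci) * (r * Ci))%C with (r * r * (Ci * Ci))%C by ring.
    replace ((- (r * Ci)) * (- (r * Ci)))%C with (r * r * (Ci * Ci))%C by ring. rewrite Ci_sq. ring. }
  apply (f_equal Cmod) in E. rewrite Cmod_mult, Cmod_R, Rabs_right in E by lra.
  assert (E1 : 4 * kp <= (kp + kp + kp * (1 - (r / y0) ^ 2 / 4) + kp) + (C0 * r ^ 3 + C0 * r ^ 3 + C0 * r ^ 3 + C0 * r ^ 3)).
  { unfold kp at 1. rewrite Ev, E. eapply Rle_trans; [apply Cmod_tri2|].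
    apply Rplus_le_compat; repeat apply Cmod_add_le; auto. }
  replace ((r / y0) ^ 2) with (r ^ 2 / y0 ^ 2) in E1 by (field; lra).
  assert (E2 : kp * (r ^ 2 / y0 ^ 2) <= 16 * C0 * r ^ 3) by lra.
  assert (Hr2p : 0 < r ^ 2) by (apply pow_lt; auto).
  assert (E3 : kp <= 16 * C0 * r * y0 ^ 2).
  { apply Rmult_le_reg_r with (r ^ 2 / y0 ^ 2); [apply Rdiv_lt_0_compat; auto|].
    replace (16 * C0 * r * y0 ^ 2 * (r ^ 2 / y0 ^ 2)) with (16 * C0 * r ^ 3) by (field; lra). auto. }
  apply Rmult_le_compat_r with (r := y0 ^ 2 * (16 * (C0 + 1)) + 1) in Hr3; [|lra].
  replace (kp / (y0 ^ 2 * (16 * (C0 + 1)) + 1) * (y0 ^ 2 * (16 * (C0 + 1)) + 1)) with kp in Hr3 by (field; lra).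
  assert (0 < r * y0 ^ 2) by (apply Rmult_lt_0_compat; auto). nra.
Qed.

Theorem liouville (h : C -> C) :
  (forall z, in_H z -> T2at h z) -> (forall z, in_H z -> h (z + 1)%C = h z) -> (forall z, in_H z -> h (- / z)%C = h z) ->
  (exists C0 Y, forall z, Y <= Im z -> in_H z -> Cmod (h z) <= C0 * Cmod (eu z)) ->
  forall z, in_H z -> h z = RtoC 0.
Proof.
  intros HT2 HT HS [C0 [Y Hdec]].
  assert (HinT : forall z, in_H z -> in_H (z + 1)%C) by (intros z Hz; unfold in_H in *; destruct z; simpl in *; lra).
  assert (HinT' : forall z, in_H z -> in_H (z - 1)%C) by (intros z Hz; unfold in_H in *; destruct z; simpl in *; lra).
  apply NNPP. intros Hcontra.
  assert (Hex : exists z1, in_H z1 /\ 0.86 <= Im z1 /\ Rabs (Re z1) <= 1 / 2 /\ h z1 <> RtoC 0).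
  { apply NNPP. intros Hn. apply Hcontra. assert (G : forall z, in_H z -> in_H z -> h z = RtoC 0); [|auto].
    apply (modular_reduction (fun z => in_H z -> h z = RtoC 0)).
    - intros z Hz H _. rewrite <- HT by auto. auto.
    - intros z Hz H _. rewrite <- (HT (z - 1)%C) in H by auto. replace (z - 1 + 1)%C with z in H by ring. auto.
    - intros z Hz H _. rewrite <- HS by auto. apply H. apply in_H_S; auto.
    - intros z H1 H2 Hz. apply NNPP. intros Hz0. apply Hn. exists z. auto. }
  destruct Hex as [z1 [Hz1 [Hi1 [Hr1 Hne1]]]].
  (* |Delta| y^6 is invariant because Delta has weight 12, and squaring h makes the quotient O(|q|)
     at the cusp although Delta vanishes there to first order. *)
  set (psi := fun z => Cmod (h z) ^ 2 / (Cmod (Delta z) * Im z ^ 6)).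
  assert (HDp : forall z, in_H z -> 0 < Cmod (Delta z) * Im z ^ 6).
  { intros z Hz. apply Rmult_lt_0_compat; [apply Cmod_gt_0, Delta_neq0; auto|apply pow_lt; auto]. }
  assert (Hmu : 0 < psi z1).
  { apply Rdiv_lt_0_compat; [|apply HDp; auto]. apply pow_lt, Cmod_gt_0. auto. }
  assert (HpsiT : forall z, in_H z -> psi (z + 1)%C = psi z).
  { intros z Hz. unfold psi. rewrite HT, Delta_T by auto. do 3 f_equal. destruct z; simpl; ring. }
  assert (HpsiS : forall z, in_H z -> psi (- / z)%C = psi z).
  { intros z Hz. unfold psi. rewrite HS, Delta_S, Im_Sz, Cmod_mult, Cmod_pow by auto. f_equal.
    assert (0 < Cmod z) by (apply Cmod_gt_0, in_H_neq0; auto). field. lra. }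
  assert (HY2 : exists Y2, Im z1 <= Y2 /\ 1 <= Y2 /\ forall z, Y2 <= Im z -> in_H z -> psi z < psi z1).
  { pose proof PI_lower.
    assert (HE : 0 <= 10 * C0 ^ 2 / psi z1).
    { apply Rmult_le_pos; [pose proof (pow2_ge_0 C0); lra|left; apply Rinv_0_lt_compat; auto]. }
    exists (Rmax (Rmax (Im z1) 1) (Rmax Y (10 * C0 ^ 2 / psi z1))).
    pose proof (Rmax_l (Rmax (Im z1) 1) (Rmax Y (10 * C0 ^ 2 / psi z1))).
    pose proof (Rmax_r (Rmax (Im z1) 1) (Rmax Y (10 * C0 ^ 2 / psi z1))).
    pose proof (Rmax_l (Im z1) 1). pose proof (Rmax_r (Im z1) 1). pose proof (Rmax_l Y (10 * C0 ^ 2 / psi z1)).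
    pose proof (Rmax_r Y (10 * C0 ^ 2 / psi z1)). split; [lra|]. split; [lra|]. intros z Hz HzH.
    destruct (Delta_high z ltac:(lra) HzH) as [D1 _]. specialize (Hdec z ltac:(lra) HzH).
    assert (Hq : 0 < Cmod (eu z)) by apply Cmod_gt_0, eu_neq0.
    assert (Hy1 : 1 <= Im z ^ 6) by (apply pow_R1_Rle; lra).
    assert (P1 : Cmod (h z) ^ 2 <= C0 ^ 2 * Cmod (eu z) ^ 2).
    { rewrite <- Rpow_mult_distr. apply pow_incr. split; [apply Cmod_ge_0|auto]. }
    assert (P2 : 0.1 * Cmod (eu z) <= Cmod (Delta z) * Im z ^ 6) by (pose proof (Cmod_ge_0 (Delta z)); nra).
    assert (P3 : psi z <= 10 * C0 ^ 2 * Cmod (eu z)).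
    { unfold psi. apply Rmult_le_reg_r with (Cmod (Delta z) * Im z ^ 6); [apply HDp; auto|].
      unfold Rdiv. rewrite Rmult_assoc, Rinv_l, Rmult_1_r by (pose proof (HDp z HzH); lra).
      eapply Rle_trans; [exact P1|]. pose proof (pow2_ge_0 C0).
      apply Rle_trans with (10 * C0 ^ 2 * Cmod (eu z) * (0.1 * Cmod (eu z))); [right; simpl; lra|].
      apply Rmult_le_compat_l; auto. apply Rmult_le_pos; lra. }
    eapply Rle_lt_trans; [exact P3|]. rewrite Cmod_eu. replace (- (2 * PI) * Im z) with (- (2 * PI * Im z)) by ring.
    rewrite exp_Ropp. pose proof (exp_ineq1_le (2 * PI * Im z)).
    assert (Hb : 10 * C0 ^ 2 / psi z1 < exp (2 * PI * Im z)) by nra.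
    pose proof (exp_pos (2 * PI * Im z)).
    apply Rmult_lt_compat_r with (r := psi z1) in Hb; auto.
    replace (10 * C0 ^ 2 / psi z1 * psi z1) with (10 * C0 ^ 2) in Hb by (field; lra).
    apply Rmult_lt_reg_r with (exp (2 * PI * Im z)); auto. rewrite Rmult_assoc, Rinv_l by lra. lra. }
  destruct HY2 as [Y2 [HY2a [HY2b HY2]]].
  assert (Hcont : forall z, in_H z -> forall eps, 0 < eps -> exists d, 0 < d /\ forall w, in_H w -> Cmod (w - z) < d -> Rabs (psi w - psi z) < eps).
  { intros z Hz eps He.
    set (G := fun w => (h w * h w * / Delta w)%C).
    assert (HG : T2at G z).
    { apply (T2at_mult (fun w => h w * h w)%C (fun w => / Delta w)%C); [apply T2at_mult; auto|].
      apply T2at_inv; [apply Delta_T2; auto|apply Delta_neq0; auto]. }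
    assert (HGm : forall w, in_H w -> psi w = Cmod (G w) * / Im w ^ 6).
    { intros w Hw. unfold psi, G. rewrite !Cmod_mult, Cmod_inv by (apply Delta_neq0; auto). unfold Rdiv. rewrite Rinv_mult. ring. }
    assert (Hlim : is_lim_seq (fun n => 0) 0) by apply is_lim_seq_const.
    set (y := Im z). assert (Hy : 0 < y) by exact Hz.
    assert (Hci : continuity_pt (fun s => / s ^ 6) y).
    { apply continuity_pt_inv; [apply derivable_continuous_pt, derivable_pt_pow|]. assert (0 < y ^ 6) by (apply pow_lt; auto). lra. }
    set (B := Cmod (G z) + 1). set (B2 := / y ^ 6 + 1).
    assert (HB2 : 1 < B2) by (unfold B2; assert (0 < / y ^ 6) by (apply Rinv_0_lt_compat, pow_lt; auto); lra).
    assert (HBp : 1 <= B) by (unfold B; pose proof (Cmod_ge_0 (G z)); lra).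
    destruct (T2_cont G z HG (Rmin 1 (eps / (2 * B2)))) as [d1 [Hd1 H1]].
    { apply Rmin_pos; [lra|]. apply Rdiv_lt_0_compat; lra. }
    destruct (Hci (Rmin 1 (eps / (2 * B)))) as [d2 [Hd2 H2]].
    { apply Rmin_pos; [lra|]. apply Rdiv_lt_0_compat; lra. }
    exists (Rmin d1 d2). split; [apply Rmin_pos; auto|]. intros w Hw Hwd.
    pose proof (Rmin_l d1 d2). pose proof (Rmin_r d1 d2).
    specialize (H1 (w - z)%C ltac:(lra)). replace (z + (w - z))%C with w in H1 by ring.
    assert (H2' : Rabs (/ Im w ^ 6 - / y ^ 6) < Rmin 1 (eps / (2 * B))).
    { destruct (Req_dec (Im w) y) as [e|e].
      - rewrite e. rewrite Rminus_diag, Rabs_R0. apply Rmin_pos; [lra|apply Rdiv_lt_0_compat; lra].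
      - apply (H2 (Im w)). split; [split; [exact I|auto]|]. simpl. unfold Rdist.
        replace (Im w - y) with (Im (w - z)%C) by (unfold y; destruct w, z; simpl; ring).
        eapply Rle_lt_trans; [apply im_le_Cmod|]. lra. }
    rewrite !HGm by auto. fold y.
    assert (M1 : Rabs (Cmod (G w) - Cmod (G z)) <= Cmod (G w - G z)).
    { apply Rabs_le. pose proof (Cmod_tri_inv2 (G w) (G z)). pose proof (Cmod_tri_inv2 (G z) (G w)). rewrite Cmod_minus_sym in H4. lra. }
    pose proof (Rmin_l 1 (eps / (2 * B2))). pose proof (Rmin_r 1 (eps / (2 * B2))).
    pose proof (Rmin_l 1 (eps / (2 * B))). pose proof (Rmin_r 1 (eps / (2 * B))).
    replace (Cmod (G w) * / Im w ^ 6 - Cmod (G z) * / y ^ 6) with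
      ((Cmod (G w) - Cmod (G z)) * / Im w ^ 6 + Cmod (G z) * (/ Im w ^ 6 - / y ^ 6)) by ring.
    eapply Rle_lt_trans; [apply Rabs_triang|]. rewrite !Rabs_mult, (Rabs_right (Cmod (G z))) by (apply Rle_ge, Cmod_ge_0).
    assert (Hiw : Rabs (/ Im w ^ 6) <= B2).
    { unfold B2. replace (/ Im w ^ 6) with (/ y ^ 6 + (/ Im w ^ 6 - / y ^ 6)) by ring.
      eapply Rle_trans; [apply Rabs_triang|]. rewrite (Rabs_right (/ y ^ 6)); [lra|].
      apply Rle_ge. left. apply Rinv_0_lt_compat, pow_lt; auto. }
    assert (S1 : Rabs (Cmod (G w) - Cmod (G z)) * Rabs (/ Im w ^ 6) < eps / 2).
    { apply Rle_lt_trans with (Rabs (Cmod (G w) - Cmod (G z)) * B2); [apply Rmult_le_compat_l; [apply Rabs_pos|auto]|].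
      apply Rlt_le_trans with (eps / (2 * B2) * B2); [apply Rmult_lt_compat_r; lra|right; field; lra]. }
    assert (S2 : Cmod (G z) * Rabs (/ Im w ^ 6 - / y ^ 6) <= eps / 2).
    { apply Rle_trans with (B * (eps / (2 * B))); [|right; field; lra].
      apply Rmult_le_compat; [apply Cmod_ge_0|apply Rabs_pos|unfold B; lra|lra]. }
    lra. }
  destruct (EVT2 (fun x y => psi (x, y)) (- (1 / 2)) (1 / 2) 0.86 Y2) as [x0 [y0 [Hx0 [Hy0 Hmax]]]]; try lra.
  { intros x y Hx Hy eps He. destruct (Hcont (x, y) ltac:(unfold in_H; simpl; lra) eps He) as [d [Hd H]].
    exists (d / 2). split; [lra|]. intros x' y' Hx' Hy' D1 D2. apply H; [unfold in_H; simpl; lra|].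
    eapply Rle_lt_trans; [apply Cmod_le_sum|]. simpl. unfold Rminus in *. lra. }
  set (t0 := (x0, y0) : C) in *. assert (Ht0 : in_H t0) by (unfold in_H, t0; simpl; lra).
  assert (Hge : psi z1 <= psi t0).
  { destruct z1 as [a b]. simpl in *. apply Rabs_le_between in Hr1. apply Hmax; lra. }
  (* Every point reduces to the strip; there [HY2] covers the heights above Y2 and the maximum over
     the rectangle covers the rest. *)
  assert (Hglob : forall z, in_H z -> psi z <= psi t0).
  { assert (G : forall z, in_H z -> in_H z -> psi z <= psi t0); [|auto].
    apply (modular_reduction (fun z => in_H z -> psi z <= psi t0)).
    - intros z Hz H _. rewrite <- HpsiT by auto. auto.
    - intros z Hz H _. rewrite <- (HpsiT (z - 1)%C) in H by auto. replace (z - 1 + 1)%C with z in H by ring. auto.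
    - intros z Hz H _. rewrite <- HpsiS by auto. apply H. apply in_H_S; auto.
    - intros z H1 H2 Hz. destruct (Rle_lt_dec (Im z) Y2) as [e|e].
      + destruct z as [a b]. simpl in *. apply Rabs_le_between in H2. apply Hmax; lra.
      + specialize (HY2 z ltac:(lra) Hz). lra. }
  (* The exponential has modulus e^{-6 Im t/y0} and cancels the first-order growth of (y0 + Im t)^6,
     which leaves the damping ((1 + u) e^{-u})^6 with u = Im t/y0. *)
  set (K := fun t => (h (t0 + t) * h (t0 + t) * / Delta (t0 + t) * Cexp (RtoC (6 / y0) * Ci * t))%C).
  assert (Hshift : forall f, T2at f t0 -> T2at (fun t => f (t0 + t)%C) 0).
  { intros f [a [b [c H]]]. exists a, b, c. eapply O3_ext; [|exact H]. intros t. cbv beta. rewrite Cplus_0_l. reflexivity. }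
  assert (HKm : forall t, in_H (t0 + t)%C -> Cmod (K t) = psi (t0 + t)%C * (y0 + Im t) ^ 6 * exp (- (6 * (Im t / y0)))).
  { intros t Ht. unfold K, psi. rewrite !Cmod_mult, Cmod_inv, Cmod_Cexp by (apply Delta_neq0; auto).
    replace (Re ((6 / y0)%R * Ci * t)%C) with (- (6 * (Im t / y0))) by (destruct t; simpl; field; lra).
    replace (Im (t0 + t)%C) with (y0 + Im t) by (unfold t0; destruct t; simpl; ring).
    assert (Hpos : 0 < y0 + Im t) by (unfold in_H, t0 in Ht; destruct t; simpl in *; lra).
    pose proof (proj1 (Cmod_gt_0 _) (Delta_neq0 _ Ht)). field. split; lra. }
  assert (HK0m : Cmod (K 0) = psi t0 * y0 ^ 6).
  { rewrite HKm; replace (t0 + 0)%C with t0 by ring; auto. replace (Im 0) with 0 by reflexivity.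
    rewrite Rplus_0_r. unfold Rdiv. rewrite Rmult_0_l, Rmult_0_r, Ropp_0, exp_0. ring. }
  assert (Hy6 : 0 < y0 ^ 6) by (apply pow_lt; lra).
  apply (no_damped_max K y0); [lra| | |].
  - unfold K. apply (T2at_mult (fun t => h (t0 + t) * h (t0 + t) * / Delta (t0 + t))%C (fun t => Cexp ((6 / y0)%R * Ci * t)%C)); [|apply T2at_Cexp].
    apply (Hshift (fun z => h z * h z * / Delta z)%C).
    apply (T2at_mult (fun w => h w * h w)%C (fun w => / Delta w)%C); [apply T2at_mult; auto|].
    apply T2at_inv; [apply Delta_T2; auto|apply Delta_neq0; auto].
  - apply Cmod_gt_0. rewrite HK0m. apply Rmult_lt_0_compat; lra.
  - exists y0. split; [lra|]. intros t Ht.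
    assert (Hti : in_H (t0 + t)%C).
    { unfold in_H, t0. pose proof (im_le_Cmod t) as Hi. apply Rabs_le_between in Hi. destruct t; simpl in *; lra. }
    rewrite HKm, HK0m by auto.
    replace (- (6 * (Im t / y0))) with (INR 6 * (- (Im t / y0))) by (simpl INR; ring). rewrite exp_INR_mult.
    replace (psi t0 * y0 ^ 6 * ((1 + Im t / y0) * exp (- (Im t / y0))) ^ 6) with
      (psi t0 * (y0 + Im t) ^ 6 * exp (- (Im t / y0)) ^ 6).
    2:{ rewrite Rpow_mult_distr. replace (1 + Im t / y0) with ((y0 + Im t) / y0) by (field; lra).
        unfold Rdiv. rewrite Rpow_mult_distr, pow_inv. field. lra. }
    apply Rmult_le_compat_r; [apply pow_le; left; apply exp_pos|].
    apply Rmult_le_compat_r; [|apply Hglob; auto]. apply pow_le.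
    unfold in_H, t0 in Hti. destruct t; simpl in *; lra.
Qed.

(** * Formal power series and expansions at the cusp *)

Definition PS := nat -> C.
Definition psc (c : C) : PS := fun n => match n with O => c | _ => RtoC 0 end.
Definition psX : PS := fun n => match n with 1%nat => RtoC 1 | _ => RtoC 0 end.
Definition psadd (a b : PS) : PS := fun n => (a n + b n)%C.
Definition psopp (a : PS) : PS := fun n => (- a n)%C.
Definition pssub (a b : PS) : PS := fun n => (a n - b n)%C.
Definition psmul (a b : PS) : PS := fun n => Csum (fun i => a i * b (n - i)%nat)%C (S n).
Fixpoint pspow (a : PS) (n : nat) : PS := match n with O => psc 1 | S p => psmul a (pspow a p) end.
Definition psshift (a : PS) : PS := fun n => a (S n).

Lemma Csum_triangle (F : nat -> nat -> C) N :
  Csum (fun i => Csum (F i) (S i)) N = Csum (fun j => Csum (fun l => F (j + l)%nat j) (N - j)) N.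
Proof.
  induction N as [|N IH]; [reflexivity|].
  rewrite Csum_S, IH, (Csum_S (fun j => Csum (fun l => F (j + l)%nat j) (S N - j))).
  replace (S N - N)%nat with 1%nat by lia.
  rewrite (Csum_ext (fun j => Csum (fun l => F (j + l)%nat j) (S N - j)) (fun j => Csum (fun l => F (j + l)%nat j) (N - j) + F N j)%C).
  2:{ intros i Hi. replace (S N - i)%nat with (S (N - i)) by lia. rewrite Csum_S. do 2 f_equal. lia. }
  rewrite Csum_plus, Csum_S. simpl (Csum _ 1). rewrite Nat.add_0_r. ring.
Qed.

Lemma psmul_comm a b : psmul a b = psmul b a.
Proof.
  apply functional_extensionality. intros n. unfold psmul. rewrite Csum_rev. apply Csum_ext. intros i Hi.
  replace (S n - 1 - i)%nat with (n - i)%nat by lia. replace (n - (n - i))%nat with i by lia. ring.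
Qed.

Lemma psmul_assoc a b c : psmul a (psmul b c) = psmul (psmul a b) c.
Proof.
  apply functional_extensionality. intros n. unfold psmul. symmetry.
  rewrite (Csum_ext _ (fun i => Csum (fun j => a j * b (i - j)%nat * c (n - i)%nat)%C (S i))).
  2:{ intros i _. rewrite <- Csum_scal_r. reflexivity. }
  rewrite (Csum_triangle (fun i j => a j * b (i - j)%nat * c (n - i)%nat)%C). apply Csum_ext. intros j Hj.
  rewrite <- Csum_scal. replace (S n - j)%nat with (S (n - j)) by lia. apply Csum_ext. intros l Hl.
  replace (j + l - j)%nat with l by lia. replace (n - (j + l))%nat with (n - j - l)%nat by lia. ring.
Qed.

Lemma psmul_1_l a : psmul (psc 1) a = a.
Proof.
  apply functional_extensionality. intros n. unfold psmul. rewrite Csum_Sl, Csum_zero.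
  - simpl. rewrite Nat.sub_0_r. ring.
  - intros i _. simpl. ring.
Qed.

Lemma ps_ring_theory : ring_theory (psc 0) (psc 1) psadd psmul pssub psopp eq.
Proof.
  constructor; intros; try (apply functional_extensionality; intros n; unfold psadd, pssub, psopp, psc; simpl; try (destruct n); ring).
  - apply psmul_1_l.
  - apply psmul_comm.
  - apply psmul_assoc.
  - apply functional_extensionality. intros n. unfold psmul, psadd. rewrite <- Csum_plus. apply Csum_ext. intros; ring.
Qed.
Add Ring PSring : ps_ring_theory.

Lemma psmul_c_l c a n : psmul (psc c) a n = (c * a n)%C.
Proof.
  unfold psmul. rewrite Csum_Sl, Csum_zero.
  - simpl. rewrite Nat.sub_0_r. ring.
  - intros i _. simpl. ring.
Qed.

Lemma psmul_0 a b : psmul a b 0%nat = (a O * b O)%C.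
Proof. unfold psmul. simpl. ring. Qed.

Lemma psmul_1 a b : psmul a b 1%nat = (a O * b 1%nat + a 1%nat * b O)%C.
Proof. unfold psmul. simpl. ring. Qed.

Lemma psmul_2 a b : psmul a b 2%nat = (a O * b 2%nat + a 1%nat * b 1%nat + a 2%nat * b O)%C.
Proof. unfold psmul. simpl. ring. Qed.

Lemma psmul_X_S a n : psmul psX a (S n) = a n.
Proof.
  unfold psmul. rewrite Csum_Sl, Csum_Sl, Csum_zero.
  - simpl. rewrite Nat.sub_0_r. ring.
  - intros i _. simpl. ring.
Qed.

Lemma psmul_local a b b' n : (forall i, (i <= n)%nat -> b i = b' i) -> psmul a b n = psmul a b' n.
Proof. intros H. apply Csum_ext. intros i Hi. rewrite H by lia. reflexivity. Qed.

Lemma pspow_0 a n : a O = RtoC 1 -> pspow a n O = RtoC 1.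
Proof. intros H. induction n; simpl; [reflexivity|]. rewrite psmul_0, H, IHn. ring. Qed.

Lemma pspow_low x k m : x O = RtoC 0 -> (m < k)%nat -> pspow x k m = RtoC 0.
Proof.
  intros Hx. revert m. induction k as [|k IH]; intros m Hm; [lia|]. simpl. unfold psmul.
  apply Csum_zero. intros i Hi. destruct i; [rewrite Hx; ring|]. rewrite IH by lia. ring.
Qed.

Fixpoint pssum (f : nat -> PS) (n : nat) : PS := match n with O => psc 0 | S p => psadd (pssum f p) (f p) end.

Lemma pssum_coef f n m : pssum f n m = Csum (fun k => f k m) n.
Proof. induction n as [|n IH]; simpl; [destruct m; reflexivity|]. unfold psadd. rewrite IH. reflexivity. Qed.

Lemma ps_geom x n : psmul (pssub (psc 1) x) (pssum (pspow x) n) = pssub (psc 1) (pspow x n).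
Proof.
  induction n as [|n IH]; simpl; [ring|].
  transitivity (psadd (psmul (pssub (psc 1) x) (pssum (pspow x) n)) (psmul (pssub (psc 1) x) (pspow x n))); [ring|].
  rewrite IH. ring.
Qed.

(* Geometric series in 1 - a; an inverse only when a O = 1. *)
Definition psinv (a : PS) : PS := fun n => pssum (pspow (pssub (psc 1) a)) (S n) n.

Lemma psinv_correct (a : PS) : a O = RtoC 1 -> psmul a (psinv a) = psc 1.
Proof.
  intros Ha. set (x := pssub (psc 1) a). assert (Hx : x O = RtoC 0) by (unfold x, pssub; simpl; rewrite Ha; ring).
  assert (Ea : a = pssub (psc 1) x) by (unfold x; ring).
  apply functional_extensionality. intros n.
  rewrite (psmul_local a (psinv a) (pssum (pspow x) (S n)) n).
  - rewrite Ea at 1. rewrite ps_geom. unfold pssub. rewrite (pspow_low x (S n) n) by auto. ring.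
  (* Powers of x beyond the index contribute nothing to coefficient i, so the geometric sum of
     length S n may replace the one of length S i. *)
  - intros i Hi. unfold psinv. fold x. rewrite !pssum_coef.
    replace (S n) with (S i + (n - i))%nat by lia. rewrite (Csum_split _ (S i)).
    rewrite (Csum_zero (fun k => pspow x (S i + k) i)); [ring|]. intros k _. apply pspow_low; auto. lia.
Qed.

Lemma psinv_0 (a : PS) : a O = RtoC 1 -> psinv a O = RtoC 1.
Proof. intros Ha. pose proof (f_equal (fun s => s O) (psinv_correct a Ha)) as H. cbv beta in H. rewrite psmul_0, Ha in H. simpl in H. rewrite <- H. ring. Qed.

(* [Asy f a]: the series a is an asymptotic expansion of f in q at the cusp; nothing is asked
   about convergence. *)
Definition EvB (K : nat) (r : C -> C) : Prop :=
  exists B Y, 0 <= B /\ 0 < Y /\ forall z, Y <= Im z -> Cmod (r z) <= B * Cmod (eu z) ^ K.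

Definition Asy (f : C -> C) (a : PS) : Prop :=
  forall K, EvB K (fun z => f z - Csum (fun n => a n * eu z ^ n) K)%C.

Lemma EvB_ext K r s : (exists Y, forall z, Y <= Im z -> r z = s z) -> EvB K r -> EvB K s.
Proof.
  intros [Y E] [B [Y' [HB [HY H]]]]. exists B, (Rmax Y Y'). pose proof (Rmax_l Y Y'). pose proof (Rmax_r Y Y').
  repeat split; try lra. intros z Hz. rewrite <- E by lra. apply H. lra.
Qed.

Lemma EvB_plus K r s : EvB K r -> EvB K s -> EvB K (fun z => r z + s z)%C.
Proof.
  intros [B [Y [HB [HY H]]]] [B' [Y' [HB' [HY' H']]]]. exists (B + B'), (Rmax Y Y').
  pose proof (Rmax_l Y Y'). pose proof (Rmax_r Y Y'). repeat split; try lra. intros z Hz.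
  rewrite Rmult_plus_distr_r. apply Cmod_add_le; [apply H|apply H']; lra.
Qed.

Lemma EvB_mult K L r s : EvB K r -> EvB L s -> EvB (K + L) (fun z => r z * s z)%C.
Proof.
  intros [B [Y [HB [HY H]]]] [B' [Y' [HB' [HY' H']]]]. exists (B * B'), (Rmax Y Y').
  pose proof (Rmax_l Y Y'). pose proof (Rmax_r Y Y'). repeat split; try nra. intros z Hz.
  rewrite Cmod_mult, pow_add. replace (B * B' * (Cmod (eu z) ^ K * Cmod (eu z) ^ L)) with (B * Cmod (eu z) ^ K * (B' * Cmod (eu z) ^ L)) by ring.
  apply Rmult_le_compat; try apply Cmod_ge_0; [apply H|apply H']; lra.
Qed.

Lemma EvB_const c : EvB 0 (fun _ => c).
Proof. exists (Cmod c), 1. repeat split; try lra; [apply Cmod_ge_0|]. intros. simpl. lra. Qed.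

Lemma EvB_q n : EvB n (fun z => eu z ^ n)%C.
Proof. exists 1, 1. repeat split; try lra. intros. rewrite Cmod_pow. lra. Qed.

Lemma EvB_zero K : EvB K (fun _ => RtoC 0).
Proof. exists 0, 1. repeat split; try lra. intros. rewrite Cmod_0. lra. Qed.

Lemma EvB_Csum K (r : nat -> C -> C) n : (forall i, (i < n)%nat -> EvB K (r i)) -> EvB K (fun z => Csum (fun i => r i z) n).
Proof.
  induction n as [|n IH]; intros H; simpl; [apply EvB_zero|].
  apply (EvB_plus K (fun z => Csum (fun i => r i z) n) (r n)); [apply IH; auto|apply H; lia].
Qed.

Lemma EvB_weak K L r : (L <= K)%nat -> EvB K r -> EvB L r.
Proof.
  intros HL [B [Y [HB [HY H]]]]. exists B, Y. repeat split; auto. intros z Hz. eapply Rle_trans; [apply H; auto|].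
  apply Rmult_le_compat_l; auto. assert (Hq : Cmod (eu z) < 1) by (apply eu_lt1; unfold in_H; lra).
  pose proof (Cmod_ge_0 (eu z)). replace K with (L + (K - L))%nat by lia. rewrite pow_add.
  rewrite <- (Rmult_1_r (Cmod (eu z) ^ L)) at 2. apply Rmult_le_compat_l; [apply pow_le; auto|].
  rewrite <- (pow1 (K - L)). apply pow_incr. lra.
Qed.

Lemma Asy_bdd f a : Asy f a -> EvB 0 f.
Proof. intros H. eapply EvB_ext; [|apply (H O)]. exists 0. intros z _. simpl. ring. Qed.

Lemma Asy_ext f g a : (exists Y, forall z, Y <= Im z -> f z = g z) -> Asy f a -> Asy g a.
Proof. intros [Y E] H K. eapply EvB_ext; [|apply (H K)]. exists Y. intros z Hz. cbv beta. rewrite E; auto. Qed.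

Lemma Asy_plus f g a b : Asy f a -> Asy g b -> Asy (fun z => f z + g z)%C (psadd a b).
Proof.
  intros H H' K. eapply EvB_ext; [|apply EvB_plus; [apply (H K)|apply (H' K)]]. exists 0. intros z _. cbv beta.
  unfold psadd. rewrite (Csum_ext (fun n => (a n + b n) * eu z ^ n)%C (fun n => a n * eu z ^ n + b n * eu z ^ n)%C) by (intros; ring).
  rewrite Csum_plus. ring.
Qed.

(** The term of degree i in f is multiplied by the error of g truncated at the complementary order K
    - i, so every error is O(q^K). *)
Lemma Asy_mult f g a b : Asy f a -> Asy g b -> Asy (fun z => f z * g z)%C (psmul a b).
Proof.
  intros H H' K.
  apply EvB_ext with (r := fun z => ((f z - Csum (fun n => a n * eu z ^ n) K) * g z +
     Csum (fun i => (a i * eu z ^ i) * (g z - Csum (fun n => b n * eu z ^ n) (K - i))) K)%C).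
  - exists 0. intros z _.
    rewrite (Csum_ext (fun i => (a i * eu z ^ i) * (g z - Csum (fun n => b n * eu z ^ n) (K - i)))%C
      (fun i => (a i * eu z ^ i) * g z - Csum (fun l => a i * b l * eu z ^ (i + l)) (K - i))%C).
    2:{ intros i _. unfold Cminus. rewrite Cmult_plus_distr_l. f_equal.
        rewrite (Csum_ext (fun l => a i * b l * eu z ^ (i + l))%C (fun l => (a i * eu z ^ i) * (b l * eu z ^ l))%C); [rewrite Csum_scal; ring|].
        intros l _. rewrite Cpow_add_r. ring. }
    rewrite Csum_minus, Csum_scal_r.
    set (F := fun i j => (a j * b (i - j)%nat * eu z ^ i)%C).
    rewrite (Csum_ext (fun i => Csum (fun l => a i * b l * eu z ^ (i + l))%C (K - i)) (fun j => Csum (fun l => F (j + l)%nat j) (K - j))).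
    2:{ intros j _. apply Csum_ext. intros l _. unfold F. replace (j + l - j)%nat with l by lia. reflexivity. }
    rewrite <- Csum_triangle.
    rewrite (Csum_ext (fun n => psmul a b n * eu z ^ n)%C (fun i => Csum (F i) (S i))).
    2:{ intros i _. unfold psmul. rewrite <- Csum_scal_r. reflexivity. }
    ring.
  - apply EvB_plus.
    + replace K with (K + 0)%nat at 1 by lia. apply (EvB_mult K 0 (fun z => f z - Csum (fun n => a n * eu z ^ n) K)%C g); [apply (H K)|]. apply (Asy_bdd g b H').
    + apply (EvB_Csum K (fun i z => (a i * eu z ^ i) * (g z - Csum (fun n => b n * eu z ^ n) (K - i)))%C). intros i Hi.
      replace K with (i + (K - i))%nat at 1 by lia.
      apply (EvB_mult i (K - i) (fun z => a i * eu z ^ i)%C (fun z => g z - Csum (fun n => b n * eu z ^ n) (K - i))%C).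
      * apply (EvB_mult 0 i (fun _ => a i) (fun z => eu z ^ i)%C); [apply EvB_const|apply EvB_q].
      * apply H'.
Qed.

Lemma Asy_poly (b : PS) N : (forall n, (N <= n)%nat -> b n = RtoC 0) -> Asy (fun z => Csum (fun n => b n * eu z ^ n) N)%C b.
Proof.
  intros Hb K. destruct (Nat.le_gt_cases N K) as [h|h].
  - eapply EvB_ext; [|apply EvB_zero]. exists 0. intros z _. replace K with (N + (K - N))%nat by lia. rewrite Csum_split.
    rewrite (Csum_zero (fun i => b (N + i)%nat * eu z ^ (N + i))%C); [ring|]. intros i _. rewrite Hb by lia. ring.
  - eapply EvB_ext with (r := fun z => Csum (fun i => b (K + i)%nat * eu z ^ (K + i))%C (N - K)%nat).
    + exists 0. intros z _. replace N with (K + (N - K))%nat at 2 by lia. rewrite Csum_split. ring.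
    + apply (EvB_Csum K (fun i z => b (K + i)%nat * eu z ^ (K + i))%C). intros i _. apply EvB_weak with (0 + (K + i))%nat; [lia|].
      apply (EvB_mult 0 (K + i) (fun _ => b (K + i)%nat) (fun z => eu z ^ (K + i))%C); [apply EvB_const|apply EvB_q].
Qed.

Lemma Asy_const c : Asy (fun _ => c) (psc c).
Proof.
  eapply Asy_ext; [|apply (Asy_poly (psc c) 1)].
  - exists 0. intros z _. simpl. ring.
  - intros [|n] H; [lia|reflexivity].
Qed.

Lemma Asy_eu : Asy eu psX.
Proof.
  eapply Asy_ext; [|apply (Asy_poly psX 2)].
  - exists 0. intros z _. simpl. ring.
  - intros [|[|n]] H; try lia. reflexivity.
Qed.

Lemma Asy_pow f a n : Asy f a -> Asy (fun z => f z ^ n)%C (pspow a n).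
Proof.
  intros H. induction n as [|n IH]; simpl; [apply Asy_const|]. apply (Asy_mult f (fun z => f z ^ n)%C); auto.
Qed.

Lemma eu_small_ev eps : 0 < eps -> exists Y, 0 < Y /\ forall z, Y <= Im z -> Cmod (eu z) < eps.
Proof.
  intros He. exists (/ eps). pose proof (Rinv_0_lt_compat eps He) as Hi. split; auto. intros z Hz.
  rewrite Cmod_eu. pose proof PI_lower. replace (- (2 * PI) * Im z) with (- (2 * PI * Im z)) by ring. rewrite exp_Ropp.
  pose proof (exp_ineq1_le (2 * PI * Im z)). rewrite <- (Rinv_inv eps). apply Rinv_lt_contravar.
  - apply Rmult_lt_0_compat; [auto|apply exp_pos].
  - nra.
Qed.

Lemma Asy_lower f a : Asy f a -> a O <> RtoC 0 -> exists Y, 0 < Y /\ forall z, Y <= Im z -> Cmod (a O) / 2 <= Cmod (f z).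
Proof.
  intros H Ha. destruct (H 1%nat) as [B [Y [HB [HY Hb]]]]. assert (Hp : 0 < Cmod (a O)) by (apply Cmod_gt_0; auto).
  destruct (eu_small_ev (Cmod (a O) / (2 * (B + 1)))) as [Y' [HY' Hq]]; [apply Rdiv_lt_0_compat; lra|].
  exists (Rmax Y Y'). pose proof (Rmax_l Y Y'). pose proof (Rmax_r Y Y'). split; [lra|]. intros z Hz.
  specialize (Hb z ltac:(lra)). specialize (Hq z ltac:(lra)). simpl in Hb. rewrite Rmult_1_r in Hb.
  replace (f z - (0 + a O * 1))%C with (f z - a O)%C in Hb by ring.
  assert (B * Cmod (eu z) <= Cmod (a O) / 2).
  { apply Rle_trans with ((B + 1) * (Cmod (a O) / (2 * (B + 1)))); [|right; field; lra].
    apply Rmult_le_compat; try lra. apply Cmod_ge_0. }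
  pose proof (Cmod_tri_inv2 (a O) (f z)). rewrite Cmod_minus_sym in H3.
  pose proof (Cmod_tri_inv2 (a O) (a O - f z)). replace (a O - (a O - f z))%C with (f z) in H4 by ring.
  rewrite (Cmod_minus_sym (a O)) in H4. lra.
Qed.

(** Let P be [psinv a] cut at degree K. Then f P = 1 + O(q^K), and 1/f - P = (1 - f P)/f with 1/f
    bounded near the cusp. *)
Lemma Asy_inv f a : Asy f a -> a O = RtoC 1 -> Asy (fun z => / f z)%C (psinv a).
Proof.
  intros H Ha K. destruct (Asy_lower f a H) as [Y [HY Hl]]; [rewrite Ha; apply C1_nz|].
  rewrite Ha, Cmod_1 in Hl.
  assert (Hi : EvB 0 (fun z => / f z)%C).
  { exists 2, Y. repeat split; try lra. intros z Hz. specialize (Hl z Hz). simpl.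
    rewrite Cmod_inv by (apply Cmod_gt_0; lra). apply Rmult_le_reg_r with (Cmod (f z)); [lra|]. rewrite Rinv_l by lra. lra. }
  set (b := fun n => if (n <? K)%nat then psinv a n else RtoC 0).
  assert (Hb : Asy (fun z => Csum (fun n => b n * eu z ^ n) K)%C b).
  { apply Asy_poly. intros n Hn. unfold b. destruct (Nat.ltb_spec n K); [lia|reflexivity]. }
  pose proof (Asy_mult _ _ _ _ H Hb K) as HP.
  apply EvB_ext with (r := fun z => (/ f z * ((RtoC (-1)) * (f z * Csum (fun n => b n * eu z ^ n) K - Csum (fun n => psmul a b n * eu z ^ n) K) + (1 - Csum (fun n => psmul a b n * eu z ^ n) K)))%C).
  - exists Y. intros z Hz. specialize (Hl z Hz). assert (f z <> RtoC 0) by (apply Cmod_gt_0; lra).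
    rewrite (Csum_ext (fun n => b n * eu z ^ n)%C (fun n => psinv a n * eu z ^ n)%C).
    + field. auto.
    + intros i Hi'. unfold b. destruct (Nat.ltb_spec i K); [reflexivity|lia].
  - replace K with (0 + K)%nat at 1 by lia.
    apply (EvB_mult 0 K (fun z => / f z)%C (fun z => RtoC (-1) * (f z * Csum (fun n => b n * eu z ^ n) K - Csum (fun n => psmul a b n * eu z ^ n) K) + (1 - Csum (fun n => psmul a b n * eu z ^ n) K))%C); [exact Hi|].
    apply EvB_plus.
    + replace K with (0 + K)%nat at 1 by lia.
      apply (EvB_mult 0 K (fun _ => RtoC (-1)) (fun z => f z * Csum (fun n => b n * eu z ^ n) K - Csum (fun n => psmul a b n * eu z ^ n) K)%C); [apply EvB_const|exact HP].
    + destruct K as [|K'].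
      * simpl. eapply EvB_ext; [|apply (EvB_const 1)]. exists 0. intros. ring.
      * eapply EvB_ext; [|apply EvB_zero]. exists 0. intros z _.
        rewrite (Csum_ext _ (fun n => psc 1 n * eu z ^ n)%C).
        -- rewrite Csum_Sl, Csum_zero; [simpl; ring|]. intros; simpl; ring.
        -- intros i Hi'. rewrite <- (psinv_correct a Ha). f_equal. apply psmul_local. intros j Hj. unfold b.
           destruct (Nat.ltb_spec j (S K')); [reflexivity|lia].
Qed.

Lemma Asy_shift f a : Asy f a -> a O = RtoC 0 -> Asy (fun z => f z / eu z)%C (psshift a).
Proof.
  intros H Ha K. destruct (H (S K)) as [B [Y [HB [HY Hb]]]]. exists B, Y. repeat split; auto. intros z Hz.
  specialize (Hb z Hz). pose proof (eu_neq0 z) as Hq.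
  replace (f z / eu z - Csum (fun n => psshift a n * eu z ^ n) K)%C with ((f z - Csum (fun n => a n * eu z ^ n) (S K)) / eu z)%C.
  - rewrite Cmod_div by auto. assert (0 < Cmod (eu z)) by (apply Cmod_gt_0; auto).
    apply Rmult_le_reg_r with (Cmod (eu z)); auto. unfold Rdiv. rewrite Rmult_assoc, Rinv_l by lra. rewrite <- tech_pow_Rmult in Hb. lra.
  - rewrite Csum_Sl, Ha. unfold psshift.
    rewrite (Csum_ext (fun i => a (S i) * eu z ^ S i)%C (fun i => eu z * (a (S i) * eu z ^ i))%C) by (intros; simpl; ring).
    rewrite Csum_scal. field. auto.
Qed.

Lemma Asy_EvB1 f a : Asy f a -> a O = RtoC 0 -> EvB 1 f.
Proof. intros H Ha. eapply EvB_ext; [|apply (H 1%nat)]. exists 0. intros z _. simpl. rewrite Ha. ring. Qed.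

(** A first non-zero coefficient would be O(|q|) high up on the imaginary axis. *)
Lemma Asy_zero_unique a : Asy (fun _ => RtoC 0) a -> forall n, a n = RtoC 0.
Proof.
  intros H n. induction n as [n IH] using lt_wf_ind. apply NNPP. intros Hn.
  assert (Hp : 0 < Cmod (a n)) by (apply Cmod_gt_0; auto).
  destruct (H (S n)) as [B [Y [HB [HY Hb]]]].
  destruct (eu_small_ev (Cmod (a n) / (B + 1))) as [Y' [HY' Hq]]; [apply Rdiv_lt_0_compat; lra|].
  set (z := (RtoC (Rmax Y Y') * Ci)%C). assert (Hz : Im z = Rmax Y Y') by (unfold z; simpl; ring).
  pose proof (Rmax_l Y Y'). pose proof (Rmax_r Y Y'). specialize (Hb z ltac:(lra)). specialize (Hq z ltac:(lra)).
  rewrite Csum_S, Csum_zero in Hb by (intros i Hi; rewrite IH by auto; ring).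
  replace (0 - (0 + a n * eu z ^ n))%C with (- (a n * eu z ^ n))%C in Hb by ring.
  rewrite Cmod_opp, Cmod_mult, Cmod_pow in Hb. simpl in Hb.
  assert (Hq0 : 0 < Cmod (eu z)) by apply Cmod_gt_0, eu_neq0.
  assert (Hb' : Cmod (a n) <= B * Cmod (eu z)).
  { apply Rmult_le_reg_r with (Cmod (eu z) ^ n); [apply pow_lt; auto|]. lra. }
  apply Rmult_lt_compat_l with (r := B + 1) in Hq; [|lra].
  replace ((B + 1) * (Cmod (a n) / (B + 1))) with (Cmod (a n)) in Hq by (field; lra). lra.
Qed.

Lemma Asy_unique f a b : Asy f a -> Asy f b -> a = b.
Proof.
  intros H H'. apply functional_extensionality. intros n. apply Ceq_minus.
    assert (Hz : Asy (fun _ => RtoC 0) (psadd a (psmul (psc (-1)) b))).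
  { eapply Asy_ext; [|apply Asy_plus; [exact H|apply Asy_mult; [apply (Asy_const (-1))|exact H']]]. exists 0. intros; ring. }
  pose proof (Asy_zero_unique _ Hz n) as E. unfold psadd in E. rewrite psmul_c_l in E. rewrite <- E. ring.
Qed.

(** Positive radius of convergence, in the quantitative form that [GB_Nm] turns into norm bounds. *)
Definition GB (a : PS) : Prop := exists B R0, 0 <= B /\ 0 < R0 /\ forall n, Cmod (a n) <= B * R0 ^ n.

Lemma qseries_GB (a : PS) f : (forall z, in_H z -> Csums (fun n => a n * eu z ^ n)%C (f z)) -> GB a.
Proof.
  intros H. destruct (CLim_bounded _ _ (Csums_term0 _ _ (H Ci ltac:(unfold in_H; simpl; lra)))) as [B [HB0 HB]].
  assert (Hq : 0 < Cmod (eu Ci)) by apply Cmod_gt_0, eu_neq0.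
  exists B, (/ Cmod (eu Ci)). repeat split; auto; [apply Rinv_0_lt_compat; auto|]. intros n. specialize (HB n).
  rewrite Cmod_mult, Cmod_pow in HB. rewrite pow_inv.
  apply Rmult_le_reg_r with (Cmod (eu Ci) ^ n); [apply pow_lt; auto|].
  rewrite Rmult_assoc, Rinv_l by (apply Rgt_not_eq, pow_lt; auto). lra.
Qed.

Lemma qseries_Asy (a : PS) f : (forall z, in_H z -> Csums (fun n => a n * eu z ^ n)%C (f z)) -> Asy f a.
Proof.
  intros H K. destruct (qseries_GB a f H) as [B [R0 [HB [HR HG]]]].
  destruct (eu_small_ev (/ (2 * R0))) as [Y [HY Hq]]; [apply Rinv_0_lt_compat; lra|].
  exists (2 * B * R0 ^ K), Y. repeat split; auto.
  { apply Rmult_le_pos; [lra|apply pow_le; lra]. }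
  intros z Hz. specialize (Hq z Hz). pose proof (Cmod_ge_0 (eu z)) as Hq0.
  apply Csums_tail with (b := fun n => (B * R0 ^ K * Cmod (eu z) ^ K) * (/ 2) ^ n).
  - apply H. unfold in_H. lra.
  - intros i. rewrite Cmod_mult, Cmod_pow.
    apply Rle_trans with (B * R0 ^ (K + i) * Cmod (eu z) ^ (K + i)).
    + apply Rmult_le_compat_r; [apply pow_le; auto|apply HG].
    + rewrite !pow_add. replace (B * (R0 ^ K * R0 ^ i) * (Cmod (eu z) ^ K * Cmod (eu z) ^ i)) with
        (B * R0 ^ K * Cmod (eu z) ^ K * ((R0 * Cmod (eu z)) ^ i)) by (rewrite Rpow_mult_distr; ring).
      apply Rmult_le_compat_l.
      * apply Rmult_le_pos; [apply Rmult_le_pos; auto; apply pow_le; lra|apply pow_le; auto].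
      * apply pow_incr. split; [apply Rmult_le_pos; lra|].
        apply Rle_trans with (R0 * / (2 * R0)); [apply Rmult_le_compat_l; lra|right; field; lra].
  - intros n. replace (2 * B * R0 ^ K * Cmod (eu z) ^ K) with (B * R0 ^ K * Cmod (eu z) ^ K / (1 - / 2)) by field.
    apply Rsum_geom_bound; [|lra]. apply Rmult_le_pos; [apply Rmult_le_pos; auto; apply pow_le; lra|apply pow_le; auto].
Qed.

(** * Integer powers and their expansions at the cusp *)

Lemma pow_n_Cpow (w : C) n : pow_n w n = (w ^ n)%C.
Proof. induction n as [|n IH]; simpl; [reflexivity|]. rewrite IH. reflexivity. Qed.

Lemma Cpowz_nat w n : Cpowz w (Z.of_nat n) = (w ^ n)%C.
Proof.
  unfold Cpowz. destruct (Z.leb_spec 0 (Z.of_nat n)); [|lia]. rewrite Nat2Z.id. apply pow_n_Cpow.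
Qed.

Lemma Cpowz_opp_nat w n : Cpowz w (- Z.of_nat n) = (/ w ^ n)%C.
Proof.
  destruct n as [|n].
  - change (- Z.of_nat 0)%Z with (Z.of_nat 0). rewrite Cpowz_nat. simpl. field.
  - unfold Cpowz. destruct (Z.leb_spec 0 (- Z.of_nat (S n))); [lia|]. rewrite Z.opp_involutive, Nat2Z.id.
    rewrite pow_n_Cpow. reflexivity.
Qed.

Lemma Z_nat_cases (k : Z) : exists n, k = Z.of_nat n \/ k = (- Z.of_nat n)%Z.
Proof. exists (Z.abs_nat k). rewrite Zabs2Nat.id_abs. lia. Qed.

Lemma Cpowz_neq0 w k : w <> RtoC 0 -> Cpowz w k <> RtoC 0.
Proof.
  intros Hw. destruct (Z_nat_cases k) as [n [E|E]]; subst.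
  - rewrite Cpowz_nat. apply Cpow_nz; auto.
  - rewrite Cpowz_opp_nat. intros F. apply C1_nz. rewrite <- (Cinv_r (w ^ n)) by (apply Cpow_nz; auto). rewrite F. ring.
Qed.

Lemma Cpowz_succ w k : w <> RtoC 0 -> Cpowz w (k + 1) = (w * Cpowz w k)%C.
Proof.
  intros Hw. destruct (Z_nat_cases k) as [n [E|E]]; subst.
  - replace (Z.of_nat n + 1)%Z with (Z.of_nat (S n)) by lia. rewrite !Cpowz_nat. reflexivity.
  - destruct n as [|n].
    + change (- Z.of_nat 0 + 1)%Z with (Z.of_nat 1). change (- Z.of_nat 0)%Z with (Z.of_nat 0). rewrite !Cpowz_nat. reflexivity.
    + replace (- Z.of_nat (S n) + 1)%Z with (- Z.of_nat n)%Z by lia. rewrite !Cpowz_opp_nat. simpl. field.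
      split; auto. apply Cpow_nz; auto.
Qed.

Lemma Cpowz_add_nat w k n : w <> RtoC 0 -> Cpowz w (k + Z.of_nat n) = (w ^ n * Cpowz w k)%C.
Proof.
  intros Hw. induction n as [|n IH]; [rewrite Z.add_0_r; simpl; ring|].
  replace (k + Z.of_nat (S n))%Z with (k + Z.of_nat n + 1)%Z by lia. rewrite Cpowz_succ, IH by auto. simpl. ring.
Qed.

Lemma Cpowz_add w k l : w <> RtoC 0 -> Cpowz w (k + l) = (Cpowz w k * Cpowz w l)%C.
Proof.
  intros Hw. destruct (Z_nat_cases l) as [n [E|E]]; subst.
  - rewrite Cpowz_add_nat, Cpowz_nat by auto. ring.
  - pose proof (Cpowz_add_nat w (k + - Z.of_nat n) n Hw) as H. replace (k + - Z.of_nat n + Z.of_nat n)%Z with k in H by lia.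
    rewrite Cpowz_opp_nat, H. field. apply Cpow_nz; auto.
Qed.

Lemma Cpowz_mult_l a b k : a <> RtoC 0 -> b <> RtoC 0 -> Cpowz (a * b)%C k = (Cpowz a k * Cpowz b k)%C.
Proof.
  intros Ha Hb. destruct (Z_nat_cases k) as [n [E|E]]; subst.
  - rewrite !Cpowz_nat. apply Cpow_mult_l.
  - rewrite !Cpowz_opp_nat, Cpow_mult_l. field. split; apply Cpow_nz; auto.
Qed.

Lemma Cpowz_pow w n k : w <> RtoC 0 -> Cpowz (w ^ n)%C k = Cpowz w (Z.of_nat n * k).
Proof.
  intros Hw. destruct (Z_nat_cases k) as [p [E|E]]; subst.
  - rewrite Cpowz_nat. replace (Z.of_nat n * Z.of_nat p)%Z with (Z.of_nat (n * p)) by lia. rewrite Cpowz_nat. symmetry. apply Cpow_mult_r.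
  - rewrite Cpowz_opp_nat. replace (Z.of_nat n * - Z.of_nat p)%Z with (- Z.of_nat (n * p))%Z by lia. rewrite Cpowz_opp_nat, Cpow_mult_r. reflexivity.
Qed.

Lemma qpow_eu n z : qpow n z = Cpowz (eu z) n.
Proof.
  unfold qpow. destruct (Z_nat_cases n) as [p [E|E]]; subst.
  - rewrite Cpowz_nat, <- eu_INR. unfold eu. f_equal. rewrite <- INR_IZR_INZ. rewrite !RtoC_mult. ring.
  - rewrite Cpowz_opp_nat, <- eu_INR. unfold eu. rewrite <- Cexp_opp. f_equal. rewrite opp_IZR, <- INR_IZR_INZ.
    rewrite Ropp_mult_distr_r_reverse, RtoC_opp, !RtoC_mult. ring.
Qed.

Lemma is_series_Csums (a : nat -> C) (l : C) : is_series a l -> Csums a l.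
Proof.
  intros H eps He. pose proof (proj1 (filterlim_locally _ _) H (mkposreal (eps / 2) ltac:(lra))) as [N HN].
  exists (S N). intros n Hn. destruct n as [|n]; [lia|]. specialize (HN n ltac:(lia)). simpl in HN.
  assert (E : Csum a (S n) = sum_n a n).
  { clear. induction n as [|n IH]; [rewrite sum_O; simpl; ring|]. rewrite sum_Sn, Csum_S, IH. reflexivity. }
  eapply Rle_lt_trans; [apply Cmod_le_sum|].
  assert (H1 : Rabs (Re (Csum a (S n) - l)%C) < eps / 2 /\ Rabs (Im (Csum a (S n) - l)%C) < eps / 2).
  { assert (HN' : ball l (eps / 2) (Csum a (S n))) by (rewrite E; exact HN). clear HN. set (s := Csum a (S n)) in *. clearbody s. destruct HN' as [H1 H2]. unfold ball in H1, H2. simpl in H1, H2. unfold AbsRing_ball, abs, minus, plus, opp in H1, H2. simpl in H1, H2.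
    destruct s, l. simpl in *. unfold Rminus. split; assumption. }
  lra.
Qed.

Definition pspowz (a : PS) (k : Z) : PS :=
  if (0 <=? k)%Z then pspow a (Z.to_nat k) else pspow (psinv a) (Z.to_nat (- k)).

Lemma Asy_powz f a k : Asy f a -> a O = RtoC 1 -> Asy (fun z => Cpowz (f z) k) (pspowz a k).
Proof.
  intros H Ha. unfold pspowz. destruct (Z.leb_spec 0 k).
  - eapply Asy_ext; [|apply Asy_pow; exact H]. exists 0. intros z _. rewrite <- Cpowz_nat, Z2Nat.id by auto. reflexivity.
  - eapply Asy_ext; [|apply Asy_pow; apply Asy_inv; [exact H|exact Ha]].
    destruct (Asy_lower f a H) as [Y [HY Hl]]; [rewrite Ha; apply C1_nz|]. rewrite Ha, Cmod_1 in Hl.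
    exists Y. intros z Hz. specialize (Hl z Hz). assert (f z <> RtoC 0) by (apply Cmod_gt_0; lra).
    rewrite Cpow_inv by auto. rewrite <- Cpowz_opp_nat, Z2Nat.id by lia. f_equal. lia.
Qed.

Lemma T2at_powz f z k : T2at f z -> f z <> RtoC 0 -> T2at (fun w => Cpowz (f w) k) z.
Proof.
  intros H Hn. destruct (Z_nat_cases k) as [p [E|E]]; subst.
  - eapply T2at_ext; [|apply (T2at_pow f z p H)]. exists 1. split; [lra|]. intros h _. rewrite Cpowz_nat. reflexivity.
  - eapply T2at_ext; [|apply (T2at_inv (fun w => f w ^ p)%C z (T2at_pow f z p H)); apply Cpow_nz; auto].
    exists 1. split; [lra|]. intros h _. rewrite Cpowz_opp_nat. reflexivity.
Qed.

(** * Expansions of Delta and j; forms of weight 0 as polynomials in j *)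

Definition a4 : PS := fun n => RtoC (e4 n).
Definition a6 : PS := fun n => RtoC (e6 n).
(* q-expansions of Delta, Delta/q and q j. *)
Definition dD : PS := psmul (psc (/ 1728)) (pssub (pspow a4 3) (pspow a6 2)).
Definition Ah : PS := psshift dD.
Definition Uh : PS := psmul (pspow a4 3) (psinv Ah).
Definition Del1 (z : C) : C := (Delta z / eu z)%C.
Definition jf (z : C) : C := (E4 z ^ 3 / Delta z)%C.

Lemma a4_vals : a4 0%nat = RtoC 1 /\ a4 1%nat = RtoC 240 /\ a4 2%nat = RtoC 2160.
Proof. unfold a4, e4. rewrite sig_1, sig_2. repeat split; f_equal; ring. Qed.

Lemma a6_vals : a6 0%nat = RtoC 1 /\ a6 1%nat = RtoC (-504) /\ a6 2%nat = RtoC (-16632).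
Proof. unfold a6, e6. rewrite sig_1, sig_2. repeat split; f_equal; ring. Qed.

(** The coefficient -24 is the source of the number 24 in the definition of the limit curves. *)
Lemma dD_vals : dD 0%nat = RtoC 0 /\ dD 1%nat = RtoC 1 /\ dD 2%nat = RtoC (-24).
Proof.
  unfold dD. rewrite !psmul_c_l. unfold pssub. simpl pspow.
  repeat (rewrite psmul_0 || rewrite psmul_1 || rewrite psmul_2).
  destruct a4_vals as [x0 [x1 x2]]. destruct a6_vals as [y0 [y1 y2]]. rewrite x0, x1, x2, y0, y1, y2. simpl.
  repeat split; field.
Qed.

Lemma Asy_E4 : Asy E4 a4. Proof. apply qseries_Asy. apply E4_facts. Qed.
Lemma Asy_E6 : Asy E6 a6. Proof. apply qseries_Asy. apply E6_facts. Qed.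

Lemma Asy_Delta : Asy Delta dD.
Proof.
  assert (E : dD = psmul (psc (/ 1728)) (psadd (pspow a4 3) (psmul (psc (-1)) (pspow a6 2)))).
  { unfold dD. f_equal. apply functional_extensionality. intros n. unfold pssub, psadd. rewrite psmul_c_l. ring. }
  rewrite E. eapply Asy_ext; [|apply Asy_mult; [apply (Asy_const (/ 1728)%C)|apply Asy_plus; [apply (Asy_pow _ _ 3 Asy_E4)|apply Asy_mult; [apply (Asy_const (-1))|apply (Asy_pow _ _ 2 Asy_E6)]]]].
  exists 0. intros z _. unfold Delta, Cdiv. ring.
Qed.

Lemma Asy_Del1 : Asy Del1 Ah.
Proof. apply Asy_shift; [apply Asy_Delta|apply dD_vals]. Qed.

Lemma Ah_0 : Ah 0%nat = RtoC 1. Proof. apply dD_vals. Qed.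
Lemma Ah_1 : Ah 1%nat = RtoC (-24). Proof. apply dD_vals. Qed.

Lemma Del1_neq0 z : in_H z -> Del1 z <> RtoC 0.
Proof.
  intros H. unfold Del1, Cdiv. apply Cmult_neq_0; [apply Delta_neq0; auto|]. apply Cmod_gt_0.
  rewrite Cmod_inv by apply eu_neq0. apply Rinv_0_lt_compat, Cmod_gt_0, eu_neq0.
Qed.

Lemma Delta_Del1 z : Delta z = (eu z * Del1 z)%C.
Proof. unfold Del1. field. apply eu_neq0. Qed.

Lemma Asy_qj : Asy (fun z => eu z * jf z)%C Uh.
Proof.
  eapply Asy_ext; [|apply Asy_mult; [apply (Asy_pow _ _ 3 Asy_E4)|apply Asy_inv; [apply Asy_Del1|apply Ah_0]]].
  exists 1. intros z Hz. assert (Hh : in_H z) by (unfold in_H; lra). unfold jf. rewrite Delta_Del1. field.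
  split; [apply Del1_neq0; auto|apply eu_neq0].
Qed.

Lemma Uh_0 : Uh 0%nat = RtoC 1.
Proof. unfold Uh. rewrite psmul_0, pspow_0, psinv_0; [ring|apply Ah_0|apply a4_vals]. Qed.

Lemma jf_T z : jf (z + 1)%C = jf z.
Proof. unfold jf. rewrite E4_T, Delta_T. reflexivity. Qed.

Lemma jf_S z : in_H z -> jf (- / z)%C = jf z.
Proof.
  intros H. unfold jf. rewrite (proj2 E4_facts), Delta_S by auto. pose proof (in_H_neq0 z H). pose proof (Delta_neq0 z H). field. auto.
Qed.

Lemma jf_T2 z : in_H z -> T2at jf z.
Proof.
  intros H. apply (T2at_mult (fun w => E4 w ^ 3)%C (fun w => / Delta w)%C); [apply T2at_pow, E4_T2; auto|].
  apply T2at_inv; [apply Delta_T2; auto|apply Delta_neq0; auto].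
Qed.

Lemma jf_1728 z : in_H z -> (jf z - 1728)%C = (E6 z ^ 2 / Delta z)%C.
Proof.
  intros H. unfold jf. pose proof (Delta_neq0 z H) as Hd.
  replace (E4 z ^ 3)%C with (1728 * Delta z + E6 z ^ 2)%C by (unfold Delta; field). field. auto.
Qed.

(** Induction on the pole order: as q j = 1 + O(q), subtracting the leading coefficient times the
    matching power of j lowers the order by one. At order 0 the difference from the constant term is
    O(q), hence 0 by [liouville]. *)
Lemma weight0_poly K : forall (h : C -> C) (hh : PS),
  (forall z, in_H z -> T2at h z) -> (forall z, in_H z -> h (z + 1)%C = h z) -> (forall z, in_H z -> h (- / z)%C = h z) ->
  Asy (fun z => eu z ^ K * h z)%C hh ->
  exists p : nat -> C, forall z, in_H z -> h z = Csum (fun i => p i * jf z ^ i)%C (S K).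
Proof.
  induction K as [|K IH]; intros h hh H2 HT HS HA.
  - exists (fun _ => hh O). intros z Hz. simpl. apply Ceq_minus.
    replace (h z - (0 + hh O * 1))%C with (h z + - hh O)%C by ring.
    apply (liouville (fun w => h w + - hh O)%C); auto.
    + intros w Hw. apply T2at_plus; [auto|apply T2at_const].
    + intros w Hw. rewrite HT; auto.
    + intros w Hw. rewrite HS; auto.
    + assert (HA1 : Asy (fun w => h w + - hh O)%C (psadd hh (psc (- hh O)))).
      { eapply Asy_ext; [|apply Asy_plus; [exact HA|apply (Asy_const (- hh O)%C)]]. exists 0. intros w _. simpl. ring. }
      destruct (Asy_EvB1 _ _ HA1) as [B [Y [HB [HY HE]]]]; [unfold psadd; simpl; ring|].
      exists B, Y. intros w Hw _. specialize (HE w Hw). rewrite pow_1 in HE. exact HE.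
  - set (h' := fun z => (h z + - hh O * jf z ^ S K)%C).
    assert (HA1 : Asy (fun z => eu z ^ S K * h' z)%C (psadd hh (psmul (psc (- hh O)) (pspow Uh (S K))))).
    { eapply Asy_ext; [|apply Asy_plus; [exact HA|apply Asy_mult; [apply (Asy_const (- hh O)%C)|apply (Asy_pow _ _ (S K) Asy_qj)]]].
      exists 0. intros z _. unfold h'. rewrite Cpow_mult_l. ring. }
    destruct (IH h' (psshift (psadd hh (psmul (psc (- hh O)) (pspow Uh (S K)))))) as [p Hp].
    + intros z Hz. apply T2at_plus; [auto|]. apply (T2at_mult (fun _ => (- hh O)%C) (fun w => jf w ^ S K)%C); [apply T2at_const|apply T2at_pow, jf_T2; auto].
    + intros z Hz. unfold h'. rewrite HT, jf_T; auto.
    + intros z Hz. unfold h'. rewrite HS, jf_S; auto.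
    + eapply Asy_ext; [|apply Asy_shift; [exact HA1|]].
      * exists 0. intros z _. simpl. field. apply eu_neq0.
      * unfold psadd. rewrite psmul_c_l, pspow_0 by apply Uh_0. ring.
    + exists (fun i => if (i =? S K)%nat then hh O else p i). intros z Hz. rewrite Csum_S, Nat.eqb_refl.
      rewrite (Csum_ext _ (fun i => p i * jf z ^ i)%C).
      * rewrite <- Hp by auto. unfold h'. ring.
      * intros i Hi. destruct (Nat.eqb_spec i (S K)); [lia|reflexivity].
Qed.

Lemma poly_factor (p : nat -> C) r n :
  exists q, forall x, (Csum (fun i => p i * x ^ i) (S n) - Csum (fun i => p i * r ^ i) (S n) = (x - r) * Csum (fun i => q i * x ^ i) n)%C.
Proof.
  induction n as [|n [q Hq]].
  - exists (fun _ => RtoC 0). intros x. simpl. ring.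
  - exists (fun j => (if (j <? n)%nat then q j else 0) + p (S n) * r ^ (n - j))%C. intros x.
    rewrite (Csum_S _ (S n)), (Csum_S (fun i => p i * r ^ i)%C (S n)).
    assert (E : (x ^ S n - r ^ S n = (x - r) * Csum (fun j => r ^ (n - j) * x ^ j) (S n))%C).
    { clear. induction n as [|n IH]; [simpl; ring|].
      rewrite (Csum_S _ (S n)), Nat.sub_diag.
      rewrite (Csum_ext _ (fun j => r * (r ^ (n - j) * x ^ j))%C).
      - rewrite Csum_scal. replace (x ^ S (S n) - r ^ S (S n))%C with (r * (x ^ S n - r ^ S n) + (x - r) * x ^ S n)%C by (simpl; ring).
        rewrite IH. simpl. ring.
      - intros i Hi. replace (S n - i)%nat with (S (n - i)) by lia. simpl. ring. }
    rewrite (Csum_ext (fun i => ((if (i <? n)%nat then q i else 0) + p (S n) * r ^ (n - i)) * x ^ i)%C (fun i => (if (i <? n)%nat then q i else 0) * x ^ i + p (S n) * (r ^ (n - i) * x ^ i))%C) by (intros; ring).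
    rewrite Csum_plus, Csum_scal, Cmult_plus_distr_l.
    replace ((x - r) * (p (S n) * Csum (fun i => r ^ (n - i) * x ^ i) (S n)))%C with (p (S n) * (x ^ S n - r ^ S n))%C by (rewrite E; ring).
    rewrite (Csum_S (fun i => (if (i <? n)%nat then q i else 0) * x ^ i)%C n), Nat.ltb_irrefl.
    rewrite (Csum_ext (fun i => (if (i <? n)%nat then q i else 0) * x ^ i)%C (fun i => q i * x ^ i)%C).
    + rewrite Cmult_plus_distr_l, <- Hq. ring.
    + intros i Hi. destruct (Nat.ltb_spec i n); [reflexivity|lia].
Qed.

Lemma Asy_pssum (f : nat -> C -> C) (a : nat -> PS) n : (forall i, (i < n)%nat -> Asy (f i) (a i)) ->
  Asy (fun z => Csum (fun i => f i z) n) (pssum a n).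
Proof.
  induction n as [|n IH]; intros H; simpl; [apply Asy_const|].
  apply (Asy_plus (fun z => Csum (fun i => f i z) n) (f n)); [apply IH; auto|apply H; lia].
Qed.

(** Division by E4 and E6, which have zeros, is avoided by working with h = g E4^(3-u) E6^(2-v)
    Delta^(-l-2). Its weight k + 4(3-u) + 6(2-v) - 12(l+2) is 0 and its pole order at most D + 2, so
    it is a polynomial in j. As 3 - u and 2 - v are positive, h vanishes at rho and i; dividing by j
    (j - 1728) = E4^3 E6^2/Delta^2 leaves F, whose coefficients [c] are listed from the top degree
    down. *)
Theorem gkm_structure (k m : Z) (g : C -> C) (u v : nat) :
  is_gkm k m g -> k = (12 * ell k + 4 * Z.of_nat u + 6 * Z.of_nat v)%Z -> (u <= 2)%nat -> (v <= 1)%nat ->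
  exists c a' : PS,
    (forall z, inF z -> z <> Ci -> z <> rho -> z <> (rho + 1)%C -> g z = RtoC 0 ->
      Csum (fun i => c i * jf z ^ (Z.to_nat (ell k - m) - i))%C (S (Z.to_nat (ell k - m))) = RtoC 0) /\
    a' O = RtoC 1 /\ (forall n, (1 <= n <= Z.to_nat (ell k - m))%nat -> a' n = RtoC 0) /\
    pssum (fun i => psmul (psc (c i)) (psmul (pspow psX i) (pspow Uh (Z.to_nat (ell k - m) - i)))) (S (Z.to_nat (ell k - m))) =
      psmul a' (psmul (pspowz Ah (- ell k)) (psinv (psmul (pspow a4 u) (pspow a6 v)))).
Proof.
  intros [Hml [[Hmod _] [a [Hser [Ha1 Ha0]]]]] Hk Hu Hv.
  set (l := ell k) in *. set (D := Z.to_nat (l - m)). assert (HD : Z.of_nat D = (l - m)%Z) by (unfold D; rewrite Z2Nat.id; lia).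
  set (a' := fun j : nat => a (m + Z.of_nat j)%Z).
  (* G = g/q^m has the expansion [a'] at the cusp, and the gap condition says that [a'] agrees with
     1 up to degree D. *)
  set (G := fun z => (g z * / Cpowz (eu z) m)%C).
  assert (HGs : forall z, in_H z -> Csums (fun n => a' n * eu z ^ n)%C (G z)).
  { intros z Hz. pose proof (is_series_Csums _ _ (Hser z Hz)) as H.
    pose proof (Cpowz_neq0 (eu z) m (eu_neq0 z)) as Hq.
    unfold G. rewrite Cmult_comm. eapply Csums_ext; [|apply Csums_scal; exact H]. intros n. cbv beta.
    rewrite qpow_eu, Cpowz_add_nat by apply eu_neq0. unfold a'. field. auto. }
  assert (HgG : forall z, g z = (Cpowz (eu z) m * G z)%C).
  { intros z. unfold G. field. apply Cpowz_neq0, eu_neq0. }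
  assert (HGA : Asy G a') by (apply qseries_Asy; auto).
  assert (HGT : forall z, in_H z -> T2at G z) by (apply qseries_T2 with (a := a'); auto).
  assert (HeuT : forall z, T2at eu z) by (intros z; apply T2at_Cexp).
  assert (HgT2 : forall z, in_H z -> T2at g z).
  { intros z Hz. apply T2at_ext with (f := fun w => (Cpowz (eu w) m * G w)%C).
    - exists 1. split; [lra|]. intros h _. symmetry. apply HgG.
    - apply (T2at_mult (fun w => Cpowz (eu w) m) G); [apply T2at_powz; [apply HeuT|apply eu_neq0]|auto]. }
  assert (HgT : forall z, in_H z -> g (z + 1)%C = g z).
  { intros z Hz. pose proof (Hmod 1%Z 1%Z 0%Z 1%Z ltac:(lia) z Hz) as H.
    replace ((1 * z + 1) / (0 * z + 1))%C with (z + 1)%C in H by field.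
    replace (0 * z + 1)%C with (RtoC 1) in H by ring. rewrite H.
    replace (Cpowz 1 k) with (RtoC 1); [ring|].
    destruct (Z_nat_cases k) as [p [E|E]]; rewrite E; [rewrite Cpowz_nat, Cpow_1_l; auto|rewrite Cpowz_opp_nat, Cpow_1_l; field]. }
  assert (HgS : forall z, in_H z -> g (- / z)%C = (Cpowz z k * g z)%C).
  { intros z Hz. pose proof (Hmod 0%Z (-1)%Z 1%Z 0%Z ltac:(lia) z Hz) as H. pose proof (in_H_neq0 z Hz) as Hz0.
    replace ((0 * z + -1) / (1 * z + 0))%C with (- / z)%C in H by (field; auto).
    replace (1 * z + 0)%C with z in H by ring. exact H. }
  set (h := fun z => (g z * (E4 z ^ (3 - u) * (E6 z ^ (2 - v) * Cpowz (Delta z) (- (l + 2)))))%C).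
  assert (HhT2 : forall z, in_H z -> T2at h z).
  { intros z Hz. apply T2at_mult; [auto|].
    apply (T2at_mult (fun w => E4 w ^ (3 - u))%C (fun w => E6 w ^ (2 - v) * Cpowz (Delta w) (- (l + 2)))%C); [apply T2at_pow, E4_T2; auto|].
    apply (T2at_mult (fun w => E6 w ^ (2 - v))%C (fun w => Cpowz (Delta w) (- (l + 2)))); [apply T2at_pow, E6_T2; auto|].
    apply T2at_powz; [apply Delta_T2; auto|apply Delta_neq0; auto]. }
  assert (HhT : forall z, in_H z -> h (z + 1)%C = h z).
  { intros z Hz. unfold h. rewrite HgT, E4_T, E6_T, Delta_T by auto. reflexivity. }
  assert (HhS : forall z, in_H z -> h (- / z)%C = h z).
  { intros z Hz. pose proof (in_H_neq0 z Hz) as Hz0. unfold h.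
    rewrite HgS, (proj2 E4_facts), (proj2 E6_facts), Delta_S by auto.
    rewrite !Cpow_mult_l, <- !Cpow_mult_r, Cpowz_mult_l, Cpowz_pow by (try apply Cpow_nz; auto; apply Delta_neq0; auto).
    assert (E : (Cpowz z k * (z ^ (4 * (3 - u)) * (z ^ (6 * (2 - v)) * Cpowz z (Z.of_nat 12 * - (l + 2)))) = 1)%C).
    { rewrite <- !Cpowz_nat, <- !Cpowz_add by auto.
      replace (k + (Z.of_nat (4 * (3 - u)) + (Z.of_nat (6 * (2 - v)) + Z.of_nat 12 * - (l + 2))))%Z with (Z.of_nat 0) by lia.
      rewrite Cpowz_nat. reflexivity. }
    transitivity ((Cpowz z k * (z ^ (4 * (3 - u)) * (z ^ (6 * (2 - v)) * Cpowz z (Z.of_nat 12 * - (l + 2))))) *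
       (g z * (E4 z ^ (3 - u) * (E6 z ^ (2 - v) * Cpowz (Delta z) (- (l + 2))))))%C; [ring|rewrite E; ring]. }
  assert (Hqh : forall z, in_H z -> (eu z ^ (D + 2) * h z = G z * (E4 z ^ (3 - u) * (E6 z ^ (2 - v) * Cpowz (Del1 z) (- (l + 2)))))%C).
  { intros z Hz. unfold h. rewrite HgG, Delta_Del1, Cpowz_mult_l by (try apply eu_neq0; apply Del1_neq0; auto).
    assert (E : (eu z ^ (D + 2) * (Cpowz (eu z) m * Cpowz (eu z) (- (l + 2))) = 1)%C).
    { pose proof (eu_neq0 z). rewrite <- Cpowz_nat, <- !Cpowz_add by auto.
      replace (Z.of_nat (D + 2) + (m + - (l + 2)))%Z with (Z.of_nat 0) by lia. rewrite Cpowz_nat. reflexivity. }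
    transitivity ((eu z ^ (D + 2) * (Cpowz (eu z) m * Cpowz (eu z) (- (l + 2)))) * (G z * (E4 z ^ (3 - u) * (E6 z ^ (2 - v) * Cpowz (Del1 z) (- (l + 2))))))%C; [ring|rewrite E; ring]. }
  destruct (weight0_poly (D + 2) h (psmul a' (psmul (pspow a4 (3 - u)) (psmul (pspow a6 (2 - v)) (pspowz Ah (- (l + 2)))))) HhT2 HhT HhS) as [p Hp].
  { eapply Asy_ext; [|apply Asy_mult; [exact HGA|apply Asy_mult; [apply (Asy_pow _ _ (3 - u) Asy_E4)|apply Asy_mult; [apply (Asy_pow _ _ (2 - v) Asy_E6)|apply (Asy_powz _ _ (- (l + 2)) Asy_Del1 Ah_0)]]]].
    exists 1. intros z Hz. symmetry. apply Hqh. unfold in_H. lra. }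
  replace (S (D + 2)) with (S (S (S D))) in Hp by lia.
  (* The root 1728 comes from the zero of E6 at i, the root 0 split off below from the zero of E4 at
     rho. *)
  destruct (poly_factor p 1728 (S (S D))) as [q1 Hq1].
  assert (HrhoH : in_H rho) by apply inF_rho. assert (HCiH : in_H Ci) by apply inF_Ci.
  assert (HP1728 : Csum (fun i => p i * 1728 ^ i)%C (S (S (S D))) = RtoC 0).
  { pose proof (Hp Ci HCiH) as H. replace (jf Ci) with (RtoC 1728) in H.
    - rewrite <- H. unfold h. rewrite E6_Ci. replace (2 - v)%nat with (S (1 - v)) by lia. simpl. ring.
    - symmetry. apply Ceq_minus. rewrite jf_1728, E6_Ci by auto. simpl. unfold Cdiv. ring. }
  destruct (poly_factor q1 0 (S D)) as [f Hf].
  assert (HP0 : Csum (fun i => p i * 0 ^ i)%C (S (S (S D))) = RtoC 0).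
  { pose proof (Hp rho HrhoH) as H. replace (jf rho) with (RtoC 0) in H.
    - rewrite <- H. unfold h. rewrite E4_rho. replace (3 - u)%nat with (S (2 - u)) by lia. simpl. ring.
    - unfold jf. rewrite E4_rho. simpl. unfold Cdiv. ring. }
  assert (HQ0 : Csum (fun i => q1 i * 0 ^ i)%C (S (S D)) = RtoC 0).
  { pose proof (Hq1 (RtoC 0)) as H. rewrite HP1728, HP0 in H.
    apply (f_equal (fun w => w * (/ (-1728)))%C) in H.
    replace ((0 - 1728) * Csum (fun i => q1 i * 0 ^ i) (S (S D)) * / -1728)%C with (Csum (fun i => q1 i * 0 ^ i) (S (S D)))%C in H by field.
    rewrite <- H. ring. }
  assert (HPF : forall x, Csum (fun i => p i * x ^ i)%C (S (S (S D))) = ((x - 1728) * (x * Csum (fun i => f i * x ^ i) (S D)))%C).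
  { intros x. pose proof (Hq1 x) as H1. pose proof (Hf x) as H2. rewrite HP1728 in H1. rewrite HQ0 in H2.
    replace (x * Csum (fun i => f i * x ^ i) (S D))%C with ((x - 0) * Csum (fun i => f i * x ^ i) (S D))%C by ring.
    rewrite <- H2. replace (Csum (fun i => q1 i * x ^ i) (S (S D)) - 0)%C with (Csum (fun i => q1 i * x ^ i) (S (S D)))%C by ring.
    rewrite <- H1. ring. }
  set (c := fun i => f (D - i)%nat).
  assert (Hc : forall x, Csum (fun i => c i * x ^ (D - i))%C (S D) = Csum (fun i => f i * x ^ i)%C (S D)).
  { intros x. rewrite (Csum_rev (fun i => f i * x ^ i)%C). apply Csum_ext. intros i Hi. unfold c.
    replace (S D - 1 - i)%nat with (D - i)%nat by lia. reflexivity. }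
  exists c, a'. split; [|split; [|split]].
  - intros z HF Hz1 Hz2 Hz3 Hg0. assert (Hz : in_H z) by apply HF. rewrite Hc.
    pose proof (Hp z Hz) as H. rewrite HPF in H. unfold h in H. rewrite Hg0, Cmult_0_l in H.
    destruct (Ceq_dec (Csum (fun i => f i * jf z ^ i)%C (S D)) 0) as [|Hn]; [auto|exfalso].
    assert (J1 : (jf z - 1728)%C <> RtoC 0).
    { rewrite jf_1728 by auto. unfold Cdiv. apply Cmult_neq_0.
      - apply Cpow_nz. intros F. apply Hz1. apply E6_zero; auto.
      - apply Cmod_gt_0. rewrite Cmod_inv by (apply Delta_neq0; auto). apply Rinv_0_lt_compat, Cmod_gt_0, Delta_neq0; auto. }
    assert (J2 : jf z <> RtoC 0).
    { unfold jf, Cdiv. apply Cmult_neq_0.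
      - apply Cpow_nz. intros F. destruct (E4_zero z HF F); auto.
      - apply Cmod_gt_0. rewrite Cmod_inv by (apply Delta_neq0; auto). apply Rinv_0_lt_compat, Cmod_gt_0, Delta_neq0; auto. }
    symmetry in H. apply (Cmult_neq_0 _ _ J1 (Cmult_neq_0 _ _ J2 Hn)). exact H.
  - unfold a'. rewrite Z.add_0_r. auto.
  - intros n Hn. unfold a'. apply Ha0. lia.
  (* Both series are expansions of q^D F(j), once directly and once through g; uniqueness turns this
     into an identity of formal series. *)
  - apply Asy_unique with (f := fun z => Csum (fun i => c i * (eu z ^ i * (eu z * jf z) ^ (D - i)))%C (S D)).
    + apply (Asy_pssum (fun i z => c i * (eu z ^ i * (eu z * jf z) ^ (D - i)))%C). intros i Hi.
      apply (Asy_mult (fun _ => c i) (fun z => eu z ^ i * (eu z * jf z) ^ (D - i))%C); [apply Asy_const|].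
      apply (Asy_mult (fun z => eu z ^ i)%C (fun z => (eu z * jf z) ^ (D - i))%C); [apply Asy_pow, Asy_eu|apply (Asy_pow _ _ (D - i) Asy_qj)].
    + destruct (Asy_lower E4 a4 Asy_E4) as [Y4 [HY4 L4]]; [destruct a4_vals as [e _]; rewrite e; apply C1_nz|].
      destruct (Asy_lower E6 a6 Asy_E6) as [Y6 [HY6 L6]]; [destruct a6_vals as [e _]; rewrite e; apply C1_nz|].
      destruct a4_vals as [v4 _]. destruct a6_vals as [v6 _]. rewrite v4, Cmod_1 in L4. rewrite v6, Cmod_1 in L6.
      eapply Asy_ext; [|apply Asy_mult; [exact HGA|apply Asy_mult; [apply (Asy_powz _ _ (- l) Asy_Del1 Ah_0)|apply Asy_inv; [apply Asy_mult; [apply (Asy_pow _ _ u Asy_E4)|apply (Asy_pow _ _ v Asy_E6)]|]]]].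
      2:{ rewrite psmul_0, !pspow_0 by auto. ring. }
      exists (Rmax Y4 Y6). intros z Hz. pose proof (Rmax_l Y4 Y6). pose proof (Rmax_r Y4 Y6).
      specialize (L4 z ltac:(lra)). specialize (L6 z ltac:(lra)).
      assert (N4 : E4 z <> RtoC 0) by (apply Cmod_gt_0; lra). assert (N6 : E6 z <> RtoC 0) by (apply Cmod_gt_0; lra).
      assert (HzH : in_H z) by (unfold in_H; lra). pose proof (eu_neq0 z) as Nq. pose proof (Del1_neq0 z HzH) as ND.
      pose proof (Hqh z HzH) as Q. rewrite (Hp z HzH), HPF in Q.
      replace (Csum (fun i => c i * (eu z ^ i * (eu z * jf z) ^ (D - i))) (S D))%C with (eu z ^ D * Csum (fun i => f i * jf z ^ i) (S D))%C.
      2:{ rewrite <- Hc, <- Csum_scal. apply Csum_ext. intros i Hi. rewrite Cpow_mult_l.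
          replace (eu z ^ D)%C with (eu z ^ i * eu z ^ (D - i))%C; [ring|]. rewrite <- Cpow_add_r. f_equal. lia. }
      set (FF := Csum (fun i => f i * jf z ^ i)%C (S D)) in *.
      rewrite jf_1728 in Q by auto. unfold jf in Q. rewrite Delta_Del1 in Q.
      replace (- (l + 2))%Z with (- l + - Z.of_nat 2)%Z in Q by lia. rewrite Cpowz_add, Cpowz_opp_nat in Q by auto.
      assert (P4 : (E4 z ^ 3 = E4 z ^ (3 - u) * E4 z ^ u)%C) by (rewrite <- Cpow_add_r; f_equal; lia).
      assert (P6 : (E6 z ^ 2 = E6 z ^ (2 - v) * E6 z ^ v)%C) by (rewrite <- Cpow_add_r; f_equal; lia).
      pose proof (Cpow_nz (E4 z) (3 - u) N4) as M1. pose proof (Cpow_nz (E6 z) (2 - v) N6) as M2.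
      pose proof (Cpow_nz (E4 z) u N4) as M3. pose proof (Cpow_nz (E6 z) v N6) as M4.
      rewrite P4, P6, Cpow_add_r in Q.
      set (x1 := (E4 z ^ (3 - u))%C) in *. set (x2 := (E4 z ^ u)%C) in *. set (y1 := (E6 z ^ (2 - v))%C) in *. set (y2 := (E6 z ^ v)%C) in *.
      set (w := Cpowz (Del1 z) (- l)) in *. set (qD := (eu z ^ D)%C) in *. set (d := Del1 z) in *. set (q := eu z) in *. set (GG := G z) in *.
      transitivity ((GG * (x1 * (y1 * (w * / d ^ 2)))) * (d ^ 2 / (x1 * x2 * (y1 * y2))))%C; [field; repeat split; auto|].
      rewrite <- Q. field. repeat split; auto.
Qed.

Lemma Rsum_triangle (F : nat -> nat -> R) N :
  Rsum (fun i => Rsum (F i) (S i)) N = Rsum (fun j => Rsum (fun l => F (j + l)%nat j) (N - j)) N.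
Proof.
  induction N as [|N IH]; [reflexivity|].
  rewrite Rsum_S, IH, (Rsum_S (fun j => Rsum (fun l => F (j + l)%nat j) (S N - j))).
  replace (S N - N)%nat with 1%nat by lia.
  rewrite (Rsum_ext (fun j => Rsum (fun l => F (j + l)%nat j) (S N - j)) (fun j => Rsum (fun l => F (j + l)%nat j) (N - j) + F N j)).
  2:{ intros i Hi. replace (S N - i)%nat with (S (N - i)) by lia. rewrite Rsum_S. do 2 f_equal. lia. }
  rewrite Rsum_plus, Rsum_S. simpl (Rsum _ 1). rewrite Nat.add_0_r. ring.
Qed.

(** * Coefficients of the Faber polynomial *)

(** Truncation at degree D keeps the norm submultiplicative and discards exactly what the gap
    condition leaves undetermined. Here [rho] is a real radius, not the cube root of unity. *)
Definition Nm (rho : R) (D : nat) (a : PS) : R := Rsum (fun n => Cmod (a n) * rho ^ n) (S D).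

Section Norm.
Variables (rho : R) (D : nat).
Hypothesis rho_pos : 0 <= rho.

Lemma Nm_pos a : 0 <= Nm rho D a.
Proof. apply Rsum_pos. intros i _. apply Rmult_le_pos; [apply Cmod_ge_0|apply pow_le; auto]. Qed.

Lemma Nm_ext a b : (forall n, (n <= D)%nat -> a n = b n) -> Nm rho D a = Nm rho D b.
Proof. intros H. apply Rsum_ext. intros i Hi. rewrite H by lia. reflexivity. Qed.

Lemma Nm_add a b : Nm rho D (psadd a b) <= Nm rho D a + Nm rho D b.
Proof.
  unfold Nm. rewrite <- Rsum_plus. apply Rsum_le. intros i _. rewrite <- Rmult_plus_distr_r.
  apply Rmult_le_compat_r; [apply pow_le; auto|]. apply Cmod_triangle.
Qed.

Lemma Nm_mul a b : Nm rho D (psmul a b) <= Nm rho D a * Nm rho D b.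
Proof.
  unfold Nm.
  apply Rle_trans with (Rsum (fun i => Rsum ((fun i j => (Cmod (a j) * rho ^ j) * (Cmod (b (i - j)%nat) * rho ^ (i - j))) i) (S i)) (S D)).
  - apply Rsum_le. intros i _. unfold psmul.
    rewrite (Rsum_ext _ (fun j => Cmod (a j * b (i - j)%nat) * rho ^ i)).
    + rewrite Rsum_scal_r. apply Rmult_le_compat_r; [apply pow_le; auto|]. apply Cmod_Csum.
    + intros j Hj. rewrite Cmod_mult. replace (rho ^ i) with (rho ^ j * rho ^ (i - j)); [ring|].
      rewrite <- pow_add. f_equal. lia.
  - rewrite Rsum_triangle.
    rewrite <- Rsum_scal_r. apply Rsum_le. intros j Hj. 
    rewrite (Rsum_ext _ (fun l => (Cmod (a j) * rho ^ j) * (Cmod (b l) * rho ^ l))).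
    + rewrite Rsum_scal. apply Rmult_le_compat_l; [apply Rmult_le_pos; [apply Cmod_ge_0|apply pow_le; auto]|].
      apply Rsum_mono; [|lia]. intros i. apply Rmult_le_pos; [apply Cmod_ge_0|apply pow_le; auto].
    + intros l _. replace (j + l - j)%nat with l by lia. reflexivity.
Qed.

Lemma Nm_c c : Nm rho D (psc c) = Cmod c.
Proof.
  unfold Nm. rewrite Rsum_Sl. simpl. rewrite (Rsum_ext _ (fun _ => 0)).
  - rewrite Rsum_const. ring.
  - intros i _. rewrite Cmod_0. ring.
Qed.

Lemma Nm_X_pow i : Nm rho D (pspow psX i) <= rho ^ i.
Proof.
  induction i as [|i IH]; [simpl; rewrite Nm_c, Cmod_1; lra|].
  simpl pspow. eapply Rle_trans; [apply Nm_mul|]. simpl. apply Rmult_le_compat; try apply Nm_pos; auto.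
  unfold Nm. rewrite Rsum_Sl. simpl (psX 0%nat). rewrite Cmod_0, Rmult_0_l, Rplus_0_l. destruct D as [|D']; [simpl; auto|].
  rewrite Rsum_Sl. simpl (psX 1%nat). rewrite Cmod_1, (Rsum_ext _ (fun _ => 0)).
  - rewrite Rsum_const. lra.
  - intros j _. simpl. rewrite Cmod_0. ring.
Qed.

Lemma Nm_pow_le a M n : Nm rho D a <= M -> Nm rho D (pspow a n) <= M ^ n.
Proof.
  intros H. induction n as [|n IH]; [simpl; rewrite Nm_c, Cmod_1; lra|]. simpl.
  eapply Rle_trans; [apply Nm_mul|]. apply Rmult_le_compat; auto; apply Nm_pos.
Qed.

(** Telescoping through a^(n+1) - b^(n+1) = a (a^n - b^n) + (a - b) b^n; M >= 1 allows M^n where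
    M^(n-1) would suffice. *)
Lemma Nm_pow_diff a b M d n : 1 <= M -> Nm rho D a <= M -> Nm rho D b <= M -> Nm rho D (pssub a b) <= d ->
  Nm rho D (pssub (pspow a n) (pspow b n)) <= INR n * d * M ^ n.
Proof.
  intros HM Ha Hb Hd. pose proof (Nm_pos (pssub a b)) as H0. induction n as [|n IH].
  - simpl. rewrite Rmult_0_l, Rmult_0_l. right. rewrite (Nm_ext _ (psc 0)); [rewrite Nm_c; apply Cmod_0|].
    intros n _. unfold pssub. unfold psc at 3. destruct n; ring.
  - simpl pspow.
    replace (pssub (psmul a (pspow a n)) (psmul b (pspow b n))) with (psadd (psmul a (pssub (pspow a n) (pspow b n))) (psmul (pssub a b) (pspow b n))) by ring.
    eapply Rle_trans; [apply Nm_add|]. pose proof (Nm_mul a (pssub (pspow a n) (pspow b n))). pose proof (Nm_mul (pssub a b) (pspow b n)).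
    pose proof (Nm_pow_le b M n Hb). pose proof (Nm_pos a). pose proof (Nm_pos (pssub (pspow a n) (pspow b n))). pose proof (Nm_pos (pspow b n)).
    assert (P1 : Nm rho D a * Nm rho D (pssub (pspow a n) (pspow b n)) <= M * (INR n * d * M ^ n)) by (apply Rmult_le_compat; auto).
    assert (P2 : Nm rho D (pssub a b) * Nm rho D (pspow b n) <= d * M ^ n) by (apply Rmult_le_compat; auto).
    assert (0 <= M ^ n) by (apply pow_le; lra). rewrite S_INR. simpl (M ^ S n).
    assert (0 <= d * M ^ n) by (apply Rmult_le_pos; lra). nra.
Qed.

Lemma Nm_pssum f n : Nm rho D (pssum f n) <= Rsum (fun i => Nm rho D (f i)) n.
Proof.
  induction n as [|n IH]; simpl; [rewrite Nm_c, Cmod_0; lra|]. eapply Rle_trans; [apply Nm_add|]. lra.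
Qed.

Lemma Nm_tri a b c : Nm rho D (pssub a c) <= Nm rho D (pssub a b) + Nm rho D (pssub b c).
Proof. replace (pssub a c) with (psadd (pssub a b) (pssub b c)) by ring. apply Nm_add. Qed.

Lemma Nm_sub_l a b : Nm rho D a <= Nm rho D b + Nm rho D (pssub a b).
Proof. replace a with (psadd b (pssub a b)) at 1 by ring. apply Nm_add. Qed.
End Norm.

Lemma GB_mul a b : GB a -> GB b -> GB (psmul a b).
Proof.
  intros [B [R0 [HB [HR H]]]] [B' [R0' [HB' [HR' H']]]]. exists (B * B'), (2 * (R0 + R0')).
  repeat split; [apply Rmult_le_pos; auto|lra|]. intros n. unfold psmul.
  apply Rle_trans with (Rsum (fun i => B * B' * (R0 + R0') ^ n) (S n)).
  - apply Cmod_Csum_le. intros i Hi. rewrite Cmod_mult.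
    apply Rle_trans with (B * R0 ^ i * (B' * R0' ^ (n - i))); [apply Rmult_le_compat; auto; apply Cmod_ge_0|].
    replace (B * R0 ^ i * (B' * R0' ^ (n - i))) with (B * B' * (R0 ^ i * R0' ^ (n - i))) by ring.
    apply Rmult_le_compat_l; [apply Rmult_le_pos; auto|].
    replace n with (i + (n - i))%nat at 2 by lia. rewrite pow_add. apply Rmult_le_compat; try (apply pow_le; lra); apply pow_incr; lra.
  - rewrite Rsum_const, Rpow_mult_distr.
    assert (0 <= B * B' * (R0 + R0') ^ n) by (apply Rmult_le_pos; [apply Rmult_le_pos; auto|apply pow_le; lra]).
    assert (INR (S n) <= 2 ^ n).
    { clear. induction n as [|n IH]; [simpl; lra|]. rewrite S_INR, <- tech_pow_Rmult. assert (1 <= 2 ^ n) by (apply pow_R1_Rle; lra). lra. }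
    nra.
Qed.

Lemma GB_c c : GB (psc c).
Proof.
  exists (Cmod c), 1. repeat split; [apply Cmod_ge_0|lra|]. intros n. rewrite pow1. destruct n; simpl; [lra|]. rewrite Cmod_0.
  pose proof (Cmod_ge_0 c). lra.
Qed.

Lemma GB_sub a b : GB a -> GB b -> GB (pssub a b).
Proof.
  intros [B [R0 [HB [HR H]]]] [B' [R0' [HB' [HR' H']]]]. exists (B + B'), (R0 + R0').
  repeat split; try lra. intros n. unfold pssub. eapply Rle_trans; [apply Cmod_tri2|].
  specialize (H n). specialize (H' n). rewrite Rmult_plus_distr_r.
  assert (R0 ^ n <= (R0 + R0') ^ n) by (apply pow_incr; lra). assert (R0' ^ n <= (R0 + R0') ^ n) by (apply pow_incr; lra).
  assert (B * R0 ^ n <= B * (R0 + R0') ^ n) by (apply Rmult_le_compat_l; auto).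
  assert (B' * R0' ^ n <= B' * (R0 + R0') ^ n) by (apply Rmult_le_compat_l; auto). lra.
Qed.

Lemma GB_pow a n : GB a -> GB (pspow a n).
Proof. intros H. induction n; simpl; [apply GB_c|apply GB_mul; auto]. Qed.

Lemma GB_shift a : GB a -> GB (psshift a).
Proof.
  intros [B [R0 [HB [HR H]]]]. exists (B * R0), R0. repeat split; auto; [apply Rmult_le_pos; lra|].
  intros n. unfold psshift. specialize (H (S n)). simpl in H. lra.
Qed.

(** The order of vanishing at q = 0 becomes a power of the radius. The constants do not depend on D,
    which tends to infinity. *)
Lemma GB_Nm a k : GB a -> (forall n, (n < k)%nat -> a n = RtoC 0) ->
  exists C0 r0, 0 <= C0 /\ 0 < r0 /\ forall rho D, 0 <= rho <= r0 -> Nm rho D a <= C0 * rho ^ k.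
Proof.
  intros [B [R0 [HB [HR H]]]] Hk. exists (2 * B * R0 ^ k), (/ (2 * R0)).
  repeat split; [apply Rmult_le_pos; [lra|apply pow_le; lra]|apply Rinv_0_lt_compat; lra|].
  intros rho D [Hr0 Hr]. unfold Nm.
  assert (Hx : 0 <= R0 * rho <= 1 / 2).
  { split; [apply Rmult_le_pos; lra|]. apply Rle_trans with (R0 * / (2 * R0)); [apply Rmult_le_compat_l; lra|right; field; lra]. }
  assert (Hterm : forall n, 0 <= Cmod (a n) * rho ^ n) by (intros n; apply Rmult_le_pos; [apply Cmod_ge_0|apply pow_le; auto]).
  apply Rle_trans with (Rsum (fun n => Cmod (a n) * rho ^ n) (k + S D)); [apply Rsum_mono; [auto|lia]|].
  rewrite Rsum_split, (Rsum_ext _ (fun _ => 0)), Rsum_const, Rmult_0_r, Rplus_0_l.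
  2:{ intros i Hi. rewrite Hk, Cmod_0 by auto. ring. }
  apply Rle_trans with (Rsum (fun i => (B * (R0 * rho) ^ k) * (R0 * rho) ^ i) (S D)).
  - apply Rsum_le. intros i _. rewrite Rmult_assoc, <- pow_add, Rpow_mult_distr, <- Rmult_assoc.
    apply Rmult_le_compat_r; [apply pow_le; auto|apply H].
  - eapply Rle_trans; [apply Rsum_geom_bound; [apply Rmult_le_pos; auto; apply pow_le; lra|lra]|].
    rewrite Rpow_mult_distr. replace (2 * B * R0 ^ k * rho ^ k) with (B * (R0 ^ k * rho ^ k) * 2) by ring.
    apply Rmult_le_compat_l; [apply Rmult_le_pos; auto; apply Rmult_le_pos; apply pow_le; lra|].
    apply Rle_trans with (/ (1 / 2)); [apply Rinv_le_contravar; lra|lra].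
Qed.

(** At a radius where 1 - a has norm at most 1/2 the geometric series has norm at most 2, and this
    bounds each single coefficient. *)
Lemma GB_inv a : GB a -> a O = RtoC 1 -> GB (psinv a).
Proof.
  intros Ha H0. set (x := pssub (psc 1) a).
  assert (Hx : GB x) by (apply GB_sub; [apply GB_c|auto]).
  destruct (GB_Nm x 1 Hx) as [C0 [r0 [HC [Hr HN]]]].
  { intros n Hn. destruct n; [|lia]. unfold x, pssub. simpl. rewrite H0. ring. }
  set (rho := Rmin r0 (/ (2 * (C0 + 1)))).
  assert (Hi : 0 < / (2 * (C0 + 1))) by (apply Rinv_0_lt_compat; lra).
  assert (Hrho : 0 < rho) by (apply Rmin_pos; auto).
  assert (Hrl : rho <= r0) by apply Rmin_l. assert (Hrr : rho <= / (2 * (C0 + 1))) by apply Rmin_r.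
  assert (Hhalf : forall D, Nm rho D x <= 1 / 2).
  { intros D. eapply Rle_trans; [apply HN; lra|]. rewrite pow_1.
    apply Rle_trans with ((C0 + 1) * / (2 * (C0 + 1))); [apply Rmult_le_compat; lra|right; field; lra]. }
  exists 2, (/ rho). repeat split; [lra|apply Rinv_0_lt_compat; auto|]. intros n.
  rewrite pow_inv. apply Rmult_le_reg_r with (rho ^ n); [apply pow_lt; auto|].
  rewrite Rmult_assoc, Rinv_l, Rmult_1_r by (apply Rgt_not_eq, pow_lt; auto).
  apply Rle_trans with (Nm rho n (pssum (pspow x) (S n))).
  - unfold psinv. fold x. unfold Nm. apply (Rsum_term (fun m => Cmod (pssum (pspow x) (S n) m) * rho ^ m)); [|lia].
    intros i. apply Rmult_le_pos; [apply Cmod_ge_0|apply pow_le; lra].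
  - eapply Rle_trans; [apply Nm_pssum; lra|]. eapply Rle_trans; [apply Rsum_le; intros i _; apply (Nm_pow_le rho n ltac:(lra) x (1 / 2) i (Hhalf n))|].
    eapply Rle_trans; [apply Rsum_geom_le; lra|]. lra.
Qed.

Definition expseq (t : R) : PS := fun n => RtoC (t ^ n / INR (fact n)).

Lemma sum_f_R0_Rsum f n : sum_f_R0 f n = Rsum f (S n).
Proof. induction n as [|n IH]; [simpl; ring|]. rewrite Rsum_S, <- IH. reflexivity. Qed.

Lemma RtoC_Rsum f n : RtoC (Rsum f n) = Csum (fun i => RtoC (f i)) n.
Proof. induction n as [|n IH]; [reflexivity|]. rewrite Rsum_S, Csum_S, RtoC_plus, IH. reflexivity. Qed.

Lemma expseq_mul s t : psmul (expseq s) (expseq t) = expseq (s + t).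
Proof.
  apply functional_extensionality. intros n. unfold psmul, expseq.
  rewrite (binomial s t n), sum_f_R0_Rsum. unfold Rdiv. rewrite <- Rsum_scal_r, RtoC_Rsum.
  apply Csum_ext. intros i Hi. rewrite <- RtoC_mult. f_equal. unfold Binomial.C.
  pose proof (INR_fact_neq_0 n). pose proof (INR_fact_neq_0 i). pose proof (INR_fact_neq_0 (n - i)). field. auto.
Qed.

Lemma expseq_pow t n : pspow (expseq t) n = expseq (INR n * t).
Proof.
  induction n as [|n IH].
  - apply functional_extensionality. intros [|m]; unfold expseq; simpl; [f_equal; field|].
    rewrite !Rmult_0_l. f_equal. unfold Rdiv. ring.
  - simpl pspow. rewrite IH, expseq_mul. f_equal. rewrite S_INR. ring.
Qed.

Lemma expseq_Nm t rho D : 0 <= rho -> Nm rho D (expseq t) <= exp (Rabs t * rho).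
Proof.
  intros Hr. pose proof (Rabs_pos t).
  eapply Rle_trans; [|apply (exp_ge_taylor (Rabs t * rho) D); apply Rmult_le_pos; auto].
  rewrite sum_f_R0_Rsum. unfold Nm. right. apply Rsum_ext. intros i _. unfold expseq.
  rewrite Cmod_R. unfold Rdiv. rewrite Rabs_mult, <- RPow_abs, Rpow_mult_distr, (Rabs_right (/ _)).
  - ring.
  - apply Rle_ge. left. apply Rinv_0_lt_compat, INR_fact_lt_0.
Qed.

Lemma expseq_GB t : GB (expseq t).
Proof.
  exists 1, (Rabs t + 1). pose proof (Rabs_pos t). repeat split; try lra. intros n. unfold expseq. rewrite Cmod_R.
  unfold Rdiv. rewrite Rabs_mult, <- RPow_abs. rewrite (Rabs_right (/ _)) by (apply Rle_ge; left; apply Rinv_0_lt_compat, INR_fact_lt_0).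
  assert (Hf : / INR (fact n) <= 1).
  { rewrite <- Rinv_1. apply Rinv_le_contravar; [lra|]. apply (le_INR 1). apply lt_O_fact. }
  assert (Rabs t ^ n <= (Rabs t + 1) ^ n) by (apply pow_incr; lra).
  assert (0 <= Rabs t ^ n) by (apply pow_le; auto). pose proof (INR_fact_lt_0 n) as Hf0. apply Rinv_0_lt_compat in Hf0. nra.
Qed.

Lemma GB_a4 : GB a4. Proof. apply (qseries_GB a4 E4). apply E4_facts. Qed.
Lemma GB_a6 : GB a6. Proof. apply (qseries_GB a6 E6). apply E6_facts. Qed.
Lemma GB_Ah : GB Ah.
Proof. apply GB_shift, GB_mul; [apply GB_c|]. apply GB_sub; apply GB_pow; [apply GB_a4|apply GB_a6]. Qed.
Lemma GB_Uh : GB Uh.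
Proof. apply GB_mul; [apply GB_pow, GB_a4|apply GB_inv; [apply GB_Ah|apply Ah_0]]. Qed.

Lemma psinv_Ah_1 : psinv Ah 1%nat = RtoC 24.
Proof.
  pose proof (f_equal (fun s => s 1%nat) (psinv_correct Ah Ah_0)) as H. cbv beta in H.
  rewrite psmul_1, Ah_0, Ah_1, psinv_0 in H by apply Ah_0. simpl in H.
  apply (f_equal (fun w => w + 24)%C) in H. ring_simplify in H. rewrite H. reflexivity.
Qed.

Lemma exp_le x y : x <= y -> exp x <= exp y.
Proof. intros [h|h]; [left; apply exp_increasing; auto|rewrite h; lra]. Qed.

(** [W] will be Delta/q or its inverse according to the sign of l. It agrees with e^{24 s q} up to
    O(q^2), and [Nm_pow_diff] compares the L-th powers with the common norm bound M = e^{24 rho + C0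
    rho^2}. *)
Lemma W_estimate (W : PS) (s : R) : GB W -> W 0%nat = RtoC 1 -> W 1%nat = RtoC (24 * s) -> Rabs s = 1 ->
  exists C0 r0, 0 <= C0 /\ 0 < r0 /\ forall rho D L, 0 <= rho <= r0 ->
    Nm rho D (pssub (pspow W L) (expseq (24 * s * INR L))) <= INR L * C0 * rho ^ 2 * exp (INR L * (24 * rho + C0 * rho ^ 2)) /\
    Nm rho D (pspow W L) <= exp (INR L * (24 * rho + C0 * rho ^ 2)).
Proof.
  intros HW W0 W1 Hs.
  destruct (GB_Nm (pssub W (expseq (24 * s))) 2) as [C1 [r1 [HC1 [Hr1 HN1]]]].
  { apply GB_sub; [auto|apply expseq_GB]. }
  { intros [|[|n]] Hn; [| |lia]; unfold pssub, expseq; [rewrite W0|rewrite W1]; simpl; rewrite <- RtoC_minus; f_equal; field. }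
  (* Comparison with 1 + 24 s q bounds the norm of [W] by 1 + 24 rho + C2 rho^2, hence by M. *)
  destruct (GB_Nm (pssub W (psadd (psc 1) (psmul (psc (RtoC (24 * s)%R)) psX))) 2) as [C2 [r2 [HC2 [Hr2 HN2]]]].
  { assert (HX : GB psX).
    { exists 1, 1. repeat split; try lra. intros n. rewrite pow1. destruct n as [|[|n]]; simpl; rewrite ?Cmod_0, ?Cmod_1; lra. }
    replace (pssub W (psadd (psc 1) (psmul (psc (RtoC (24 * s)%R)) psX))) with (pssub (pssub W (psc 1)) (psmul (psc (RtoC (24 * s)%R)) psX)) by ring.
    apply GB_sub; [apply GB_sub; [auto|apply GB_c]|]. apply GB_mul; [apply GB_c|auto]. }
  { intros [|[|n]] Hn; [| |lia]; unfold pssub, psadd; rewrite psmul_c_l; [rewrite W0|rewrite W1]; simpl; ring. }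
  exists (C1 + C2), (Rmin r1 r2). repeat split; [lra|apply Rmin_pos; auto| |].
  all: pose proof (Rmin_l r1 r2); pose proof (Rmin_r r1 r2); specialize (HN1 rho D ltac:(lra)); specialize (HN2 rho D ltac:(lra)).
  all: assert (Hr : 0 <= rho) by lra; assert (Hr2' : 0 <= rho ^ 2) by (apply pow_le; auto).
  all: set (M := exp (24 * rho + (C1 + C2) * rho ^ 2)).
  all: assert (HM1 : 1 <= M) by (unfold M; rewrite <- exp_0; apply exp_le; nra).
  all: assert (HWM : Nm rho D W <= M).
  1, 3: eapply Rle_trans; [apply (Nm_sub_l rho D Hr W (psadd (psc 1) (psmul (psc (RtoC (24 * s)%R)) psX)))|];
    pose proof (Nm_add rho D Hr (psc 1) (psmul (psc (RtoC (24 * s)%R)) psX)) as HA; pose proof (Nm_mul rho D Hr (psc (RtoC (24 * s)%R)) psX) as HB;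
    pose proof (Nm_X_pow rho D Hr 1) as HX; simpl pspow in HX; replace (psmul psX (psc 1)) with psX in HX by ring;
    rewrite Nm_c, Cmod_1 in HA; rewrite Nm_c, Cmod_R, Rabs_mult, Hs, (Rabs_right 24) in HB by lra; rewrite pow_1 in HX;
    unfold M; eapply Rle_trans; [|apply exp_ineq1_le]; nra.
  - rewrite exp_INR_mult. fold M.
    replace (24 * s * INR L) with (INR L * (24 * s)) by ring. rewrite <- expseq_pow.
    replace (INR L * (C1 + C2) * rho ^ 2 * M ^ L) with (INR L * ((C1 + C2) * rho ^ 2) * M ^ L) by ring.
    apply Nm_pow_diff; auto.
    + eapply Rle_trans; [apply expseq_Nm; auto|]. unfold M. apply exp_le. rewrite Rabs_mult, Hs, (Rabs_right 24) by lra. nra.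
    + nra.
  - rewrite exp_INR_mult. fold M. apply Nm_pow_le; auto.
Qed.

Lemma psmul_a'_local (a' x : PS) D n : a' O = RtoC 1 -> (forall i, (1 <= i <= D)%nat -> a' i = RtoC 0) -> (n <= D)%nat ->
  psmul a' x n = x n.
Proof.
  intros H0 H Hn. unfold psmul. rewrite Csum_Sl, Csum_zero; [rewrite H0, Nat.sub_0_r; ring|].
  intros i Hi. rewrite H by lia. ring.
Qed.

Lemma pspow_X i n : pspow psX i n = if (n =? i)%nat then RtoC 1 else RtoC 0.
Proof.
  revert n. induction i as [|i IH]; intros n; [destruct n; reflexivity|]. simpl pspow.
  destruct n; [rewrite psmul_0; simpl; ring|]. rewrite psmul_X_S, IH. reflexivity.
Qed.

(** The powers U^(D-i) are within kp <= 1/2 of 1 in norm, so [c] differs from W^L Q by at most kp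
    times its own norm, which is absorbed. At rho = D/(24 L) one has D rho = ep/24 and L rho^2 =
    ep/576 with ep = D^2/L, while the main exponential e^{24 L rho} is e^D. *)
Lemma coef_estimate (W Q : PS) (s : R) : GB W -> W 0%nat = RtoC 1 -> W 1%nat = RtoC (24 * s) -> Rabs s = 1 -> GB Q -> Q 0%nat = RtoC 1 ->
  exists C0 eta0, 0 <= C0 /\ 0 < eta0 /\ forall (L D : nat) (c a' : PS),
    (1 <= L)%nat -> (1 <= D)%nat -> INR D ^ 2 / INR L <= eta0 -> a' O = RtoC 1 -> (forall i, (1 <= i <= D)%nat -> a' i = RtoC 0) ->
    pssum (fun i => psmul (psc (c i)) (psmul (pspow psX i) (pspow Uh (D - i)))) (S D) = psmul a' (psmul (pspow W L) Q) ->
    Nm (INR D / (24 * INR L)) D (pssub c (expseq (24 * s * INR L))) <= C0 * (INR D ^ 2 / INR L) * exp (INR D).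
Proof.
  intros HW W0 W1 Hs HQ Q0.
  destruct (W_estimate W s HW W0 W1 Hs) as [Cw [rw [HCw [Hrw HWe]]]].
  destruct (GB_Nm (pssub Q (psc 1)) 1) as [Cq [rq [HCq [Hrq HQe]]]].
  { apply GB_sub; [auto|apply GB_c]. }
  { intros [|n] Hn; [|lia]. unfold pssub. rewrite Q0. simpl. ring. }
  destruct (GB_Nm (pssub Uh (psc 1)) 1) as [Cu [ru [HCu [Hru HUe]]]].
  { apply GB_sub; [apply GB_Uh|apply GB_c]. }
  { intros [|n] Hn; [|lia]. unfold pssub. rewrite Uh_0. simpl. ring. }
  (* The last entry keeps [ep] times each of Cw, Cq and 6 Cu below 1. The correction exponentials
     are then at most e <= 3, the origin of the factors 3, and kp = 3 Cu ep is at most 1/2. *)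
  set (e0 := Rmin (Rmin rw rq) (Rmin ru (/ (Cw + Cq + 6 * Cu + 1)))).
  assert (Hinv : 0 < / (Cw + Cq + 6 * Cu + 1)) by (apply Rinv_0_lt_compat; lra).
  exists (3 * Cw + 9 * Cq + 18 * (2 * Cu * 3)), e0.
  split; [lra|]. split; [unfold e0; repeat apply Rmin_pos; auto|].
  intros L D c a' HL HD Heps Ha0 Ha Hid.
  assert (HLp : 1 <= INR L) by (apply (le_INR 1); auto). assert (HDp : 1 <= INR D) by (apply (le_INR 1); auto).
  set (rho := INR D / (24 * INR L)). set (ep := INR D ^ 2 / INR L) in *.
  assert (Hrho : 0 < rho) by (unfold rho; apply Rdiv_lt_0_compat; lra).
  assert (Hrho0 : 0 <= rho) by lra.
  assert (Hre : INR D * rho = ep / 24) by (unfold rho, ep; field; lra).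
  assert (Hrho_ep : rho <= ep) by (assert (0 <= ep) by nra; nra).
  assert (HLrho : INR L * rho ^ 2 = ep / 576) by (unfold rho, ep; field; lra).
  assert (HL24 : INR L * (24 * rho) = INR D) by (unfold rho; field; lra).
  assert (E1 : e0 <= rw) by (unfold e0; eapply Rle_trans; [apply Rmin_l|apply Rmin_l]).
  assert (E2 : e0 <= rq) by (unfold e0; eapply Rle_trans; [apply Rmin_l|apply Rmin_r]).
  assert (E3 : e0 <= ru) by (unfold e0; eapply Rle_trans; [apply Rmin_r|apply Rmin_l]).
  assert (E4 : e0 <= / (Cw + Cq + 6 * Cu + 1)) by (unfold e0; eapply Rle_trans; [apply Rmin_r|apply Rmin_r]).
  assert (Hep : 0 < ep) by nra.
  assert (E5 : ep * (Cw + Cq + 6 * Cu + 1) <= 1).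
  { apply Rmult_le_reg_r with (/ (Cw + Cq + 6 * Cu + 1)); auto. rewrite Rmult_assoc, Rinv_r by lra. lra. }
  assert (F1 : ep * Cw <= 1) by nra. assert (F2 : ep * Cq <= 1) by nra. assert (F3 : ep * (6 * Cu) <= 1) by nra.
  destruct (HWe rho D L ltac:(lra)) as [HW1 HW2]. specialize (HQe rho D ltac:(lra)). specialize (HUe rho D ltac:(lra)).
  rewrite pow_1 in HQe, HUe.
  assert (Hexp : exp (INR L * (24 * rho + Cw * rho ^ 2)) <= 3 * exp (INR D)).
  { replace (INR L * (24 * rho + Cw * rho ^ 2)) with (Cw * (INR L * rho ^ 2) + INR L * (24 * rho)) by ring.
    rewrite HLrho, HL24, exp_plus. apply Rmult_le_compat_r; [left; apply exp_pos|].
    eapply Rle_trans; [|apply exp_le_3]. apply exp_le. nra. }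
  pose proof (exp_pos (INR D)) as HeD.
  assert (HW1' : Nm rho D (pssub (pspow W L) (expseq (24 * s * INR L))) <= 3 * Cw * ep * exp (INR D)).
  { eapply Rle_trans; [exact HW1|]. replace (INR L * Cw * rho ^ 2) with (Cw * (INR L * rho ^ 2)) by ring. rewrite HLrho.
    assert (0 <= Cw * (ep / 576)) by nra. 
    apply Rle_trans with (Cw * (ep / 576) * (3 * exp (INR D))); [apply Rmult_le_compat_l; auto|].
    assert (0 <= Cw * ep * exp (INR D)) by (apply Rmult_le_pos; nra). lra. }
  assert (HW2' : Nm rho D (pspow W L) <= 3 * exp (INR D)) by lra.
  set (RR := psmul (pspow W L) Q) in *.
  assert (HRW : Nm rho D (pssub RR (pspow W L)) <= 3 * Cq * ep * exp (INR D)).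
  { unfold RR. replace (pssub (psmul (pspow W L) Q) (pspow W L)) with (psmul (pspow W L) (pssub Q (psc 1))) by ring.
    eapply Rle_trans; [apply Nm_mul; auto|].
    apply Rle_trans with (3 * exp (INR D) * (Cq * ep)); [|right; ring].
    apply Rmult_le_compat; try apply Nm_pos; auto. eapply Rle_trans; [exact HQe|]. apply Rmult_le_compat_l; auto. }
  assert (HRe : Nm rho D (pssub RR (expseq (24 * s * INR L))) <= (3 * Cw + 3 * Cq) * ep * exp (INR D)).
  { eapply Rle_trans; [apply (Nm_tri rho D Hrho0 RR (pspow W L))|]. lra. }
  assert (HRn : Nm rho D RR <= 6 * exp (INR D)).
  { eapply Rle_trans; [apply (Nm_sub_l rho D Hrho0 RR (pspow W L))|].
    assert (Cq * ep * exp (INR D) <= 1 * exp (INR D)) by (apply Rmult_le_compat_r; lra). lra. }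
  assert (HUp : forall p, (p <= D)%nat -> Nm rho D (pssub (pspow Uh p) (psc 1)) <= Cu * 3 * ep).
  { intros p Hp. replace (psc 1) with (pspow (psc 1) p).
    2:{ clear. induction p as [|p IH]; [reflexivity|]. simpl. rewrite IH. ring. }
    assert (HMU : 1 <= exp (Cu * rho)) by (rewrite <- exp_0; apply exp_le; nra).
    eapply Rle_trans; [apply (Nm_pow_diff rho D Hrho0 Uh (psc 1) (exp (Cu * rho)) (Cu * rho) p)|]; auto.
    - eapply Rle_trans; [apply (Nm_sub_l rho D Hrho0 Uh (psc 1))|]. rewrite Nm_c, Cmod_1.
      eapply Rle_trans; [|apply exp_ineq1_le]. lra.
    - rewrite Nm_c, Cmod_1. auto.
    - rewrite <- exp_INR_mult.
      assert (HpD : INR p <= INR D) by (apply le_INR; auto). pose proof (pos_INR p).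
      assert (G1 : INR p * (Cu * rho) <= Cu * (ep / 24)) by (rewrite <- Hre; assert (0 <= Cu * rho) by nra; nra).
      assert (G2 : exp (INR p * (Cu * rho)) <= 3) by (eapply Rle_trans; [|apply exp_le_3]; apply exp_le; nra).
      pose proof (exp_pos (INR p * (Cu * rho))). 
      apply Rle_trans with (Cu * (ep / 24) * 3); [|nra]. apply Rmult_le_compat; [|lra|lra|lra]. apply Rmult_le_pos; nra. }
  set (kp := Cu * 3 * ep) in *. assert (Hkp : kp <= 1 / 2) by (unfold kp; lra). assert (Hkp0 : 0 <= kp) by (unfold kp; nra).
  (* [T] is the left side of the identity with U^(D-i) - 1 in place of U^(D-i); hence RR = c + T up
     to degree D. *)
  set (T := pssum (fun i => psmul (psc (c i)) (psmul (pspow psX i) (pssub (pspow Uh (D - i)) (psc 1)))) (S D)).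
  assert (HT : Nm rho D T <= kp * Nm rho D c).
  { unfold T. eapply Rle_trans; [apply Nm_pssum; auto|]. unfold Nm at 2. rewrite <- Rsum_scal. apply Rsum_le. intros i Hi.
    eapply Rle_trans; [apply Nm_mul; auto|]. rewrite Nm_c.
    replace (kp * (Cmod (c i) * rho ^ i)) with (Cmod (c i) * (rho ^ i * kp)) by ring.
    apply Rmult_le_compat_l; [apply Cmod_ge_0|]. eapply Rle_trans; [apply Nm_mul; auto|].
    apply Rmult_le_compat; try (apply Nm_pos; auto); [apply Nm_X_pow; auto|apply HUp; lia]. }
  assert (Hdec : forall n, (n <= D)%nat -> RR n = psadd c T n).
  { intros n Hn. rewrite <- (psmul_a'_local a' RR D n Ha0 Ha Hn), <- Hid. unfold T, psadd. rewrite !pssum_coef.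
    rewrite (Csum_ext _ (fun i => psmul (psc (c i)) (pspow psX i) n + psmul (psc (c i)) (psmul (pspow psX i) (pssub (pspow Uh (D - i)) (psc 1))) n)%C).
    - rewrite Csum_plus. f_equal. rewrite (Csum_single _ (S D) n); [|lia|].
      + rewrite psmul_c_l, pspow_X, Nat.eqb_refl. ring.
      + intros i Hi Hne. rewrite psmul_c_l, pspow_X. destruct (Nat.eqb_spec n i); [lia|ring].
    - intros i Hi.
      change (psmul (psc (c i)) (pspow psX i) n + psmul (psc (c i)) (psmul (pspow psX i) (pssub (pspow Uh (D - i)) (psc 1))) n)%C with
       (psadd (psmul (psc (c i)) (pspow psX i)) (psmul (psc (c i)) (psmul (pspow psX i) (pssub (pspow Uh (D - i)) (psc 1)))) n).
      apply (f_equal (fun x : PS => x n)). ring. }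
  assert (Hc_RR : Nm rho D (pssub c RR) <= kp * Nm rho D c).
  { rewrite (Nm_ext rho D (pssub c RR) (psmul (psc (-1)) T)).
    - eapply Rle_trans; [apply Nm_mul; auto|]. rewrite Nm_c, Cmod_R, Rabs_left by lra. lra.
    - intros n Hn. unfold pssub. rewrite Hdec, psmul_c_l by auto. unfold psadd. ring. }
  (* Absorption: the norm of [c] is at most that of [RR] plus half of itself. *)
  assert (Hcn : Nm rho D c <= 12 * exp (INR D)).
  { pose proof (Nm_sub_l rho D Hrho0 c RR). pose proof (Nm_pos rho D Hrho0 c). nra. }
  eapply Rle_trans; [apply (Nm_tri rho D Hrho0 c RR)|].
  assert (kp * Nm rho D c <= kp * (12 * exp (INR D))) by (apply Rmult_le_compat_l; auto).
  unfold kp in *. assert (0 <= Cu * ep * exp (INR D)) by (apply Rmult_le_pos; nra).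
  assert (0 <= Cq * ep * exp (INR D)) by (apply Rmult_le_pos; nra). nra.
Qed.

(** * Truncated exponentials *)

Lemma exp_beats_square eta M : 0 < eta -> exists D0 : nat, forall D, (D0 <= D)%nat -> M * INR D ^ 2 < exp (eta * INR D).
Proof.
  intros He. destruct (INR_unbounded (6 * (Rabs M + 1) / eta ^ 3)) as [N HN]. exists (S N). intros D HD.
  assert (He3 : 0 < eta ^ 3) by (apply pow_lt; auto).
  assert (HDN : INR N < INR D) by (apply lt_INR; lia). pose proof (pos_INR N). pose proof (Rle_abs M). pose proof (Rabs_pos M).
  pose proof (exp_ge_taylor (eta * INR D) 3 ltac:(apply Rmult_le_pos; lra)) as Hx. cbv [sum_f_R0] in Hx.
  replace (INR (fact 0)) with 1 in Hx by (simpl; ring). replace (INR (fact 1)) with 1 in Hx by (simpl; ring).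
  replace (INR (fact 2)) with 2 in Hx by (simpl; ring). replace (INR (fact 3)) with 6 in Hx by (simpl; ring).
  assert (0 < INR D) by lra. assert (0 < eta * INR D) by nra.
  assert (Hp2 : 0 <= (eta * INR D) ^ 2) by (apply pow_le; lra).
  assert (Hx3 : (eta * INR D) ^ 3 / 6 <= exp (eta * INR D)) by (simpl pow in *; lra).
  eapply Rlt_le_trans; [|exact Hx3]. rewrite Rpow_mult_distr.
  assert (HD2 : 0 < INR D ^ 2) by (apply pow_lt; lra).
  apply Rmult_lt_compat_l with (r := eta ^ 3) in HN; auto.
  replace (eta ^ 3 * (6 * (Rabs M + 1) / eta ^ 3)) with (6 * (Rabs M + 1)) in HN by (field; lra).
  replace (eta ^ 3 * INR D ^ 3 / 6) with (eta ^ 3 * INR D / 6 * INR D ^ 2) by (simpl; field).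
  apply Rmult_lt_compat_r; auto. nra.
Qed.

Section TruncatedExp.
Variable D : nat.
Hypothesis D_ge : (2 <= D)%nat.
(** The coefficients of e^{DW}. They increase weakly up to the index D and decrease from there on,
    which is the basis of all the tail estimates. *)
Definition ac (i : nat) : R := INR D ^ i / INR (fact i).
Definition pD (W : C) : C := Csum (fun i => RtoC (ac i) * W ^ i)%C (S D).

Lemma D_pos : 2 <= INR D.
Proof. apply (le_INR 2) in D_ge. simpl in D_ge. lra. Qed.

Lemma ac_pos i : 0 < ac i.
Proof. pose proof D_pos. apply Rdiv_lt_0_compat; [apply pow_lt; lra|apply INR_fact_lt_0]. Qed.

Lemma ac_S i : ac (S i) * INR (S i) = INR D * ac i.
Proof.
  unfold ac. change (fact (S i)) with (S i * fact i)%nat. rewrite mult_INR. simpl pow. field.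
  split; [apply INR_fact_neq_0|apply not_0_INR; lia].
Qed.

Lemma ac_incr i : (i < D)%nat -> ac i <= ac (S i).
Proof.
  intros H. pose proof (ac_S i). pose proof (ac_pos i). pose proof (ac_pos (S i)).
  assert (INR (S i) <= INR D) by (apply le_INR; lia). pose proof (lt_0_INR (S i) ltac:(lia)).
  apply Rmult_le_reg_r with (INR D); [pose proof D_pos; lra|]. nra.
Qed.

Lemma ac_decr i : (D <= i)%nat -> ac (S i) <= ac i.
Proof.
  intros H. pose proof (ac_S i). pose proof (ac_pos i). pose proof (ac_pos (S i)).
  assert (INR D <= INR (S i)) by (apply le_INR; lia). pose proof (lt_0_INR (S i) ltac:(lia)).
  apply Rmult_le_reg_r with (INR (S i)); [lra|]. nra.
Qed.

Lemma ac_le_D i : (i <= D)%nat -> ac i <= ac D.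
Proof.
  intros H. assert (G : forall j, (i + j <= D)%nat -> ac i <= ac (i + j)).
  { induction j as [|j IH]; intros Hj; [rewrite Nat.add_0_r; lra|]. eapply Rle_trans; [apply IH; lia|].
    rewrite Nat.add_succ_r. apply ac_incr. lia. }
  replace D with (i + (D - i))%nat by lia. apply G. lia.
Qed.

Lemma ac_ge_D i : ac (D + i) <= ac D.
Proof.
  induction i as [|i IH]; [rewrite Nat.add_0_r; lra|]. rewrite Nat.add_succ_r. eapply Rle_trans; [apply ac_decr; lia|]. auto.
Qed.

Lemma ac_D_ge1 : 1 <= ac D.
Proof. apply Rle_trans with (ac 0); [unfold ac; simpl; lra|]. apply ac_le_D. lia. Qed.

(** First differences of [ac]. By [bc_val] they vanish at i = D, so the second summation by parts
    leaves no boundary term. *)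
Definition bc (i : nat) : R := match i with O => ac O | S j => ac i - ac j end.

Lemma bc_sum n : Rsum bc (S n) = ac n.
Proof. induction n as [|n IH]; [simpl; ring|]. rewrite Rsum_S, IH. simpl. ring. Qed.

Lemma bc_val i : bc i = ac i * (1 - INR i / INR D).
Proof.
  pose proof D_pos. destruct i as [|i]; [simpl; field; lra|]. change (bc (S i)) with (ac (S i) - ac i).
  pose proof (ac_S i). assert (E : ac i = ac (S i) * INR (S i) / INR D) by (rewrite H0; field; lra). rewrite E at 1. field. lra.
Qed.

Definition bb (i : nat) : R := match i with O => bc O | S j => bc i - bc j end.

(* The total variation of bb is o(ac D), so once |W|^D is bounded below the top term makes
   pD W large unless W is near 1. *)
Lemma second_difference W : ((W - 1) * (W - 1) * pD W = RtoC (ac D) * W ^ S D * (W - 1) + Csum (fun i => RtoC (bb i) * W ^ i) (S D))%C.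
Proof.
  assert (G1 : forall n, ((W - 1) * Csum (fun i => RtoC (ac i) * W ^ i) (S n) = RtoC (ac n) * W ^ S n - Csum (fun i => RtoC (bc i) * W ^ i) (S n))%C).
  { induction n as [|n IH]; [simpl; ring|]. rewrite (Csum_S (fun i => RtoC (ac i) * W ^ i)%C), Cmult_plus_distr_l, IH, (Csum_S (fun i => RtoC (bc i) * W ^ i)%C (S n)).
    change (bc (S n)) with (ac (S n) - ac n). rewrite RtoC_minus. simpl. ring. }
  assert (G2 : forall n, ((W - 1) * Csum (fun i => RtoC (bc i) * W ^ i) (S n) = RtoC (bc n) * W ^ S n - Csum (fun i => RtoC (bb i) * W ^ i) (S n))%C).
  { induction n as [|n IH]; [simpl; ring|]. rewrite (Csum_S (fun i => RtoC (bc i) * W ^ i)%C), Cmult_plus_distr_l, IH, (Csum_S (fun i => RtoC (bb i) * W ^ i)%C (S n)).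
    change (bb (S n)) with (bc (S n) - bc n). rewrite RtoC_minus. simpl. ring. }
  unfold pD. rewrite <- Cmult_assoc, G1.
  replace ((W - 1) * (RtoC (ac D) * W ^ S D - Csum (fun i => RtoC (bc i) * W ^ i) (S D)))%C with
    (RtoC (ac D) * W ^ S D * (W - 1) - (W - 1) * Csum (fun i => RtoC (bc i) * W ^ i) (S D))%C by ring.
  rewrite G2. replace (bc D) with 0; [ring|]. rewrite bc_val. pose proof D_pos. field. lra.
Qed.

(** The last T terms are at most [ac D] each. For i < D - T the factor 1 - i/D exceeds T/D, so ac i
    <= (D/T) bc i, and the sum of [bc] telescopes. *)
Lemma sum_ac_bound T : (1 <= T)%nat -> Rsum ac D <= (INR T + INR D / INR T) * ac D.
Proof.
  intros HT. pose proof D_pos as HD. assert (HTp : 1 <= INR T) by (apply (le_INR 1); auto).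
  pose proof (ac_pos D) as Ha.
  assert (HDT : 0 < INR D / INR T) by (apply Rdiv_lt_0_compat; lra).
  destruct (Nat.le_gt_cases D T) as [h|h].
  - apply Rle_trans with (Rsum (fun _ => ac D) D); [apply Rsum_le; intros i Hi; apply ac_le_D; lia|].
    rewrite Rsum_const. apply Rmult_le_compat_r; [lra|]. apply le_INR in h. lra.
  - replace D with ((D - T) + T)%nat at 1 by lia. rewrite Rsum_split.
    assert (S2 : Rsum (fun i => ac (D - T + i)) T <= INR T * ac D).
    { rewrite <- Rsum_const. apply Rsum_le. intros i Hi. apply ac_le_D. lia. }
    assert (S1 : Rsum ac (D - T) <= INR D / INR T * ac D).
    { apply Rle_trans with (INR D / INR T * Rsum bc (D - T)).
      - rewrite <- Rsum_scal. apply Rsum_le. intros i Hi. rewrite bc_val. pose proof (ac_pos i).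
        assert (Hi' : INR i <= INR D - INR T) by (rewrite <- minus_INR by lia; apply le_INR; lia).
        replace (INR D / INR T * (ac i * (1 - INR i / INR D))) with (ac i * ((INR D - INR i) / INR T)) by (field; lra).
        rewrite <- (Rmult_1_r (ac i)) at 1. apply Rmult_le_compat_l; [lra|].
        apply Rmult_le_reg_r with (INR T); [lra|]. unfold Rdiv. rewrite Rmult_assoc, Rinv_l by lra. lra.
      - apply Rmult_le_compat_l; [lra|]. replace (D - T)%nat with (S (D - T - 1)) by lia. rewrite bc_sum. apply ac_le_D. lia. }
    lra.
Qed.

Lemma bb_val i : bb (S i) = ac (S i) * (1 - INR (S i) / INR D) ^ 2 - ac i / INR D.
Proof.
  pose proof D_pos as HD. change (bb (S i)) with (bc (S i) - bc i). rewrite !bc_val. rewrite S_INR.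
  pose proof (ac_S i) as H. rewrite S_INR in H. assert (E : ac i = ac (S i) * (INR i + 1) / INR D) by (rewrite H; field; lra).
  rewrite E. field. lra.
Qed.

Lemma bb_abs i : Rabs (bb i) <= ac i * (1 - INR i / INR D) ^ 2 + match i with O => 0 | S j => ac j / INR D end.
Proof.
  pose proof D_pos as HD. destruct i as [|i].
  - simpl. pose proof (ac_pos 0). rewrite Rabs_right by lra. unfold Rdiv. rewrite Rmult_0_l. lra.
  - rewrite bb_val. pose proof (ac_pos (S i)). pose proof (ac_pos i). pose proof (pow2_ge_0 (1 - INR (S i) / INR D)).
    assert (0 < ac i / INR D) by (apply Rdiv_lt_0_compat; lra).
    set (q := (1 - INR (S i) / INR D) ^ 2) in *. apply Rabs_le. nra.
Qed.

(** A second moment of truncated Poisson weights: by [bb_val] each term is a difference of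
    consecutive [bc] plus the preceding [ac] over D, and the differences telescope. *)
Lemma variance_sum n : Rsum (fun i => ac i * (1 - INR i / INR D) ^ 2) (S n) = bc n + Rsum ac n / INR D.
Proof.
  pose proof D_pos as HD. induction n as [|n IH].
  - simpl. unfold Rdiv. ring.
  - rewrite Rsum_S, IH, (Rsum_S ac). pose proof (bb_val n) as H. change (bb (S n)) with (bc (S n) - bc n) in H.
    assert (E : ac (S n) * (1 - INR (S n) / INR D) ^ 2 = bc (S n) - bc n + ac n / INR D) by lra. rewrite E. field. lra.
Qed.

Lemma bb_variation : Rsum (fun i => Rabs (bb i)) (S D) <= 2 * Rsum ac D / INR D.
Proof.
  pose proof D_pos as HD.
  eapply Rle_trans; [apply Rsum_le; intros i _; apply bb_abs|]. rewrite Rsum_plus, variance_sum.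
  replace (bc D) with 0 by (rewrite bc_val; field; lra).
  rewrite Rsum_Sl. unfold Rdiv. rewrite Rsum_scal_r. lra.
Qed.

Lemma bernoulli t n : 0 <= t <= 1 -> 1 - INR n * t <= (1 - t) ^ n.
Proof.
  intros Ht. induction n as [|n IH]; [simpl; lra|]. rewrite S_INR. simpl.
  pose proof (pos_INR n). apply Rle_trans with ((1 - t) * (1 - INR n * t)); [nra|apply Rmult_le_compat_l; lra].
Qed.

(** Bernoulli's inequality. The collar of width 1/(2D) inside the unit circle is where |W|^D is
    still comparable with 1. *)
Lemma pow_near_one W : 1 - / (2 * INR D) <= Cmod W -> 1 <= 2 * Cmod W ^ D.
Proof.
  pose proof D_pos as HD. intros H.
  assert (Hi : 0 < / (2 * INR D) <= 1).
  { split; [apply Rinv_0_lt_compat; lra|]. rewrite <- Rinv_1. apply Rinv_le_contravar; lra. }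
  assert (Hp : (1 - / (2 * INR D)) ^ D <= Cmod W ^ D) by (apply pow_incr; lra).
  pose proof (bernoulli (/ (2 * INR D)) D ltac:(lra)) as HB.
  replace (INR D * / (2 * INR D)) with (1 / 2) in HB by (field; lra). lra.
Qed.

(** With [pD W] small, the top term ac D W^(D+1) (W - 1) in [second_difference] must be balanced by
    the sum of the [bb] terms, and the variation of [bb] is at most 2 (T/D + 1/T) ac D. The
    parameter T is free: it is taken large first, and D afterwards. *)
Lemma outer_bound W T : (1 <= T)%nat -> 1 - / (2 * INR D) <= Cmod W -> Cmod (pD W) <= / 100 * Rmax 1 (Cmod W) ^ D ->
  Cmod (W - 1) <= 32 * (INR T / INR D + / INR T).
Proof.
  intros HT HW Hp. pose proof D_pos as HD. pose proof (pow_near_one W HW) as H1. pose proof ac_D_ge1 as Ha.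
  assert (HTp : 1 <= INR T) by (apply (le_INR 1); auto).
  assert (Hi : 0 < / (2 * INR D) <= 1 / 4).
  { split; [apply Rinv_0_lt_compat; lra|]. apply Rle_trans with (/ 4); [apply Rinv_le_contravar; lra|lra]. }
  set (w := Cmod W) in *. assert (Hw : 1 / 2 <= w) by lra.
  assert (HwD : 0 < w ^ D) by (apply pow_lt; lra).
  assert (Hmax : Rmax 1 w ^ D <= 2 * w ^ D).
  { unfold Rmax. destruct (Rle_dec 1 w); [lra|rewrite pow1; lra]. }
  assert (HtermD : forall i, (i <= D)%nat -> w ^ i <= 2 * w ^ D).
  { intros i Hi'. destruct (Rle_lt_dec 1 w) as [h|h].
    - assert (w ^ i <= w ^ D) by (apply Rle_pow; auto). lra.
    - assert (w ^ i <= 1) by (rewrite <- (pow1 i); apply pow_incr; lra). lra. }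
  set (d := Cmod (W - 1)) in *. assert (Hd0 : 0 <= d) by apply Cmod_ge_0.
  assert (Hdw : d <= 3 * w).
  { unfold d. eapply Rle_trans; [apply Cmod_tri2|]. rewrite Cmod_1. fold w. lra. }
  set (V := INR T / INR D + / INR T).
  assert (HV : Rsum (fun i => Rabs (bb i)) (S D) <= 2 * V * ac D).
  { eapply Rle_trans; [apply bb_variation|]. pose proof (sum_ac_bound T HT) as S1.
    apply Rmult_le_reg_r with (INR D); [lra|]. unfold Rdiv at 1. rewrite Rmult_assoc, Rinv_l by lra.
    replace (2 * V * ac D * INR D) with (2 * ((INR T + INR D / INR T) * ac D)) by (unfold V; field; lra). lra. }
  assert (HS : Cmod (Csum (fun i => RtoC (bb i) * W ^ i)%C (S D)) <= 2 * w ^ D * (2 * V * ac D)).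
  { apply Rle_trans with (Rsum (fun i => 2 * w ^ D * Rabs (bb i)) (S D)).
    - apply Cmod_Csum_le. intros i Hi'. rewrite Cmod_mult, Cmod_R, Cmod_pow. fold w. rewrite Rmult_comm.
      apply Rmult_le_compat_r; [apply Rabs_pos|apply HtermD; lia].
    - rewrite Rsum_scal. apply Rmult_le_compat_l; lra. }
  pose proof (f_equal Cmod (second_difference W)) as E. rewrite !Cmod_mult in E. fold d in E.
  assert (E1 : ac D * w ^ S D * d - 2 * w ^ D * (2 * V * ac D) <= d * d * Cmod (pD W)).
  { rewrite E. pose proof (Cmod_tri_inv (RtoC (ac D) * W ^ S D * (W - 1)) (Csum (fun i => RtoC (bb i) * W ^ i)%C (S D))) as Ht.
    rewrite !Cmod_mult, Cmod_R, Cmod_pow, Rabs_right in Ht by lra. fold w d in Ht. lra. }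
  assert (E2 : d * d * Cmod (pD W) <= d * (3 * w) * (/ 100 * (2 * w ^ D))).
  { apply Rmult_le_compat; [nra|apply Cmod_ge_0|apply Rmult_le_compat_l; auto|lra]. }
  simpl pow in E1.
  assert (E3 : (ac D * w * d - 4 * V * ac D) * w ^ D <= (d * w * (6 / 100)) * w ^ D) by lra.
  apply Rmult_le_reg_r in E3; auto.
  assert (HVp : 0 <= V) by (unfold V; apply Rplus_le_le_0_compat; [apply Rmult_le_pos; [lra|left; apply Rinv_0_lt_compat; lra]|left; apply Rinv_0_lt_compat; lra]).
  assert (Hdw0 : 0 <= d * w) by nra.
  assert (E4 : ac D * (d * w) - 4 * V * ac D <= ac D * (d * w) * (6 / 100)).
  { assert (d * w <= ac D * (d * w)) by nra. nra. }
  assert (E5 : d * w * (94 / 100) <= 4 * V) by nra.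
  assert (d * (1 / 2) <= d * w) by nra. lra.
Qed.

Lemma exp_series_ac W : Csums (fun i => RtoC (ac i) * W ^ i)%C (Cexp (RtoC (INR D) * W)).
Proof.
  eapply Csums_ext; [|apply Cexp_series]. intros n. cbv beta. unfold ac.
  rewrite Cpow_mult_l, RtoC_div, RtoC_pow by apply INR_fact_neq_0. unfold Cdiv. ring.
Qed.

(** Past the index D the coefficients are at most [ac D], so a geometric series dominates the
    tail. *)
Lemma tail_upper W : Cmod W < 1 -> Cmod (Cexp (RtoC (INR D) * W) - pD W) <= ac D * Cmod W ^ D / (1 - Cmod W).
Proof.
  intros HW. pose proof (Cmod_ge_0 W) as H0. pose proof (ac_pos D).
  unfold pD. apply Csums_tail with (b := fun i => (ac D * Cmod W ^ D) * Cmod W ^ i).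
  - apply exp_series_ac.
  - intros i. rewrite Cmod_mult, Cmod_R, Cmod_pow, Rabs_right by (apply Rle_ge; left; apply ac_pos).
    rewrite Rmult_assoc, <- pow_add. apply Rmult_le_compat; [left; apply ac_pos|apply pow_le; auto| |].
    + replace (S D + i)%nat with (D + S i)%nat by lia. apply ac_ge_D.
    + replace (S D + i)%nat with (D + i + 1)%nat by lia. rewrite (pow_add _ (D + i)), pow_1.
      rewrite <- (Rmult_1_r (Cmod W ^ (D + i))) at 2. apply Rmult_le_compat_l; [apply pow_le; auto|lra].
  - intros n. apply Rsum_geom_bound; [|lra]. apply Rmult_le_pos; [lra|apply pow_le; auto].
Qed.

(** Abel summation: multiplied by 1 - W, the tail is its first term plus terms whose coefficients
    are differences of the decreasing [ac]. These add up to at most ac (S D) |W|^(D+2), so the first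
    term prevails. *)
Lemma tail_lower W : Cmod W < 1 ->
  ac (S D) * Cmod W ^ S D * (1 - Cmod W) <= 2 * Cmod (Cexp (RtoC (INR D) * W) - pD W).
Proof.
  intros HW. pose proof (Cmod_ge_0 W) as H0. set (w := Cmod W) in *.
  set (tk := fun i => (RtoC (ac (S D + i)) * W ^ (S D + i))%C).
  assert (HT : Csums tk (Cexp (RtoC (INR D) * W) - pD W)).
  { unfold pD. apply (Csums_shift (fun i => RtoC (ac i) * W ^ i)%C). apply exp_series_ac. }
  set (T := (Cexp (RtoC (INR D) * W) - pD W)%C) in *.
  assert (HwD : 0 <= w ^ S D) by (apply pow_le; auto).
  assert (Hwn : forall n, w ^ S n <= w).
  { intros n. simpl. rewrite <- (Rmult_1_r w) at 3. apply Rmult_le_compat_l; auto.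
    rewrite <- (pow1 n). apply pow_incr. unfold w in *. lra. }
  assert (G : forall n, Cmod ((1 - W) * Csum tk (S n) + RtoC (ac (S D + n)) * W ^ (S D + S n) - RtoC (ac (S D)) * W ^ S D) <= w ^ S D * w * (ac (S D) - ac (S D + n))).
  { induction n as [|n IH].
    - simpl Csum. unfold tk. rewrite !Nat.add_0_r. rewrite Rminus_diag, Rmult_0_r. right.
      replace ((1 - W) * (0 + RtoC (ac (S D)) * W ^ S D) + RtoC (ac (S D)) * W ^ (S D + 1) - RtoC (ac (S D)) * W ^ S D)%C with (RtoC 0).
      + apply Cmod_0.
      + rewrite Cpow_add_r. simpl (W ^ 1)%C. ring.
    - rewrite Csum_S. unfold tk at 2.
      replace ((1 - W) * (Csum tk (S n) + RtoC (ac (S D + S n)) * W ^ (S D + S n)) + RtoC (ac (S D + S n)) * W ^ (S D + S (S n)) - RtoC (ac (S D)) * W ^ S D)%C with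
        (((1 - W) * Csum tk (S n) + RtoC (ac (S D + n)) * W ^ (S D + S n) - RtoC (ac (S D)) * W ^ S D) + RtoC (ac (S D + S n) - ac (S D + n)) * W ^ (S D + S n))%C.
      + eapply Rle_trans; [apply Cmod_triangle|]. rewrite Cmod_mult, Cmod_R, Cmod_pow. fold w.
        pose proof (ac_decr (S D + n) ltac:(lia)) as Hd. replace (S (S D + n)) with (S D + S n)%nat in Hd by lia.
        rewrite Rabs_left1 by lra.
        assert (w ^ (S D + S n) <= w ^ S D * w).
        { rewrite pow_add. apply Rmult_le_compat_l; auto. }
        nra.
      + rewrite RtoC_minus, (Nat.add_succ_r (S D) (S n)), (Cpow_S W (S D + S n)). ring. }
  assert (HL : forall n, ac (S D) * w ^ S D * (1 - w) <= Cmod ((1 - W) * Csum tk (S n))).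
  { intros n. specialize (G n). pose proof (ac_pos (S D + n)) as Hp. pose proof (ac_pos (S D)) as Hp'.
    assert (H1 : Cmod (RtoC (ac (S D)) * W ^ S D) = ac (S D) * w ^ S D).
    { rewrite Cmod_mult, Cmod_R, Cmod_pow, Rabs_right by lra. reflexivity. }
    assert (H2 : Cmod (RtoC (ac (S D + n)) * W ^ (S D + S n)) <= ac (S D + n) * (w ^ S D * w)).
    { rewrite Cmod_mult, Cmod_R, Cmod_pow, Rabs_right by lra. apply Rmult_le_compat_l; [lra|]. fold w. rewrite pow_add.
      apply Rmult_le_compat_l; auto. }
    assert (H3 : Cmod (RtoC (ac (S D)) * W ^ S D) <= Cmod ((1 - W) * Csum tk (S n)) + Cmod (RtoC (ac (S D + n)) * W ^ (S D + S n)) +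
       Cmod ((1 - W) * Csum tk (S n) + RtoC (ac (S D + n)) * W ^ (S D + S n) - RtoC (ac (S D)) * W ^ S D)).
    { replace (RtoC (ac (S D)) * W ^ S D)%C with (((1 - W) * Csum tk (S n) + RtoC (ac (S D + n)) * W ^ (S D + S n)) -
        ((1 - W) * Csum tk (S n) + RtoC (ac (S D + n)) * W ^ (S D + S n) - RtoC (ac (S D)) * W ^ S D))%C at 1 by ring.
      eapply Rle_trans; [apply Cmod_tri2|]. apply Rplus_le_compat_r, Cmod_triangle. }
    rewrite H1 in H3. lra. }
  assert (HLim : CLim (fun n => (1 - W) * Csum tk (S n))%C ((1 - W) * T)%C).
  { apply CLim_scal. apply (CLim_sub (Csum tk) T S); [intros; lia|exact HT]. }
  assert (HF : ac (S D) * w ^ S D * (1 - w) <= Cmod ((1 - W) * T)).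
  { apply Rnot_lt_le. intros Hlt. destruct (HLim (ac (S D) * w ^ S D * (1 - w) - Cmod ((1 - W) * T)) ltac:(lra)) as [N HN].
    specialize (HN N (Nat.le_refl N)). specialize (HL N). pose proof (Cmod_tri_inv2 ((1 - W) * Csum tk (S N)) ((1 - W) * T)). lra. }
  eapply Rle_trans; [exact HF|]. rewrite Cmod_mult. apply Rmult_le_compat_r; [apply Cmod_ge_0|].
  eapply Rle_trans; [apply Cmod_tri2|]. rewrite Cmod_1. fold w. unfold w in *. lra.
Qed.

Lemma ac_D_upper : ac D <= exp (INR D).
Proof.
  pose proof (exp_ge_taylor (INR D) D ltac:(apply pos_INR)) as H. rewrite sum_f_R0_Rsum in H.
  eapply Rle_trans; [|exact H]. apply (Rsum_term (fun k => INR D ^ k / INR (fact k))); [|lia]. intros i. left. apply ac_pos.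
Qed.
End TruncatedExp.

(** A weak Stirling formula, by induction through (1 + 1/n)^(n+1) >= e. With [ac_D_upper] it
    determines [ac D] as e^D up to a factor of order D. *)
Lemma ac_D_lower D : (1 <= D)%nat -> exp (INR D - 1) <= INR D * (INR D ^ D / INR (fact D)).
Proof.
  intros HD. induction D as [|D IH]; [lia|]. destruct D as [|D].
  - simpl. rewrite Rminus_diag, exp_0. lra.
  - specialize (IH ltac:(lia)). set (n := S D) in *. assert (Hn : 0 < INR n) by (apply lt_0_INR; unfold n; lia).
    rewrite S_INR. change (fact (S n)) with (S n * fact n)%nat. rewrite mult_INR, S_INR.
    pose proof (INR_fact_lt_0 n) as Hf.
    replace ((INR n + 1) * ((INR n + 1) ^ S n / ((INR n + 1) * INR (fact n)))) with ((1 + / INR n) ^ S n * (INR n * (INR n ^ n / INR (fact n)))).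
    2:{ replace (1 + / INR n) with ((INR n + 1) / INR n) by (field; lra). unfold Rdiv. rewrite Rpow_mult_distr, pow_inv, <- !tech_pow_Rmult. field.
        repeat split; try lra. apply Rgt_not_eq, pow_lt; auto. }
    replace (INR n + 1 - 1) with (1 + (INR n - 1)) by ring. rewrite exp_plus.
    apply Rmult_le_compat; try (left; apply exp_pos); auto.
    assert (HS : 0 < INR (S n)) by (apply lt_0_INR; lia).
    replace 1 with (INR (S n) * / INR (S n)) at 1 by (field; lra). rewrite exp_INR_mult.
    apply pow_incr. split; [left; apply exp_pos|].
    (* e^{1/(n+1)} <= 1/(1 - 1/(n+1)) = 1 + 1/n *)
    pose proof (exp_ineq1_le (- / INR (S n))) as H. rewrite exp_Ropp in H.
    assert (Hx : 1 + - / INR (S n) = INR n / INR (S n)) by (rewrite S_INR; field; lra). rewrite Hx in H.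
    pose proof (exp_pos (/ INR (S n))). apply Rmult_le_reg_r with (/ exp (/ INR (S n)) ); [apply Rinv_0_lt_compat; auto|].
    rewrite Rinv_r by lra. apply Rle_trans with ((1 + / INR n) * (INR n / INR (S n))).
    + right. rewrite S_INR. field. lra.
    + apply Rmult_le_compat_l; auto. pose proof (Rinv_0_lt_compat _ Hn). lra.
Qed.

Lemma ln_ge_near_1 x : 1 / 2 <= x -> x <= 1 -> - (2 * (1 - x)) <= ln x.
Proof.
  intros H1 H2. rewrite <- (ln_exp (- (2 * (1 - x)))). apply ln_le; [apply exp_pos|].
  rewrite exp_Ropp. pose proof (exp_ineq1_le (2 * (1 - x))). apply Rle_trans with (/ (1 + 2 * (1 - x))); [apply Rinv_le_contravar; lra|].
  apply Rmult_le_reg_r with (1 + 2 * (1 - x)); [lra|]. rewrite Rinv_l by lra. nra.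
Qed.

Lemma ln_le_minus x : 0 < x -> ln x <= x - 1.
Proof.
  intros H. rewrite <- (ln_exp (x - 1)). apply ln_le; auto. pose proof (exp_ineq1_le (x - 1)). lra.
Qed.

(** Two regimes. Outside the circle of radius 1 - 1/(2D), [outer_bound] puts W near 1. Inside it,
    [pD W] is e^{DW} minus the tail; being negligible, it forces the two to have comparable moduli,
    e^{D Re W} and e^{D (ln |W| + 1)} up to powers of D, and the exponents are compared. *)
Theorem zero_location e1 : 0 < e1 -> e1 <= 1 -> exists D0, forall D W, (D0 <= D)%nat ->
  Cmod (pD D W) <= exp (- (3 * INR D)) * Rmax 1 (Cmod W) ^ D ->
  W <> RtoC 0 /\ Cmod W <= 1 + e1 /\ Rabs (ln (Cmod W) + 1 - Re W) <= e1.
Proof.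
  intros He0 He1. set (e0 := e1 / 4).
  (* T makes 1/T small and DT then makes T/D small; D1 and D2 let e^{e1 D} beat the powers of D in
     the two inner cases, and D3 makes e^D exceed 100. *)
  destruct (INR_unbounded (64 / e0)) as [T HT]. 
  destruct (INR_unbounded (64 * INR T / e0)) as [DT HDT].
  destruct (exp_beats_square e1 4 He0) as [D1 HD1].
  destruct (exp_beats_square e1 (16 * exp 3) He0) as [D2 HD2].
  destruct (exp_beats_square 1 100 ltac:(lra)) as [D3 HD3].
  exists (10 + DT + D1 + D2 + D3)%nat. intros D W HD Hp.
  assert (HDge : (2 <= D)%nat) by lia. assert (HDp := D_pos D HDge).
  assert (He0p : 0 < e0) by (unfold e0; lra).
  assert (HTp : (1 <= T)%nat).
  { destruct T; [|lia]. simpl in HT. assert (0 < 64 / e0) by (apply Rdiv_lt_0_compat; lra). lra. }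
  assert (HTp' : 1 <= INR T) by (apply (le_INR 1); auto).
  specialize (HD1 D ltac:(lia)). specialize (HD2 D ltac:(lia)). specialize (HD3 D ltac:(lia)).
  assert (Hsmall : exp (- (3 * INR D)) <= / 100).
  { rewrite exp_Ropp. apply Rinv_le_contravar; [lra|]. apply Rle_trans with (exp (1 * INR D)); [nra|apply exp_le; lra]. }
  pose proof (Cmod_ge_0 W) as Hw0. set (w := Cmod W) in *.
  assert (HRe : - w <= Re W <= w) by (apply Rabs_le_between, re_le_Cmod).
  destruct (Rle_lt_dec (1 - / (2 * INR D)) w) as [Hout|Hin].
  - assert (Hd : Cmod (W - 1) <= e0).
    { eapply Rle_trans; [apply (outer_bound D HDge W T HTp Hout)|].
      - eapply Rle_trans; [exact Hp|]. apply Rmult_le_compat_r; auto. apply pow_le. eapply Rle_trans; [|apply Rmax_l]. lra.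
      - assert (A1 : INR T / INR D <= e0 / 64).
        { assert (INR DT <= INR D) by (apply le_INR; lia). apply Rmult_le_reg_r with (INR D); [lra|].
          unfold Rdiv at 1. rewrite Rmult_assoc, Rinv_l by lra.
          assert (64 * INR T / e0 <= INR D) by lra. apply Rmult_le_compat_l with (r := e0 / 64) in H0; [|lra].
          replace (e0 / 64 * (64 * INR T / e0)) with (INR T) in H0 by (field; lra). lra. }
        assert (A2 : / INR T <= e0 / 64).
        { replace (e0 / 64) with (/ (64 / e0)) by (field; lra). apply Rinv_le_contravar; [apply Rdiv_lt_0_compat; lra|lra]. }
        lra. }
    assert (Hw1 : w <= 1 + e0).
    { pose proof (Cmod_tri_inv2 W 1). rewrite Cmod_1 in H. fold w in H. lra. }
    assert (Hw2 : 1 - e0 <= w).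
    { pose proof (Cmod_tri_inv2 1 W). rewrite Cmod_1, Cmod_minus_sym in H. fold w in H. lra. }
    assert (HR : - e0 <= 1 - Re W <= e0).
    { pose proof (re_le_Cmod (W - 1)) as H. apply Rabs_le_between in H. replace (Re (W - 1)%C) with (Re W - 1) in H by (destruct W; simpl; ring). lra. }
    assert (He4 : e0 <= 1 / 4) by (unfold e0; lra).
    split; [|split].
    + apply Cmod_gt_0. fold w. lra.
    + unfold e0 in *. lra.
    + assert (L1 : ln w <= e0) by (pose proof (ln_le_minus w ltac:(lra)); lra).
      assert (L2 : - (2 * e0) <= ln w).
      { destruct (Rle_lt_dec w 1) as [h|h].
        - pose proof (ln_ge_near_1 w ltac:(lra) h). lra.
        - pose proof (ln_le 1 w ltac:(lra) ltac:(lra)) as Hl. rewrite ln_1 in Hl. lra. }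
      apply Rabs_le. unfold e0 in *. lra.
  - assert (Hi : 0 < / (2 * INR D)) by (apply Rinv_0_lt_compat; lra). assert (Hwlt : w < 1) by lra.
    assert (Hmax : Rmax 1 w ^ D = 1) by (rewrite Rmax_left, pow1; lra).
    rewrite Hmax, Rmult_1_r in Hp.
    assert (Hinv : / (1 - w) <= 2 * INR D).
    { rewrite <- (Rinv_inv (2 * INR D)). apply Rinv_le_contravar; lra. }
    pose proof (tail_upper D HDge W Hwlt) as TU. pose proof (tail_lower D HDge W Hwlt) as TL. fold w in TU, TL.
    pose proof (ac_D_upper D HDge) as AU. pose proof (ac_D_lower D ltac:(lia)) as AL. fold (ac D D) in AL.
    assert (HE : Cmod (Cexp (RtoC (INR D) * W)) = exp (INR D * Re W)).
    { rewrite Cmod_Cexp. f_equal. apply re_scal_l. }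
    (* On the unit disc |e^{DW}| is at least e^{-D}, so e^{-3D} is at most a hundredth of it. *)
    assert (HEl : exp (- INR D) <= exp (INR D * Re W)) by (apply exp_le; nra).
    assert (H3D : exp (- (3 * INR D)) <= exp (- INR D) / 100).
    { replace (- (3 * INR D)) with (- INR D + - (2 * INR D)) by ring. rewrite exp_plus. apply Rmult_le_compat_l; [left; apply exp_pos|].
      rewrite exp_Ropp. apply Rinv_le_contravar; [lra|]. apply Rle_trans with (exp (1 * INR D)); [nra|apply exp_le; lra]. }
    pose proof (exp_pos (- INR D)) as HeD.
    assert (HW0 : W <> RtoC 0).
    { intros F. rewrite F in Hp. replace (pD D 0) with (RtoC 1) in Hp.
      - rewrite Cmod_1 in Hp. lra.
      - unfold pD. rewrite Csum_Sl, Csum_zero; [unfold ac; simpl; rewrite RtoC_div by lra; field|]. intros i _. simpl. ring. }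
    assert (Hwp : 0 < w) by (apply Cmod_gt_0; auto).
    assert (HwD : w ^ D * exp (INR D) = exp (INR D * (ln w + 1))).
    { rewrite exp_INR_mult, exp_plus, exp_ln, Rpow_mult_distr by auto. f_equal. rewrite <- exp_INR_mult, Rmult_1_r. reflexivity. }
    assert (HwDp : 0 < w ^ D) by (apply pow_lt; auto).
    split; [auto|split; [lra|]]. apply Rabs_le. split; apply Rnot_lt_le; intros Hlt.
    (* If ln |W| + 1 - Re W < -e1, the tail is at most half of |e^{DW}|, and [pD W] would be too
       large. *)
    + assert (TU2 : Cmod (Cexp (RtoC (INR D) * W) - pD D W) <= exp (INR D * Re W) / 2).
      { eapply Rle_trans; [exact TU|].
        apply Rle_trans with (exp (INR D) * w ^ D * (2 * INR D)).
        - unfold Rdiv. apply Rmult_le_compat; auto; [|left; apply Rinv_0_lt_compat; lra|].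
          + apply Rmult_le_pos; [left; apply ac_pos; auto|lra].
          + apply Rmult_le_compat_r; lra.
        - rewrite (Rmult_comm (exp _)), HwD.
          apply Rle_trans with (exp (INR D * Re W + - (e1 * INR D)) * (2 * INR D)).
          + apply Rmult_le_compat_r; [lra|]. apply exp_le. nra.
          + rewrite exp_plus, exp_Ropp. pose proof (exp_pos (INR D * Re W)). pose proof (exp_pos (e1 * INR D)).
            rewrite Rmult_assoc. apply Rmult_le_compat_l; [lra|].
            apply Rmult_le_reg_l with (exp (e1 * INR D)); auto. rewrite <- Rmult_assoc, Rinv_r by lra. nra. }
      pose proof (Cmod_tri_inv2 (Cexp (RtoC (INR D) * W)) (Cexp (RtoC (INR D) * W) - pD D W)) as Ht.
      replace (Cexp (RtoC (INR D) * W) - (Cexp (RtoC (INR D) * W) - pD D W))%C with (pD D W) in Ht by ring. rewrite HE in Ht. lra.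
    (* In the opposite case the tail is at most 2 |e^{DW}|, whereas [tail_lower] makes it at least
       of order e^{e1 D}/D^2 times |e^{DW}|. *)
    + assert (TU3 : Cmod (Cexp (RtoC (INR D) * W) - pD D W) <= 2 * exp (INR D * Re W)).
      { eapply Rle_trans; [apply Cmod_tri2|]. rewrite HE. lra. }
      assert (Hac : INR D * ac D D <= 2 * INR D * ac D (S D)).
      { pose proof (ac_S D HDge D) as E. rewrite S_INR in E. pose proof (ac_pos D HDge (S D)). nra. }
      assert (Hwl : exp (-2) <= w).
      { rewrite <- (exp_ln w) by auto. apply exp_le. lra. }
      (* ac (S D) w^(D+1) (1-w) >= e^{D-1}/(2D) w^D e^{-2} / (2D) *)
      assert (LB : exp (INR D * Re W) * exp (e1 * INR D) * exp (-3) <= 4 * INR D ^ 2 * (ac D (S D) * w ^ S D * (1 - w))).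
      { apply Rle_trans with (exp (INR D - 1) * w ^ D * exp (-2)).
        - replace (INR D - 1) with (INR D + -1) by ring. rewrite exp_plus.
          replace (exp (INR D) * exp (-1) * w ^ D * exp (-2)) with ((w ^ D * exp (INR D)) * (exp (-1) * exp (-2))) by ring.
          rewrite HwD, <- !exp_plus. apply exp_le. nra.
        - simpl (w ^ S D).
          apply Rle_trans with ((2 * INR D * ac D (S D)) * w ^ D * w).
          + apply Rmult_le_compat; auto; [|left; apply exp_pos|].
            * apply Rmult_le_pos; [left; apply exp_pos|lra].
            * apply Rmult_le_compat_r; [lra|]. lra.
          + pose proof (ac_pos D HDge (S D)) as Hap. assert (H1 : 1 <= 2 * INR D * (1 - w)).
            { apply Rmult_le_compat_r with (r := 1 - w) in Hinv; [|lra]. rewrite Rinv_l in Hinv by lra. lra. }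
            set (X := ac D (S D) * (w * w ^ D)) in *.
            assert (HX : 0 < X) by (unfold X; apply Rmult_lt_0_compat; auto; apply Rmult_lt_0_compat; auto).
            replace (2 * INR D * ac D (S D) * w ^ D * w) with (2 * INR D * X) by (unfold X; ring).
            replace (4 * INR D ^ 2 * (X * (1 - w))) with (2 * INR D * X * (2 * INR D * (1 - w))) by ring.
            rewrite <- (Rmult_1_r (2 * INR D * X)) at 1. apply Rmult_le_compat_l; auto. apply Rmult_le_pos; lra. }
      assert (UB : 4 * INR D ^ 2 * (ac D (S D) * w ^ S D * (1 - w)) <= 16 * INR D ^ 2 * exp (INR D * Re W)).
      { pose proof (pow2_ge_0 (INR D)). replace (16 * INR D ^ 2 * exp (INR D * Re W)) with (4 * INR D ^ 2 * (4 * exp (INR D * Re W))) by ring.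
        apply Rmult_le_compat_l; lra. }
      assert (FB : exp (e1 * INR D) * exp (-3) <= 16 * INR D ^ 2).
      { apply Rmult_le_reg_l with (exp (INR D * Re W)); [apply exp_pos|]. lra. }
      replace (-3) with (- (3)) in FB by ring. rewrite exp_Ropp in FB. pose proof (exp_pos 3) as H3.
      apply Rmult_le_compat_r with (r := exp 3) in FB; [|lra]. rewrite Rmult_assoc, Rinv_l, Rmult_1_r in FB by lra. lra.
Qed.

(** * The Szego curve *)

Lemma exp_convex_gap d e : 0 <= e -> e <= d -> e - 1 + exp (- e) <= d - 1 + exp (- d).
Proof.
  intros He Hd. replace (exp (- d)) with (exp (- e) * exp (- (d - e))) by (rewrite <- exp_plus; f_equal; ring).
  pose proof (exp_ineq1_le (- (d - e))). pose proof (exp_pos (- e)).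
  assert (exp (- e) <= 1) by (rewrite <- exp_0; apply exp_le; lra). nra.
Qed.

Lemma exp_gap_pos e : 0 < e -> 0 < e - 1 + exp (- e).
Proof. intros He. pose proof (exp_ineq1 (- e) ltac:(lra)). lra. Qed.

(** On a vertical line the curve has the equation u + 1 - c e^u = 0, with u the logarithm of the
    modulus of 24 s q and c = s cos(2 pi x). For c = 1 the derivative vanishes at u = 0, so
    increments are bounded below only by the gap d - 1 + e^{-d}, quadratic for small d. *)
Lemma szego_gap c eta u w : -1 <= c <= 1 -> 0 <= eta -> u <= w -> exp w <= 1 + eta ->
  (w - u) - 1 + exp (- (w - u)) - eta <= (w + 1 - exp w * c) - (u + 1 - exp u * c).
Proof.
  intros Hc He Hu Hw. replace (exp u) with (exp w * exp (- (w - u))) by (rewrite <- exp_plus; f_equal; ring).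
  pose proof (exp_pos w). pose proof (exp_pos (- (w - u))).
  assert (exp (- (w - u)) <= 1) by (rewrite <- exp_0; apply exp_le; lra).
  set (E := exp (- (w - u))) in *. assert (0 <= 1 - E <= 1) by lra.
  assert (exp w * c * (1 - E) <= exp w * (1 - E)).
  { apply Rmult_le_compat_r; [lra|]. nra. }
  nra.
Qed.

(** An exact root exists in [-3, 0] because the function is negative at -3 and equals 1 - c >= 0 at
    0; [szego_gap] then keeps every approximate root close to it. *)
Lemma szego_root_near eps : 0 < eps -> exists eta, 0 < eta <= 1 /\
  forall c U, -1 <= c <= 1 -> exp U <= 1 + eta -> Rabs (U + 1 - exp U * c) <= eta ->
  exists u0, u0 <= 0 /\ u0 + 1 - exp u0 * c = 0 /\ Rabs (U - u0) <= eps.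
Proof.
  intros He. pose proof (exp_gap_pos eps He) as Hg.
  exists (Rmin 1 ((eps - 1 + exp (- eps)) / 3)). split.
  { split; [apply Rmin_pos; lra|apply Rmin_l]. }
  intros c U Hc HU HhU. set (eta := Rmin 1 ((eps - 1 + exp (- eps)) / 3)) in *.
  assert (Heta : 0 < eta) by (apply Rmin_pos; lra).
  assert (Heta3 : 3 * eta <= eps - 1 + exp (- eps)) by (pose proof (Rmin_r 1 ((eps - 1 + exp (- eps)) / 3)); unfold eta; lra).
  destruct (IVT_gen (fun u => u + 1 - exp u * c) (-3) 0 0) as [u0 [[Hu1 Hu2] Hu3]].
  { intros x. apply derivable_continuous_pt. reg. }
  { assert (exp (-3) <= 1) by (rewrite <- exp_0; apply exp_le; lra). pose proof (exp_pos (-3)). rewrite exp_0.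
    rewrite Rmin_left, Rmax_right; nra. }
  rewrite Rmin_left in Hu1 by lra. rewrite Rmax_right in Hu2 by lra.
  exists u0. split; [lra|]. split; [exact Hu3|].
  destruct (Rle_dec (Rabs (U - u0)) eps) as [h|h]; [exact h|exfalso]. apply Rnot_le_lt in h.
  apply Rabs_le_between in HhU.
  assert (Hu0 : exp u0 <= 1 + eta) by (assert (exp u0 <= exp 0) by (apply exp_le; lra); rewrite exp_0 in *; lra).
  destruct (Rle_dec u0 U) as [h1|h1].
  - rewrite Rabs_right in h by lra. pose proof (szego_gap c eta u0 U Hc ltac:(lra) h1 HU).
    pose proof (exp_convex_gap (U - u0) eps ltac:(lra) ltac:(lra)). lra.
  - rewrite Rabs_left in h by lra. pose proof (szego_gap c eta U u0 Hc ltac:(lra) ltac:(lra) Hu0).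
    pose proof (exp_convex_gap (u0 - U) eps ltac:(lra) ltac:(lra)). replace (- (U - u0)) with (u0 - U) in * by ring. lra.
Qed.

Lemma Re_eu z : Re (eu z) = Cmod (eu z) * cos (2 * PI * Re z).
Proof.
  rewrite Cmod_eu. unfold eu, Cexp. destruct z as [x y]. simpl. f_equal; [f_equal; ring|f_equal; ring].
Qed.

Lemma Re_scal_eu a z : Re (RtoC a * eu z)%C = a * Cmod (eu z) * cos (2 * PI * Re z).
Proof. rewrite Rmult_assoc, <- Re_eu. destruct (eu z). simpl. ring. Qed.

(** The point of the curve is sought on the vertical line through [tau]: the real part is kept, and
    only the height is moved to the exact root. [X] stands for L/D, the inverse of |1 - delta|. *)
Lemma Sdelta_near eps : 0 < eps -> exists eta, 0 < eta <= 1 /\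
  forall s tau delta X, s = 1 \/ s = -1 -> inF tau -> 0 < X -> Rabs (1 - delta) = / X ->
  Cmod (RtoC (24 * s * X) * eu tau)%C <= 1 + eta ->
  Rabs (ln (Cmod (RtoC (24 * s * X) * eu tau)%C) + 1 - Re (RtoC (24 * s * X) * eu tau)%C) <= eta ->
  exists w, Sdelta s delta w /\ Cmod (tau - w)%C < eps.
Proof.
  intros He. destruct (szego_root_near eps He) as [eta [Heta Hroot]]. exists eta. split; [exact Heta|].
  intros s tau delta X Hs Htau HX Hd H1 H2. pose proof PI_lower as HPI.
  assert (Hsa : Rabs s = 1) by (destruct Hs; subst; [apply Rabs_R1|rewrite Rabs_left; lra]).
  set (c := s * cos (2 * PI * Re tau)).
  assert (Hc : -1 <= c <= 1) by (pose proof (COS_bound (2 * PI * Re tau)); unfold c; destruct Hs; subst; lra).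
  assert (Hm : Cmod (RtoC (24 * s * X) * eu tau)%C = 24 * X * exp (- (2 * PI) * Im tau)).
  { rewrite Cmod_mult, Cmod_eu, Cmod_R, !Rabs_mult, Hsa, (Rabs_right 24), (Rabs_right X) by lra. ring. }
  set (U := ln 24 + ln X - 2 * PI * Im tau).
  assert (HeU : exp U = 24 * X * exp (- (2 * PI) * Im tau)).
  { unfold U. unfold Rminus. rewrite !exp_plus, !exp_ln by lra. do 2 f_equal. ring. }
  assert (HU : ln (Cmod (RtoC (24 * s * X) * eu tau)%C) = U) by (rewrite Hm, <- HeU; apply ln_exp).
  rewrite HU, Re_scal_eu in H2. rewrite Hm, <- HeU in H1.
  destruct (Hroot c U Hc H1) as [u0 [Hu0 [Hu1 Hu2]]].
  { replace (exp U * c) with (24 * s * X * Cmod (eu tau) * cos (2 * PI * Re tau)); [exact H2|].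
    rewrite HeU, Cmod_eu. unfold c. ring. }
  destruct Htau as [Ht1 [Ht2 Ht3]].
  (* The height makes |24 [eu t]| equal to e^{u0}; it is positive since u0 <= 0 < ln 24. *)
  set (t := (Re tau, (ln 24 - u0) / (2 * PI)) : C).
  exists (t - Ci / RtoC (2 * PI) * RtoC (ln (Rabs (1 - delta))))%C. split.
  - exists t. split; [|reflexivity].
    assert (Hln : 0 < ln 24) by (rewrite <- ln_1; apply ln_increasing; lra).
    split; [unfold in_H, t; simpl; apply Rdiv_lt_0_compat; lra|].
    split; [exact Ht2|].
    change (Cexp (RtoC (2 * PI) * Ci * t)) with (eu t).
    assert (Hmt : Cmod (RtoC (s * 24) * eu t)%C = exp u0).
    { rewrite Cmod_mult, Cmod_eu, Cmod_R, Rabs_mult, Hsa, (Rabs_right 24) by lra. unfold t. simpl Im.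
      replace (- (2 * PI) * ((ln 24 - u0) / (2 * PI))) with (u0 + - ln 24) by (field; lra).
      rewrite exp_plus, exp_Ropp, exp_ln by lra. field. }
    assert (Hret : Re (RtoC (s * 24) * eu t)%C = exp u0 * c).
    { rewrite Re_scal_eu. rewrite Cmod_mult, Cmod_R, Rabs_mult, Hsa, (Rabs_right 24) in Hmt by lra.
      unfold c. rewrite <- Hmt. unfold t. simpl Re. ring. }
    split; [|rewrite Hmt, <- exp_0; apply exp_le; lra].
    rewrite Cmod_mult, Cmod_Cexp, Hmt, <- exp_plus.
    change (Re (RtoC 1 - RtoC (s * 24) * eu t)%C) with (1 - Re (RtoC (s * 24) * eu t)%C). rewrite Hret.
    replace (exp u0 * c) with (u0 + 1) by lra. replace (u0 + (1 - (u0 + 1))) with 0 by ring. apply exp_0.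
  - rewrite Hd, ln_Rinv by lra.
    replace (tau - (t - Ci / RtoC (2 * PI) * RtoC (- ln X)))%C with (Ci * RtoC ((u0 - U) / (2 * PI)))%C.
    + rewrite Cmod_mult, Cmod_R. replace (Cmod Ci) with 1.
      2:{ unfold Cmod. simpl. replace (0 * (0 * 1) + 1 * (1 * 1)) with 1 by ring. symmetry. apply sqrt_1. }
      rewrite Rmult_1_l, Rabs_div by lra. rewrite (Rabs_right (2 * PI)) by lra. rewrite Rabs_minus_sym in Hu2.
      apply Rle_lt_trans with (eps / (2 * PI)).
      * apply Rmult_le_compat_r; [left; apply Rinv_0_lt_compat; lra|exact Hu2].
      * apply Rmult_lt_reg_r with (2 * PI); [lra|]. replace (eps / (2 * PI) * (2 * PI)) with eps by (field; lra). nra.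
    + unfold Cdiv; rewrite <- ?RtoC_inv by lra.
      unfold U, t. destruct tau as [x y]. apply C_eq; simpl; field; lra.
Qed.

(** * From approximate zeros to the theorem *)

Lemma growth_bound kappa B : 0 < kappa < 1 -> exists M, 0 < M /\ forall K d, M < K -> d < kappa * ln K / ln (ln K) ->
  B * exp (6 * d) <= K / 24.
Proof.
  intros Hk. pose proof (Rle_abs B) as HB. pose proof (Rabs_pos B) as HB0. set (b := 24 * Rabs B + 24).
  assert (Hb : 24 <= b) by (unfold b; lra).
  assert (Hlb : 0 < ln b) by (rewrite <- ln_1; apply ln_increasing; lra).
  (* exp 12 gives ln (ln K) >= 12, hence d <= ln K / 12 and e^{6d} <= sqrt K; the summand 2 ln b
     gives sqrt K >= b, which absorbs the factor 24 B. *)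
  exists (exp (exp 12 + 2 * ln b)). split; [apply exp_pos|]. intros K d HK Hd.
  pose proof (exp_pos 12). pose proof (exp_pos (exp 12 + 2 * ln b)).
  assert (Hl : exp 12 + 2 * ln b < ln K) by (rewrite <- (ln_exp (exp 12 + 2 * ln b)); apply ln_increasing; lra).
  assert (Hll : 12 <= ln (ln K)) by (rewrite <- (ln_exp 12); apply ln_le; lra).
  assert (Hd12 : d <= ln K / 12).
  { left. eapply Rlt_le_trans; [exact Hd|]. unfold Rdiv. apply Rmult_le_compat; [nra|left; apply Rinv_0_lt_compat; lra|nra|].
    apply Rinv_le_contravar; lra. }
  assert (He : exp (6 * d) <= exp (ln K / 2)) by (apply exp_le; lra).
  assert (Hb2 : b <= exp (ln K / 2)) by (rewrite <- (exp_ln b) by lra; apply exp_le; lra).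
  assert (HKe : K = exp (ln K / 2) * exp (ln K / 2)) by (rewrite <- exp_plus, <- Rdiv_plus_distr, <- (exp_ln K) at 1 by lra; f_equal; field).
  pose proof (exp_pos (6 * d)). pose proof (exp_pos (ln K / 2)).
  apply Rle_trans with (Rabs B * exp (ln K / 2)); [nra|]. set (y := exp (ln K / 2)) in *. unfold b in *. nra.
Qed.

(** 0, 4, 6, 8, 10 and 14 are the values of 4u + 6v; 14, with u = 2 and v = 1, stands for the
    residue 2. *)
Lemma ell_spec k : Z.even k = true -> exists u v : nat, (u <= 2)%nat /\ (v <= 1)%nat /\ k = (12 * ell k + 4 * Z.of_nat u + 6 * Z.of_nat v)%Z.
Proof.
  intros He. apply Z.even_spec in He. destruct He as [j Hj]. unfold ell.
  pose proof (Z.div_mod k 12 ltac:(lia)) as Hk. pose proof (Z.mod_pos_bound k 12 ltac:(lia)) as Hb.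
  destruct (Z.eqb_spec (k mod 12) 2) as [h|h].
  - exists 2%nat, 1%nat. split; [lia|]. split; [lia|].
    replace (k - 14)%Z with ((k / 12 - 1) * 12)%Z by lia. rewrite Z.div_mul by lia. lia.
  - set (r := (k mod 12)%Z) in *. set (l := (k / 12)%Z) in *.
    assert (Hr : (r = 0 \/ r = 4 \/ r = 6 \/ r = 8 \/ r = 10)%Z) by lia.
    destruct Hr as [Hr|[Hr|[Hr|[Hr|Hr]]]];
      [exists 0%nat, 0%nat|exists 1%nat, 0%nat|exists 0%nat, 1%nat|exists 2%nat, 0%nat|exists 1%nat, 1%nat]; lia.
Qed.

Lemma Csum_rev_pow (c : nat -> C) x v D : (x * v = 1)%C ->
  Csum (fun i => c i * v ^ i)%C (S D) = (v ^ D * Csum (fun i => c i * x ^ (D - i)) (S D))%C.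
Proof.
  intros H. rewrite <- Csum_scal. apply Csum_ext. intros i Hi.
  replace (v ^ D)%C with (v ^ i * v ^ (D - i))%C by (rewrite <- Cpow_add_r; f_equal; lia).
  assert (G : forall n, (v ^ n * x ^ n = 1)%C).
  { intros n. rewrite <- Cpow_mult_l, (Cmult_comm v x), H. apply Cpow_1_l. }
  replace (v ^ i * v ^ (D - i) * (c i * x ^ (D - i)))%C with (c i * v ^ i * (v ^ (D - i) * x ^ (D - i)))%C by ring.
  rewrite G. ring.
Qed.

Lemma Rmax_pow_le W D i : 0 <= W -> (i <= D)%nat -> W ^ i <= Rmax 1 W ^ D.
Proof.
  intros HW Hi. apply Rle_trans with (Rmax 1 W ^ i).
  - apply pow_incr. split; [auto|apply Rmax_r].
  - apply Rle_pow; [apply Rmax_l|auto].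
Qed.

(** Dividing by x^D gives a polynomial in v = 1/x with |v| = r |W|, so the norm of radius r controls
    the perturbation up to max(1, |W|)^D. The value x = 0 would force c D = 0, although the model
    coefficient times r^D is D^D/D! >= 1 > beta. *)
Lemma zero_perturbed_exp (s : R) (L D : nat) (c : PS) (beta : R) (x : C) : Rabs s = 1 -> (1 <= L)%nat -> (2 <= D)%nat -> beta < 1 ->
  Nm (INR D / (24 * INR L)) D (pssub c (expseq (24 * s * INR L))) <= beta ->
  Csum (fun i => c i * x ^ (D - i))%C (S D) = 0 ->
  x <> 0 /\ Cmod (pD D (RtoC (24 * s * INR L / INR D) / x)%C) <= beta * Rmax 1 (Cmod (RtoC (24 * s * INR L / INR D) / x)%C) ^ D.
Proof.
  intros Hs HL HD Hb HN Hz. apply (le_INR 1) in HL. simpl in HL.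
  assert (HDp : 2 <= INR D) by (apply (le_INR 2) in HD; simpl in HD; lra).
  set (r := INR D / (24 * INR L)) in *. set (T := 24 * s * INR L) in *.
  assert (Hr : 0 < r) by (apply Rdiv_lt_0_compat; lra).
  assert (HT : Rabs T * r = INR D) by (unfold T, r; rewrite !Rabs_mult, Hs, !Rabs_right by lra; field; lra).
  assert (HT0 : T <> 0) by (intros h; rewrite h, Rabs_R0 in HT; lra).
  assert (Hx : x <> 0).
  { intros h. rewrite h in Hz. rewrite (Csum_single _ (S D) D) in Hz; [|lia|].
    2:{ intros i Hi Hn. replace (D - i)%nat with (S (D - i - 1)) by lia. simpl. ring. }
    rewrite Nat.sub_diag in Hz. simpl in Hz. rewrite Cmult_1_r in Hz.
    assert (Ht : Cmod (pssub c (expseq T) D) * r ^ D <= beta).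
    { eapply Rle_trans; [|exact HN]. unfold Nm.
      apply (Rsum_term (fun n => Cmod (pssub c (expseq T) n) * r ^ n) (S D) D); [|lia].
      intros i. apply Rmult_le_pos; [apply Cmod_ge_0|apply pow_le; lra]. }
    unfold pssub in Ht. rewrite Hz in Ht. replace (0 - expseq T D)%C with (- expseq T D)%C in Ht by ring.
    rewrite Cmod_opp in Ht. unfold expseq in Ht. rewrite Cmod_R in Ht. unfold Rdiv in Ht.
    rewrite Rabs_mult, <- RPow_abs, (Rabs_right (/ INR (fact D))) in Ht.
    2:{ left. apply Rinv_0_lt_compat, INR_fact_lt_0. }
    replace (Rabs T ^ D * / INR (fact D) * r ^ D) with ((Rabs T * r) ^ D / INR (fact D)) in Ht
      by (rewrite Rpow_mult_distr; field; apply INR_fact_neq_0).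
    rewrite HT in Ht. pose proof (ac_D_ge1 D HD). unfold ac in *. lra. }
  split; [exact Hx|]. set (W := (RtoC (T / INR D) / x)%C). set (v := (/ x)%C).
  assert (Hxv : (x * v = 1)%C) by (apply Cinv_r; auto).
  assert (Hv0 : Csum (fun i => c i * v ^ i)%C (S D) = 0) by (rewrite (Csum_rev_pow c x v D Hxv), Hz; ring).
  assert (HW : W = (RtoC (T / INR D) * v)%C) by reflexivity.
  assert (Hmv : Cmod v = r * Cmod W).
  { rewrite HW, Cmod_mult, Cmod_R, Rabs_div, (Rabs_right (INR D)) by lra.
    replace (r * (Rabs T / INR D * Cmod v)) with (Rabs T * r / INR D * Cmod v) by (field; lra). rewrite HT. field. lra. }
  assert (HpD : pD D W = (- Csum (fun i => (pssub c (expseq T) i) * v ^ i) (S D))%C).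
  { assert (E : forall A B : C, (A + B = 0)%C -> A = (- B)%C).
    { intros A B h. replace A with (A + B - B)%C by ring. rewrite h. ring. }
    apply E. rewrite <- Hv0. unfold pD. rewrite <- Csum_plus. apply Csum_ext. intros i Hi.
    unfold pssub, expseq. rewrite HW, Cpow_mult_l, <- RtoC_pow.
    replace (RtoC (T ^ i / INR (fact i))) with (RtoC (ac D i) * RtoC ((T / INR D) ^ i))%C; [ring|].
    rewrite <- RtoC_mult. f_equal. unfold ac. unfold Rdiv. rewrite Rpow_mult_distr, pow_inv. field.
    split; [apply INR_fact_neq_0|apply pow_nonzero; lra]. }
  rewrite HpD, Cmod_opp. eapply Rle_trans; [apply Cmod_Csum|].
  apply Rle_trans with (Nm r D (pssub c (expseq T)) * Rmax 1 (Cmod W) ^ D).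
  2:{ apply Rmult_le_compat_r; [apply pow_le; pose proof (Rmax_l 1 (Cmod W)); lra|exact HN]. }
  unfold Nm. rewrite <- Rsum_scal_r. apply Rsum_le. intros i Hi. rewrite Cmod_mult, Cmod_pow, Hmv, Rpow_mult_distr.
  rewrite <- Rmult_assoc. apply Rmult_le_compat_l.
  - apply Rmult_le_pos; [apply Cmod_ge_0|apply pow_le; lra].
  - apply Rmax_pow_le; [apply Cmod_ge_0|lia].
Qed.

(** 270 = 3^3 / 0.1, from |E4| <= 3 and the lower bound in [Delta_high]. *)
Lemma jf_upper z : in_H z -> 0.86 <= Im z -> Cmod (jf z) * Cmod (eu z) <= 270.
Proof.
  intros Hz Hy. pose proof (eu_small z Hy) as Hq. pose proof (Cmod_ge_0 (eu z)) as Hq0.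
  assert (HE : Cmod (E4 z) <= 3).
  { rewrite (E4_sser z Hz).
    pose proof (sser3_expand (eu z) Hq) as H3.
    replace (1 + 240 * sser 3 (eu z))%C with (1 + 240 * (eu z + (9 * eu z ^ 2 + (sser 3 (eu z) - eu z - 9 * eu z ^ 2))))%C by ring.
    set (t := (sser 3 (eu z) - eu z - 9 * eu z ^ 2)%C) in *. set (m := Cmod (eu z)) in *.
    assert (M3 : m ^ 3 <= m ^ 2 * / 200) by (simpl; nra).
    assert (M2 : m ^ 2 <= m * / 200) by (simpl; nra).
    assert (B : Cmod (240 * (eu z + (9 * eu z ^ 2 + t)))%C <= 240 * (m + (9 * m ^ 2 + 83 * m ^ 3))).
    { rewrite Cmod_mult, Cmod_R, Rabs_right by lra. apply Rmult_le_compat_l; [lra|].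
      apply Cmod_add_le; [unfold m; lra|]. apply Cmod_add_le; [|exact H3].
      rewrite Cmod_mult, Cmod_R, Cmod_pow, Rabs_right by lra. unfold m. lra. }
    eapply Rle_trans; [apply Cmod_triangle|]. rewrite Cmod_1. lra. }
  destruct (Delta_high z Hy Hz) as [Hd _].
  assert (Hq1 : 0 < Cmod (eu z)) by (apply Cmod_gt_0, eu_neq0).
  unfold jf. unfold Cdiv. rewrite Cmod_mult, Cmod_pow, Cmod_inv by (apply Delta_neq0; auto).
  assert (H27 : Cmod (E4 z) ^ 3 <= 27).
  { replace 27 with (3 ^ 3) by ring. apply pow_incr. split; [apply Cmod_ge_0|lra]. }
  apply Rmult_le_reg_r with (Cmod (Delta z)); [nra|].
  replace (Cmod (E4 z) ^ 3 * / Cmod (Delta z) * Cmod (eu z) * Cmod (Delta z)) with (Cmod (E4 z) ^ 3 * Cmod (eu z)) by (field; nra).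
  nra.
Qed.

(** The factor 1 + th will be q j, which turns 24 s L/(D j) into 24 s (L/D) q. *)
Lemma perturb_factor e t (W th : C) : 0 <= e <= 1 -> 0 <= t <= 1 / 2 -> W <> 0 -> Cmod th <= t -> Cmod W <= 1 + e ->
  Rabs (ln (Cmod W) + 1 - Re W) <= e ->
  Cmod (W * (1 + th))%C <= 1 + (e + 4 * t) /\ Rabs (ln (Cmod (W * (1 + th))%C) + 1 - Re (W * (1 + th))%C) <= e + 4 * t.
Proof.
  intros He Ht HW Hth HW1 HWl. pose proof (proj1 (Cmod_gt_0 W) HW) as HWp.
  assert (Hup : Cmod (1 + th)%C <= 1 + t) by (eapply Rle_trans; [apply Cmod_triangle|]; rewrite Cmod_1; lra).
  assert (Hlo : 1 - t <= Cmod (1 + th)%C).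
  { pose proof (Cmod_triangle (1 + th) (- th)) as H. replace (1 + th + - th)%C with (RtoC 1) in H by ring. rewrite Cmod_1, Cmod_opp in H. lra. }
  assert (Hl1 : ln (Cmod (1 + th)%C) <= t).
  { rewrite <- (ln_exp t). apply ln_le; [lra|]. pose proof (exp_ineq1_le t). lra. }
  assert (Hl2 : - (2 * t) <= ln (Cmod (1 + th)%C)).
  { rewrite <- (ln_exp (- (2 * t))). apply ln_le; [apply exp_pos|]. apply Rle_trans with (1 - t); [|exact Hlo].
    rewrite exp_Ropp. pose proof (exp_ineq1_le (2 * t)). pose proof (exp_pos (2 * t)).
    apply Rmult_le_reg_l with (exp (2 * t)); [lra|]. rewrite Rinv_r by lra. nra. }
  rewrite Cmod_mult. split; [nra|].
  rewrite ln_mult by lra.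
  replace (W * (1 + th))%C with (W + W * th)%C by ring. rewrite re_plus.
  assert (HR : Rabs (Re (W * th)%C) <= 2 * t).
  { eapply Rle_trans; [apply re_le_Cmod|]. rewrite Cmod_mult. pose proof (Cmod_ge_0 th). nra. }
  apply Rabs_le_between in HR. apply Rabs_le_between in HWl. apply Rabs_le_between. lra.
Qed.

Lemma uniform_bound (P : nat -> R -> Prop) n : (forall i B B', B <= B' -> P i B -> P i B') ->
  (forall i, (i <= n)%nat -> exists B, P i B) -> exists B, forall i, (i <= n)%nat -> P i B.
Proof.
  intros Hm. induction n as [|n IH]; intros H.
  - destruct (H 0%nat ltac:(lia)) as [B HB]. exists B. intros i Hi. replace i with 0%nat by lia. exact HB.
  - destruct IH as [B1 H1]; [intros i Hi; apply H; lia|]. destruct (H (S n) ltac:(lia)) as [B2 H2].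
    exists (Rmax B1 B2). intros i Hi. destruct (Nat.eq_dec i (S n)) as [->|h].
    + eapply Hm; [apply Rmax_r|exact H2].
    + eapply Hm; [apply Rmax_l|apply H1; lia].
Qed.

(** One threshold B serves both for D and as the factor of e^{6D}. The property is then monotone in
    B, so the finitely many classes (s, u, v) can share a threshold. *)
Definition gkm_near (eps s : R) (u v : nat) (B : R) : Prop :=
  forall (k m : Z) (g : C -> C), is_gkm k m g -> k = (12 * ell k + 4 * Z.of_nat u + 6 * Z.of_nat v)%Z ->
    0 < s * IZR (ell k) -> B < IZR (ell k - m) -> B * exp (6 * IZR (ell k - m)) <= Rabs (IZR (ell k)) ->
    forall tau, inF tau -> tau <> Ci -> tau <> rho -> tau <> (rho + 1)%C -> g tau = 0 ->
    exists w, Sdelta s (IZR m / IZR (ell k)) w /\ Cmod (tau - w)%C < eps.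

Lemma gkm_near_mono eps s u v B B' : B <= B' -> gkm_near eps s u v B -> gkm_near eps s u v B'.
Proof.
  intros HB H k m g Hg Hk Hs HD HL. apply (H k m g Hg Hk Hs); [lra|].
  eapply Rle_trans; [|exact HL]. apply Rmult_le_compat_r; [left; apply exp_pos|exact HB].
Qed.

Lemma gkm_near_class s u v eps : s = 1 \/ s = -1 -> (u <= 2)%nat -> (v <= 1)%nat -> 0 < eps ->
  exists B, gkm_near eps s u v B.
Proof.
  intros Hs Hu Hv Heps. destruct (Sdelta_near eps Heps) as [eta [Heta HS]].
  destruct (zero_location (eta / 2) ltac:(lra) ltac:(lra)) as [D0 HD0].
  set (Wser := if Rlt_dec 0 s then psinv Ah else Ah). set (Q := psinv (psmul (pspow a4 u) (pspow a6 v))).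
  assert (Hq0 : psmul (pspow a4 u) (pspow a6 v) O = RtoC 1).
  { rewrite psmul_0, !pspow_0; [ring|apply a6_vals|apply a4_vals]. }
  assert (HsR : Rabs s = 1) by (destruct Hs; subst; [apply Rabs_R1|rewrite Rabs_left; lra]).
  destruct (coef_estimate Wser Q s) as [C0 [eta0 [HC0 [Heta0 Hcoef]]]].
  { unfold Wser. destruct (Rlt_dec 0 s); [apply GB_inv; [apply GB_Ah|apply Ah_0]|apply GB_Ah]. }
  { unfold Wser. destruct (Rlt_dec 0 s); [apply psinv_0, Ah_0|apply Ah_0]. }
  { unfold Wser. destruct (Rlt_dec 0 s); [rewrite psinv_Ah_1|rewrite Ah_1]; f_equal; destruct Hs; lra. }
  { exact HsR. }
  { apply GB_inv; [apply GB_mul; apply GB_pow; [apply GB_a4|apply GB_a6]|exact Hq0]. }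
  { apply psinv_0, Hq0. }
  assert (Hth : EvB 1 (fun z => eu z * jf z + - RtoC 1)%C).
  { apply (Asy_EvB1 _ (psadd Uh (psc (- RtoC 1)))); [apply Asy_plus; [apply Asy_qj|apply Asy_const]|].
    unfold psadd. rewrite Uh_0. simpl. ring. }
  destruct Hth as [Bt [Y [HBt [HY Hth]]]].
  pose proof (Rinv_0_lt_compat _ Heta0) as Hie. pose proof (exp_pos (2 * PI * Y)) as HeY.
  pose proof PI_lower as HPI.
  assert (Hdiv : 0 <= 540 * 16 * Bt / eta) by (apply Rmult_le_pos; [nra|left; apply Rinv_0_lt_compat; lra]).
  (* 2 and D0 bound D from below; 1/eta0 and C0 are consumed by [coef_estimate]; the last two terms
     make |q| small enough for Im tau >= Y and |th| <= eta/16. *)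
  set (B := 2 + INR D0 + / eta0 + C0 + 540 * exp (2 * PI * Y) + 540 * 16 * Bt / eta).
  pose proof (pos_INR D0) as HD0p. assert (HB : 2 <= B) by (unfold B; lra).
  exists B.
  intros k m g Hg Hk Hsl HD HL tau Htau Hti Htr Htr1 Hz.
  destruct (gkm_structure k m g u v Hg Hk Hu Hv) as [c [a' [Hzc [Ha0 [Ha Hid]]]]].
  set (D := Z.to_nat (ell k - m)) in *. set (L := Z.abs_nat (ell k)).
  assert (HDm : (0 < ell k - m)%Z) by (apply lt_IZR; lra).
  assert (HDR : INR D = IZR (ell k - m)) by (unfold D; rewrite INR_IZR_INZ, Z2Nat.id by lia; reflexivity).
  assert (HLR : INR L = Rabs (IZR (ell k))) by (unfold L; rewrite INR_IZR_INZ, Zabs2Nat.id_abs, abs_IZR; reflexivity).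
  assert (HLs : IZR (ell k) = s * INR L).
  { rewrite HLR. destruct Hs; subst s; [rewrite Rabs_right|rewrite Rabs_left]; lra. }
  rewrite <- HDR in HD, HL. rewrite <- HLR in HL.
  pose proof (exp_ineq1_le (INR D)) as He1. set (E := exp (INR D)) in *.
  assert (HE6 : exp (6 * INR D) = E ^ 6) by (unfold E; rewrite <- exp_INR_mult; f_equal; simpl; ring).
  rewrite HE6 in HL. assert (HE1 : 1 <= E) by lra.
  assert (HEn : forall n, 1 <= E ^ n) by (intros n; apply pow_R1_Rle; exact HE1).
  assert (HLpos : B <= INR L) by (pose proof (HEn 6%nat); nra).
  assert (HDn : (D0 <= D)%nat) by (apply INR_le; unfold B in HD; lra).
  assert (HD2n : (2 <= D)%nat) by (apply INR_le; simpl; lra).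
  assert (HL1 : (1 <= L)%nat) by (apply INR_le; simpl; lra).
  (* With E = e^D, D <= E and L >= B E^6. The factor E in [coef_estimate] then leaves E^{-3}, which
     accounts for 6 = 2 + 1 + 3. *)
  assert (HDL : INR D ^ 2 / INR L <= / B * / E ^ 4).
  { apply Rle_trans with (E ^ 2 / (B * E ^ 6)).
    - unfold Rdiv. apply Rmult_le_compat; [apply pow_le; lra|left; apply Rinv_0_lt_compat; lra|apply pow_incr; lra|].
      apply Rinv_le_contravar; [|exact HL]. pose proof (HEn 6%nat). nra.
    - right. field. split; [|lra]. lra. }
  assert (HiB : 0 < / B) by (apply Rinv_0_lt_compat; lra).
  assert (HiE : / E ^ 4 <= 1).
  { rewrite <- Rinv_1. apply Rinv_le_contravar; [lra|apply HEn]. }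
  assert (HiEp : 0 < / E ^ 4) by (apply Rinv_0_lt_compat; pose proof (HEn 4%nat); lra).
  assert (HN : Nm (INR D / (24 * INR L)) D (pssub c (expseq (24 * s * INR L))) <= exp (- (3 * INR D))).
  { eapply Rle_trans; [apply (Hcoef L D c a')|]; auto; [lia| | |].
    - eapply Rle_trans; [exact HDL|]. apply Rle_trans with (/ B * 1); [apply Rmult_le_compat_l; lra|].
      rewrite Rmult_1_r. rewrite <- (Rinv_inv eta0). apply Rinv_le_contravar; [auto|unfold B; lra].
    - rewrite Hid. f_equal. f_equal. unfold Wser, pspowz. destruct (Rlt_dec 0 s) as [h|h].
      + assert (0 < ell k)%Z by (apply lt_IZR; destruct Hs; subst; lra).
        destruct (Z.leb_spec 0 (- ell k)); [lia|]. f_equal. unfold L. lia.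
      + assert (ell k < 0)%Z by (apply lt_IZR; destruct Hs; subst; lra).
        destruct (Z.leb_spec 0 (- ell k)); [|lia]. f_equal. unfold L. lia.
    - fold E. replace (exp (- (3 * INR D))) with (/ E ^ 3) by (unfold E; rewrite exp_Ropp, <- exp_INR_mult; do 2 f_equal; simpl; ring).
      apply Rle_trans with (C0 * (/ B * / E ^ 4) * E).
      + apply Rmult_le_compat_r; [lra|]. apply Rmult_le_compat_l; lra.
      + replace (C0 * (/ B * / E ^ 4) * E) with (C0 * / B * / E ^ 3) by (field; lra).
        rewrite <- (Rmult_1_l (/ E ^ 3)) at 2. apply Rmult_le_compat_r.
        * left. apply Rinv_0_lt_compat. pose proof (HEn 3%nat). lra.
        * apply Rmult_le_reg_r with B; [lra|]. rewrite Rmult_assoc, Rinv_l by lra. unfold B; lra. }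
  assert (Hb1 : exp (- (3 * INR D)) < 1) by (rewrite <- exp_0; apply exp_increasing; lra).
  specialize (Hzc tau Htau Hti Htr Htr1 Hz).
  destruct (zero_perturbed_exp s L D c _ (jf tau) HsR HL1 HD2n Hb1 HN Hzc) as [Hx HpD].
  set (W := (RtoC (24 * s * INR L / INR D) / jf tau)%C) in *.
  destruct (HD0 D W HDn HpD) as [HW0 [HW1 HW2]].
  assert (HHt : in_H tau) by apply Htau. pose proof (inF_Im tau Htau) as HIm.
  pose proof (jf_upper tau HHt HIm) as Hjq. pose proof (proj1 (Cmod_gt_0 _) Hx) as Hxp. pose proof (proj1 (Cmod_gt_0 _) (eu_neq0 tau)) as Hqp.
  assert (HWm : Cmod W * Cmod (jf tau) = 24 * (INR L / INR D)).
  { rewrite <- Cmod_mult. unfold W. replace (RtoC (24 * s * INR L / INR D) / jf tau * jf tau)%C with (RtoC (24 * s * INR L / INR D)) by (field; auto).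
    unfold Rdiv. rewrite Cmod_R, !Rabs_mult, HsR, Rabs_inv, !Rabs_right by lra. ring. }
  assert (HLD : B <= INR L / INR D).
  { apply Rmult_le_reg_r with (INR D); [lra|]. unfold Rdiv. rewrite Rmult_assoc, Rinv_l, Rmult_1_r by lra.
    eapply Rle_trans; [|exact HL]. apply Rmult_le_compat_l; [lra|]. apply Rle_trans with E; [lra|].
    change (E ^ 6) with (E * E ^ 5). pose proof (HEn 5%nat). nra. }
  (* As |W| < 2, |j| is at least 12 L/D >= 12 B, and |q j| <= 270 forces q to be small. *)
  assert (HqB : B * Cmod (eu tau) <= 540).
  { assert (Hj : 24 * B <= 2 * Cmod (jf tau)) by nra. nra. }
  assert (HYt : Y <= Im tau).
  { apply Rnot_lt_le. intros h. assert (exp (- (2 * PI * Y)) < Cmod (eu tau)).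
    { rewrite Cmod_eu. apply exp_increasing. nra. }
    assert (exp (2 * PI * Y) * exp (- (2 * PI * Y)) = 1) by (rewrite <- exp_plus, <- exp_0; f_equal; ring).
    assert (540 * exp (2 * PI * Y) + 2 <= B) by (unfold B; lra).
    pose proof (exp_pos (- (2 * PI * Y))). nra. }
  specialize (Hth tau HYt). simpl pow in Hth. rewrite Rmult_1_r in Hth.
  set (th := (eu tau * jf tau + - RtoC 1)%C) in *.
  assert (Ht : Cmod th <= eta / 16).
  { eapply Rle_trans; [exact Hth|].
    assert (Hb : 540 * 16 * Bt / eta <= B) by (unfold B; lra).
    apply Rmult_le_compat_r with (r := eta) in Hb; [|lra]. unfold Rdiv in Hb. rewrite Rmult_assoc, Rinv_l, Rmult_1_r in Hb by lra.
    assert (540 * 16 * Bt * Cmod (eu tau) <= 540 * eta) by nra. lra. }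
  destruct (perturb_factor (eta / 2) (eta / 16) W th) as [P1 P2]; auto; try lra.
  assert (HWth : (W * (1 + th) = RtoC (24 * s * (INR L / INR D)) * eu tau)%C).
  { unfold th, W. replace (24 * s * INR L / INR D) with (24 * s * (INR L / INR D)) by (field; lra). field. auto. }
  rewrite HWth in P1, P2.
  apply (HS s tau _ (INR L / INR D)); auto; try lra.
  rewrite Rinv_div, HLs.
  (* Since m = l - D, 1 - m/l equals D/l, of modulus D/L. *)
  assert (Hm : IZR m = s * INR L - INR D) by (rewrite HDR, minus_IZR; lra).
  rewrite Hm. replace (1 - (s * INR L - INR D) / (s * INR L)) with (INR D / INR L * / s) by (field; split; [lra|destruct Hs; lra]).
  rewrite Rabs_mult, Rabs_inv, HsR, Rinv_1, Rmult_1_r. apply Rabs_right, Rle_ge, Rmult_le_pos; [lra|left; apply Rinv_0_lt_compat; lra].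
Qed.

Lemma gkm_near_all eps : 0 < eps -> exists B, forall s u v, s = 1 \/ s = -1 -> (u <= 2)%nat -> (v <= 1)%nat -> gkm_near eps s u v B.
Proof.
  intros He.
  assert (Hs : forall s, s = 1 \/ s = -1 -> exists B, forall u v, (u <= 2)%nat -> (v <= 1)%nat -> gkm_near eps s u v B).
  { intros s Hs. destruct (uniform_bound (fun u B => forall v, (v <= 1)%nat -> gkm_near eps s u v B) 2) as [B HB].
    - intros u B B' Hle H v Hv. apply (gkm_near_mono _ _ _ _ B); auto.
    - intros u Hu. apply (uniform_bound (fun v B => gkm_near eps s u v B) 1).
      + intros v B B' Hle. apply gkm_near_mono, Hle.
      + intros v Hv. apply gkm_near_class; auto.
    - exists B. intros u v Hu. apply HB, Hu. }
  destruct (Hs 1 ltac:(auto)) as [B1 H1]. destruct (Hs (-1) ltac:(auto)) as [B2 H2].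
  exists (Rmax B1 B2). intros s u v [Es|Es] Hu Hv; rewrite Es.
  - apply (gkm_near_mono _ _ _ _ B1); [apply Rmax_l|auto].
  - apply (gkm_near_mono _ _ _ _ B2); [apply Rmax_r|auto].
Qed.

(** The corner [rho + 1] of the closed domain is the translate of [rho]; E4 vanishes there as well,
    so it is excluded together with [rho]. *)
Theorem theoremB :
  forall kappa : R, 0 < kappa < 1 ->
  forall (k m : nat -> Z) (g : nat -> C -> C),
    (forall n, Z.even (k n) = true) ->
    (forall M : Z, exists N, forall n, (N <= n)%nat -> (M < Z.abs (k n))%Z) ->
    (forall n, (m n <= ell (k n))%Z) ->
    (forall n, (0 < k n)%Z -> (0 <= m n)%Z) ->
    (forall M : Z, exists N, forall n, (N <= n)%nat -> (M < ell (k n) - m n)%Z) ->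
    (exists N, forall n, (N <= n)%nat ->
        IZR (ell (k n) - m n) <
        kappa * ln (IZR (Z.abs (k n))) / ln (ln (IZR (Z.abs (k n))))) ->
    (forall n, is_gkm (k n) (m n) (g n)) ->
    forall eps : R, 0 < eps ->
    exists N, forall n, (N <= n)%nat ->
      forall tau : C, inF tau -> tau <> Ci -> tau <> rho -> tau <> (rho + RtoC 1)%C ->
        g n tau = RtoC 0 ->
        exists w : C,
          Sdelta (if (0 <? k n)%Z then 1 else -1)
                 (IZR (m n) / IZR (ell (k n))) w /\
          Cmod (tau - w)%C < eps.
Proof.
  intros kappa Hkap k m g Heven Hk _ _ HD [N1 HN1] Hg eps Heps.
  destruct (gkm_near_all eps Heps) as [B HB].
  destruct (growth_bound kappa B Hkap) as [M [HM HMb]].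
  (* 28 = 2 * 14: beyond it [ell k] has the sign of k and modulus at least |k|/24, whichever
     remainder k' occurs. *)
  destruct (Hk (Z.max 28 (up M))) as [N2 HN2]. destruct (HD (up B)) as [N3 HN3].
  exists (N1 + N2 + N3)%nat. intros n Hn tau Htau Hti Htr Htr1 Hz.
  specialize (HN1 n ltac:(lia)). specialize (HN2 n ltac:(lia)). specialize (HN3 n ltac:(lia)).
  destruct (ell_spec (k n) (Heven n)) as [u [v [Hu [Hv Hkn]]]].
  destruct (archimed M) as [HupM _]. destruct (archimed B) as [HupB _].
  assert (HKM : M < IZR (Z.abs (k n))).
  { eapply Rlt_trans; [exact HupM|]. apply IZR_lt. lia. }
  assert (Hell : IZR (Z.abs (k n)) / 24 <= Rabs (IZR (ell (k n)))).
  { rewrite <- abs_IZR. apply Rmult_le_reg_r with 24; [lra|].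
    replace (IZR (Z.abs (k n)) / 24 * 24) with (IZR (Z.abs (k n))) by field.
    rewrite <- mult_IZR. apply IZR_le. lia. }
  assert (HDB : B < IZR (ell (k n) - m n)).
  { eapply Rlt_trans; [exact HupB|]. apply IZR_lt, HN3. }
  apply (HB _ u v) with (g := g n); auto.
  - destruct (0 <? k n)%Z; auto.
  - destruct (Z.ltb_spec 0 (k n)) as [h|h].
    + rewrite Rmult_1_l. apply IZR_lt. lia.
    + assert (IZR (ell (k n)) < 0) by (apply IZR_lt; lia). lra.
  - eapply Rle_trans; [|exact Hell]. apply HMb; auto.
Qed.
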